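(* Let $K,L\subset H^2$ be closed convex proper subsets with nonempty interior. If all connected components of the boundaries of both $K$ and $L$ are straight lines, assume that their total number is finite. Then $(1)\Leftrightarrow(2)$, where (1) For each pair of orientation preserving congruences $\varphi,\psi:H^2\to H^2$ with $\operatorname{int}[(\varphi K)\cap(\psi L)]\neq\emptyset$, the set $(\varphi K)\cap(\psi L)$ is centrally symmetric. (2) $K$ and $L$ are congruent circles.
   Context: $H^2$ is the hyperbolic plane (curvature $-1$). A congruence is an isometry of $H^2$ onto itself. A set $M\subset H^2$ is centrally symmetric if it is invariant under the symmetry with respect to (rotation by $\pi$ about) some point of $H^2$. ''Proper'' means different from $H^2$. A ''circle'' as a set $K$ or $L$ means a closed disk of $H^2$ (of finite positive radius). *)

(* Defs.v *)
From HB Require Import structures.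
From mathcomp Require Import all_boot all_order all_algebra.
From mathcomp Require Import ring lra.
From mathcomp Require Import all_classical all_reals all_analysis.

Set Implicit Arguments.
Unset Strict Implicit.
Unset Printing Implicit Defensive.

Import Order.TTheory GRing.Theory Num.Theory.
Import numFieldNormedType.Exports.

Local Open Scope classical_set_scope.
Local Open Scope ring_scope.

(* The hyperbolic plane of curvature -1 is the upper sheet of the hyperboloid
   x0^2 - x1^2 - x2^2 = 1 in R^3, with cosh (d(x, y)) = x0 y0 - x1 y1 - x2 y2. *)

Definition lorentz (R : realType) (u v : 'rV[R]_3) : R :=
  u 0 0 * v 0 0 - u 0 1 * v 0 1 - u 0 2 * v 0 2.

Record hplane (R : realType) := HPlane {
  hvec :> 'rV[R]_3;
  hvecP : (lorentz hvec hvec == 1) && (0 < hvec 0 0) }.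

HB.instance Definition _ (R : realType) := [isSub for @hvec R].
HB.instance Definition _ (R : realType) := [Choice of hplane R by <:].

Definition arcosh (R : realType) (t : R) : R := ln (t + Num.sqrt (t ^+ 2 - 1)).

Definition hdist (R : realType) (x y : hplane R) : R := arcosh (lorentz x y).

Section hyperbolic_metric.
Variable R : realType.
Implicit Types (x y z : hplane R) (a b c t : R).

Lemma lorentzC (u v : 'rV[R]_3) : lorentz u v = lorentz v u.
Proof. by rewrite /lorentz; ring. Qed.

Lemma hvec_norm x : lorentz x x = 1.
Proof. by have /andP[/eqP] := hvecP x. Qed.

Lemma hvec0_gt0 x : 0 < x 0 0.
Proof. by have /andP[] := hvecP x. Qed.

Lemma lorentz_sq_identity x y :
  (x 0 0 * y 0 0) ^+ 2 - (1 + x 0 1 * y 0 1 + x 0 2 * y 0 2) ^+ 2 =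
  (x 0 1 - y 0 1) ^+ 2 + (x 0 2 - y 0 2) ^+ 2
    + (x 0 1 * y 0 2 - x 0 2 * y 0 1) ^+ 2.
Proof.
have /eqP := hvec_norm x; have /eqP := hvec_norm y; rewrite /lorentz.
rewrite -!expr2 !subr_eq => /eqP hy /eqP hx.
by rewrite exprMn hx hy; ring.
Qed.

Lemma lorentz_ge1 x y : 1 <= lorentz x y.
Proof.
have h := lorentz_sq_identity x y.
have p0 : 0 < x 0 0 * y 0 0 by rewrite mulr_gt0 ?hvec0_gt0.
rewrite /lorentz -subr_ge0.
set p := x 0 0 * y 0 0 in h p0 *.
have h2 : (1 + x 0 1 * y 0 1 + x 0 2 * y 0 2) ^+ 2 <= p ^+ 2.
  by rewrite -subr_ge0 h !addr_ge0 ?sqr_ge0.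
have : 1 + x 0 1 * y 0 1 + x 0 2 * y 0 2 <= p.
  have [n0|n0] := leP 0 (1 + x 0 1 * y 0 1 + x 0 2 * y 0 2).
    by move: h2; rewrite ler_pXn2r ?nnegrE// ltW.
  by rewrite ltW// (lt_trans n0).
lra.
Qed.

Lemma lorentz_eq1 x y : lorentz x y = 1 -> x = y.
Proof.
move=> e; have := lorentz_sq_identity x y.
have -> : x 0 0 * y 0 0 = 1 + x 0 1 * y 0 1 + x 0 2 * y 0 2.
  by move: e; rewrite /lorentz => e; lra.
rewrite subrr => /esym/eqP.
rewrite paddr_eq0 ?addr_ge0 ?sqr_ge0// paddr_eq0 ?sqr_ge0// !sqrf_eq0 !subr_eq0.
move=> /andP[/andP[/eqP e1 /eqP e2] _].
have e0 : x 0 0 = y 0 0.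
  have := hvec_norm x; have := hvec_norm y; rewrite /lorentz e1 e2 => h1 h2.
  apply/eqP; rewrite -(@eqrXn2 _ 2)// ?ltW ?hvec0_gt0//; apply/eqP.
  by rewrite !expr2; lra.
apply: val_inj; apply/rowP => i /=.
have : [|| i == 0, i == 1 | i == 2] by case: i => [[|[|[|]]]].
by move=> /or3P[] /eqP ->.
Qed.

Lemma lorentz_gram x y z :
  (lorentz x z - lorentz x y * lorentz y z) ^+ 2 <=
  (lorentz x y ^+ 2 - 1) * (lorentz y z ^+ 2 - 1).
Proof.
rewrite -subr_ge0.
have -> : (lorentz x y ^+ 2 - 1) * (lorentz y z ^+ 2 - 1) -
    (lorentz x z - lorentz x y * lorentz y z) ^+ 2 =
    (x 0 0 * (y 0 1 * z 0 2 - y 0 2 * z 0 1)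
     - x 0 1 * (y 0 0 * z 0 2 - y 0 2 * z 0 0)
     + x 0 2 * (y 0 0 * z 0 1 - y 0 1 * z 0 0)) ^+ 2; last exact: sqr_ge0.
transitivity ((lorentz x y ^+ 2 - lorentz x x * lorentz y y)
    * (lorentz y z ^+ 2 - lorentz y y * lorentz z z) -
    (lorentz x z * lorentz y y - lorentz x y * lorentz y z) ^+ 2).
  by rewrite !hvec_norm !mulr1.
rewrite -[RHS]mulr1 -(hvec_norm y) /lorentz; ring.
Qed.

Lemma le_arcosh a b : 1 <= a -> a <= b -> arcosh a <= arcosh b.
Proof.
move=> a1 ab; have b1 := le_trans a1 ab.
rewrite /arcosh ler_ln ?posrE ?ltr_wpDr ?sqrtr_ge0 ?(lt_le_trans ltr01)//.
rewrite lerD// ler_sqrt ?subr_ge0 ?exprn_ege1// lerD2r ler_pXn2r// nnegrE.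
  exact: le_trans ler01 a1.
exact: le_trans ler01 b1.
Qed.

Lemma arcoshD a b : 1 <= a -> 1 <= b ->
  arcosh a + arcosh b =
  arcosh (a * b + Num.sqrt ((a ^+ 2 - 1) * (b ^+ 2 - 1))).
Proof.
move=> a1 b1.
have a0 : 0 < a by exact: lt_le_trans ltr01 a1.
have b0 : 0 < b by exact: lt_le_trans ltr01 b1.
have sa : 0 <= a ^+ 2 - 1 by rewrite subr_ge0 exprn_ege1.
have sb : 0 <= b ^+ 2 - 1 by rewrite subr_ge0 exprn_ege1.
rewrite /arcosh -lnM ?posrE ?ltr_wpDr ?sqrtr_ge0// sqrtrM//; congr ln.
set s := Num.sqrt (a ^+ 2 - 1); set t := Num.sqrt (b ^+ 2 - 1).
have s2 : s ^+ 2 = a ^+ 2 - 1 by rewrite sqr_sqrtr.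
have t2 : t ^+ 2 = b ^+ 2 - 1 by rewrite sqr_sqrtr.
have -> : (a * b + s * t) ^+ 2 - 1 = (a * t + s * b) ^+ 2.
  have -> : (a * b + s * t) ^+ 2 - 1
    = a ^+ 2 * b ^+ 2 + s ^+ 2 * t ^+ 2 - 1 + 2 * a * b * s * t by ring.
  have -> : (a * t + s * b) ^+ 2
    = a ^+ 2 * t ^+ 2 + s ^+ 2 * b ^+ 2 + 2 * a * b * s * t by ring.
  by rewrite s2 t2; ring.
rewrite sqrtr_sqr ger0_norm; first by ring.
by rewrite addr_ge0// mulr_ge0 ?sqrtr_ge0// ltW.
Qed.

Lemma hdistxx x : hdist x x = 0.
Proof. by rewrite /hdist /arcosh hvec_norm expr1n subrr sqrtr0 addr0 ln1. Qed.

Lemma hdist_positivity x y : hdist x y = 0 -> x = y.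
Proof.
move=> d0; apply: lorentz_eq1; apply/eqP; rewrite eq_le lorentz_ge1 andbT.
have p : 0 < lorentz x y by exact: lt_le_trans ltr01 (lorentz_ge1 x y).
rewrite leNgt; apply/negP => l1.
have : 0 < hdist x y.
  by rewrite /hdist /arcosh ln_gt0// ltr_wpDr ?sqrtr_ge0.
by rewrite d0 ltxx.
Qed.

Lemma hdist_sym x y : hdist x y = hdist y x.
Proof. by rewrite /hdist lorentzC. Qed.

Lemma hdist_triangle y x z : hdist x z <= hdist x y + hdist y z.
Proof.
rewrite /hdist arcoshD ?lorentz_ge1//; apply: le_arcosh; first exact: lorentz_ge1.
rewrite addrC -lerBlDr (le_trans (ler_norm _))// -sqrtr_sqr ler_wsqrtr//.
exact: lorentz_gram.
Qed.

End hyperbolic_metric.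

HB.instance Definition _ (R : realType) := @isMetric.Build R (hplane R)
  (@hdist R) (@hdistxx R) (@hdist_positivity R) (@hdist_sym R) (@hdist_triangle R).

Section geometry.
Variable R : realType.
Implicit Types (f : hplane R -> hplane R) (A C K M : set (hplane R)).

Definition congruence f :=
  (forall x y, mdist (f x) (f y) = mdist x y) /\ range f = setT.

(* The sign of this determinant is the orientation of the triangle (x, y, z);
   it is 0 exactly when the points lie on a common line. *)
Definition hdet (x y z : hplane R) : R :=
  \det (\matrix_(i < 3) [:: hvec x; hvec y; hvec z]`_i).

Definition orientation_preserving f :=
  forall x y z, Num.sg (hdet (f x) (f y) (f z)) = Num.sg (hdet x y z).

(* The set of z with d(x, z) + d(z, y) = d(x, y) is the segment [x, y]. *)
Definition hconvex A :=
  forall x y z, A x -> A y -> mdist x z + mdist z y = mdist x y -> A z.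

Definition straight_line A :=
  exists2 g : R -> hplane R,
    (forall s t, mdist (g s) (g t) = `|s - t|) & A = range g.

Definition hdisk (c : hplane R) (r : R) : set (hplane R) :=
  [set x | mdist c x <= r].

(* A circle is here the closed disk, not the curve bounding it. *)
Definition circle A := exists c : hplane R, exists2 r : R, 0 < r & A = hdisk c r.

Definition congruent A C := exists2 f, congruence f & f @` A = C.

(* Linear map fixing c and equal to -1 on the orthogonal complement of c. *)
Definition symm_vec (c x : hplane R) : 'rV[R]_3 :=
  (2 * lorentz c x) *: hvec c - hvec x.

Lemma symm_vecP (c x : hplane R) :
  (lorentz (symm_vec c x) (symm_vec c x) == 1) && (0 < symm_vec c x 0 0).
Proof.
have cc := hvec_norm c; have xx := hvec_norm x.
have n1 : lorentz (symm_vec c x) (symm_vec c x) = 1.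
  have -> : lorentz (symm_vec c x) (symm_vec c x) =
    4 * lorentz c x ^+ 2 * lorentz c c - 4 * lorentz c x ^+ 2 + lorentz x x.
    by rewrite /symm_vec /lorentz !mxE; ring.
  by rewrite cc xx; ring.
rewrite n1 eqxx /= ltNge; apply/negP => v0.
have w0 : 0 < (- symm_vec c x) 0 0.
  rewrite mxE oppr_gt0 lt_neqAle v0 andbT; apply/eqP => e.
  have := sqr_ge0 (symm_vec c x 0 1); have := sqr_ge0 (symm_vec c x 0 2).
  by move: n1; rewrite /lorentz e !expr2; lra.
have wP : (lorentz (- symm_vec c x) (- symm_vec c x) == 1)
    && (0 < (- symm_vec c x) 0 0).
  rewrite w0 andbT; apply/eqP; rewrite -[RHS]n1.
  by rewrite /lorentz ![(- symm_vec c x) _ _]mxE; ring.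
have := lorentz_ge1 c (HPlane wP); have := lorentz_ge1 c x => /=.
suff -> : lorentz c (- symm_vec c x) = - lorentz c x by lra.
transitivity (lorentz c x - 2 * lorentz c x * lorentz c c).
  by rewrite /symm_vec /lorentz !mxE; ring.
by rewrite cc; ring.
Qed.

Definition symm (c x : hplane R) : hplane R := HPlane (symm_vecP c x).

Definition centrally_symmetric M := exists c : hplane R, symm c @` M = M.

Definition boundary A := closure A `\` interior A.

Definition boundary_components A : set (set (hplane R)) :=
  connected_component (boundary A) @` boundary A.

End geometry.

(* Main.v *)
(* Put the intersection of K and of the mirror image of a copy of L into the position of a
   thin lens with corners at the ends of a common chord.  Its centre of symmetry has to
   exchange the two corners, since a boundary point of one body cannot be mapped to an
   interior point of the other one; hence the two caps cut off by the chord are congruent.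
   For a moving chord this says that distances on the boundary arc b of L satisfy
   <a(F(s1,t)), a(F(s2,t))> = <b(s1), b(s2)> with F(s,t) = <b(s), b(t)>.  Inscribed
   equilateral chains are planar in the hyperboloid model, and a dyadic refinement makes the
   arc planar: the boundaries of K and L are locally plane sections <v, z> = k with the same
   k and <v, v>.  By connectedness of these sections a boundary component is a whole section.
   If k = 1 and <v, v> > 0 both bodies are disks of the same radius.  If k = 1 and
   <v, v> <= 0, the bodies can be placed so that the intersection is unbounded but lies in a
   horodisk, and no central symmetry exists.  If k = 0 all boundary components are lines; for
   two lines crossing at a small angle the corner can only be mapped to another crossing, and
   finiteness of the number of lines excludes this once the angle is small. *)

Require Import Defs.
From mathcomp Require Import all_boot all_order all_algebra.
From mathcomp Require Import ring lra.
From mathcomp Require Import all_classical all_reals all_analysis.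
Set Implicit Arguments.
Unset Strict Implicit.
Unset Printing Implicit Defensive.
Import Order.TTheory GRing.Theory Num.Theory.
Import numFieldNormedType.Exports.
Local Open Scope classical_set_scope.
Local Open Scope ring_scope.

(** The boundaries are not assumed smooth, and any boundary point may be a corner. Local arguments
    therefore start from a one-sided tangent, which convexity provides, and compare sets instead of
    curves. In the hyperboloid model convexity means closure under nonnegative linear combinations,
    so membership and interiority are read off from signs of coefficients and of 3 by 3
    determinants.

    The second body enters through its mirror image: both bodies then lie above their chord in the
    same position and are described by the same record. The lens has to be thin at the corner [ho]
    only; at the other corner it suffices that the two angles above the chord add up to at least a
    straight angle.

    An arc yields planarity only on one side of one chosen boundary point. To reach an arbitrary
    boundary point, a chord is drawn from a point on its right to a point on its left; the lens then
    carries a neighbourhood of that point to a neighbourhood of a point of a known arc. Normalising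
    the equation of the plane leaves only 0 and 1 as values of [k]. *)

Fact lift3_01 : (lift ord0 ord0 : 'I_3) = 1. Proof. exact: val_inj. Qed.
Fact lift3_02 : (lift ord0 (lift ord0 ord0) : 'I_3) = 2. Proof. exact: val_inj. Qed.
Definition lift3E := (lift3_02, lift3_01).

(** * Lorentz vectors and Lorentz transformations *)

Section LorentzVectors.
Variable R : realType.
Implicit Types (u v w : 'rV[R]_3) (x y z : hplane R) (a b c : R).

Definition vec3 a b c : 'rV[R]_3 := \row_(i < 3) [:: a; b; c]`_i.

Lemma vec3E a b c : (vec3 a b c 0 0 = a) * (vec3 a b c 0 1 = b) * (vec3 a b c 0 2 = c).
Proof. by rewrite !mxE. Qed.

Lemma eq_vec3 u v : u 0 0 = v 0 0 -> u 0 1 = v 0 1 -> u 0 2 = v 0 2 -> u = v.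
Proof.
move=> h0 h1 h2; apply/rowP => i.
have : [|| i == 0, i == 1 | i == 2] by case: i => [[|[|[|]]]].
by move=> /or3P[] /eqP ->.
Qed.

Definition det3 u v w : R :=
  u 0 0 * (v 0 1 * w 0 2 - v 0 2 * w 0 1)
  - u 0 1 * (v 0 0 * w 0 2 - v 0 2 * w 0 0)
  + u 0 2 * (v 0 0 * w 0 1 - v 0 1 * w 0 0).

Definition mat3 u v w : 'M[R]_3 := \matrix_(i < 3) [:: u; v; w]`_i.

Lemma mul_mat3 (z : 'rV[R]_3) u v w : z *m mat3 u v w = z 0 0 *: u + z 0 1 *: v + z 0 2 *: w.
Proof.
by apply/rowP => j; rewrite !mxE !big_ord_recl big_ord0 !mxE /= addr0 addrA !lift3E.
Qed.

Lemma det_mat3 u v w : \det (mat3 u v w) = det3 u v w.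
Proof.
rewrite (expand_det_row _ 0) !big_ord_recl big_ord0 /cofactor.
rewrite !(expand_det_row _ 0) !big_ord_recl !big_ord0 /cofactor !det_mx11 !mxE /=.
rewrite /= /bump /= ?expr0 ?expr1 !lift3E -[(0 + (1 + (1 + 0)))%N]/2%N.
rewrite (_ : lift 1 ord0 = 0); last exact: val_inj.
rewrite (_ : lift 1 (lift ord0 ord0) = 2); last exact: val_inj.
rewrite (_ : lift 2 ord0 = 0); last exact: val_inj.
rewrite (_ : lift 2 (lift ord0 ord0) = 1); last exact: val_inj.
rewrite (_ : lift ord0 (lift (lift ord0 ord0) 0) = 1); last exact: val_inj.
rewrite (_ : lift 1 (lift (lift ord0 ord0) 0) = 0); last exact: val_inj.
rewrite (_ : lift 2 (lift (lift ord0 ord0) 0) = 0); last exact: val_inj.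
rewrite (_ : ord0 = 0) //.
rewrite /det3; ring.
Qed.

Lemma lorentzDl u v w : lorentz (u + v) w = lorentz u w + lorentz v w.
Proof. by rewrite /lorentz !mxE; ring. Qed.
Lemma lorentzDr u v w : lorentz u (v + w) = lorentz u v + lorentz u w.
Proof. by rewrite /lorentz !mxE; ring. Qed.
Lemma lorentzNl u v : lorentz (- u) v = - lorentz u v.
Proof. by rewrite /lorentz ![(- u) _ _]mxE; ring. Qed.
Lemma lorentzNr u v : lorentz u (- v) = - lorentz u v.
Proof. by rewrite /lorentz ![(- v) _ _]mxE; ring. Qed.
Lemma lorentzZl a u v : lorentz (a *: u) v = a * lorentz u v.
Proof. by rewrite /lorentz !mxE; ring. Qed.
Lemma lorentzZr a u v : lorentz u (a *: v) = a * lorentz u v.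
Proof. by rewrite /lorentz !mxE; ring. Qed.
Definition lorentzE := (lorentzDl, lorentzDr, lorentzNl, lorentzNr, lorentzZl, lorentzZr).

(** Matrices act on row vectors from the right. The entry [M 0 0] is the first coordinate of the
    image of [ho]; its sign singles out the transformations that preserve the upper sheet. *)
Definition lor (M : 'M[R]_3) :=
  (forall u v, lorentz (u *m M) (v *m M) = lorentz u v) /\ 0 < M 0 0.

Lemma lor_mat3 u v w : lorentz u u = 1 -> lorentz v v = -1 -> lorentz w w = -1 ->
  lorentz u v = 0 -> lorentz u w = 0 -> lorentz v w = 0 -> 0 < u 0 0 ->
  lor (mat3 u v w).
Proof.
move=> uu vv ww uv uw vw u0; split; last by rewrite mxE.
move=> s t; rewrite !mul_mat3 !lorentzE uu vv ww (lorentzC v u) (lorentzC w u).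
by rewrite (lorentzC w v) uv uw vw /lorentz; ring.
Qed.

Definition e0 : 'rV[R]_3 := vec3 1 0 0.

Lemma ho_subproof : (lorentz e0 e0 == 1) && (0 < e0 0 0).
Proof. by rewrite /lorentz /e0 !vec3E mulr1 !mul0r !subr0 eqxx ltr01. Qed.
Definition ho : hplane R := HPlane ho_subproof.

Lemma hoE : (ho 0 0 = 1) * (ho 0 1 = 0) * (ho 0 2 = 0).
Proof. by rewrite /ho /= /e0 !vec3E. Qed.

Lemma lorentz_ho u : lorentz ho u = u 0 0.
Proof. by rewrite /lorentz !hoE; ring. Qed.

Lemma lorentz_ho_r u : lorentz u ho = u 0 0.
Proof. by rewrite lorentzC lorentz_ho. Qed.

Lemma hsqr x : x 0 0 ^+ 2 = 1 + x 0 1 ^+ 2 + x 0 2 ^+ 2.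
Proof. by have := hvec_norm x; rewrite /lorentz !expr2 => h; lra. Qed.

Lemma hge1 x : 1 <= x 0 0.
Proof. by rewrite -(lorentz_ho x) lorentz_ge1. Qed.

(** Otherwise [- u] would be a point of the upper sheet, and two such points have product at least
    1. *)
Lemma hplane_of u x : lorentz u u = 1 -> 0 < lorentz u x -> 0 < u 0 0.
Proof.
move=> uu ux; rewrite ltNge; apply/negP => u0.
have un : u 0 0 != 0.
  apply/eqP => e; have := sqr_ge0 (u 0 1); have := sqr_ge0 (u 0 2).
  by move: uu; rewrite /lorentz e !expr2; lra.
have wP : (lorentz (- u) (- u) == 1) && (0 < (- u) 0 0).
  rewrite !lorentzE opprK uu eqxx /= mxE oppr_gt0.
  by rewrite lt_neqAle un.
have := lorentz_ge1 (HPlane wP) x; rewrite /= lorentzNl; lra.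
Qed.

Lemma lor_pos M x : lor M -> 0 < (hvec x *m M) 0 0.
Proof.
move=> [ML M0]; have e : e0 *m M = row 0 M.
  apply/rowP => j; rewrite !mxE !big_ord_recl big_ord0 !mxE /=.
  by rewrite mul1r !mul0r !addr0.
have P : (lorentz (e0 *m M) (e0 *m M) == 1) && (0 < (e0 *m M) 0 0).
  by rewrite ML (hvec_norm ho) eqxx e mxE.
apply: (hplane_of (x := HPlane P)); first by rewrite ML hvec_norm.
by rewrite /= ML (lorentz_ho_r x) hvec0_gt0.
Qed.

(** The action is made total with the default value [x], which is never taken if [lor M] holds. *)
Definition hact (M : 'M[R]_3) (x : hplane R) : hplane R := insubd x (hvec x *m M).

Lemma hactE M x : lor M -> hvec (hact M x) = hvec x *m M.
Proof.
move=> HM; rewrite /hact -[LHS]/(val _) val_insubd ifT //.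
by rewrite (proj1 HM) hvec_norm eqxx lor_pos.
Qed.

Lemma lorentz_hact M x y : lor M -> lorentz (hact M x) (hact M y) = lorentz x y.
Proof. by move=> HM; rewrite !hactE // (proj1 HM). Qed.

Lemma lor1 : lor 1%:M.
Proof. by split=> [u v|]; rewrite ?mulmx1// mxE ltr01. Qed.

Lemma lorM M N : lor M -> lor N -> lor (M *m N).
Proof.
move=> HM HN; split=> [u v|]; first by rewrite !mulmxA (proj1 HN) (proj1 HM).
have := lor_pos (hact M ho) HN; rewrite hactE // -mulmxA.
suff -> : (e0 *m (M *m N)) 0 0 = (M *m N) 0 0 by [].
rewrite !mxE !big_ord_recl big_ord0 !mxE /= mul1r !mul0r !addr0.
by rewrite !big_ord_recl !big_ord0.
Qed.

Lemma hactM M N x : lor M -> lor N -> hact (M *m N) x = hact N (hact M x).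
Proof.
by move=> HM HN; apply: val_inj; rewrite /= !hactE ?mulmxA //; apply: lorM.
Qed.

Definition mink : 'M[R]_3 := mat3 (vec3 1 0 0) (vec3 0 (-1) 0) (vec3 0 0 (-1)).

Lemma lorentz_mink u v : lorentz u v = (u *m mink *m v^T) 0 0.
Proof.
rewrite mul_mat3 mxE !big_ord_recl big_ord0 !mxE /= /lorentz.
rewrite !lift3E.
by rewrite (_ : ord0 = 0) ; [ring|].
Qed.

(** Invariance of the form reads [M J M^T = J] for the matrix [J] of the form, which has determinant
    1. *)
Lemma lor_unit M : lor M -> M \in unitmx.
Proof.
move=> [HM _]; rewrite unitmxE unitfE; apply/eqP => d0.
have : (mink == M *m mink *m M^T).
  apply/eqP/matrixP => i j.
  have := HM (delta_mx 0 i) (delta_mx 0 j); rewrite !lorentz_mink.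
  rewrite !trmx_mul trmx_delta.
  have E (A : 'M[R]_3) : ((delta_mx 0 i : 'rV_3) *m A *m (delta_mx j 0 : 'cV_3)) 0 0 = A i j.
    by rewrite -rowE -colE !mxE.
  by rewrite -!mulmxA !mulmxA -(mulmxA (delta_mx 0 i)) -(mulmxA (delta_mx 0 i)) !E => ->.
move=> /eqP /(congr1 (fun A => \det A)); rewrite !det_mulmx d0 !mul0r det_mat3 /det3 !vec3E.
lra.
Qed.

Lemma lorV M : lor M -> lor (invmx M).
Proof.
move=> HM; have uM := lor_unit HM.
have L u v : lorentz (u *m invmx M) (v *m invmx M) = lorentz u v.
  by rewrite -(proj1 HM) !mulmxKV.
split=> //.
have -> : invmx M 0 0 = lorentz (e0 *m invmx M) e0.
  rewrite (lorentz_ho_r (e0 *m invmx M)) !mxE !big_ord_recl big_ord0 !mxE /=.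
  by rewrite mul1r !mul0r !addr0.
rewrite -[X in lorentz _ X](mulmxK uM) L (lorentz_ho (e0 *m M)).
exact: (lor_pos ho HM).
Qed.

Lemma hactK M : lor M -> cancel (hact M) (hact (invmx M)).
Proof.
move=> HM x; apply: val_inj; rewrite /= !hactE //; last exact: lorV.
by rewrite mulmxK // lor_unit.
Qed.

Lemma hactKV M : lor M -> cancel (hact (invmx M)) (hact M).
Proof.
move=> HM x; apply: val_inj; rewrite /= !hactE //; last exact: lorV.
by rewrite mulmxKV // lor_unit.
Qed.

Lemma hact1 x : hact 1%:M x = x.
Proof. by apply: val_inj; rewrite /= hactE ?mulmx1//; apply: lor1. Qed.

Lemma congruence_hact M : lor M -> congruence (hact M).
Proof.
move=> HM; split=> [x y|]; first by rewrite /mdist /= /hdist lorentz_hact.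
by apply/seteqP; split=> // x _; exists (hact (invmx M) x) => //; rewrite hactKV.
Qed.

Lemma hdetE x y z : hdet x y z = det3 x y z.
Proof. exact: det_mat3. Qed.

Lemma det3_mul u v w M : det3 (u *m M) (v *m M) (w *m M) = det3 u v w * \det M.
Proof.
rewrite -!det_mat3 -det_mulmx; congr (\det _); apply/row_matrixP => i.
rewrite row_mul; have : [|| i == 0, i == 1 | i == 2] by case: i => [[|[|[|]]]].
by move=> /or3P[] /eqP ->; rewrite !rowK.
Qed.

Lemma orientation_hact M : lor M -> 0 < \det M -> orientation_preserving (hact M).
Proof.
move=> HM d x y z; rewrite !hdetE !hactE // det3_mul.
by rewrite sgrM (gtr0_sg d) mulr1.
Qed.

End LorentzVectors.
Arguments ho {R}.

(** * Neighbourhoods and continuity in the hyperboloid model *)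

Section HyperbolicTopology.
Variable R : realType.
Implicit Types (u v w : 'rV[R]_3) (x y z : hplane R) (a b c : R) (A : set (hplane R)).

Definition ch (e : R) := (expR e + expR (- e)) / 2.
Definition sh (e : R) := (expR e - expR (- e)) / 2.

Lemma ch2 e : ch e ^+ 2 = 1 + sh e ^+ 2.
Proof.
have E : expR e * expR (- e) = 1 by rewrite -expRD subrr expR0.
by rewrite /ch /sh; move: E; move: (expR e) (expR (- e)) => s t E; field: E.
Qed.

Lemma sh_gt0 e : 0 < e -> 0 < sh e.
Proof. by move=> e0; rewrite /sh divr_gt0 ?subr_gt0 ?ltr_expR//; lra. Qed.

Lemma ch_gt0 e : 0 < ch e.
Proof. by rewrite /ch divr_gt0 ?addr_gt0 ?expR_gt0. Qed.

Lemma ch_gt1 e : 0 < e -> 1 < ch e.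
Proof.
move=> e0; have := ch2 e; have := sh_gt0 e0; have := ch_gt0 e; nra.
Qed.

Lemma chN e : ch (- e) = ch e.
Proof. by rewrite /ch opprK addrC. Qed.

Lemma ch_ge1 e : 1 <= ch e.
Proof. have := ch2 e; have := ch_gt0 e; have := sqr_ge0 (sh e); nra. Qed.

Lemma arcosh_ch e : 0 <= e -> arcosh (ch e) = e.
Proof.
move=> e0; rewrite /arcosh ch2 (_ : 1 + sh e ^+ 2 - 1 = sh e ^+ 2); last ring.
rewrite sqrtr_sqr ger0_norm; last by move: e0; rewrite le_eqVlt => /predU1P[<-|/sh_gt0/ltW//]; rewrite /sh oppr0 subrr mul0r.
by rewrite /ch /sh -mulrDl (_ : _ + _ = expR e * 2) ?mulfK ?expRK//; ring.
Qed.

Lemma lt_arcosh a b : 1 <= a -> a < b -> arcosh a < arcosh b.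
Proof.
move=> a1 ab; have b1 := lt_le_trans ltr01 a1.
have sa := sqrtr_ge0 (a ^+ 2 - 1); have sb := sqrtr_ge0 (b ^+ 2 - 1).
rewrite /arcosh ltr_ln ?posrE; [|lra|lra].
have : Num.sqrt (a ^+ 2 - 1) <= Num.sqrt (b ^+ 2 - 1).
  by rewrite ler_wsqrtr//; nra.
lra.
Qed.

Lemma arcosh_lt a e : 1 <= a -> 0 < e -> (arcosh a < e) = (a < ch e).
Proof.
move=> a1 e0; apply/idP/idP => h; last by rewrite -(arcosh_ch (ltW e0)) lt_arcosh.
rewrite ltNge; apply/negP => /(le_arcosh (ch_ge1 e)).
by rewrite (arcosh_ch (ltW e0)) leNgt h.
Qed.

Lemma mdistE x y : mdist x y = arcosh (lorentz x y).
Proof. by []. Qed.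

(** Describing neighbourhoods by [lorentz z x < 1 + d] keeps [arcosh] out of the later topological
    arguments. *)
Lemma nbhs_hplane z A :
  nbhs z A <-> exists2 d : R, 0 < d & forall x, lorentz z x < 1 + d -> A x.
Proof.
split=> [/nbhs_ballP[e /= e0 zA]|[d d0 zA]].
  exists (ch e - 1); first by rewrite subr_gt0 ch_gt1.
  move=> x zx; apply: zA; rewrite ballEmdist /= mdistE arcosh_lt ?lorentz_ge1//.
  by move: zx; rewrite addrC subrK.
apply/nbhs_ballP; exists (arcosh (1 + d)) => /=.
  by rewrite /arcosh ln_gt0// ltr_wpDr ?sqrtr_ge0//; lra.
move=> x; rewrite ballEmdist /= mdistE => h; apply: zA.
have d1 : 1 <= 1 + d by lra.
by rewrite ltNge; apply/negP => /(le_arcosh d1); rewrite leNgt h.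
Qed.

(** By [lorentz_sq_identity] a product close to 1 bounds the coordinate differences. The factor 8
    comes from [y 0 0 <= 4 * x 0 0], valid for [d <= 1]. *)
Lemma lorentz_coord_close x y d : d <= 1 -> lorentz x y < 1 + d ->
  [/\ (x 0 0 - y 0 0) ^+ 2 <= 8 * x 0 0 ^+ 2 * d,
      (x 0 1 - y 0 1) ^+ 2 <= 8 * x 0 0 ^+ 2 * d &
      (x 0 2 - y 0 2) ^+ 2 <= 8 * x 0 0 ^+ 2 * d].
Proof.
move=> d1 xyd.
have x1 := hge1 x; have y1 := hge1 y; have t1 := lorentz_ge1 x y.
have id := lorentz_sq_identity x y.
have y2 : y 0 0 <= 2 * x 0 0 * lorentz x y.
  have hx := hsqr x; have hy := hsqr y.
  have cs : (x 0 1 * y 0 1 + x 0 2 * y 0 2) ^+ 2 <= (x 0 0 ^+ 2 - 1) * (y 0 0 ^+ 2).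
    rewrite hx hy; have := sqr_ge0 (x 0 1 * y 0 2 - x 0 2 * y 0 1).
    by have := sqr_ge0 (x 0 1); have := sqr_ge0 (x 0 2); nra.
  set s := x 0 1 * y 0 1 + x 0 2 * y 0 2 in cs.
  have ts : lorentz x y = x 0 0 * y 0 0 - s by rewrite /s /lorentz; ring.
  rewrite leNgt; apply/negP => h.
  have s1 : (2 * x 0 0 ^+ 2 - 1) * y 0 0 < 2 * x 0 0 * s by move: h; rewrite ts; nra.
  have : ((2 * x 0 0 ^+ 2 - 1) * y 0 0) ^+ 2 < (2 * x 0 0 * s) ^+ 2.
    have sq (p q : R) : 0 <= p -> p < q -> p ^+ 2 < q ^+ 2 by nra.
    by apply: sq s1; apply: mulr_ge0; nra.
  rewrite !exprMn => h2.
  have : 2 ^+ 2 * x 0 0 ^+ 2 * s ^+ 2 <= 2 ^+ 2 * x 0 0 ^+ 2 * ((x 0 0 ^+ 2 - 1) * y 0 0 ^+ 2).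
    by rewrite ler_wpM2l// mulr_ge0// sqr_ge0.
  have := sqr_ge0 (y 0 0); nra.
have S : (x 0 1 - y 0 1) ^+ 2 + (x 0 2 - y 0 2) ^+ 2 <= 8 * x 0 0 ^+ 2 * d.
  have e : (x 0 0 * y 0 0) ^+ 2 - (1 + x 0 1 * y 0 1 + x 0 2 * y 0 2) ^+ 2
      = (lorentz x y - 1) * (2 * (x 0 0 * y 0 0) - (lorentz x y - 1)).
    by rewrite /lorentz; ring.
  have le1 : (x 0 1 - y 0 1) ^+ 2 + (x 0 2 - y 0 2) ^+ 2 <=
      (lorentz x y - 1) * (2 * (x 0 0 * y 0 0)).
    rewrite -subr_ge0; have := sqr_ge0 (x 0 1 * y 0 2 - x 0 2 * y 0 1).
    have := sqr_ge0 (lorentz x y - 1); move: id; rewrite e; nra.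
  apply: le_trans le1 _.
  have a1 : x 0 0 * y 0 0 <= x 0 0 * (4 * x 0 0).
    by rewrite ler_wpM2l ?(le_trans ler01)//; nra.
  have -> : 8 * x 0 0 ^+ 2 * d = d * (2 * (x 0 0 * (4 * x 0 0))) by ring.
  by apply: ler_pM; nra.
have T : (x 0 0 - y 0 0) ^+ 2 <= (x 0 1 - y 0 1) ^+ 2 + (x 0 2 - y 0 2) ^+ 2.
  have := hsqr x; have := hsqr y; move: t1; rewrite /lorentz; nra.
have := sqr_ge0 (x 0 1 - y 0 1); have := sqr_ge0 (x 0 2 - y 0 2).
by split; lra.
Qed.

Lemma near_coord (i : 'I_3) z (e : R) : 0 < e ->
  \forall x \near z, `|z 0 i - (x : hplane R) 0 i| < e.
Proof.
move=> e0; apply/nbhs_hplane.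
have z1 := hge1 z.
pose d := Num.min 1 (e ^+ 2 / (16 * z 0 0 ^+ 2)).
have d0 : 0 < d.
  by rewrite lt_min ltr01 divr_gt0 ?exprn_gt0// mulr_gt0// exprn_gt0// hvec0_gt0.
exists d => // x zx.
have d1 : d <= 1 by rewrite ge_min lexx.
have d2 : 8 * z 0 0 ^+ 2 * d < e ^+ 2.
  have : d <= e ^+ 2 / (16 * z 0 0 ^+ 2) by rewrite ge_min lexx orbT.
  rewrite ler_pdivlMr; last by rewrite mulr_gt0// exprn_gt0// hvec0_gt0.
  have := exprn_gt0 2 e0; have : 0 < z 0 0 ^+ 2 by rewrite exprn_gt0// hvec0_gt0.
  nra.
have [h0 h1 h2] := lorentz_coord_close d1 zx.
have H : (z 0 i - x 0 i) ^+ 2 < e ^+ 2.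
  have : [|| i == 0, i == 1 | i == 2] by case: i => [[|[|[|]]]].
  by move=> /or3P[] /eqP ->; lra.
by rewrite -ltr_sqr ?nnegrE ?normr_ge0 ?(ltW e0)// real_normK ?num_real.
Qed.

Lemma continuous_coord (i : 'I_3) : continuous (fun x : hplane R => x 0 i : R).
Proof. by move=> z; apply/(@cvgrPdist_lt _ _ _ (nbhs z)) => e e0; apply: near_coord. Qed.

Lemma continuous_lorentz v : continuous (fun x : hplane R => lorentz v x : R).
Proof.
move=> z; have c i : (v 0 i * (x : hplane R) 0 i) @[x --> z] --> v 0 i * z 0 i.
  by apply: (@cvgM R (hplane R) (nbhs z) _ (fun=> v 0 i)); [apply: cvg_cst|apply: continuous_coord].
exact: (@cvgB _ _ _ (nbhs z) _ _ _ _ _ (@cvgB _ _ _ (nbhs z) _ _ _ _ _ (c 0) (c 1)) (c 2)).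
Qed.

Lemma near_lorentz_lt v z a : lorentz v z < a -> \forall x \near z, lorentz v (x : hplane R) < a.
Proof. exact: (@cvgr_lt _ _ (nbhs z) _ _ _ (@continuous_lorentz v z)). Qed.

Lemma near_lorentz_gt v z a : a < lorentz v z -> \forall x \near z, a < lorentz v (x : hplane R).
Proof. exact: (@cvgr_gt _ _ (nbhs z) _ _ _ (@continuous_lorentz v z)). Qed.

Lemma closed_near A z : closed A -> (forall d, 0 < d -> exists2 x, A x & lorentz z x < 1 + d) -> A z.
Proof.
move=> cA h; apply: cA => B /nbhs_hplane[d d0 zB].
by have [x Ax zx] := h d d0; exists x; split=> //; apply: zB.
Qed.

Lemma boundaryE A : closed A -> boundary A = A `\` interior A.
Proof. by move=> /closure_id cA; rewrite /boundary -cA. Qed.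

End HyperbolicTopology.

(** * Convex sets as cones, moved bodies and central symmetries *)

Section ConvexSets.
Variable R : realType.
Implicit Types (u v : 'rV[R]_3) (x y z w : hplane R) (a b c : R) (A B : set (hplane R)).

(** Central projection onto the hyperboloid, with default value [ho] outside the open forward
    cone. *)
Definition hnorm v : hplane R := insubd ho ((Num.sqrt (lorentz v v))^-1 *: v).

Lemma hnormE v : 0 < lorentz v v -> 0 < v 0 0 ->
  hvec (hnorm v) = (Num.sqrt (lorentz v v))^-1 *: v.
Proof.
move=> vv v0; rewrite /hnorm -[LHS]/(val _) val_insubd ifT //.
rewrite lorentzZl lorentzZr mulrA -expr2 exprVn sqr_sqrtr ?(ltW vv)// mulVf ?(lt0r_neq0 vv)//.
by rewrite ?eqxx /= mxE mulr_gt0// invr_gt0 sqrtr_gt0.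
Qed.

Lemma hcone u x : 0 < lorentz u u -> 0 < lorentz u x ->
  exists m : hplane R, exists2 N : R, 0 < N & u = N *: hvec m.
Proof.
move=> uu ux.
have s0 : 0 < Num.sqrt (lorentz u u) by rewrite sqrtr_gt0.
have u0 : 0 < u 0 0.
  have : 0 < ((Num.sqrt (lorentz u u))^-1 *: u) 0 0.
    apply: (hplane_of (x := x)); last by rewrite lorentzZl mulr_gt0// invr_gt0.
    by rewrite lorentzZl lorentzZr mulrA -expr2 exprVn sqr_sqrtr ?ltW// mulVf ?gt_eqF.
  by rewrite mxE pmulr_rgt0// invr_gt0.
exists (hnorm u), (Num.sqrt (lorentz u u)) => //.
by rewrite hnormE// scalerA mulfV ?scale1r// gt_eqF.
Qed.

Lemma lorentz_comb2 x y a b :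
  lorentz (a *: hvec x + b *: hvec y) (a *: hvec x + b *: hvec y)
  = a ^+ 2 + b ^+ 2 + 2 * (a * b) * lorentz x y.
Proof. by rewrite !lorentzE !hvec_norm (lorentzC y x); ring. Qed.

(** Segments are central projections of Euclidean segments: a nonnegative combination of [x] and [y]
    on the hyperboloid attains equality in the triangle inequality. Later arguments use convexity in
    this linear form. *)
Lemma hconvex_comb A x y z a b : hconvex A -> A x -> A y -> 0 <= a -> 0 <= b ->
  hvec z = a *: hvec x + b *: hvec y -> A z.
Proof.
move=> cA Ax Ay a0 b0 e; apply: (cA x y z) => //.
have c1 := lorentz_ge1 x y.
have n1 : a ^+ 2 + b ^+ 2 + 2 * (a * b) * lorentz x y = 1.
  by rewrite -lorentz_comb2 -e hvec_norm.
have xz : lorentz x z = a + b * lorentz x y.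
  by rewrite e !lorentzE hvec_norm; ring.
have zy : lorentz z y = a * lorentz x y + b.
  by rewrite e !lorentzE hvec_norm; ring.
rewrite !mdistE arcoshD ?lorentz_ge1// xz zy; congr arcosh.
set c := lorentz x y in c1 n1 *.
have -> : ((a + b * c) ^+ 2 - 1) * ((a * c + b) ^+ 2 - 1) = (a * b * (c ^+ 2 - 1)) ^+ 2.
  have -> : (a + b * c) ^+ 2 - 1 = b ^+ 2 * (c ^+ 2 - 1) by rewrite -[in LHS]n1; ring.
  have -> : (a * c + b) ^+ 2 - 1 = a ^+ 2 * (c ^+ 2 - 1) by rewrite -[in LHS]n1; ring.
  ring.
rewrite sqrtr_sqr ger0_norm; last first.
  by rewrite !mulr_ge0// subr_ge0 exprn_ege1.
rewrite -[RHS]mul1r -[in RHS]n1; ring.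
Qed.

Lemma hconvex_comb3 A x y w z a b c : hconvex A -> A x -> A y -> A w ->
  0 <= a -> 0 <= b -> 0 <= c ->
  hvec z = a *: hvec x + b *: hvec y + c *: hvec w -> A z.
Proof.
move=> cA Ax Ay Aw a0 b0 c0 e.
have [a_0|an0] := eqVneq a 0.
  by apply: (hconvex_comb cA Ay Aw b0 c0); rewrite e a_0 scale0r add0r.
have {an0} a_gt0 : 0 < a by rewrite lt_neqAle eq_sym an0.
have c1 := lorentz_ge1 x y.
have [||m [N N0 mE]] := @hcone (a *: hvec x + b *: hvec y) x.
- rewrite lorentz_comb2; have : 0 <= a * b * lorentz x y by rewrite !mulr_ge0//; lra.
  by have := exprn_gt0 2 a_gt0; have := sqr_ge0 b; lra.
- rewrite !lorentzE hvec_norm (lorentzC y x).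
  have : 0 <= b * lorentz x y by rewrite mulr_ge0//; lra.
  lra.
apply: (@hconvex_comb A m w z N c) => //; [|exact: ltW|by rewrite e mE].
apply: (@hconvex_comb A x y m (N^-1 * a) (N^-1 * b)) => //.
- by rewrite mulr_ge0// invr_ge0 ltW.
- by rewrite mulr_ge0// invr_ge0 ltW.
- by rewrite -!scalerA -scalerDr mE scalerA mulVf ?scale1r// gt_eqF.
Qed.

(* The point w' = (z' - u) / c depends continuously on z' and equals w at z' = z. *)
Lemma interior_comb A B w z u c : 0 < c -> hvec z = u + c *: hvec w ->
  interior A w ->
  (forall w' z', A w' -> forall c', 0 < c' -> hvec z' = u + c' *: hvec w' -> B z') ->
  interior B z.
Proof.
move=> c0 zE /nbhs_hplane[d d0 Aw] AB.
have wE : hvec w = c^-1 *: (hvec z - u).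
  by rewrite zE addrAC subrr add0r scalerA mulVf ?scale1r// gt_eqF.
pose v (z' : hplane R) := c^-1 *: (hvec z' - u).
have vv z' : lorentz (v z') (v z') = c^-1 ^+ 2 * (1 + lorentz u u - 2 * lorentz u z').
  by rewrite /v !lorentzE hvec_norm (lorentzC z' u); ring.
have wv z' : lorentz w (v z') = c^-1 * (lorentz w z' - lorentz w u).
  by rewrite /v !lorentzE.
have c2 : 0 < c^-1 ^+ 2 by rewrite exprn_gt0// invr_gt0.
have ci : 0 < c^-1 by rewrite invr_gt0.
have vz : lorentz (v z) (v z) = 1 by rewrite /v -wE hvec_norm.
have wz : lorentz w (v z) = 1 by rewrite /v -wE hvec_norm.
(* If [N] is the norm of [v z'] and [m] its normalisation, then [N * lorentz w m < 1 + d / 2]; hence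
   [N ^+ 2 > q] gives [lorentz w m < 1 + d]. *)
pose q := ((1 + d / 2) / (1 + d)) ^+ 2.
have q0 : 0 < q by rewrite exprn_gt0// divr_gt0; lra.
have q1 : q < 1.
  have p0 : 0 < (1 + d / 2) / (1 + d) by rewrite divr_gt0; lra.
  have p1 : (1 + d / 2) / (1 + d) < 1 by rewrite ltr_pdivrMr; lra.
  rewrite /q; nra.
have N1 : \forall z' \near z, q < lorentz (v z') (v z').
  pose k := c^-1 ^+ 2; have qk : q / k * k = q by rewrite mulfVK ?lt0r_neq0.
  have : \forall z' \near z, lorentz u (z' : hplane R) < (1 + lorentz u u - q / k) / 2.
    apply: near_lorentz_lt; have : q / k < 1 + lorentz u u - 2 * lorentz u z.
      by rewrite -(ltr_pM2r c2) qk mulrC -vv vz.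
    lra.
  apply: filterS => z' h; rewrite vv -/k mulrC -qk ltr_pM2r//; lra.
have N2 : \forall z' \near z, lorentz w (v z') < 1 + d / 2.
  have : \forall z' \near z, lorentz w (z' : hplane R) < (1 + d / 2) / c^-1 + lorentz w u.
    apply: near_lorentz_lt; rewrite -ltrBlDr ltr_pdivlMr// mulrC -wv wz; lra.
  by apply: filterS => z'; rewrite wv -ltrBlDr ltr_pdivlMr// mulrC.
have N3 : \forall z' \near z, 0 < lorentz w (v z').
  have : \forall z' \near z, lorentz w u < lorentz w (z' : hplane R).
    apply: near_lorentz_gt; have := ltr01 (R := R); rewrite -wz wv pmulr_rgt0//; lra.
  by apply: filterS => z' h; rewrite wv mulr_gt0//; lra.
rewrite /interior /=; near=> z'.
have h1 : q < lorentz (v z') (v z') by near: z'.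
have h2 : lorentz w (v z') < 1 + d / 2 by near: z'.
have h3 : 0 < lorentz w (v z') by near: z'.
have [||m [N N0 mE]] := @hcone (v z') w; [by lra|by rewrite lorentzC|].
apply: (AB m z' _ (c * N)); last 2 first.
- by rewrite mulr_gt0.
- by rewrite -scalerA -mE scalerA mulfV ?gt_eqF// scale1r addrC subrK.
apply: Aw.
have NN : lorentz (v z') (v z') = N ^+ 2.
  by rewrite mE lorentzZl lorentzZr hvec_norm mulr1 expr2.
have wN : lorentz w (v z') = N * lorentz w m by rewrite mE lorentzZr.
have Nq : (1 + d / 2) / (1 + d) < N.
  have p0 : 0 < (1 + d / 2) / (1 + d) by rewrite divr_gt0; lra.
  by rewrite -(@ltr_pXn2r _ 2) ?nnegrE ?ltW// -NN.
rewrite ltr_pdivrMr in Nq; last lra.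
rewrite -(ltr_pM2l N0) -wN; lra.
Unshelve. all: by end_near.
Qed.

Lemma interior_comb2 A x w z a c : hconvex A -> A x -> interior A w -> 0 <= a -> 0 < c ->
  hvec z = a *: hvec x + c *: hvec w -> interior A z.
Proof.
move=> cA Ax Aw a0 c0 zE; apply: (interior_comb c0 zE Aw) => w' z' Aw' c' c'0.
by apply: hconvex_comb => //; apply: ltW.
Qed.

Lemma interior_comb3 A x y w z a b c : hconvex A -> A x -> A y -> interior A w ->
  0 <= a -> 0 <= b -> 0 < c ->
  hvec z = a *: hvec x + b *: hvec y + c *: hvec w -> interior A z.
Proof.
move=> cA Ax Ay Aw a0 b0 c0 zE; apply: (interior_comb c0 zE Aw) => w' z' Aw' c' c'0.
by apply: hconvex_comb3 => //; apply: ltW.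
Qed.

Lemma det3C u v (w : 'rV[R]_3) : det3 u v w = det3 v w u.
Proof. by rewrite /det3; ring. Qed.
Lemma det3N u v (w : 'rV[R]_3) : det3 u v w = - det3 v u w.
Proof. by rewrite /det3; ring. Qed.

Lemma det3_comb u v (w s : 'rV[R]_3) :
  det3 u v w *: s = det3 s v w *: u + det3 u s w *: v + det3 u v s *: w.
Proof. by apply: eq_vec3; rewrite !mxE /det3; ring. Qed.

(** The vector product for the Lorentz form, orthogonal to both factors. *)
Definition cross u v : 'rV[R]_3 :=
  vec3 (u 0 1 * v 0 2 - u 0 2 * v 0 1) (u 0 0 * v 0 2 - u 0 2 * v 0 0)
       (u 0 1 * v 0 0 - u 0 0 * v 0 1).

Lemma lorentz_cross u v (w : 'rV[R]_3) : lorentz (cross u v) w = det3 u v w.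
Proof. by rewrite /lorentz /cross !vec3E /det3; ring. Qed.

Lemma near_det3_gt u v z a : a < det3 u v z -> \forall x \near z, a < det3 u v (x : hplane R).
Proof.
by rewrite -lorentz_cross => /near_lorentz_gt; apply: filterS => x; rewrite lorentz_cross.
Qed.

Lemma det3_eq u v (w : 'rV[R]_3) : u = v \/ v = w \/ u = w -> det3 u v w = 0.
Proof. by case=> [->|[->|->]]; rewrite /det3; ring. Qed.

(* Barycentric coordinates are ratios of determinants, hence continuous. *)
Lemma interior_triangle A x y w z a b c : hconvex A -> A x -> A y -> A w ->
  0 < a -> 0 < b -> 0 < c -> det3 x y w != 0 ->
  hvec z = a *: hvec x + b *: hvec y + c *: hvec w -> interior A z.
Proof.
move=> cA Ax Ay Aw a0 b0 c0; wlog D0 : x y a b Ax Ay a0 b0 / 0 < det3 x y w.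
  move=> H; rewrite neq_lt => /orP[D0|D0] zE.
    apply: (H y x b a) => //; rewrite ?[det3 y x w]det3N ?oppr_gt0 ?oppr_eq0 ?(lt_eqF D0)//.
    by rewrite zE [a *: _ + _]addrC.
  by apply: (H x y a b) => //; rewrite gt_eqF.
move=> _ zE.
have da : det3 z y w = a * det3 x y w by rewrite zE /det3 !mxE; ring.
have db : det3 x z w = b * det3 x y w by rewrite zE /det3 !mxE; ring.
have dc : det3 x y z = c * det3 x y w by rewrite zE /det3 !mxE; ring.
have Na : \forall z' \near z, 0 < det3 y w (z' : hplane R).
  by apply: near_det3_gt; rewrite -det3C da mulr_gt0.
have Nb : \forall z' \near z, 0 < det3 w x (z' : hplane R).
  by apply: near_det3_gt; rewrite det3C db mulr_gt0.
have Nc : \forall z' \near z, 0 < det3 x y (z' : hplane R).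
  by apply: near_det3_gt; rewrite dc mulr_gt0.
rewrite /interior /=; near=> z'.
have ha : 0 < det3 y w (z' : hplane R) by near: z'.
have hb : 0 < det3 w x (z' : hplane R) by near: z'.
have hc : 0 < det3 x y (z' : hplane R) by near: z'.
apply: (@hconvex_comb3 A x y w z' ((det3 x y w)^-1 * det3 z' y w)
  ((det3 x y w)^-1 * det3 x z' w) ((det3 x y w)^-1 * det3 x y z')) => //.
- by rewrite mulr_ge0 ?invr_ge0 ?ltW// det3C.
- by rewrite mulr_ge0 ?invr_ge0 ?ltW// -det3C.
- by rewrite mulr_ge0 ?invr_ge0 ?ltW.
- by rewrite -!scalerA -!scalerDr -det3_comb scalerA mulVf ?scale1r// gt_eqF.
Unshelve. all: by end_near.
Qed.

(** Bodies are moved by preimages, so that membership unfolds to membership of a transformed point;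
    successive moves multiply the matrices in reading order. *)
Definition pre (M : 'M[R]_3) A : set (hplane R) := [set z | A (hact M z)].

Lemma preM M N A : lor M -> lor N -> pre M (pre N A) = pre (M *m N) A.
Proof. by move=> HM HN; apply/seteqP; split=> z; rewrite /pre /= hactM. Qed.

Lemma pre1 A : pre 1%:M A = A.
Proof. by apply/seteqP; split=> z; rewrite /pre /= hact1. Qed.

Lemma preE M A : lor M -> pre M A = hact (invmx M) @` A.
Proof.
move=> HM; apply/seteqP; split=> z.
  by move=> Az; exists (hact M z) => //; rewrite hactK.
by move=> [x Ax <-]; rewrite /pre /= hactKV.
Qed.

Lemma closed_pre M A : lor M -> closed A -> closed (pre M A).
Proof.
move=> HM cA z zA; apply: (closed_near cA) => d d0.
have : nbhs z [set x | lorentz z x < 1 + d] by apply/nbhs_hplane; exists d.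
move=> /zA[x [Ax zx]]; exists (hact M x) => //.
by rewrite lorentz_hact.
Qed.

Lemma hconvex_pre M A : lor M -> hconvex A -> hconvex (pre M A).
Proof.
by move=> HM cA x y z Ax Ay h; apply: cA Ax Ay _; rewrite !mdistE !lorentz_hact.
Qed.

Lemma interior_pre M A z : lor M -> interior (pre M A) z <-> interior A (hact M z).
Proof.
move=> HM; rewrite /interior /=; split=> /nbhs_hplane[d d0 h]; apply/nbhs_hplane; exists d => // x.
  rewrite -(hactKV HM x) lorentz_hact// => /h; exact.
by move=> zx; apply: h; rewrite lorentz_hact.
Qed.

Lemma symmE (c : hplane R) x : hvec (symm c x) = (2 * lorentz c x) *: hvec c - hvec x.
Proof. by []. Qed.

Lemma symmK (c : hplane R) : involutive (symm c).
Proof.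
move=> x; apply: val_inj; rewrite /= /symm_vec symmE !lorentzE hvec_norm.
move: (lorentz c x) => t; rewrite opprB addrCA -scalerBl (_ : _ - _ = 0) ?scale0r ?addr0//; ring.
Qed.

Lemma lorentz_symm (c : hplane R) x y : lorentz (symm c x) (symm c y) = lorentz x y.
Proof. by rewrite !symmE !lorentzE hvec_norm (lorentzC x c); ring. Qed.

Lemma hact_symm M (c : hplane R) x : lor M -> hact M (symm c x) = symm (hact M c) (hact M x).
Proof.
move=> HM; apply: val_inj; rewrite /= hactE// /symm_vec lorentz_hact// !hactE//.
by rewrite symmE mulmxBl -scalemxAl.
Qed.

Lemma centrally_symmetricP A : centrally_symmetric A <->
  exists c : hplane R, forall z, A z -> A (symm c z).
Proof.
split=> -[c h]; exists c; first by move=> z Az; rewrite -h; exists z.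
apply/seteqP; split=> z; first by move=> [x /h Ax <-].
by move=> /h Az; exists (symm c z) => //; rewrite symmK.
Qed.

Lemma centrally_symmetric_pre M A : lor M -> centrally_symmetric A -> centrally_symmetric (pre M A).
Proof.
move=> HM /centrally_symmetricP[c h]; apply/centrally_symmetricP.
by exists (hact (invmx M) c) => z; rewrite /pre /= hact_symm// hactKV//; apply: h.
Qed.

Lemma cvg_hplane T (F : set_system T) (FF : Filter F) (g : T -> hplane R) z :
  (forall i : 'I_3, (g t 0 i : R) @[t --> F] --> z 0 i) -> g @ F --> z.
Proof.
move=> h; apply: cvg_trans (cvg_id (F := nbhs z)) => S /nbhs_hplane[d d0 zS].
have c : lorentz z (g t) @[t --> F] --> (1 : R).
  rewrite -(hvec_norm z) /lorentz.
  have c i : (z 0 i * g t 0 i) @[t --> F] --> z 0 i * z 0 i.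
    by apply: cvgM (h i); apply: cvg_cst.
  exact: (cvgB (cvgB (c 0) (c 1)) (c 2)).
have : \forall t \near F, lorentz z (g t) < 1 + d by apply: (cvgr_lt _ c); lra.
by apply: filterS => t; apply: zS.
Qed.

Lemma cvg_quadratic (f : R -> R) (a b c t : R) :
  (forall s, f s = a * s ^+ 2 + b * s + c) -> f s @[s --> t] --> f t.
Proof.
move=> fE; have -> : f = (fun s => a * (s * s) + b * s + c).
  by apply/funext => s; rewrite fE expr2.
apply: cvgD; last exact: cvg_cst.
apply: cvgD; apply: cvgM; try exact: cvg_cst; try exact: cvg_id.
by apply: cvgM; exact: cvg_id.
Qed.

(** [w] is the last point of [A] on the way from [x] to [y], found as a supremum of parameters on
    the Euclidean segment [p]. *)
Lemma segment_boundary A x y : closed A -> A x -> ~ A y ->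
  exists (w : hplane R) a b,
    [/\ 0 < a, 0 <= b, hvec w = a *: hvec x + b *: hvec y, A w & ~ interior A w].
Proof.
move=> cA Ax nAy.
pose p (t : R) := (1 - t) *: hvec x + t *: hvec y.
have c1 := lorentz_ge1 x y.
have pp t : lorentz (p t) (p t) = (1 - t) ^+ 2 + t ^+ 2 + 2 * ((1 - t) * t) * lorentz x y.
  exact: lorentz_comb2.
have pp0 t : 0 <= t -> t <= 1 -> 0 < lorentz (p t) (p t).
  move=> t0 t1; rewrite pp; have : 0 <= (1 - t) * t * lorentz x y.
    by rewrite !mulr_ge0//; lra.
  nra.
have p0 t : 0 <= t -> t <= 1 -> 0 < p t 0 0.
  move=> t0 t1; rewrite !mxE; have := hvec0_gt0 x; have := hvec0_gt0 y; nra.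
have gE t : 0 <= t -> t <= 1 -> hvec (hnorm (p t)) = (Num.sqrt (lorentz (p t) (p t)))^-1 *: p t.
  by move=> t0 t1; rewrite hnormE ?pp0 ?p0.
have gc t : 0 <= t -> t <= 1 -> forall e, 0 < e -> exists2 d : R, 0 < d &
    forall s, 0 <= s -> s <= 1 -> `|t - s| < d -> lorentz (hnorm (p t)) (hnorm (p s)) < 1 + e.
  move=> t0 t1 e e0.
  pose f s := (Num.sqrt (lorentz (p t) (p t)))^-1 * ((Num.sqrt (lorentz (p s) (p s)))^-1
     * lorentz (p t) (p s)).
  have fc : {for t, continuous f}.
    apply: cvgM; first exact: cvg_cst.
    apply: cvgM.
      apply: cvgV; first by rewrite sqrtr_eq0 -ltNge pp0.
      apply: (@cvg_comp _ _ _ (fun s => lorentz (p s) (p s)) Num.sqrt); last exact: sqrt_continuous.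
      apply: (@cvg_quadratic _ (2 - 2 * lorentz x y) (2 * lorentz x y - 2) 1) => s.
      by rewrite pp; ring.
    apply: (@cvg_quadratic _ 0 (lorentz (p t) y - lorentz (p t) x) (lorentz (p t) x)) => s.
    by rewrite [in LHS]/p lorentzDr !lorentzZr; ring.
  have ft : f t = 1.
    rewrite /f mulrA -expr2 exprVn sqr_sqrtr ?mulVf// ?gt_eqF ?ltW ?pp0//.
  have : \forall s \near t, f s < 1 + e.
    by apply: (cvgr_lt _ fc); rewrite ft; lra.
  move=> /nbhs_ballP[d /= d0 td]; exists d => // s s0 s1 ts.
  have := td s ts; rewrite !gE// lorentzZl lorentzZr /f; lra.
pose S := [set t : R | [/\ 0 <= t, t <= 1 & A (hnorm (p t))]].
have g0 : hnorm (p 0) = x.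
  apply: val_inj; rewrite /= gE// pp subr0 expr1n expr0n /= mulr0 mulr0 mul0r !addr0.
  by rewrite sqrtr1 invr1 scale1r /p subr0 scale1r scale0r addr0.
have g1 : hnorm (p 1) = y.
  apply: val_inj; rewrite /= gE// pp subrr expr1n expr0n /= mul0r mulr0 mul0r !add0r addr0.
  by rewrite sqrtr1 invr1 scale1r /p subrr scale1r scale0r add0r.
have S0 : S 0 by split=> //; rewrite g0.
have hS : has_sup S by split; [exists 0|exists 1 => t []].
have s0 : 0 <= sup S by apply: ub_le_sup (proj2 hS) _ S0.
have s1 : sup S <= 1 by apply: ge_sup; [exists 0|move=> t []].
have Ag : A (hnorm (p (sup S))).
  apply: (closed_near cA) => e e0; have [d d0 H] := gc _ s0 s1 e e0.
  have [t [t0 t1 At] st] := sup_adherent d0 hS.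
  exists (hnorm (p t)) => //; apply: H => //.
  have ts : t <= sup S by apply: ub_le_sup (proj2 hS) _ _.
  by rewrite ger0_norm; lra.
have sl1 : sup S < 1.
  rewrite lt_neqAle s1 andbT; apply/eqP => e; move: Ag; rewrite e g1; exact: nAy.
exists (hnorm (p (sup S))), ((Num.sqrt (lorentz (p (sup S)) (p (sup S))))^-1 * (1 - sup S)),
  ((Num.sqrt (lorentz (p (sup S)) (p (sup S))))^-1 * sup S); split=> //.
- by rewrite mulr_gt0 ?invr_gt0 ?sqrtr_gt0 ?pp0//; lra.
- by rewrite mulr_ge0// invr_ge0 sqrtr_ge0.
- by rewrite gE// /p scalerDr !scalerA.
- move=> /nbhs_hplane[e e0 hA]; have [d d0 H] := gc _ s0 s1 e e0.
  (* If the last point were interior, this larger parameter would still belong to [S]. *)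
  pose t := sup S + Num.min (d / 2) (1 - sup S).
  have m0 : 0 < Num.min (d / 2) (1 - sup S) by rewrite lt_min; apply/andP; split; lra.
  have m1 : Num.min (d / 2) (1 - sup S) <= d / 2 by rewrite ge_min lexx.
  have m2 : Num.min (d / 2) (1 - sup S) <= 1 - sup S by rewrite ge_min lexx orbT.
  have St : S t.
    split; rewrite /t; [lra|lra|].
    by apply: hA; apply: H; [lra|lra|rewrite ltr0_norm; lra].
  have : t <= sup S by apply: ub_le_sup (proj2 hS) _ _.
  by rewrite /t; lra.
Qed.

End ConvexSets.

(** * Lens position: the caps below the chord and the thin corner *)

Section Lens.
Variable R : realType.
Implicit Types (x y z w q : hplane R) (a b c : R) (A B : set (hplane R)).

Definition rho : 'M[R]_3 := mat3 (vec3 1 0 0) (vec3 0 1 0) (vec3 0 0 (-1)).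

Lemma lor_rho : lor rho.
Proof. by apply: lor_mat3; rewrite /lorentz ?vec3E; lra. Qed.

Lemma hact_rho z : (hact rho z 0 0 = z 0 0) * (hact rho z 0 1 = z 0 1) * (hact rho z 0 2 = - z 0 2).
Proof. by rewrite !(hactE _ lor_rho) mul_mat3 !mxE /=; split; [split|]; ring. Qed.

Lemma hact_rhoK : involutive (hact rho).
Proof. by move=> z; apply: val_inj; apply: eq_vec3; rewrite /= !hact_rho ?opprK. Qed.

Lemma pre_rhoK A : pre rho (pre rho A) = A.
Proof. by apply/seteqP; split=> z; rewrite /pre /= hact_rhoK. Qed.

Lemma abs_coord1 z : `|z 0 1| <= z 0 0.
Proof.
have := hsqr z; have := hge1 z; have := sqr_ge0 (z 0 2).
by rewrite ler_norml => *; apply/andP; split; nra.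
Qed.

Lemma lorentz_le x y : lorentz x y <= 2 * (x 0 0 * y 0 0).
Proof.
have hx := hsqr x; have hy := hsqr y; have x1 := hge1 x; have y1 := hge1 y.
have : - (x 0 1 * y 0 1 + x 0 2 * y 0 2) <= x 0 0 * y 0 0.
  rewrite leNgt; apply/negP => h.
  have sq (p q : R) : 0 <= p -> p < q -> p ^+ 2 < q ^+ 2 by nra.
  have p0 : 0 <= x 0 0 * y 0 0 by rewrite mulr_ge0//; lra.
  have := sq _ _ p0 h; rewrite sqrrN.
  have := sqr_ge0 (x 0 1 * y 0 2 - x 0 2 * y 0 1); rewrite exprMn hx hy.
  have := sqr_ge0 (x 0 1); have := sqr_ge0 (x 0 2).
  have := sqr_ge0 (y 0 1); have := sqr_ge0 (y 0 2); nra.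
by rewrite /lorentz; lra.
Qed.

Lemma lorentz_gt0 x y : 0 < lorentz x y.
Proof. exact: lt_le_trans ltr01 (lorentz_ge1 x y). Qed.

(* [A] contains the chord from [ho] to [q], lies above a line through [ho] of
   slope [- s], and [w] bounds from below the part of [A] above the chord. *)
Record lens_side A q w (s eta C h k : R) : Prop := LensSide {
  ls_convex : hconvex A;
  ls_o : A ho;
  ls_q : A q;
  ls_nq : ~ interior A q;
  ls_s0 : 0 <= s;
  ls_s : s <= eta;
  ls_supp : forall z, A z -> 0 <= z 0 2 + s * z 0 1;
  ls_w : interior A w;
  ls_h : h <= w 0 2;
  ls_C : w 0 0 <= C;
  ls_k : w 0 0 * q 0 1 - w 0 1 * q 0 0 <= k * w 0 2 }.

Lemma axis_point q z : q 0 2 = 0 -> 0 < q 0 1 ->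
  forall v : 'rV[R]_3, v 0 2 = 0 ->
  v = ((v 0 0 * q 0 1 - v 0 1 * q 0 0) / q 0 1) *: hvec ho + (v 0 1 / q 0 1) *: hvec q.
Proof.
move=> q2 q1 v v2; have qn : q 0 1 != 0 by rewrite gt_eqF.
apply: eq_vec3; rewrite !mxE ?q2 ?v2 /=; by field.
Qed.

(** Otherwise the segment from [z] to [w] crosses the axis beyond [q], and [q] becomes a nonnegative
    combination of [ho], [z] and [w] with positive weight on the interior point [w]. *)
Lemma cap_side A q w s eta C h k z : 0 < h -> q 0 2 = 0 -> 0 < q 0 1 ->
  lens_side A q w s eta C h k -> A z -> z 0 2 < 0 ->
  0 <= (z 0 0 * q 0 1 - z 0 1 * q 0 0) * w 0 2 - (w 0 0 * q 0 1 - w 0 1 * q 0 0) * z 0 2.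
Proof.
move=> h0 q2 q1 [cA Ao Aq nq _ _ _ wA hw _ _] Az z2; rewrite leNgt; apply/negP => H; apply: nq.
have w2 : 0 < w 0 2 by apply: lt_le_trans hw.
have q0 := hvec0_gt0 q; have qs := hsqr q; rewrite q2 expr0n /= addr0 in qs.
pose D := - ((z 0 0 * q 0 1 - z 0 1 * q 0 0) * w 0 2 - (w 0 0 * q 0 1 - w 0 1 * q 0 0) * z 0 2).
have D0 : 0 < D by rewrite oppr_gt0.
pose P := (D / q 0 1) *: hvec ho + w 0 2 *: hvec z + (- z 0 2) *: hvec w.
have P2 : P 0 2 = 0 by rewrite !mxE /=; ring.
have P01 : P 0 0 * q 0 1 = P 0 1 * q 0 0.
  by rewrite !mxE /= /D; field; rewrite gt_eqF.
have P0 : 0 < P 0 0.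
  rewrite !mxE /= mulr1; have := hvec0_gt0 z; have := hvec0_gt0 w.
  have : 0 < D / q 0 1 by rewrite divr_gt0.
  nra.
have PE : P = (P 0 0 / q 0 0) *: hvec q.
  apply: eq_vec3; rewrite [RHS]mxE; first by rewrite divfK ?gt_eqF.
    by rewrite mulrAC P01 mulfK ?gt_eqF.
  by rewrite q2 mulr0.
have l0 : 0 < q 0 0 / P 0 0 by rewrite divr_gt0.
apply: (@interior_comb3 _ A ho z w q (q 0 0 / P 0 0 * (D / q 0 1)) (q 0 0 / P 0 0 * w 0 2)
   (q 0 0 / P 0 0 * - z 0 2)) => //.
- by rewrite mulr_ge0 ?ltW// divr_gt0.
- by rewrite mulr_ge0 ?ltW.
- by rewrite mulr_gt0// oppr_gt0.
- have qE : hvec q = (q 0 0 / P 0 0) *: P.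
    rewrite [X in _ *: X]PE scalerA mulrA divfK ?gt_eqF// divff ?scale1r// gt_eqF//.
  by rewrite [LHS]qE {2}/P !scalerDr !scalerA.
Qed.

(** The quotient bounded by [k] in [ls_k] is the cotangent of the angle at [q] between the chord and
    the direction of [w]. With the bounds [k] and [- k] the angles of the two bodies at [q] add up
    to at least a straight angle, so below the chord [A] has no more room at [q] than the mirror
    image of [w'] provides. At [ho] the slope bound [eta] is small against the height of [w']. *)
Lemma cap_cone A B q w w' s s' eta C h k z :
  0 < h -> 1 <= C -> 10 * C ^+ 3 * eta < h -> q 0 2 = 0 -> 0 < q 0 1 ->
  lens_side A q w s eta C h k -> lens_side B q w' s' eta C h (- k) ->
  A z -> z 0 2 < 0 ->
  exists a b c, [/\ 0 <= a, 0 <= b, 0 < c &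
    hvec z = a *: hvec ho + b *: hvec q + c *: hvec (hact rho w')].
Proof.
move=> h0 C1 small q2 q1 HA HB Az z2.
have side := cap_side h0 q2 q1 HA Az z2.
have w2 : 0 < w 0 2 by apply: lt_le_trans (ls_h HA).
have w'2 : 0 < w' 0 2 by apply: lt_le_trans (ls_h HB).
pose c := - z 0 2 / w' 0 2.
have c0 : 0 < c by rewrite divr_gt0// oppr_gt0.
have cw : c * w' 0 2 = - z 0 2 by rewrite /c divfK// gt_eqF.
pose v := hvec z - c *: hvec (hact rho w').
have v2 : v 0 2 = 0 by rewrite !mxE hact_rho mulrN cw; ring.
have := axis_point z q2 q1 v2.
set b := v 0 1 / _; set a := _ / _ => vE.
exists a, b, c; split=> //; last by rewrite -vE /v subrK.
- rewrite divr_ge0 ?(ltW q1)//.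
  have -> : v 0 0 * q 0 1 - v 0 1 * q 0 0 = (z 0 0 * q 0 1 - z 0 1 * q 0 0)
     - c * (w' 0 0 * q 0 1 - w' 0 1 * q 0 0) by rewrite !mxE !hact_rho; ring.
  have e1 : c * (w' 0 0 * q 0 1 - w' 0 1 * q 0 0) <= k * z 0 2.
    have := ler_wpM2l (ltW c0) (ls_k HB); rewrite mulrCA cw; lra.
  have e2 : k * z 0 2 <= z 0 0 * q 0 1 - z 0 1 * q 0 0.
    rewrite -(ler_pM2r w2).
    have : (k * w 0 2) * z 0 2 <= (w 0 0 * q 0 1 - w 0 1 * q 0 0) * z 0 2.
      by rewrite ler_wnM2r ?(ltW z2)// (ls_k HA).
    lra.
  lra.
- rewrite divr_ge0 ?(ltW q1)//.
  have -> : v 0 1 = z 0 1 - c * w' 0 1 by rewrite !mxE hact_rho; ring.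
  have sz := ls_supp HA Az; have s0 := ls_s0 HA; have se := ls_s HA.
  have z1 : 0 < z 0 1 by rewrite ltNge; apply/negP => z1; clear -z1 sz s0 z2; nra.
  have ez : - z 0 2 <= eta * z 0 1 by clear -sz se z1; nra.
  have w1 : w' 0 1 <= C.
    by apply: le_trans (ls_C HB); apply: le_trans (abs_coord1 w'); apply: ler_norm.
  have Ce : C * eta <= h.
    have e0 : 0 <= eta by apply: le_trans se.
    have : C * eta <= 10 * C ^+ 3 * eta by rewrite ler_wpM2r//; clear -C1; nra.
    clear -small; lra.
  have hw' := ls_h HB.
  have c1 : c * C <= z 0 1.
    rewrite /c mulrAC ler_pdivrMr//; clear -ez Ce hw' z1 C1; nra.
  clear -c1 w1 c0; nra.
Qed.

(** The reverse triangle inequality forces [a + b + c <= 1]. *)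
Lemma comb3_bound x y w z a b c (C : R) : 0 <= a -> 0 <= b -> 0 <= c -> 1 <= C ->
  x 0 0 <= C -> y 0 0 <= C -> w 0 0 <= C ->
  hvec z = a *: hvec x + b *: hvec y + c *: hvec w -> z 0 0 <= C.
Proof.
move=> a0 b0 c0 C1 xC yC wC zE.
have n1 : a ^+ 2 + b ^+ 2 + c ^+ 2 + 2 * (a * b * lorentz x y) + 2 * (a * c * lorentz x w)
    + 2 * (b * c * lorentz y w) = 1.
  rewrite -[RHS](hvec_norm z) zE !lorentzE !hvec_norm (lorentzC y x) (lorentzC w x) (lorentzC w y); ring.
have l1 (t : R) x' y' : 0 <= t -> t <= t * lorentz x' y'.
  by move=> t0; have := ler_wpM2l t0 (lorentz_ge1 x' y'); rewrite mulr1.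
have := l1 (a * b) x y (mulr_ge0 a0 b0); have := l1 (a * c) x w (mulr_ge0 a0 c0).
have := l1 (b * c) y w (mulr_ge0 b0 c0) => i1 i2 i3.
have S1 : a + b + c <= 1 by nra.
have -> : z 0 0 = a * x 0 0 + b * y 0 0 + c * w 0 0 by rewrite zE !mxE.
nra.
Qed.

(** The positivity of [b] is essential: from an interior point one can move some way towards any [k]
    without leaving [A]. *)
Lemma toward A z k : closed A -> interior A z ->
  exists t : hplane R, exists a b, [/\ 0 <= a, 0 < b, hvec t = a *: hvec z + b *: hvec k & A t].
Proof.
move=> cA Az; have [Ak|nAk] := pselect (A k).
  by exists k, 0, 1; split=> //; rewrite scale0r scale1r add0r.
have [t [a [b [a0 b0 tE At nt]]]] := segment_boundary cA (interior_subset Az) nAk.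
exists t, a, b; split=> //; first exact: ltW.
rewrite lt_neqAle b0 andbT; apply/eqP => b_0; apply: nt.
suff -> : t = z by [].
move: tE; rewrite -b_0 scale0r addr0 => tE; apply: val_inj; rewrite /= tE.
have := hvec_norm t; rewrite tE !lorentzE hvec_norm mulr1 => /eqP.
rewrite -expr2 -[1 in X in _ == X](expr1n _ 2) eqrXn2 ?ler01 ?(ltW a0)// => /eqP ->.
by rewrite scale1r.
Qed.

Lemma symm_comb (c : hplane R) x y z a b : hvec z = a *: hvec x + b *: hvec y ->
  hvec (symm c z) = a *: hvec (symm c x) + b *: hvec (symm c y).
Proof.
move=> zE; rewrite !symmE zE; apply: eq_vec3; rewrite !mxE !lorentzE; ring.
Qed.

(* If [M = A] near the image of the thin corner [ho] of [M], then all of [A] lies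
   in a thin angle. *)
Lemma thin_corner A B q w w' s s' eta C h k (c : hplane R) :
  0 < h -> 1 <= C -> 10 * C ^+ 3 * eta < h ->
  lens_side A q w s eta C h k -> lens_side B q w' s' eta C h (- k) -> closed B ->
  (forall z, (A `&` pre rho B) z -> (A `&` pre rho B) (symm c z)) ->
  symm c ho 0 0 <= C -> interior (pre rho B) (symm c ho) -> False.
Proof.
move=> h0 C1 small HA HB clB sM zC zB.
have M0 : (A `&` pre rho B) ho.
  split; first exact: (ls_o HA).
  rewrite /pre /=; suff -> : hact rho ho = ho :> hplane R by apply: (ls_o HB).
  by apply: val_inj; apply: eq_vec3; rewrite /= !hact_rho ?hoE ?oppr0.
have [Az Bz] := sM _ M0.
have clB' := closed_pre lor_rho clB; have cB' := hconvex_pre lor_rho (ls_convex HB).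
have nu t : (A `&` pre rho B) t -> 0 <= t 0 2 + s * t 0 1 /\ 0 <= - t 0 2 + s' * t 0 1.
  by move=> [/(ls_supp HA) ? /(ls_supp HB)]; rewrite !hact_rho.
(* [t] lies in both bodies, on the way from the image of [ho] towards [w]. Its mirror point is seen
   from [ho] in the direction of [symm c w], which therefore satisfies both slope inequalities. *)
have [t [a [b [a0 b0 tE Bt]]]] := toward w clB' zB.
have At : A t.
  by apply: (hconvex_comb (ls_convex HA) Az (interior_subset (ls_w HA)) a0 (ltW b0)).
have [] := nu _ (sM _ (conj At Bt)).
have stE : hvec (symm c t) = a *: hvec ho + b *: hvec (symm c w).
  by rewrite (symm_comb c tE) symmK.
have st1 : symm c t 0 1 = b * symm c w 0 1.
  by rewrite stE [LHS]mxE [X in X + _]mxE [X in _ + X]mxE !hoE mulr0 add0r.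
have st2 : symm c t 0 2 = b * symm c w 0 2.
  by rewrite stE [LHS]mxE [X in X + _]mxE [X in _ + X]mxE !hoE mulr0 add0r.
rewrite st1 st2 => n1 n2.
have k1 : 0 <= symm c w 0 2 + s * symm c w 0 1.
  by rewrite -(pmulr_rge0 _ b0); clear -n1; lra.
have k2 : 0 <= - symm c w 0 2 + s' * symm c w 0 1.
  by rewrite -(pmulr_rge0 _ b0); clear -n2; lra.
(* The centre is the midpoint of [ho] and its image, hence lies in the intersection. *)
have cE : hvec c = (2 * c 0 0)^-1 *: hvec ho + (2 * c 0 0)^-1 *: hvec (symm c ho).
  rewrite -scalerDr symmE lorentz_ho_r addrCA subrr addr0 scalerA mulVf ?scale1r//.
  by rewrite mulf_neq0 ?gt_eqF ?hvec0_gt0//; lra.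
have i0 : 0 <= (2 * c 0 0)^-1 by rewrite invr_ge0 mulr_ge0// ltW// hvec0_gt0.
have Mc : (A `&` pre rho B) c.
  by split; [apply: hconvex_comb cE => //; [exact: (ls_convex HA)|exact: (proj1 M0)]
    |apply: hconvex_comb cE => //; exact: (proj2 M0)].
have [c2a c2b] := nu _ Mc.
have e0 : 0 <= eta by apply: le_trans (ls_s0 HA) (ls_s HA).
have c0C : c 0 0 <= C.
  have : 2 * c 0 0 ^+ 2 = 1 + symm c ho 0 0.
    by rewrite -!(lorentz_ho_r) symmE !lorentzE hvec_norm lorentz_ho_r; ring.
  by have := hge1 c; clear -zC C1; nra.
have cw : lorentz c w <= 2 * C ^+ 2.
  apply: le_trans (lorentz_le c w) _; have := ls_C HA; have := hge1 c; have := hge1 w; clear -c0C; nra.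
have cw0 := lorentz_gt0 c w.
have k0 : symm c w 0 0 <= 4 * C ^+ 3.
  rewrite symmE !mxE; have := hge1 c; have := hge1 w => w1 c1.
  have : lorentz c w * c 0 0 <= 2 * C ^+ 2 * C by apply: ler_pM => //; lra.
  have -> : 4 * C ^+ 3 = 2 * (2 * C ^+ 2 * C) by ring.
  by lra.
have := abs_coord1 (symm c w); have := abs_coord1 c; rewrite !ler_norml.
move=> /andP[_ c1] /andP[_ k1'].
have b1 : s' * c 0 1 <= eta * C.
  have := ls_s HB; have := ls_s0 HB => *; have : c 0 1 <= C by lra.
  by nra.
have b2 : s * symm c w 0 1 <= eta * (4 * C ^+ 3).
  have := ls_s HA; have := ls_s0 HA => *; have : symm c w 0 1 <= 4 * C ^+ 3 by lra.
  move=> kC; apply: (@le_trans _ _ (s * (4 * C ^+ 3))); first exact: ler_wpM2l.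
  by apply: ler_wpM2r => //; rewrite mulr_ge0// exprn_ge0// (le_trans ler01 C1).
(* The height of [w] is estimated through those of [c] and [symm c w]. The bounds sum to
   [8 * C ^+ 3 * eta], which is below [h]. *)
have wE : w 0 2 = 2 * (lorentz c w * c 0 2) - symm c w 0 2.
  by rewrite symmE !mxE; ring.
have : lorentz c w * c 0 2 <= 2 * C ^+ 2 * (eta * C).
  have [c2n|c2p] := leP (c 0 2) 0.
    apply: (le_trans (mulr_ge0_le0 (ltW cw0) c2n)).
    by rewrite !mulr_ge0// ?sqr_ge0// (le_trans ler01 C1).
  by apply: ler_pM => //; [exact: ltW|exact: ltW|clear -c2b b1; lra].
have := ls_h HA; move: small.
have -> : 2 * C ^+ 2 * (eta * C) = 2 * (C ^+ 3 * eta) by ring.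
have -> : 10 * C ^+ 3 * eta = 10 * (C ^+ 3 * eta) by ring.
move: b2; have -> : eta * (4 * C ^+ 3) = 4 * (C ^+ 3 * eta) by ring.
have : 0 <= C ^+ 3 * eta by rewrite mulr_ge0// exprn_ge0// (le_trans ler01 C1).
clear -k1 k2 wE; lra.
Qed.

End Lens.

(** * The centre of symmetry of a lens exchanges the ends of the chord *)

Section LensTheorem.
Variable R : realType.
Implicit Types (x y z w q : hplane R) (a b c : R) (A B : set (hplane R)).

Lemma hact_rho_ho : hact (rho R) ho = ho.
Proof. by apply: val_inj; apply: eq_vec3; rewrite /= !hact_rho ?hoE ?oppr0. Qed.

Lemma hact_rho_axis z : z 0 2 = 0 -> hact (rho R) z = z.
Proof. by move=> z2; apply: val_inj; apply: eq_vec3; rewrite /= !hact_rho ?z2 ?oppr0. Qed.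

Lemma interior_pre_rho A z : interior (pre (rho R) A) z <-> interior A (hact (rho R) z).
Proof. exact/interior_pre/lor_rho. Qed.

(** The axis vector spanned by [z] and [w] is subtracted from [t] with a factor [e] so small that
    the coefficients of [x] and [y] stay nonnegative; this puts positive weight on the interior
    point [w]. *)
Lemma axis_interior A x y z t w a b : hconvex A -> A x -> A y -> A z -> interior A w ->
  x 0 2 = 0 -> y 0 2 = 0 -> z 0 2 < 0 -> 0 < w 0 2 -> x 0 0 * y 0 1 != x 0 1 * y 0 0 ->
  0 < a -> 0 < b -> hvec t = a *: hvec x + b *: hvec y -> interior A t.
Proof.
move=> cA Ax Ay Az Aw x2 y2 z2 w2 xy a0 b0 tE.
pose d := x 0 0 * y 0 1 - x 0 1 * y 0 0.
have d0 : d != 0 by rewrite subr_eq0.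
(* [w2 *: z - z2 *: w] lies on the axis, hence is a combination of [x] and [y]. *)
pose p0 := w 0 2 * z 0 0 - z 0 2 * w 0 0; pose p1 := w 0 2 * z 0 1 - z 0 2 * w 0 1.
pose al := (p0 * y 0 1 - p1 * y 0 0) / d; pose be := (p1 * x 0 0 - p0 * x 0 1) / d.
pose e := Num.min (a / (`|al| + 1)) (b / (`|be| + 1)) / 2.
have na := normr_ge0 al; have nb := normr_ge0 be.
have m0 : 0 < Num.min (a / (`|al| + 1)) (b / (`|be| + 1)).
  by rewrite lt_min; apply/andP; split; rewrite divr_gt0//; lra.
have e0 : 0 < e by rewrite divr_gt0.
have ea : e * al <= a.
  have : e * (`|al| + 1) <= a.
    rewrite -ler_pdivlMr; last lra.
    apply: (@le_trans _ _ (Num.min (a / (`|al| + 1)) (b / (`|be| + 1)))); last by rewrite ge_min lexx.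
    by rewrite /e; lra.
  by have := ler_norm al; nra.
have eb : e * be <= b.
  have : e * (`|be| + 1) <= b.
    rewrite -ler_pdivlMr; last lra.
    apply: (@le_trans _ _ (Num.min (a / (`|al| + 1)) (b / (`|be| + 1)))); last by rewrite ge_min lexx orbT.
    by rewrite /e; lra.
  by have := ler_norm be; nra.
have E0 : al * x 0 0 + be * y 0 0 = p0 by rewrite /al /be /d; field.
have E1 : al * x 0 1 + be * y 0 1 = p1 by rewrite /al /be /d; field.
pose r := (a - e * al) *: hvec x + (b - e * be) *: hvec y.
have tw : hvec t = r + (e * w 0 2) *: hvec z + (e * - z 0 2) *: hvec w.
  rewrite tE; apply: eq_vec3; rewrite !mxE ?x2 ?y2.
  - have -> : (a - e * al) * x 0 0 + (b - e * be) * y 0 0 =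
      a * x 0 0 + b * y 0 0 - e * (al * x 0 0 + be * y 0 0) by ring.
    by rewrite E0 /p0; ring.
  - have -> : (a - e * al) * x 0 1 + (b - e * be) * y 0 1 =
      a * x 0 1 + b * y 0 1 - e * (al * x 0 1 + be * y 0 1) by ring.
    by rewrite E1 /p1; ring.
  - by ring.
have ew : 0 < e * - z 0 2 by rewrite mulr_gt0// oppr_gt0.
have ez : 0 <= e * w 0 2 by rewrite mulr_ge0// ltW.
have [r0|rn] := eqVneq r 0.
  by apply: (interior_comb2 (a := e * w 0 2) (c := e * - z 0 2) cA Az Aw) => //; rewrite tw r0 add0r.
have ga : 0 <= a - e * al by lra.
have gb : 0 <= b - e * be by lra.
have rr : lorentz r r = (a - e * al) ^+ 2 + (b - e * be) ^+ 2
    + 2 * ((a - e * al) * (b - e * be)) * lorentz x y by exact: lorentz_comb2.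
have gg : 0 <= (a - e * al) * (b - e * be) * lorentz x y.
  by rewrite !mulr_ge0// ltW// lorentz_gt0.
have gab : 0 < a - e * al \/ 0 < b - e * be.
  have [g|g] := ltP 0 (a - e * al); first by left.
  right; rewrite lt_neqAle gb andbT; apply/eqP => bb; move: rn.
  have aa : a - e * al = 0 by lra.
  by rewrite /r -bb aa !scale0r addr0 eqxx.
have [||m [N N0 mE]] := @hcone _ r x.
- rewrite rr; have := sqr_ge0 (a - e * al); have := sqr_ge0 (b - e * be).
  by clear -gab gg; case: gab => g; have := exprn_gt0 2 g; lra.
- rewrite /r !lorentzE hvec_norm mulr1; have l0 := lorentz_gt0 y x.
  by clear -gab ga gb l0; case: gab => g; nra.
have Am : A m.
  apply: (@hconvex_comb _ A x y m (N^-1 * (a - e * al)) (N^-1 * (b - e * be))) => //.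
  - by rewrite mulr_ge0// invr_ge0 ltW.
  - by rewrite mulr_ge0// invr_ge0 ltW.
  - by rewrite -!scalerA -scalerDr -/r mE scalerA mulVf ?scale1r// gt_eqF.
by apply: (interior_comb3 cA Am Az Aw (ltW N0) ez ew); rewrite -mE.
Qed.

(* For [q] on the axis, the reflection exchanging [ho] and [q]. *)
Definition kap q : 'M[R]_3 :=
  mat3 (vec3 (q 0 0) (q 0 1) 0) (vec3 (- q 0 1) (- q 0 0) 0) (vec3 0 0 1).

Lemma lor_kap q : q 0 2 = 0 -> lor (kap q).
Proof.
move=> q2; have := hsqr q; rewrite q2 expr0n /= addr0 => h; have := hvec0_gt0 q => q0.
by apply: lor_mat3; rewrite /lorentz ?vec3E//; rewrite ?mulrNN -?expr2 ?h; ring.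
Qed.

Lemma hact_kap q z : q 0 2 = 0 -> (hact (kap q) z 0 0 = z 0 0 * q 0 0 - z 0 1 * q 0 1) *
  (hact (kap q) z 0 1 = z 0 0 * q 0 1 - z 0 1 * q 0 0) * (hact (kap q) z 0 2 = z 0 2).
Proof. by move=> q2; rewrite !(hactE _ (lor_kap q2)) mul_mat3 !mxE /=; split; [split|]; ring. Qed.

(** The image of [ho] is located by exclusion. Off the axis it would be interior to one of the
    bodies by [cap_cone], and strictly between [ho] and [q] by [axis_interior]; [thin_corner]
    forbids both. Beyond [q] it would make [q] interior. If it were [ho], the centre would be [ho]
    and the image of [q] would lie on the wrong side. *)
Lemma lens_center A B q w w' s s' eta C h k (c : hplane R) :
  0 < h -> 1 <= C -> q 0 0 <= C -> 10 * C ^+ 3 * eta < h -> q 0 2 = 0 -> 0 < q 0 1 ->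
  lens_side A q w s eta C h k -> lens_side B q w' s' eta C h (- k) -> closed A -> closed B ->
  (forall z, (A `&` pre (rho R) B) z -> (A `&` pre (rho R) B) (symm c z)) ->
  (exists2 z, A z & z 0 2 < 0) \/ (exists2 z, B z & z 0 2 < 0) ->
  symm c ho = q.
Proof.
move=> h0 C1 qC small q2 q1 HA HB clA clB sM solid.
have small' : 10 * C ^+ 3 * eta < h by [].
have sM' z : (B `&` pre (rho R) A) z -> (B `&` pre (rho R) A) (symm (hact (rho R) c) z).
  move=> [Bz Az]; have [] := sM (hact (rho R) z); first by split=> //; rewrite /pre /= hact_rhoK.
  by rewrite /pre /= hact_symm ?hact_rhoK => *; [split; rewrite // hact_symm ?hact_rhoK; [|exact: lor_rho]|exact: lor_rho].
have HB' : lens_side B q w' s' eta C h (- k) by [].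
have HA' : lens_side A q w s eta C h (- - k) by rewrite opprK.
have T1 : symm c ho 0 0 <= C -> ~ interior (pre (rho R) B) (symm c ho).
  by move=> zC; apply: (thin_corner h0 C1 small HA HB).
have T2 : symm c ho 0 0 <= C -> ~ interior A (symm c ho).
  move=> zC iA; apply: (thin_corner h0 C1 small HB HA' clA sM').
    rewrite -hact_rho_ho -hact_symm; [by rewrite hact_rho|exact: lor_rho].
  apply/interior_pre_rho; rewrite hact_symm; last exact: lor_rho.
  by rewrite hact_rhoK hact_rho_ho.
have M0 : (A `&` pre (rho R) B) ho.
  by split; [exact: (ls_o HA)|rewrite /pre /= hact_rho_ho; exact: (ls_o HB)].
have [Az Bz] := sM _ M0; set z := symm c ho in Az Bz T1 T2 *.
have w2 : 0 < w 0 2 by apply: lt_le_trans (ls_h HA).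
have w'2 : 0 < w' 0 2 by apply: lt_le_trans (ls_h HB).
have wC : hact (rho R) w 0 0 <= C by rewrite hact_rho; exact: (ls_C HA).
have wC' : hact (rho R) w' 0 0 <= C by rewrite hact_rho; exact: (ls_C HB).
have oC : (ho : hplane R) 0 0 <= C by rewrite hoE.
have pB : hconvex (pre (rho R) B) by apply: hconvex_pre (ls_convex HB); apply: lor_rho.
have [z2|z2|z2] := ltgtP (z 0 2) 0.
- have [a [b [d [a0 b0 d0 zE]]]] := cap_cone h0 C1 small q2 q1 HA HB Az z2.
  case: (T1 (comb3_bound a0 b0 (ltW d0) C1 oC qC wC' zE)).
  apply: (interior_comb3 pB _ _ _ a0 b0 d0 zE); first exact: (proj2 M0).
    by rewrite /pre /= hact_rho_axis//; exact: (ls_q HB).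
  by apply/interior_pre_rho; rewrite hact_rhoK; exact: (ls_w HB).
- have z2' : hact (rho R) z 0 2 < 0 by rewrite hact_rho oppr_lt0.
  have [a [b [d [a0 b0 d0 zE]]]] := cap_cone h0 C1 small q2 q1 HB HA' Bz z2'.
  have zC : z 0 0 <= C.
    by rewrite -(hact_rho z); apply: (comb3_bound a0 b0 (ltW d0) C1 oC qC wC zE).
  case: (T2 zC); rewrite -(hact_rhoK z); apply/interior_pre_rho.
  have pA : hconvex (pre (rho R) A) by apply: hconvex_pre (ls_convex HA); apply: lor_rho.
  apply: (interior_comb3 pA _ _ _ a0 b0 d0 zE).
  - by rewrite /pre /= hact_rho_ho; exact: (ls_o HA).
  - by rewrite /pre /= hact_rho_axis//; exact: (ls_q HA).
  - by apply/interior_pre_rho; rewrite hact_rhoK; exact: (ls_w HA).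
have sA := ls_supp HA; have sB := ls_supp HB.
have s0 := ls_s0 HA; have s'0 := ls_s0 HB.
have Bz' : B z by rewrite -(hact_rho_axis z2).
(* A common point of the axis to the left of [ho] forces both slopes to vanish, against [solid]. *)
have nneg (t : hplane R) : t 0 2 = 0 -> A t -> B t -> 0 <= t 0 1.
  move=> t2 /sA; rewrite t2 add0r => tA /sB; rewrite t2 add0r => tB.
  rewrite leNgt; apply/negP => t1.
  have s_0 : s = 0 by apply/eqP; rewrite eq_le s0 andbT; nra.
  have s'_0 : s' = 0 by apply/eqP; rewrite eq_le s'0 andbT; nra.
  case: solid => -[y]; first by move=> /sA; rewrite s_0 mul0r addr0 leNgt => /negP.
  by move=> /sB; rewrite s'_0 mul0r addr0 leNgt => /negP.
have qs := hsqr q; rewrite q2 expr0n /= addr0 in qs.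
have zs := hsqr z; rewrite z2 expr0n /= addr0 in zs.
have q0 := hvec0_gt0 q; have z0 := hvec0_gt0 z.
have z1 : 0 < z 0 1.
  rewrite lt_neqAle (nneg z)// andbT; apply/eqP => /esym z1.
  have zo : z = ho.
    apply: val_inj; apply: eq_vec3; rewrite /= ?hoE//.
    by move: zs; rewrite z1 expr0n /= addr0; nra.
  have co : c = ho.
    have : lorentz c c = 1 by rewrite hvec_norm.
    have : lorentz (symm c ho) ho = 1 by rewrite -/z zo hvec_norm.
    rewrite symmE !lorentzE hvec_norm !lorentz_ho_r => e _.
    by apply: lorentz_eq1; rewrite lorentz_ho_r; have := hge1 c; nra.
  have Mq : (A `&` pre (rho R) B) q.
    by split; [exact: (ls_q HA)|rewrite /pre /= hact_rho_axis//; exact: (ls_q HB)].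
  have [Aq Bq] := sM _ Mq.
  have sq2 : symm c q 0 2 = 0 by rewrite symmE co !mxE /= q2; ring.
  have sq1 : symm c q 0 1 = - q 0 1 by rewrite symmE co !mxE /=; ring.
  have := nneg _ sq2 Aq; rewrite -{1}(hact_rho_axis sq2) => /(_ Bq).
  by rewrite sq1; lra.
have det1 : (ho : hplane R) 0 0 * z 0 1 != (ho : hplane R) 0 1 * z 0 0.
  by rewrite !hoE mul1r mul0r gt_eqF.
have det2 : (ho : hplane R) 0 0 * q 0 1 != (ho : hplane R) 0 1 * q 0 0.
  by rewrite !hoE mul1r mul0r gt_eqF.
have [lt|gt|eq] := ltgtP (z 0 1) (q 0 1).
- have cr : 0 < z 0 0 * q 0 1 - z 0 1 * q 0 0.
    have : z 0 1 ^+ 2 < q 0 1 ^+ 2 by clear -lt z1; nra.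
    move=> hh; have : (z 0 1 * q 0 0) ^+ 2 < (z 0 0 * q 0 1) ^+ 2 by rewrite !exprMn qs zs; clear -hh; nra.
    have zq : 0 <= z 0 1 * q 0 0 by rewrite mulr_ge0 ?ltW.
    have qz : 0 <= z 0 0 * q 0 1 by rewrite mulr_ge0 ?ltW.
    by rewrite ltr_pXn2r// subr_gt0.
  have zE := axis_point z q2 q1 z2.
  have a0 : 0 < (z 0 0 * q 0 1 - z 0 1 * q 0 0) / q 0 1 by rewrite divr_gt0.
  have b0 : 0 < z 0 1 / q 0 1 by rewrite divr_gt0.
  have zC : z 0 0 <= C.
    apply: le_trans qC; rewrite leNgt; apply/negP => h1.
    have : q 0 0 ^+ 2 < z 0 0 ^+ 2 by clear -h1 q0; nra.
    by rewrite qs zs; clear -lt z1; nra.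
  case: solid => -[y Ay y2].
  + case: (T2 zC); apply: (axis_interior (ls_convex HA) (proj1 M0) (ls_q HA) Ay (ls_w HA) _ _ y2 w2 det2 a0 b0 zE) => //.
    by rewrite hoE.
  + case: (T1 zC); apply/interior_pre_rho; rewrite hact_rho_axis//.
    apply: (axis_interior (ls_convex HB) (ls_o HB) (ls_q HB) Ay (ls_w HB) _ _ y2 w'2 det2 a0 b0 zE) => //.
    by rewrite hoE.
- have cr : 0 < q 0 0 * z 0 1 - q 0 1 * z 0 0.
    have : q 0 1 ^+ 2 < z 0 1 ^+ 2 by clear -gt q1; nra.
    move=> hh; have : (q 0 1 * z 0 0) ^+ 2 < (q 0 0 * z 0 1) ^+ 2 by rewrite !exprMn qs zs; clear -hh; nra.
    have zq : 0 <= q 0 1 * z 0 0 by rewrite mulr_ge0 ?ltW.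
    have qz : 0 <= q 0 0 * z 0 1 by rewrite mulr_ge0 ?ltW.
    by rewrite ltr_pXn2r// subr_gt0.
  have qE := axis_point q z2 z1 q2.
  have a0 : 0 < (q 0 0 * z 0 1 - q 0 1 * z 0 0) / z 0 1 by rewrite divr_gt0.
  have b0 : 0 < q 0 1 / z 0 1 by rewrite divr_gt0.
  case: solid => -[y Ay y2].
  + case: (ls_nq HA); apply: (axis_interior (ls_convex HA) (ls_o HA) Az Ay (ls_w HA) _ _ y2 w2 det1 a0 b0 qE) => //.
    by rewrite hoE.
  + case: (ls_nq HB); apply: (axis_interior (ls_convex HB) (ls_o HB) Bz' Ay (ls_w HB) _ _ y2 w'2 det1 a0 b0 qE) => //.
    by rewrite hoE.
- apply: val_inj; apply: eq_vec3 => //=; last by rewrite z2 q2.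
  by apply/eqP; rewrite -(@eqrXn2 _ 2)// ?ltW// qs zs eq.
Qed.

End LensTheorem.

(** * The caps of the two bodies below the chord are congruent *)

Section LensTheorem2.
Variable R : realType.
Implicit Types (x y z w q : hplane R) (a b c : R) (A B : set (hplane R)).

(** Each cap lies in the mirror image of the other body, hence in the intersection. The central
    symmetry exchanging [ho] and [q] is [kap q] followed by [rho], so [kap q] exchanges the caps. If
    neither body has points below the axis, there is nothing to prove. *)
Lemma lens A B q w w' s s' eta C h k :
  0 < h -> 1 <= C -> q 0 0 <= C -> 10 * C ^+ 3 * eta < h -> q 0 2 = 0 -> 0 < q 0 1 ->
  lens_side A q w s eta C h k -> lens_side B q w' s' eta C h (- k) -> closed A -> closed B ->
  (interior (A `&` pre (rho R) B) !=set0 -> centrally_symmetric (A `&` pre (rho R) B)) ->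
  forall z, z 0 2 < 0 -> A z <-> B (hact (kap q) z).
Proof.
move=> h0 C1 qC small q2 q1 HA HB clA clB sym.
have HA' : lens_side A q w s eta C h (- - k) by rewrite opprK.
have [solid|flat] := pselect ((exists2 z, A z & z 0 2 < 0) \/ (exists2 z, B z & z 0 2 < 0)); last first.
  move=> z z2; split=> Hz; case: flat; first by left; exists z.
  by right; exists (hact (kap q) z) => //; rewrite hact_kap.
have pB : hconvex (pre (rho R) B) by apply: hconvex_pre (ls_convex HB); apply: lor_rho.
have inB z : A z -> z 0 2 < 0 -> pre (rho R) B z.
  move=> Az z2; have [a [b [d [a0 b0 d0 zE]]]] := cap_cone h0 C1 small q2 q1 HA HB Az z2.
  apply: (hconvex_comb3 pB _ _ _ a0 b0 (ltW d0) zE); rewrite /pre /=.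
  - by rewrite hact_rho_ho; exact: (ls_o HB).
  - by rewrite hact_rho_axis//; exact: (ls_q HB).
  - by rewrite hact_rhoK; exact: (interior_subset (ls_w HB)).
have inA z : B z -> z 0 2 < 0 -> pre (rho R) A z.
  move=> Bz z2; have [a [b [d [a0 b0 d0 zE]]]] := cap_cone h0 C1 small q2 q1 HB HA' Bz z2.
  have pA : hconvex (pre (rho R) A) by apply: hconvex_pre (ls_convex HA); apply: lor_rho.
  apply: (hconvex_comb3 pA _ _ _ a0 b0 (ltW d0) zE); rewrite /pre /=.
  - by rewrite hact_rho_ho; exact: (ls_o HA).
  - by rewrite hact_rho_axis//; exact: (ls_q HA).
  - by rewrite hact_rhoK; exact: (interior_subset (ls_w HA)).
have Mo : (A `&` pre (rho R) B) ho.
  by split; [exact: (ls_o HA)|rewrite /pre /= hact_rho_ho; exact: (ls_o HB)].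
have Mq : (A `&` pre (rho R) B) q.
  by split; [exact: (ls_q HA)|rewrite /pre /= hact_rho_axis//; exact: (ls_q HB)].
have cM : hconvex (A `&` pre (rho R) B).
  by move=> x y t [Ax Bx] [Ay By] xyt; split; [exact: (ls_convex HA) xyt|exact: pB xyt].
have [c sM] : exists c : hplane R, forall z, (A `&` pre (rho R) B) z -> (A `&` pre (rho R) B) (symm c z).
  apply/centrally_symmetricP/sym.
  (* A point of the intersection off the axis spans with [ho] and [q] a triangle, which provides
     interior points. *)
  have [y My y2] : exists2 y, (A `&` pre (rho R) B) y & y 0 2 != 0.
    case: solid => -[y Ay y2].
      by exists y; [split=> //; apply: inB|rewrite lt_eqF].
    exists (hact (rho R) y); last by rewrite hact_rho oppr_eq0 lt_eqF.
    by split; [apply: inA|rewrite /pre /= hact_rhoK].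
  have [||m [N N0 mE]] := @hcone _ (hvec ho + hvec q + hvec y) ho.
  - rewrite !lorentzE !hvec_norm; have := lorentz_gt0 ho q; have := lorentz_gt0 q ho.
    have := lorentz_gt0 ho y; have := lorentz_gt0 y ho; have := lorentz_gt0 q y.
    by have := lorentz_gt0 y q; lra.
  - rewrite !lorentzE !hvec_norm; have := lorentz_gt0 q ho; have := lorentz_gt0 y ho; lra.
  exists m; apply: (@interior_triangle _ _ ho q y m N^-1 N^-1 N^-1) => //; try by rewrite invr_gt0.
    by rewrite /det3 !hoE q2; move: y2; apply: contraNneq => e; apply/eqP; nra.
  by rewrite -!scalerDr mE scalerA mulVf ?scale1r// gt_eqF.
have cq : symm c ho = q.
  exact: (lens_center h0 C1 qC small q2 q1 HA HB clA clB sM solid).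
have kE z : hact (kap q) z = hact (rho R) (symm c z).
  have q0 := hvec0_gt0 q; have qs := hsqr q; rewrite q2 expr0n /= addr0 in qs.
  have c0 := hvec0_gt0 c.
  have e0 : 2 * c 0 0 ^+ 2 = 1 + q 0 0.
    by rewrite -cq -[symm c ho 0 0](lorentz_ho_r) symmE !lorentzE hvec_norm lorentz_ho_r; ring.
  have e1 : 2 * (c 0 0 * c 0 1) = q 0 1.
    by rewrite -cq symmE !mxE /= lorentz_ho_r; ring.
  have e2 : c 0 2 = 0.
    have : q 0 2 = 2 * c 0 0 * c 0 2 by rewrite -cq symmE !mxE /= lorentz_ho_r; ring.
    by rewrite q2 => /esym/eqP; rewrite !mulf_eq0 (gt_eqF c0) pnatr_eq0 /= => /eqP.
  have e3 : 2 * c 0 1 ^+ 2 = q 0 0 - 1.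
    by have := hsqr c; rewrite e2 expr0n /= addr0; lra.
  have sE i : symm c z 0 i = 2 * (c 0 0 * z 0 0 - c 0 1 * z 0 1) * c 0 i - z 0 i.
    by rewrite symmE !mxE /lorentz e2 mul0r subr0.
  have e0' : 2 * (c 0 0 * z 0 0 - c 0 1 * z 0 1) * c 0 0 - z 0 0 =
      (2 * c 0 0 ^+ 2) * z 0 0 - (2 * (c 0 0 * c 0 1)) * z 0 1 - z 0 0 by ring.
  have e1' : 2 * (c 0 0 * z 0 0 - c 0 1 * z 0 1) * c 0 1 - z 0 1 =
      (2 * (c 0 0 * c 0 1)) * z 0 0 - (2 * c 0 1 ^+ 2) * z 0 1 - z 0 1 by ring.
  apply: val_inj; apply: eq_vec3.
  - by rewrite [LHS](hact_kap z q2) [RHS]hact_rho sE e0' e0 e1; ring.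
  - by rewrite [LHS](hact_kap z q2) [RHS]hact_rho sE e1' e1 e3; ring.
  - by rewrite [LHS](hact_kap z q2) [RHS]hact_rho sE e2; ring.
move=> z z2; rewrite kE; split.
  by move=> Az; have [_] := sM z (conj Az (inB z Az z2)).
move=> Bz; set y := hact (rho R) (symm c z) in Bz.
have y2 : y 0 2 < 0 by rewrite /y -kE hact_kap.
have [Az _] : (A `&` pre (rho R) B) z; last by [].
rewrite -(symmK c z); apply: sM; split; last exact: Bz.
by rewrite -[symm c z]hact_rhoK; apply: inA.
Qed.

End LensTheorem2.

(** * One-sided tangents at boundary points *)

Section Germs.
Variable R : realType.
Implicit Types (x y z w q p : hplane R) (a b c m : R) (A B : set (hplane R)).

Definition direct (N : 'M[R]_3) := lor N /\ \det N = 1.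

Lemma directM M N : direct M -> direct N -> direct (M *m N).
Proof. by move=> [? dM] [? dN]; split; [exact: lorM|rewrite det_mulmx dM dN mulr1]. Qed.

Lemma directV M : direct M -> direct (invmx M).
Proof. by move=> [? dM]; split; [exact: lorV|rewrite det_inv dM invr1]. Qed.

Definition rotm c (s : R) : 'M[R]_3 := mat3 (vec3 1 0 0) (vec3 0 c s) (vec3 0 (- s) c).

Lemma direct_rotm c (s : R) : c ^+ 2 + s ^+ 2 = 1 -> direct (rotm c s).
Proof.
move=> cs; split; last by rewrite det_mat3 /det3 !vec3E -[RHS]cs; ring.
by apply: lor_mat3; rewrite /lorentz ?vec3E; move: cs; rewrite ?expr2; lra.
Qed.

Lemma hact_rotm c (s : R) z : c ^+ 2 + s ^+ 2 = 1 -> (hact (rotm c s) z 0 0 = z 0 0) *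
  (hact (rotm c s) z 0 1 = c * z 0 1 - s * z 0 2) *
  (hact (rotm c s) z 0 2 = s * z 0 1 + c * z 0 2).
Proof.
move=> /direct_rotm[cs _]; rewrite !(hactE _ cs) mul_mat3 !mxE /=.
by split; [split|]; ring.
Qed.

Lemma rotmK c (s : R) z : c ^+ 2 + s ^+ 2 = 1 -> hact (rotm c s) (hact (rotm c (- s)) z) = z.
Proof.
move=> cs; have cs' : c ^+ 2 + (- s) ^+ 2 = 1 by rewrite sqrrN.
have E := hact_rotm (hact (rotm c (- s)) z) cs; have E' := hact_rotm z cs'.
apply: val_inj; apply: eq_vec3; rewrite [LHS]E !E' //.
- by rewrite -[RHS]mul1r -[X in _ = X * _]cs; ring.
- by rewrite -[RHS]mul1r -[X in _ = X * _]cs; ring.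
Qed.

Lemma rotm_ho c (s : R) : c ^+ 2 + s ^+ 2 = 1 -> hact (rotm c s) ho = ho.
Proof.
move=> cs; apply: val_inj; apply: eq_vec3.
- by rewrite [LHS](hact_rotm ho cs).
- by rewrite [LHS](hact_rotm ho cs) !hoE; ring.
- by rewrite [LHS](hact_rotm ho cs) !hoE; ring.
Qed.

(** The rotation about [ho] that turns the axis into the line of slope [m]. *)
Definition slope_rot m : 'M[R]_3 := rotm (Num.sqrt (1 + m ^+ 2))^-1 (m / Num.sqrt (1 + m ^+ 2)).

Lemma slope_rotP m : (Num.sqrt (1 + m ^+ 2))^-1 ^+ 2 + (m / Num.sqrt (1 + m ^+ 2)) ^+ 2 = 1.
Proof.
have h : 0 < 1 + m ^+ 2 by have := sqr_ge0 m; lra.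
rewrite exprMn exprVn sqr_sqrtr ?(ltW h)// -[X in X + _]mul1r -mulrDl mulfV//.
by rewrite gt_eqF.
Qed.

Lemma lorentz_sub a t (u v : 'rV[R]_3) :
  lorentz (a *: (u - t *: v)) (a *: (u - t *: v))
  = a ^+ 2 * (lorentz u u - 2 * t * lorentz v u + t ^+ 2 * lorentz v v).
Proof. by rewrite !lorentzE (lorentzC u v); ring. Qed.

(** An orthonormal frame at [p] whose last vector points towards [i]; taking the middle one as a
    cross product gives determinant 1. *)
Lemma frame_at p i : p != i -> exists2 N, direct N /\ hact N ho = p &
  exists j, [/\ hact N j = i, j 0 1 = 0 & 0 < j 0 2].
Proof.
move=> pi.
have c1 : 1 < lorentz p i.
  rewrite lt_neqAle lorentz_ge1 andbT eq_sym; apply: contra_neq pi; exact: lorentz_eq1.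
pose d := Num.sqrt (lorentz p i ^+ 2 - 1).
have d2 : d ^+ 2 = lorentz p i ^+ 2 - 1 by rewrite sqr_sqrtr// subr_ge0 exprn_ege1// ltW.
have d0 : 0 < d by rewrite sqrtr_gt0 subr_gt0 exprn_egt1.
pose n := d^-1 *: (hvec i - lorentz p i *: hvec p).
have nn : lorentz n n = -1.
  rewrite /n lorentz_sub !hvec_norm exprVn d2; move: d2; move: (lorentz p i) => t d2.
  rewrite (_ : 1 - _ + _ = - (t ^+ 2 - 1)); last ring.
  by rewrite mulrN mulVf// -d2 expf_eq0 gt_eqF.
have pn : lorentz p n = 0 by rewrite /n !lorentzE hvec_norm; ring.
pose e := cross p n.
have ee : lorentz e e = -1.
  have -> : lorentz e e = lorentz p p * lorentz n n - lorentz p n ^+ 2.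
    by rewrite /e /lorentz /cross !vec3E; ring.
  by rewrite hvec_norm nn pn; ring.
have pe : lorentz p e = 0 by rewrite lorentzC lorentz_cross /det3; ring.
have en : lorentz e n = 0 by rewrite lorentz_cross /det3; ring.
have L : lor (mat3 p e n) by apply: lor_mat3; rewrite ?hvec_norm ?hvec0_gt0.
have o : hact (mat3 p e n) ho = p.
  by apply: val_inj; rewrite /= hactE// mul_mat3 !hoE scale1r !scale0r !addr0.
exists (mat3 p e n).
  split=> //; split=> //; rewrite det_mat3.
  by rewrite det3N det3C -lorentz_cross -/e ee opprK.
have P : (lorentz (vec3 (lorentz p i) 0 d) (vec3 (lorentz p i) 0 d) == 1)
    && (0 < vec3 (lorentz p i) 0 d 0 0).
  rewrite /lorentz !vec3E -/(lorentz p i) -!expr2 d2; apply/andP; split; last lra.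
  by apply/eqP; ring.
exists (HPlane P); split; rewrite /= ?vec3E//.
apply: val_inj; rewrite /= hactE// mul_mat3 /= !vec3E scale0r addr0 /n scalerA mulfV ?gt_eqF//.
by rewrite scale1r addrC subrK.
Qed.

Lemma hpoint_side (s : R) : exists k : hplane R, k 0 1 = s /\ k 0 2 = 0.
Proof.
have P : (lorentz (vec3 (Num.sqrt (1 + s ^+ 2)) s 0) (vec3 (Num.sqrt (1 + s ^+ 2)) s 0) == 1)
    && (0 < vec3 (Num.sqrt (1 + s ^+ 2)) s 0 0 0).
  have h : 0 < 1 + s ^+ 2 by have := sqr_ge0 s; lra.
  rewrite /lorentz !vec3E sqrtr_gt0 h andbT -!expr2 sqr_sqrtr ?ltW//; apply/eqP; ring.
by exists (HPlane P); rewrite /= !vec3E.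
Qed.

(* The axis is the right tangent of [A] at its boundary point [ho]. *)
Record germ A : Prop := Germ {
  germ_o : A ho;
  germ_up : forall z, A z -> 0 <= z 0 2;
  germ_tan : forall eta, 0 < eta ->
    exists w, [/\ interior A w, 0 < w 0 1, 0 < w 0 2 & w 0 2 <= eta * w 0 1] }.

(* Otherwise [ho] would be a positive combination of [y], [z] and the interior point [i]. *)
Lemma boundary_cone A i z y : hconvex A -> ~ interior A ho -> interior A i ->
  i 0 1 = 0 -> 0 < i 0 2 -> A z -> A y -> 0 <= z 0 1 -> y 0 1 <= 0 ->
  0 < z 0 1 - y 0 1 -> 0 <= z 0 1 * y 0 2 - y 0 1 * z 0 2.
Proof.
move=> cA no Ai i1 i2 Az Ay z1 y1 zy; rewrite leNgt; apply/negP => D; apply: no.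
have [g g0 gi] : exists2 g, 0 < g & g * i 0 2 = - (z 0 1 * y 0 2 - y 0 1 * z 0 2).
  exists (- (z 0 1 * y 0 2 - y 0 1 * z 0 2) / i 0 2); last by rewrite divfK// gt_eqF.
  by rewrite divr_gt0// oppr_gt0.
pose l := - y 0 1 * z 0 0 + z 0 1 * y 0 0 + g * i 0 0.
have l0 : 0 < l.
  have t1 : 0 <= - y 0 1 * z 0 0 by rewrite mulr_ge0 ?oppr_ge0// ltW// hvec0_gt0.
  have t2 : 0 <= z 0 1 * y 0 0 by rewrite mulr_ge0// ltW// hvec0_gt0.
  have t3 : 0 < g * i 0 0 by rewrite mulr_gt0// hvec0_gt0.
  by rewrite /l ltr_wpDl// addr_ge0.
have li : 0 < l^-1 by rewrite invr_gt0.
apply: (@interior_comb3 _ A z y i ho (l^-1 * - y 0 1) (l^-1 * z 0 1) (l^-1 * g)) => //.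
- by rewrite mulr_ge0 ?oppr_ge0// ltW.
- by rewrite mulr_ge0// ltW.
- by rewrite mulr_gt0.
rewrite -!scalerA -!scalerDr; apply: eq_vec3; rewrite !mxE /=.
- by rewrite -/l mulVf// gt_eqF.
- by rewrite i1; ring.
- by rewrite gi; ring.
Qed.

(** In a frame with an interior point straight above the boundary point, the slope of the right
    tangent is the infimum of the slopes of the points on the right. By [boundary_cone] the points
    on the left bound it from below, and all of [A] lies above the line of this slope. *)
Lemma germ_exists A i p : closed A -> hconvex A -> interior A i -> A p -> ~ interior A p ->
  exists N, [/\ direct N, hact N ho = p & germ (pre N A)].
Proof.
move=> clA0 cA0 Ai0 Ap np.
have pi : p != i by apply: contra_notN np => /eqP ->.
have [N [dN No] [j [ji j1 j2]]] := frame_at pi.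
suff [m gm] : exists m, germ (pre (slope_rot m) (pre N A)).
  exists (slope_rot m *m N); have dr := direct_rotm (slope_rotP m).
  split; first exact: directM.
    by rewrite hactM ?rotm_ho//; [exact: slope_rotP|exact: (proj1 dr)|exact: (proj1 dN)].
  by rewrite -preM//; [exact: (proj1 dr)|exact: (proj1 dN)].
have clA := closed_pre (proj1 dN) clA0; have cA := hconvex_pre (proj1 dN) cA0.
have Aj : interior (pre N A) j by apply/interior_pre; [exact: (proj1 dN)|rewrite ji].
have Ao : pre N A ho by rewrite /pre /= No.
have no : ~ interior (pre N A) ho by move/interior_pre; rewrite No => /(_ (proj1 dN)).
move: (pre N A) clA cA Aj Ao no => {A clA0 cA0 Ai0 Ap np pi N dN No ji} A clA cA Aj Ao no.
have [k1 [k11 k12]] := hpoint_side 1; have [k2 [k21 k22]] := hpoint_side (-1).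
have [y1 [a1 [b1 [a10 b10 y1E Ay1]]]] := toward k1 clA Aj.
have [y2 [a2 [b2 [a20 b20 y2E Ay2]]]] := toward k2 clA Aj.
have y1_1 : 0 < y1 0 1 by rewrite y1E !mxE j1 k11; lra.
have y2_1 : y2 0 1 < 0 by rewrite y2E !mxE j1 k21; lra.
have BC z y : A z -> A y -> 0 <= z 0 1 -> y 0 1 <= 0 -> 0 < z 0 1 - y 0 1 ->
  0 <= z 0 1 * y 0 2 - y 0 1 * z 0 2 := boundary_cone cA no Aj j1 j2.
pose S := [set s : R | exists z, [/\ A z, 0 < z 0 1 & s = z 0 2 / z 0 1]].
have lbS : lbound S (y2 0 2 / y2 0 1).
  move=> _ [z [Az z1 ->]]; rewrite ler_pdivlMr// mulrAC ler_ndivrMr//.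
  by have := BC z y2 Az Ay2 (ltW z1) (ltW y2_1); lra.
have hS : has_inf S by split; [exists (y1 0 2 / y1 0 1), y1|exists (y2 0 2 / y2 0 1)].
pose m := inf S.
have mz z : A z -> m * z 0 1 <= z 0 2.
  move=> Az; have [z1|z1|z1] := ltgtP (z 0 1) 0.
  - have : z 0 2 / z 0 1 <= m.
      apply: lb_le_inf; first exact: (proj1 hS).
      move=> _ [y [Ay y_1 ->]]; rewrite ler_pdivlMr// mulrAC ler_ndivrMr//.
      by have := BC y z Ay Az (ltW y_1) (ltW z1); lra.
    by rewrite ler_ndivrMr.
  - rewrite -ler_pdivlMr//; apply: ge_inf (proj2 hS) _ _.
    by exists z.
  - rewrite z1 mulr0; have := BC y1 z Ay1 Az (ltW y1_1).
    by rewrite z1 mul0r !subr0 => /(_ (lexx _) y1_1); rewrite pmulr_rge0.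
exists m; set T := Num.sqrt (1 + m ^+ 2).
have T0 : 0 < T by rewrite sqrtr_gt0; have := sqr_ge0 m; lra.
have rE z := hact_rotm z (slope_rotP m).
have dr := direct_rotm (slope_rotP m).
split.
- by rewrite /pre /= rotm_ho//; exact: slope_rotP.
- move=> z; rewrite /pre /= => /mz; rewrite /slope_rot !rE -/T.
  rewrite -(ler_pM2l T0) => h.
  have -> : z 0 2 = ((m / T * z 0 1 + T^-1 * z 0 2) * T - m * (T^-1 * z 0 1 - m / T * z 0 2) * T) / (1 + m ^+ 2).
    by field; rewrite !gt_eqF//; have := sqr_ge0 m; lra.
  by rewrite divr_ge0//; [move: h; clear; lra|have := sqr_ge0 m; clear; lra].
move=> eta eta0.
(* The second bound keeps [1 + m ^+ 2 + m * de] at least 1/2; after the rotation the slope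
   [de / (1 + m ^+ 2 + m * de)] is then at most [eta]. *)
pose de := Num.min (eta / 2) (2 * (`|m| + 1))^-1.
have nm := normr_ge0 m.
have de0 : 0 < de by rewrite lt_min divr_gt0// invr_gt0 mulr_gt0//; lra.
have de1 : de <= eta / 2 by rewrite ge_min lexx.
have de2 : de * (2 * (`|m| + 1)) <= 1.
  rewrite -ler_pdivlMr; last by rewrite mulr_gt0//; lra.
  by rewrite ge_min mul1r lexx orbT.
have [_ [y [Ay y_1 ->]] ym] := inf_adherent de0 hS.
have {}ym : y 0 2 < (m + de) * y 0 1 by rewrite -ltr_pdivrMr.
(* Adding a multiple of the interior point [j], straight above [ho], raises the slope of [y] to
   exactly [m + de]. *)
pose e := ((m + de) * y 0 1 - y 0 2) / j 0 2.
have e0 : 0 < e by rewrite divr_gt0// subr_gt0.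
have [||w' [N N0 w'E]] := @hcone _ (hvec y + e *: hvec j) y.
- rewrite !lorentzE !hvec_norm; have := mulr_gt0 e0 (lorentz_gt0 y j).
  have := mulr_gt0 e0 (lorentz_gt0 j y); have := mulr_gt0 e0 e0; clear; lra.
- by rewrite !lorentzE !hvec_norm; have := mulr_gt0 e0 (lorentz_gt0 j y); clear; lra.
have w'A : interior A w'.
  apply: (@interior_comb2 _ A y j w' N^-1 (N^-1 * e)) => //.
  - by rewrite invr_ge0 ltW.
  - by rewrite mulr_gt0// invr_gt0.
  - by rewrite -scalerA -scalerDr w'E scalerA mulVf ?scale1r// gt_eqF.
have w1 : N * w' 0 1 = y 0 1.
  have := congr1 (fun v : 'rV_3 => v 0 1) w'E; rewrite !mxE j1 => <-; ring.
have w2 : N * w' 0 2 = (m + de) * y 0 1.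
  have := congr1 (fun v : 'rV_3 => v 0 2) w'E; rewrite !mxE => <-.
  by rewrite /e divfK ?gt_eqF//; ring.
have w'1 : 0 < w' 0 1 by rewrite -(pmulr_rgt0 _ N0) w1.
have w'2 : w' 0 2 = (m + de) * w' 0 1.
  by apply: (mulfI (lt0r_neq0 N0)); rewrite w2 mulrCA w1.
have cs := slope_rotP m.
have cs' : (Num.sqrt (1 + m ^+ 2))^-1 ^+ 2 + (- (m / Num.sqrt (1 + m ^+ 2))) ^+ 2 = 1.
  by rewrite sqrrN.
exists (hact (rotm T^-1 (- (m / T))) w'); split.
- by apply/interior_pre; [exact: (proj1 dr)|rewrite rotmK].
- rewrite (hact_rotm _ cs') w'2.
  have -> : T^-1 * w' 0 1 - - (m / T) * ((m + de) * w' 0 1) = T^-1 * w' 0 1 * (1 + m ^+ 2 + m * de).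
    by ring.
  rewrite mulr_gt0 ?mulr_gt0 ?invr_gt0//.
  have mm : - m <= `|m| by rewrite -normrN ler_norm.
  by have := sqr_ge0 m; clear -mm de0 de2 nm; nra.
- rewrite (hact_rotm _ cs') w'2.
  have -> : - (m / T) * w' 0 1 + T^-1 * ((m + de) * w' 0 1) = T^-1 * w' 0 1 * de by ring.
  by rewrite !mulr_gt0// invr_gt0.
- rewrite !(hact_rotm _ cs') w'2.
  have -> : - (m / T) * w' 0 1 + T^-1 * ((m + de) * w' 0 1) = T^-1 * w' 0 1 * de by ring.
  have -> : eta * (T^-1 * w' 0 1 - - (m / T) * ((m + de) * w' 0 1))
     = T^-1 * w' 0 1 * (eta * (1 + m ^+ 2 + m * de)) by ring.
  rewrite ler_pM2l; last by rewrite mulr_gt0// invr_gt0.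
  have mm : - m <= `|m| by rewrite -normrN ler_norm.
  have : 1 / 2 <= 1 + m ^+ 2 + m * de by have := sqr_ge0 m; clear -mm de0 de2 nm; nra.
  by clear -de1 eta0; nra.
Qed.

End Germs.

(** * The boundary arc to the right of a boundary point *)

Section Arcs.
Variable R : realType.
Implicit Types (x y z w q p : hplane R) (a b c m s t : R) (A B : set (hplane R)).

(** For [1 <= c] this is the point at distance [arcosh c] from [ho] in the direction [(1, m)]. *)
Definition hpt c m : hplane R := insubd ho
  (vec3 c (Num.sqrt (c ^+ 2 - 1) / Num.sqrt (1 + m ^+ 2))
          (m * (Num.sqrt (c ^+ 2 - 1) / Num.sqrt (1 + m ^+ 2)))).

Lemma sqr1_gt0 m : 0 < 1 + m ^+ 2.
Proof. by have := sqr_ge0 m; lra. Qed.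

Lemma sqrt1_ge1 m : 1 <= Num.sqrt (1 + m ^+ 2).
Proof. by rewrite -[X in X <= _]sqrtr1 ler_wsqrtr// lerDl sqr_ge0. Qed.

Lemma sqr_sqrt1 m : Num.sqrt (1 + m ^+ 2) ^+ 2 = 1 + m ^+ 2.
Proof. by rewrite sqr_sqrtr// ltW// sqr1_gt0. Qed.

Lemma hptE c m : 1 <= c -> hvec (hpt c m) =
  (vec3 c (Num.sqrt (c ^+ 2 - 1) / Num.sqrt (1 + m ^+ 2))
          (m * (Num.sqrt (c ^+ 2 - 1) / Num.sqrt (1 + m ^+ 2)))).
Proof.
move=> c1; rewrite /hpt -[LHS]/(val _) val_insubd ifT //; apply/andP; split.
  apply/eqP; rewrite /lorentz !vec3E.
  have := sqr_sqrtr (_ : 0 <= c ^+ 2 - 1); rewrite subr_ge0 exprn_ege1// => /(_ isT).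
  have := sqr_sqrt1 m; have := sqrt1_ge1 m; set S := Num.sqrt _; set T := Num.sqrt _ => T1 T2 S2.
  have -> : c * c - T / S * (T / S) - m * (T / S) * (m * (T / S))
      = c ^+ 2 - T ^+ 2 * (1 + m ^+ 2) / S ^+ 2 by field; rewrite gt_eqF//; lra.
  by rewrite T2 S2 mulfK ?gt_eqF ?sqr1_gt0//; ring.
by rewrite vec3E; lra.
Qed.

Lemma hptC c m : 1 <= c -> (hpt c m 0 0 = c) *
  (hpt c m 0 1 = Num.sqrt (c ^+ 2 - 1) / Num.sqrt (1 + m ^+ 2)) *
  (hpt c m 0 2 = m * hpt c m 0 1).
Proof. by move=> c1; rewrite hptE// !vec3E. Qed.

Lemma hpt1 m : hpt 1 m = ho.
Proof.
apply: val_inj; rewrite /= hptE// expr1n subrr sqrtr0 mul0r mulr0.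
by apply: eq_vec3; rewrite !vec3E.
Qed.

Lemma hpt_gt0 c m : 1 < c -> 0 < hpt c m 0 1.
Proof.
by move=> c1; rewrite hptC ?ltW// divr_gt0// sqrtr_gt0 ?sqr1_gt0// subr_gt0 exprn_egt1.
Qed.

Lemma hpt_sqr c m : 1 <= c -> hpt c m 0 1 ^+ 2 * (1 + m ^+ 2) = c ^+ 2 - 1.
Proof.
move=> c1; rewrite hptC// expr_div_n sqr_sqrt1 divfK ?gt_eqF ?sqr1_gt0//.
by rewrite sqr_sqrtr// subr_ge0 exprn_ege1.
Qed.

Lemma hpt_eq z m : 0 < z 0 1 -> z 0 2 = m * z 0 1 -> hpt (z 0 0) m = z.
Proof.
move=> z1 z2; have h := hpt_sqr m (hge1 z).
have e1 : hpt (z 0 0) m 0 1 = z 0 1.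
  have c1 : 0 <= hpt (z 0 0) m 0 1.
    by rewrite hptC ?hge1// divr_ge0// sqrtr_ge0.
  apply/eqP; rewrite -(@eqrXn2 _ 2)// ?ltW//; apply/eqP.
  apply: (mulIf (lt0r_neq0 (sqr1_gt0 m))); rewrite h (hsqr z) z2; ring.
have C := hptC m (hge1 z); apply: val_inj; apply: eq_vec3; first by rewrite [LHS]C.
  exact: e1.
by rewrite [LHS]C e1 z2.
Qed.

(** [x] is the cosine of the angle between the two directions; being nonnegative, it satisfies
    [1 - x <= 1 - x ^+ 2], which is at most the squared difference of the slopes. *)
Lemma lorentz_hpt_close c m m' : 1 <= c -> 0 <= 1 + m * m' ->
  lorentz (hpt c m) (hpt c m') <= 1 + (c ^+ 2 - 1) * (m - m') ^+ 2.
Proof.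
move=> c1 mm.
have T1 := sqrt1_ge1 m; have T1' := sqrt1_ge1 m'.
have S0 : 0 <= c ^+ 2 - 1 by rewrite subr_ge0 exprn_ege1.
have S2 := sqr_sqrtr S0; have T2 := sqr_sqrt1 m; have T2' := sqr_sqrt1 m'.
pose x := (1 + m * m') / (Num.sqrt (1 + m ^+ 2) * Num.sqrt (1 + m' ^+ 2)).
have -> : lorentz (hpt c m) (hpt c m') = c ^+ 2 - (c ^+ 2 - 1) * x.
  rewrite /lorentz !hptC// /x -[in RHS]S2; move: S2 T2 T2' T1 T1'.
  move: (Num.sqrt (c ^+ 2 - 1)) (Num.sqrt (1 + m ^+ 2)) (Num.sqrt (1 + m' ^+ 2)) => S T T' *.
  by field; rewrite !gt_eqF//; lra.
have x0 : 0 <= x by rewrite divr_ge0// mulr_ge0; lra.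
have x2 : x ^+ 2 = 1 - (m - m') ^+ 2 / ((1 + m ^+ 2) * (1 + m' ^+ 2)).
  rewrite /x expr_div_n exprMn T2 T2'; field.
  by rewrite !gt_eqF ?sqr1_gt0.
have d0 : 0 <= (m - m') ^+ 2 / ((1 + m ^+ 2) * (1 + m' ^+ 2)).
  by rewrite divr_ge0 ?sqr_ge0// mulr_ge0// ltW// sqr1_gt0.
have d1 : (m - m') ^+ 2 / ((1 + m ^+ 2) * (1 + m' ^+ 2)) <= (m - m') ^+ 2.
  rewrite ler_pdivrMr ?mulr_gt0 ?sqr1_gt0// ler_peMr ?sqr_ge0//.
  by have := sqr_ge0 m; have := sqr_ge0 m'; nra.
move: d0 d1; set d := _ / _ in x2 * => d0 d1.
have x1 : x <= 1 by nra.
have : (c ^+ 2 - 1) * (1 - x) <= (c ^+ 2 - 1) * (m - m') ^+ 2.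
  by rewrite ler_wpM2l//; nra.
lra.
Qed.

(** At fixed radii the distance grows with the angle; [key] compares the cosines. *)
Lemma lorentz_hpt_mono c c' m a b : 1 <= c -> 1 <= c' -> 0 <= m -> m <= 1 -> m <= a -> a <= b ->
  lorentz (hpt c m) (hpt c' a) <= lorentz (hpt c m) (hpt c' b).
Proof.
move=> c1 c'1 m0 m1 ma ab.
have Ta := sqrt1_ge1 a; have Tb := sqrt1_ge1 b; have T := sqrt1_ge1 m.
have Ta2 := sqr_sqrt1 a; have Tb2 := sqr_sqrt1 b.
have S0 := sqrtr_ge0 (c ^+ 2 - 1); have S0' := sqrtr_ge0 (c' ^+ 2 - 1).
have key : (1 + m * b) / Num.sqrt (1 + b ^+ 2) <= (1 + m * a) / Num.sqrt (1 + a ^+ 2).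
  rewrite ler_pdivrMr; last lra.
  rewrite mulrAC ler_pdivlMr; last lra.
  have a0 : 0 <= a by lra.
  have b0 : 0 <= b by lra.
  have p1 : 0 <= (1 + m * b) * Num.sqrt (1 + a ^+ 2).
    by rewrite mulr_ge0 ?addr_ge0 ?mulr_ge0//; lra.
  have p2 : 0 <= (1 + m * a) * Num.sqrt (1 + b ^+ 2).
    by rewrite mulr_ge0 ?addr_ge0 ?mulr_ge0//; lra.
  rewrite -ler_sqr ?nnegrE// !exprMn Ta2 Tb2 -subr_ge0.
  have -> : (1 + m * a) ^+ 2 * (1 + b ^+ 2) - (1 + m * b) ^+ 2 * (1 + a ^+ 2) =
    (b - a) * (((a - m) + (b - m)) * (1 - m ^+ 2) + 2 * m * ((a - m) * b + m * (b - m))) by ring.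
  have u1 : 0 <= 1 - m ^+ 2 by rewrite subr_ge0 expr_le1.
  have u2 : 0 <= a - m by rewrite subr_ge0.
  have u3 : 0 <= b - m by rewrite subr_ge0 (le_trans ma).
  apply: mulr_ge0; first by rewrite subr_ge0.
  apply: addr_ge0; first by apply: mulr_ge0 => //; exact: addr_ge0.
  apply: mulr_ge0; first by rewrite mulr_ge0.
  by apply: addr_ge0; exact: mulr_ge0.
rewrite /lorentz !hptC//.
set S := Num.sqrt (c ^+ 2 - 1) in S0 *; set S' := Num.sqrt (c' ^+ 2 - 1) in S0' *.
set T' := Num.sqrt (1 + m ^+ 2) in T *.
have E u : S / T' * (S' / Num.sqrt (1 + u ^+ 2)) + m * (S / T') * (u * (S' / Num.sqrt (1 + u ^+ 2)))
   = S / T' * S' * ((1 + m * u) / Num.sqrt (1 + u ^+ 2)) by ring.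
have p0 : 0 <= S / T' * S' by rewrite !mulr_ge0// invr_ge0 (le_trans ler01 T).
have := ler_wpM2l p0 key; rewrite -!E; lra.
Qed.

Record gset A : Prop := GSet { g_closed : closed A; g_convex : hconvex A; g_germ : germ A }.

Lemma gset_not_interior A : gset A -> ~ interior A ho.
Proof.
move=> [_ _ [_ up _]] /nbhs_hplane[d d0 h].
pose e := Num.min 1 d.
have e0 : 0 < e by rewrite lt_min ltr01.
have ed : e <= d by rewrite ge_min lexx orbT.
have P : (lorentz (vec3 (Num.sqrt (1 + e ^+ 2)) 0 (- e)) (vec3 (Num.sqrt (1 + e ^+ 2)) 0 (- e)) == 1)
    && (0 < vec3 (Num.sqrt (1 + e ^+ 2)) 0 (- e) 0 0).
  rewrite /lorentz !vec3E sqrtr_gt0 sqr1_gt0 andbT -expr2 sqr_sqrt1; apply/eqP; ring.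
have := up (HPlane P); rewrite /= vec3E => /(_ _)/wrap[]; last by lra.
apply: h; rewrite lorentz_ho /= vec3E.
have T2 := sqr_sqrt1 e; have T1 := sqrt1_ge1 e; nra.
Qed.

(* [barc A c] is the lowest point of [A] at distance [arcosh c] from [ho]; for small [c] it
   runs through the boundary of [A] to the right of [ho]. *)
Definition slopes A c : set R := [set m | 0 <= m /\ A (hpt c m)].
Definition mslope A c : R := inf (slopes A c).
Definition barc A c : hplane R := hpt c (mslope A c).

(* The far point [zs] of [A] makes the angles of the arc obtuse up to the radius [c1]. *)
Record good A c1 (zs : hplane R) : Prop := Good {
  good_in : A zs; good_1 : 0 < zs 0 1; good_2 : 0 <= zs 0 2; good_le : zs 0 2 <= zs 0 1;
  good_gt1 : 1 < c1; good_far : 16 * (c1 ^+ 2 - 1) * zs 0 0 ^+ 2 <= zs 0 1 ^+ 2 }.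

Lemma good_le_c A c1 c2 zs : 1 < c2 -> c2 <= c1 -> good A c1 zs -> good A c2 zs.
Proof.
move=> c2_1 c21 [? ? ? ? ? far]; split=> //; apply: le_trans far.
rewrite ler_wpM2r ?sqr_ge0// ler_wpM2l// lerD2r ler_pXn2r ?nnegrE//; lra.
Qed.

Lemma good_lt A c1 zs : good A c1 zs -> c1 < zs 0 0.
Proof.
move=> [_ z1 _ _ c11 far]; rewrite ltNge; apply/negP => h.
have zz := hsqr zs; have z0 := hge1 zs; have z22 := sqr_ge0 (zs 0 2).
have : zs 0 0 ^+ 2 <= c1 ^+ 2 by rewrite ler_pXn2r ?nnegrE//; lra.
have : 0 < zs 0 1 ^+ 2 by rewrite exprn_gt0.
nra.
Qed.

Lemma radial A z c : hconvex A -> A ho -> A z -> 0 < z 0 1 -> 1 <= c -> c <= z 0 0 ->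
  A (hpt c (z 0 2 / z 0 1)).
Proof.
move=> cA Ao Az z1 c1 cz; set m := z 0 2 / z 0 1.
have z2 : z 0 2 = m * z 0 1 by rewrite /m divfK// gt_eqF.
have h := hpt_sqr m c1; have zz := hsqr z.
pose b := hpt c m 0 1 / z 0 1.
have b0 : 0 <= b.
  by rewrite divr_ge0 ?(ltW z1)// hptC// divr_ge0// sqrtr_ge0.
have bE : hpt c m 0 1 = b * z 0 1 by rewrite /b divfK// gt_eqF.
have ab : b * z 0 0 <= c.
  have : (b * z 0 0) ^+ 2 <= c ^+ 2.
    have e : b ^+ 2 * (z 0 0 ^+ 2 - 1) = c ^+ 2 - 1 by rewrite -h bE zz z2; ring.
    have z01 := hge1 z; have c2 : c ^+ 2 <= z 0 0 ^+ 2 by rewrite ler_pXn2r ?nnegrE//; lra.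
    have : b ^+ 2 <= 1.
      rewrite leNgt; apply/negP => e1.
      have k0 : 0 < z 0 0 ^+ 2 - 1.
        by rewrite zz z2; have := exprn_gt0 2 z1; have := sqr_ge0 (m * z 0 1); lra.
      have := mulr_gt0 k0 (_ : 0 < b ^+ 2 - 1); rewrite subr_gt0 => /(_ e1); lra.
    move=> b1; have -> : (b * z 0 0) ^+ 2 = c ^+ 2 - 1 + b ^+ 2 by rewrite -e; ring.
    by lra.
  by rewrite ler_pXn2r ?nnegrE//; [rewrite mulr_ge0// ltW// hvec0_gt0|lra].
apply: (@hconvex_comb _ A ho z _ (c - b * z 0 0) b) => //; first by rewrite subr_ge0.
apply: eq_vec3; rewrite [RHS]mxE [X in _ = X + _]mxE [X in _ = _ + X]mxE !hoE.
- by rewrite hptC//; ring.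
- by rewrite bE; ring.
- by rewrite hptC// bE z2; ring.
Qed.

Section OneArc.
Variables (A : set (hplane R)) (c1 : R) (zs : hplane R).
Hypotheses (GA : gset A) (gA : good A c1 zs).
Let cA := g_convex GA.
Let clA := g_closed GA.
Let Ao : A ho := germ_o (g_germ GA).

Lemma slopes_lb c : lbound (slopes A c) 0.
Proof. by move=> m []. Qed.

Lemma slopes_star c : 1 <= c -> c <= c1 -> slopes A c (zs 0 2 / zs 0 1).
Proof.
move=> c_1 cc1; split; first by rewrite divr_ge0 ?(good_2 gA) ?ltW ?(good_1 gA).
apply: radial => //; [exact: good_in gA|exact: good_1 gA|].
by apply: le_trans cc1 (ltW (good_lt gA)).
Qed.

Lemma slopes_inf c : 1 <= c -> c <= c1 -> has_inf (slopes A c).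
Proof.
by move=> *; split; [exists (zs 0 2 / zs 0 1); exact: slopes_star|exists 0; exact: slopes_lb].
Qed.

Lemma mslope_ge0 c : 1 <= c -> c <= c1 -> 0 <= mslope A c.
Proof.
move=> c_1 cc1; apply: lb_le_inf (slopes_lb (c := c)); exact: (proj1 (slopes_inf c_1 cc1)).
Qed.

Lemma mslope_le c m : 0 <= m -> A (hpt c m) -> mslope A c <= m.
Proof. by move=> m0 Am; apply: ge_inf; [exists 0; exact: slopes_lb|]. Qed.

Lemma mslope_le1 c : 1 <= c -> c <= c1 -> mslope A c <= zs 0 2 / zs 0 1 /\ mslope A c <= 1.
Proof.
move=> c_1 cc1; have h : mslope A c <= zs 0 2 / zs 0 1.
  by have [? ?] := slopes_star c_1 cc1; apply: mslope_le.
split=> //; apply: le_trans h _; rewrite ler_pdivrMr ?mul1r ?(good_1 gA)//.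
exact: good_le gA.
Qed.

(** The infimum of the slopes is attained: at a fixed radius close slopes give close points, and [A]
    is closed. *)
Lemma arc_in c : 1 <= c -> c <= c1 -> A (barc A c).
Proof.
move=> c_1 cc1; have m0 := mslope_ge0 c_1 cc1.
apply: (closed_near clA) => d d0.
pose e := Num.min 1 (d / (2 * c ^+ 2)).
have c2 : 1 <= c ^+ 2 by rewrite exprn_ege1.
have e0 : 0 < e by rewrite lt_min ltr01 divr_gt0// mulr_gt0//; lra.
have e1 : e <= 1 by rewrite ge_min lexx.
have e2 : e * (2 * c ^+ 2) <= d.
  by rewrite -ler_pdivlMr ?ge_min ?lexx ?orbT// mulr_gt0//; lra.
have [m' [m'0 Am'] mm'] := inf_adherent e0 (slopes_inf c_1 cc1).
exists (hpt c m') => //; apply: le_lt_trans (lorentz_hpt_close c_1 _) _.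
  by rewrite addr_ge0// mulr_ge0.
rewrite ltrD2l; have mi : mslope A c <= m' by exact: mslope_le.
rewrite -/(mslope A c) in mm'.
have : (mslope A c - m') ^+ 2 <= e by nra.
nra.
Qed.

Lemma arc_slope c : 1 <= c -> (barc A c 0 0 = c) * (barc A c 0 2 = mslope A c * barc A c 0 1).
Proof. by move=> c_1; rewrite /barc; split; rewrite hptC. Qed.

Lemma arc_gt0 c : 1 < c -> 0 < barc A c 0 1.
Proof. exact: hpt_gt0. Qed.

Lemma arc1 : barc A 1 = ho.
Proof. exact: hpt1. Qed.

Lemma mslope_min z : A z -> 0 < z 0 1 -> mslope A (z 0 0) * z 0 1 <= z 0 2.
Proof.
move=> Az z1; have z2 := germ_up (g_germ GA) Az.
rewrite -ler_pdivlMr//; apply: mslope_le; first by rewrite divr_ge0// ltW.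
by rewrite hpt_eq// divfK// gt_eqF.
Qed.

Lemma mslope_mono c c' : 1 < c -> c <= c' -> c' <= c1 -> mslope A c <= mslope A c'.
Proof.
move=> c_1 cc' c'1; have c'_1 : 1 < c' by apply: lt_le_trans cc'.
have a1 := arc_gt0 c'_1; have [a0 a2] := arc_slope (ltW c'_1).
apply: mslope_le; first by apply: mslope_ge0 => //; apply: ltW.
have := @radial A (barc A c') c cA Ao (arc_in (ltW c'_1) c'1) a1 (ltW c_1).
by rewrite a0 a2 mulfK ?gt_eqF//; apply.
Qed.

(** Otherwise the slope could be lowered inside [A], against its minimality or, if the new slope is
    negative, against [A] lying above the axis. *)
Lemma arc_not_interior c : 1 <= c -> c <= c1 -> ~ interior A (barc A c).
Proof.
rewrite le_eqVlt => /predU1P[<- _|c_1 cc1]; first by rewrite arc1; exact: gset_not_interior.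
move=> /nbhs_hplane[d d0 h].
have m0 := mslope_ge0 (ltW c_1) cc1; have [_ m1] := mslope_le1 (ltW c_1) cc1.
pose e := Num.min 1 (d / (2 * c ^+ 2)).
have c2 : 1 <= c ^+ 2 by rewrite exprn_ege1// ltW.
have e0 : 0 < e by rewrite lt_min ltr01 divr_gt0// mulr_gt0//; lra.
have e1 : e <= 1 by rewrite ge_min lexx.
have e2 : e * (2 * c ^+ 2) <= d.
  by rewrite -ler_pdivlMr ?ge_min ?lexx ?orbT// mulr_gt0//; lra.
have Ae : A (hpt c (mslope A c - e)).
  apply: h; apply: le_lt_trans (lorentz_hpt_close (ltW c_1) _) _; first by nra.
  rewrite ltrD2l (_ : mslope A c - _ = e); last ring.
  nra.
have [me|me] := leP 0 (mslope A c - e); first by have := mslope_le me Ae; lra.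
have := germ_up (g_germ GA) Ae; rewrite hptC ?(ltW c_1)//.
by rewrite pmulr_lge0 ?hpt_gt0//; lra.
Qed.

(** By the hyperbolic law of cosines the inequality says that the triangle [ho], [barc A c], [zs]
    has an obtuse angle at [barc A c]. It holds because [zs] is far away compared with the radius
    [c]. *)
Lemma arc_star c : 1 < c -> c <= c1 -> c * lorentz (barc A c) zs < zs 0 0.
Proof.
move=> c_1 cc1; have c_1' := ltW c_1.
have m0 := mslope_ge0 c_1' cc1; have [_ m1] := mslope_le1 c_1' cc1.
have [a0 a2] := arc_slope c_1'; have a1 := arc_gt0 c_1.
have hs := hpt_sqr (mslope A c) c_1'; rewrite -/(barc A c) in hs.
have z1 := good_1 gA; have z2 := good_2 gA; have z0 := hvec0_gt0 zs.
have far : 16 * (c ^+ 2 - 1) * zs 0 0 ^+ 2 <= zs 0 1 ^+ 2 := good_far (good_le_c c_1 cc1 gA).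
rewrite /lorentz a0 a2; set x := barc A c 0 1 in a1 hs *; set m := mslope A c in m0 m1 hs *.
have b1 : 2 * x * zs 0 0 <= zs 0 1.
  have : (2 * x * zs 0 0) ^+ 2 <= zs 0 1 ^+ 2.
    apply: le_trans far; rewrite -hs.
    have : 0 <= x ^+ 2 * zs 0 0 ^+ 2 by rewrite mulr_ge0 ?sqr_ge0.
    have : 0 <= x ^+ 2 * zs 0 0 ^+ 2 * m ^+ 2 by rewrite mulr_ge0 ?sqr_ge0// mulr_ge0 ?sqr_ge0.
    nra.
  by rewrite ler_pXn2r ?nnegrE//; [rewrite !mulr_ge0// ltW|exact: ltW].
have b2 : (c ^+ 2 - 1) * zs 0 0 <= x * zs 0 1.
  rewrite -hs.
  have : x * (2 * x * zs 0 0) <= x * zs 0 1 by rewrite ler_wpM2l// ltW.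
  have : 0 <= x ^+ 2 * zs 0 0 * (1 - m ^+ 2).
    rewrite mulr_ge0//; last by rewrite subr_ge0 expr_le1.
    by rewrite mulr_ge0 ?sqr_ge0// ltW.
  nra.
have b3 : 0 <= m * x * zs 0 2 by rewrite !mulr_ge0// ltW.
have b4 : 0 < x * zs 0 1 by rewrite mulr_gt0.
nra.
Qed.

Lemma closed_ball0 c : closed [set z : hplane R | z 0 0 <= c].
Proof.
apply: (@closed_comp _ _ (fun z : hplane R => z 0 0 : R) [set t : R | t <= c]).
  by move=> z _; apply: continuous_coord.
exact: closed_le.
Qed.

Lemma segment_radius z y c : z 0 0 < c -> c < y 0 0 ->
  exists w a b, [/\ 0 < a, 0 < b, hvec w = a *: hvec z + b *: hvec y & w 0 0 = c].
Proof.
move=> zc cy.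
have [||w [a [b [a0 b0 wE wc nw]]]] := @segment_boundary _ [set z : hplane R | z 0 0 <= c] z y (closed_ball0 (c := c)).
- exact: ltW.
- by move=> /=; rewrite leNgt cy.
have w0 : w 0 0 = c.
  apply/eqP; rewrite eq_le wc /= leNgt; apply/negP => wc'; apply: nw.
  have := @near_lorentz_lt _ (hvec ho) w c; rewrite lorentz_ho => /(_ wc').
  by apply: filterS => t; rewrite lorentz_ho => /ltW.
exists w, a, b; split=> //; rewrite lt_neqAle b0 andbT; apply/eqP => b_0.
move: wE; rewrite -b_0 scale0r addr0 => wE.
have : w = z.
  apply: val_inj; rewrite /= wE; have := hvec_norm w; rewrite wE !lorentzE hvec_norm mulr1.
  rewrite -expr2 -[1 in X in X -> _](expr1n _ 2) => /eqP.
  by rewrite eqrXn2 ?ler01 ?(ltW a0)// => /eqP ->; rewrite scale1r.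
by move=> e; move: zc; rewrite -w0 e ltxx.
Qed.

(** The point [w] at radius [c'] on the segment from [barc A c] to [zs] satisfies the inequality.
    The slope of [barc A c'] lies between those of [barc A c] and [w], so [barc A c'] is no farther
    from [barc A c] than [w] is. *)
Lemma arc_forward c c' : 1 < c -> c < c' -> c' <= c1 -> c * lorentz (barc A c) (barc A c') < c'.
Proof.
move=> c_1 cc' c'1; have c'_1 : 1 < c' by apply: lt_trans cc'.
have cc1 : c <= c1 by apply: le_trans (ltW cc') c'1.
have [a0 a2] := arc_slope (ltW c_1); have a1 := arc_gt0 c_1.
have [w [a [b [a_0 b0 wE w0]]]] : exists w a b,
    [/\ 0 < a, 0 < b, hvec w = a *: hvec (barc A c) + b *: hvec zs & w 0 0 = c'].
  by apply: segment_radius; rewrite ?a0//; apply: le_lt_trans c'1 (good_lt gA).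
have Aw : A w by apply: hconvex_comb (ltW a_0) (ltW b0) wE => //; [exact: arc_in (ltW c_1) cc1|exact: good_in gA].
have w1 : 0 < w 0 1.
  by rewrite wE [_ 0 1]mxE [X in X + _]mxE [X in _ + X]mxE addr_gt0// mulr_gt0// (good_1 gA).
have lw : c * lorentz (barc A c) w < c'.
  rewrite -w0 wE lorentzDr !lorentzZr hvec_norm [_ 0 0]mxE [X in _ < X + _]mxE [X in _ < _ + X]mxE a0.
  have := arc_star c_1 cc1; have -> : c * (a * 1 + b * lorentz (barc A c) zs)
    = a * c + b * (c * lorentz (barc A c) zs) by ring.
  by move=> h; rewrite ltrD2l ltr_pM2l.
apply: le_lt_trans lw; rewrite ler_pM2l; last lra.
have sw : mslope A c' <= w 0 2 / w 0 1 by rewrite ler_pdivlMr// -w0; exact: mslope_min.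
rewrite -[in leRHS](@hpt_eq w (w 0 2 / w 0 1))//; last by rewrite divfK// gt_eqF.
rewrite w0 /barc; apply: lorentz_hpt_mono => //; try exact: ltW.
- exact: mslope_ge0 (ltW c_1) cc1.
- exact: (proj2 (mslope_le1 (ltW c_1) cc1)).
- exact: mslope_mono (ltW cc') c'1.
Qed.

(** The law of cosines at [y], split into the components along the radius from [ho] and across
    it. *)
Lemma gram_ho x y z : (y 0 0 ^+ 2 - 1) * (lorentz x z - lorentz x y * lorentz y z) =
  - ((x 0 0 - y 0 0 * lorentz x y) * (z 0 0 - y 0 0 * lorentz y z))
  - det3 ho y x * det3 ho y z.
Proof.
have h := hsqr y; rewrite /det3 !hoE /lorentz.
have -> : y 0 0 ^+ 2 - 1 = y 0 1 ^+ 2 + y 0 2 ^+ 2 by rewrite h; ring.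
by ring: h.
Qed.

Lemma det3_ho x y : det3 ho x y = x 0 1 * y 0 2 - x 0 2 * y 0 1.
Proof. by rewrite /det3 !hoE; ring. Qed.

Lemma det3_ho_slopes x y m m' : 0 <= x 0 1 -> 0 <= y 0 1 -> x 0 2 = m * x 0 1 ->
  y 0 2 = m' * y 0 1 -> m <= m' -> 0 <= det3 ho x y.
Proof.
move=> x1 y1 x2 y2 mm; rewrite det3_ho x2 y2.
have -> : x 0 1 * (m' * y 0 1) - m * x 0 1 * y 0 1 = x 0 1 * y 0 1 * (m' - m) by ring.
by rewrite mulr_ge0 ?subr_ge0// mulr_ge0.
Qed.

Lemma obtuse_angle x y z a b c : x 0 0 = a -> y 0 0 = b -> z 0 0 = c ->
  1 < b -> a < b -> b * lorentz y z < c -> det3 ho x y >= 0 -> det3 ho y z >= 0 -> lorentz x y * lorentz y z < lorentz x z.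
Proof.
move=> <- <- <- y0 xy yz d1 d2; have s0 : 0 < y 0 0 ^+ 2 - 1 by rewrite subr_gt0 exprn_egt1.
rewrite -subr_gt0 -(pmulr_rgt0 _ s0) gram_ho.
have bw : x 0 0 - y 0 0 * lorentz x y < 0.
  by have := lorentz_ge1 x y; nra.
have d1' : det3 ho y x <= 0 by move: d1; rewrite !det3_ho; lra.
have := mulr_le0_ge0 d1' d2.
have : (x 0 0 - y 0 0 * lorentz x y) * (z 0 0 - y 0 0 * lorentz y z) < 0.
  by rewrite nmulr_rlt0// subr_gt0.
lra.
Qed.

Lemma arc_det c c' : 1 < c -> c <= c' -> c' <= c1 -> 0 <= det3 ho (barc A c) (barc A c').
Proof.
move=> c_1 cc' c'1; have c'_1 : 1 < c' by apply: lt_le_trans cc'.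
have [_ a2] := arc_slope (ltW c_1); have [_ b2] := arc_slope (ltW c'_1).
exact: (det3_ho_slopes (ltW (arc_gt0 c_1)) (ltW (arc_gt0 c'_1)) a2 b2 (mslope_mono c_1 cc' c'1)).
Qed.

(** The inequality says that the angle at [barc A c'] is obtuse. The directions to the two
    neighbours have strictly opposite radial components by [arc_forward], and weakly opposite
    transversal ones because the slopes increase. *)
Lemma arc_obtuse c c' c'' : 1 <= c -> c < c' -> c' < c'' -> c'' <= c1 ->
  lorentz (barc A c) (barc A c') * lorentz (barc A c') (barc A c'') < lorentz (barc A c) (barc A c'').
Proof.
move=> c_1 cc' cc'' c1''; have c'_1 : 1 < c' by apply: le_lt_trans cc'.
have c'1 : c' <= c1 by apply: le_trans (ltW cc'') c1''.
have [a0 _] := arc_slope c_1; have [a'0 _] := arc_slope (ltW c'_1).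
have [a''0 _] := arc_slope (ltW (lt_trans c'_1 cc'')).
apply: (obtuse_angle a0 a'0 a''0) => //; first exact: arc_forward.
- have [c1e|cn] := eqVneq 1 c; first by rewrite -c1e arc1 det3_eq//; left.
  have c_1' : 1 < c by rewrite lt_neqAle cn.
  exact: arc_det c_1' (ltW cc') c'1.
- exact: arc_det c'_1 (ltW cc'') c1''.
Qed.

End OneArc.

(* [x], [w] are at the same distance from [ho] and the angle [ho], [x], [q] is obtuse,
   so the circle through [x] enters the triangle [ho], [q], [x]. *)
Lemma triangle_circle x w q : w 0 0 = x 0 0 -> 1 < x 0 0 ->
  x 0 0 * lorentz x q < q 0 0 -> 0 < det3 ho x w -> 0 < det3 ho w q -> 0 < det3 ho x q ->
  exists a b c, [/\ 0 < a, 0 < b, 0 < c & hvec w = a *: hvec ho + b *: hvec q + c *: hvec x].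
Proof.
move=> wx x1 fw d1 d2 D.
have dn : det3 ho x q != 0 by rewrite gt_eqF.
exists (det3 w x q / det3 ho x q), (det3 ho x w / det3 ho x q), (det3 ho w q / det3 ho x q).
have wE : hvec w = det3 w x q / det3 ho x q *: hvec ho + det3 ho x w / det3 ho x q *: hvec q
     + det3 ho w q / det3 ho x q *: hvec x.
  have := det3_comb (hvec ho) (hvec x) (hvec q) (hvec w) => /(congr1 (fun v => (det3 ho x q)^-1 *: v)).
  rewrite scalerA mulVf// scale1r !scalerDr !scalerA => e.
  by rewrite [LHS]e addrAC ![_^-1 * _]mulrC.
split=> //; try by rewrite divr_gt0.
set a := det3 w x q / _ in wE *; set b := _ / _ in wE; set c := _ / _ in wE.
have b0 : 0 < b by rewrite divr_gt0.
have xw : 1 < lorentz x w.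
  rewrite lt_neqAle lorentz_ge1 andbT; apply/eqP => /esym/lorentz_eq1 e.
  by move: d1; rewrite e det3_eq ?ltxx//; right; left.
have e0 : x 0 0 = a + b * q 0 0 + c * x 0 0.
  by rewrite -[LHS]wx wE !mxE /=; ring.
have e1 : lorentz x w = a * x 0 0 + b * lorentz x q + c.
  by rewrite wE !lorentzE hvec_norm lorentz_ho_r; ring.
have p1 : 0 < x 0 0 * (lorentz x w - 1) by rewrite mulr_gt0; lra.
have p2 : 0 < b * (q 0 0 - x 0 0 * lorentz x q) by rewrite mulr_gt0 ?subr_gt0.
have p3 : 0 < x 0 0 ^+ 2 - 1 by rewrite subr_gt0 exprn_egt1.
have : a * (x 0 0 ^+ 2 - 1) = x 0 0 * (lorentz x w - 1) + b * (q 0 0 - x 0 0 * lorentz x q).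
  have e0' : b * q 0 0 = x 0 0 - a - c * x 0 0 by lra.
  by rewrite e1; move: (lorentz x q) => L; rewrite (mulrBr b) e0'; ring.
by move=> h; rewrite -(pmulr_lgt0 _ p3) h addr_gt0.
Qed.

(** A point of [A] strictly above the arc point at its own radius but below the ray through
    [barc A c] lies inside the triangle of [ho], [barc A c] and that arc point, by
    [triangle_circle]; so it cannot be a boundary point. *)
Lemma arc_unique A c1 zs w c : gset A -> good A c1 zs -> 1 < c -> c <= c1 ->
  A w -> ~ interior A w -> 1 < w 0 0 -> w 0 0 < c -> 0 < w 0 1 ->
  w 0 2 < mslope A c * w 0 1 -> w = barc A (w 0 0).
Proof.
move=> GA gA c_1 cc1 Aw nw w0 wc w1 ws.
have wc1 : w 0 0 <= c1 by apply: le_trans (ltW wc) cc1.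
have [e|ne] := eqVneq (mslope A (w 0 0) * w 0 1) (w 0 2).
  by rewrite /barc hpt_eq.
have sw : mslope A (w 0 0) * w 0 1 < w 0 2 by rewrite lt_neqAle ne mslope_min.
have [x0 x2] := @arc_slope A _ (ltW w0); have [q0 q2] := @arc_slope A _ (ltW c_1).
have x1 := arc_gt0 A w0; have q1 := arc_gt0 A c_1.
have fw := arc_forward GA gA w0 wc cc1.
have Ax := arc_in GA gA (ltW w0) wc1; have Aq := arc_in GA gA (ltW c_1) cc1.
case: nw; move: (barc A (w 0 0)) (barc A c) x0 x2 q0 q2 x1 q1 fw Ax Aq => x q x0 x2 q0 q2 x1 q1 fw Ax Aq.
have d1 : 0 < det3 ho x w.
  rewrite det3_ho x2; have -> : x 0 1 * w 0 2 - mslope A (w 0 0) * x 0 1 * w 0 1 =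
    x 0 1 * (w 0 2 - mslope A (w 0 0) * w 0 1) by ring.
  by rewrite mulr_gt0// subr_gt0.
have d2 : 0 < det3 ho w q.
  rewrite det3_ho q2; have -> : w 0 1 * (mslope A c * q 0 1) - w 0 2 * q 0 1 =
    q 0 1 * (mslope A c * w 0 1 - w 0 2) by ring.
  by rewrite mulr_gt0// subr_gt0.
have d3 : 0 < det3 ho x q.
  rewrite det3_ho x2 q2.
  have -> : x 0 1 * (mslope A c * q 0 1) - mslope A (w 0 0) * x 0 1 * q 0 1 =
    x 0 1 * q 0 1 * (mslope A c - mslope A (w 0 0)) by ring.
  by rewrite !mulr_gt0// subr_gt0 -(ltr_pM2r w1); apply: lt_trans ws.
have [|||a [b [d [a0 b0 d0 wE]]]] := @triangle_circle x w q _ _ _ d1 d2 d3; rewrite ?x0 ?q0//.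
apply: (interior_triangle (g_convex GA) (germ_o (g_germ GA)) Aq Ax a0 b0 d0 _ wE).
by rewrite det3C det3N -det3C oppr_eq0 gt_eqF// det3N det3C opprK.
Qed.

End Arcs.

(** * Lenses over the chords of boundary arcs *)

Section Relation.
Variable R : realType.
Implicit Types (x y z w q p : hplane R) (a b c m s t : R) (A B : set (hplane R)).

#[local] Opaque hact hpt barc mslope slope_rot kap rho.

(* [B] stands for the mirror image of the second body, so that both bodies can be
   put in the same position above a chord. *)
Definition sym_pair A B := forall N1 N2 : 'M[R]_3, direct N1 -> direct N2 ->
  interior (pre N1 A `&` pre (rho R) (pre N2 B)) !=set0 ->
  centrally_symmetric (pre N1 A `&` pre (rho R) (pre N2 B)).

Lemma sym_pairC A B : sym_pair A B -> sym_pair B A.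
Proof.
move=> H N1 N2 d1 d2.
have -> : pre N1 B `&` pre (rho R) (pre N2 A) = pre (rho R) (pre N2 A `&` pre (rho R) (pre N1 B)).
  by rewrite setIC -[pre N1 B in LHS]pre_rhoK.
move=> [z /(interior_pre _ _ (lor_rho R)) iz].
apply: centrally_symmetric_pre; first exact: lor_rho.
by apply: H => //; exists (hact (rho R) z).
Qed.

Lemma sym_pair_pre A B N : direct N -> sym_pair A B -> sym_pair (pre N A) B.
Proof.
move=> dN H N1 N2 d1 d2; rewrite (preM _ (proj1 d1) (proj1 dN)).
by apply: H => //; apply: directM.
Qed.

Definition slope_rotV m : 'M[R]_3 := rotm (Num.sqrt (1 + m ^+ 2))^-1 (- (m / Num.sqrt (1 + m ^+ 2))).

Lemma direct_slope_rot m : direct (slope_rot m).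
Proof. exact/direct_rotm/slope_rotP. Qed.

Lemma slope_rotVP m :
  (Num.sqrt (1 + m ^+ 2))^-1 ^+ 2 + (- (m / Num.sqrt (1 + m ^+ 2))) ^+ 2 = 1.
Proof. by rewrite sqrrN slope_rotP. Qed.

Lemma direct_slope_rotV m : direct (slope_rotV m).
Proof. exact/direct_rotm/slope_rotVP. Qed.

Lemma slope_rotE m z y : hact (slope_rot m) z = y -> [/\ y 0 0 = z 0 0,
  Num.sqrt (1 + m ^+ 2) * y 0 1 = z 0 1 - m * z 0 2 &
  Num.sqrt (1 + m ^+ 2) * y 0 2 = m * z 0 1 + z 0 2].
Proof.
move=> <-; have [[e0 e1] e2] := hact_rotm z (slope_rotP m); have T1 := sqrt1_ge1 m.
split; first exact: e0.
  rewrite [X in _ * X]e1; field; rewrite gt_eqF//; lra.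
rewrite [X in _ * X]e2; field; rewrite gt_eqF//; lra.
Qed.

Lemma slope_rotVE m z y : hact (slope_rotV m) z = y -> [/\ y 0 0 = z 0 0,
  Num.sqrt (1 + m ^+ 2) * y 0 1 = z 0 1 + m * z 0 2 &
  Num.sqrt (1 + m ^+ 2) * y 0 2 = z 0 2 - m * z 0 1].
Proof.
move=> <-; have [[e0 e1] e2] := hact_rotm z (slope_rotVP m); have T1 := sqrt1_ge1 m.
split; first exact: e0.
  rewrite [X in _ * X]e1; field; rewrite gt_eqF//; lra.
rewrite [X in _ * X]e2; field; rewrite gt_eqF//; lra.
Qed.

Lemma slope_rotK m z : hact (slope_rot m) (hact (slope_rotV m) z) = z.
Proof. exact/rotmK/slope_rotP. Qed.

Lemma slope_rotVK m z : hact (slope_rotV m) (hact (slope_rot m) z) = z.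
Proof.
by apply: (can_inj (hactK (proj1 (direct_slope_rot m)))); rewrite slope_rotK.
Qed.

Lemma slope_rot_ho m : hact (slope_rot m) ho = ho.
Proof. exact/rotm_ho/slope_rotP. Qed.

Lemma slope_rotV_ho m : hact (slope_rotV m) ho = ho.
Proof. exact/rotm_ho/slope_rotVP. Qed.

Lemma hpt0 c : 1 <= c -> [/\ hpt c 0 0 0 = c, hpt c 0 0 1 ^+ 2 = c ^+ 2 - 1 & hpt c 0 0 2 = 0].
Proof.
move=> c1; have [[e0 _] e2] := hptC 0 c1; have := hpt_sqr 0 c1.
by rewrite expr0n /= addr0 mulr1 e2 mul0r.
Qed.

Lemma slope_rot_chord x m : 0 < x 0 1 -> x 0 2 = m * x 0 1 ->
  [/\ hact (slope_rot m) (hpt (x 0 0) 0) = x,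
      hpt (x 0 0) 0 0 1 = Num.sqrt (1 + m ^+ 2) * x 0 1 & 0 < hpt (x 0 0) 0 0 1].
Proof.
move=> x1 x2; have [q0 q1 q2] := hpt0 (hge1 x).
have T1 := sqrt1_ge1 m; have T2 := sqr_sqrt1 m.
have x0 : 1 < x 0 0.
  have h := hsqr x; have := hge1 x; have := exprn_gt0 2 x1; have := sqr_ge0 (x 0 2); nra.
have qp : 0 < hpt (x 0 0) 0 0 1 := hpt_gt0 0 x0.
move: (hpt (x 0 0) 0) q0 q1 q2 qp => q q0 q1 q2 qp.
have qE : q 0 1 = Num.sqrt (1 + m ^+ 2) * x 0 1.
  apply/eqP; rewrite -(@eqrXn2 _ 2)// ?ltW ?mulr_gt0//; last lra.
  by apply/eqP; rewrite q1 exprMn T2 (hsqr x) x2; ring.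
split=> //; have [y0 y1 y2] := slope_rotE (erefl (hact (slope_rot m) q)).
have Tn : Num.sqrt (1 + m ^+ 2) != 0 by rewrite gt_eqF//; lra.
apply: val_inj; apply: eq_vec3; rewrite /=.
- by rewrite y0 q0.
- by apply: (mulfI Tn); rewrite y1 q2 qE; ring.
- by apply: (mulfI Tn); rewrite y2 q2 qE x2; ring.
Qed.

(** States the conditions of [lens_side] for the chord from [ho] to [x] in the coordinates before
    the chord is rotated into the axis. *)
Lemma cap_lens_side A x w m eta C h k : hconvex A -> A ho -> (forall z, A z -> 0 <= z 0 2) ->
  A x -> ~ interior A x -> 0 < x 0 1 -> x 0 2 = m * x 0 1 -> 0 <= m -> m <= eta ->
  interior A w -> w 0 0 <= C ->
  h * (Num.sqrt (1 + m ^+ 2) * x 0 1) <= x 0 1 * w 0 2 - x 0 2 * w 0 1 ->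
  w 0 0 * (x 0 0 ^+ 2 - 1) - x 0 0 * (x 0 1 * w 0 1 + x 0 2 * w 0 2) <=
    k * (x 0 1 * w 0 2 - x 0 2 * w 0 1) ->
  lens_side (pre (slope_rot m) A) (hpt (x 0 0) 0) (hact (slope_rotV m) w) m eta C h k.
Proof.
move=> cA Ao up Ax nx x1 x2 m0 me Aw wC hw kw.
have [qx q1 qp] := slope_rot_chord x1 x2; have [q0 q1' q2] := hpt0 (hge1 x).
have dr := proj1 (direct_slope_rot m).
move: (hpt (x 0 0) 0) qx q1 qp q0 q1' q2 => q qx q1 qp q0 q1' q2.
have T1 := sqrt1_ge1 m; have T0 : 0 < Num.sqrt (1 + m ^+ 2) by lra.
have [w0 w1 w2] := slope_rotVE (erefl (hact (slope_rotV m) w)).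
have wr := slope_rotK m w.
move: (hact (slope_rotV m) w) w0 w1 w2 wr => w' w0 w1 w2 wr.
split=> //.
- exact: hconvex_pre.
- by rewrite /pre /= slope_rot_ho.
- by rewrite /pre /= qx.
- by move/(interior_pre _ _ dr); rewrite qx.
- move=> z; rewrite /pre /= => /up; have [_ _ z2] := slope_rotE (erefl (hact (slope_rot m) z)).
  by rewrite -(pmulr_rge0 _ T0) z2 addrC.
- by apply/(interior_pre _ _ dr); rewrite wr.
- rewrite -(ler_pM2r qp) {1}q1; apply: le_trans hw _.
  have -> : w' 0 2 * q 0 1 = Num.sqrt (1 + m ^+ 2) * w' 0 2 * x 0 1 by rewrite q1; ring.
  by rewrite w2 x2; lra.
- by rewrite w0.
- rewrite -(ler_pM2r qp); apply: le_trans (_ : _ <= k * (x 0 1 * w 0 2 - x 0 2 * w 0 1)) _.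
    apply: le_trans kw; rewrite w0 q0.
    have -> : (w 0 0 * q 0 1 - w' 0 1 * x 0 0) * q 0 1 =
      w 0 0 * q 0 1 ^+ 2 - x 0 0 * (Num.sqrt (1 + m ^+ 2) * w' 0 1 * x 0 1) by rewrite q1; ring.
    by rewrite q1' w1 x2; lra.
  have -> : k * w' 0 2 * q 0 1 = k * (Num.sqrt (1 + m ^+ 2) * w' 0 2 * x 0 1) by rewrite q1; ring.
  by rewrite w2 x2; lra.
Qed.

(** Slopes on the arc are at most that of [zs], which the tangent condition makes as small as
    desired. *)
Lemma small_slope A (e : R) : gset A -> 0 < e -> exists c1 zs,
  [/\ good A c1 zs, c1 ^+ 2 - 1 <= e & forall c, 1 <= c -> c <= c1 -> mslope A c <= e].
Proof.
move=> GA e0; have [_ _ [_ _ tan]] := GA.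
have m0 : 0 < Num.min 1 e by rewrite lt_min ltr01.
have m1 : Num.min 1 e <= 1 by rewrite ge_min lexx.
have me : Num.min 1 e <= e by rewrite ge_min lexx orbT.
have [zs [Az z1 z2 z21]] := tan _ m0; have z0 := hvec0_gt0 zs.
pose d := Num.min (zs 0 1 ^+ 2 / (16 * zs 0 0 ^+ 2)) e.
have d0 : 0 < d by rewrite lt_min e0 divr_gt0 ?mulr_gt0 ?exprn_gt0.
have de : d <= e by rewrite ge_min lexx orbT.
have c2 : Num.sqrt (1 + d) ^+ 2 - 1 = d by rewrite sqr_sqrtr; [ring|lra].
have g : good A (Num.sqrt (1 + d)) zs.
  split=> //; rewrite ?(ltW z2)//.
  - exact: interior_subset Az.
  - by apply: le_trans z21 _; rewrite -[leRHS]mul1r ler_wpM2r// ltW.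
  - by rewrite -[X in X < _]sqrtr1 ltr_sqrt; lra.
  - rewrite c2 mulrAC mulrC -ler_pdivlMr ?ge_min ?lexx// mulr_gt0// exprn_gt0//.
exists (Num.sqrt (1 + d)), zs; split=> //; first by rewrite c2.
move=> c c_1 cc1; have [h _] := mslope_le1 GA g c_1 cc1.
apply: le_trans h _; rewrite ler_pdivrMr//; apply: le_trans z21 _.
by rewrite ler_wpM2r// ltW.
Qed.

Lemma sqrt1_le2 m : 0 <= m -> m <= 1 -> Num.sqrt (1 + m ^+ 2) <= 2.
Proof.
move=> m0 m1; have T1 := sqrt1_ge1 m; have T2 := sqr_sqrt1 m.
by rewrite leNgt; apply/negP => h; nra.
Qed.

(** The axis being tangent, [w] can be taken so flat that [w 0 1 >= (k + 2) * w 0 2]; for short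
    chords the cotangent of the angle at the far end is then at most [- k]. Since [h0] and [C0]
    depend on [w] alone, [eta] can be chosen after them. *)
Lemma right_side B k : gset B -> 0 <= k -> exists wB h0 C0, 0 < h0 /\
  forall h C eta, h <= h0 -> 0 < h -> C0 <= C -> 0 < eta -> exists2 cB, 1 < cB &
  forall t, 1 < t -> t <= cB -> lens_side (pre (slope_rot (mslope B t)) B) (hpt t 0)
     (hact (slope_rotV (mslope B t)) wB) (mslope B t) eta C h (- k).
Proof.
move=> GB k0; have k2 : 0 < (k + 2)^-1 by rewrite invr_gt0; lra.
have [w [Bw w1 w2 w21]] := germ_tan (g_germ GB) k2; have w0 := hge1 w.
have {}w21 : (k + 2) * w 0 2 <= w 0 1 by rewrite -ler_pdivlMl//; lra.
exists w, (w 0 2 / 8), (w 0 0); split; first by rewrite divr_gt0.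
move=> h C eta h8 h0 wC e0.
(* For an arc point [x] of slope [m] these bounds give [m * w 0 1 <= w 0 2 / 2] and
   [x 0 1 * w 0 0 <= w 0 2]. *)
pose e := Num.min eta (Num.min (w 0 2 / (2 * w 0 1)) ((w 0 2 / w 0 0) ^+ 2)).
have ee : 0 < e by rewrite !lt_min e0 exprn_gt0 ?divr_gt0 ?mulr_gt0//; lra.
have [e1 e2 e3] : [/\ e <= eta, e <= w 0 2 / (2 * w 0 1) & e <= (w 0 2 / w 0 0) ^+ 2].
  by split; rewrite !ge_min lexx ?orbT.
rewrite ler_pdivlMr ?mulr_gt0// in e2.
have [cB [zs [gB far small]]] := small_slope GB ee; exists cB; first exact: good_gt1 gB.
move=> t t1 tB.
have [x0 x2] := @arc_slope _ B _ (ltW t1); have x1 := arc_gt0 B t1.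
have Bx := arc_in GB gB (ltW t1) tB; have nx := arc_not_interior GB gB (ltW t1) tB.
have m0 := mslope_ge0 GB gB (ltW t1) tB; have [_ m1] := mslope_le1 GB gB (ltW t1) tB.
have me := small t (ltW t1) tB.
have te : t ^+ 2 - 1 <= e.
  have : t ^+ 2 <= cB ^+ 2 by rewrite ler_pXn2r ?nnegrE//; lra.
  lra.
move: (barc B t) x0 x2 x1 Bx nx; move: (mslope B t) m0 m1 me => m m0 m1 me x x0 x2 x1 Bx nx.
rewrite -x0; have [cB' [Bo up _]] := (g_convex GB, g_germ GB).
have T := sqrt1_le2 m0 m1; have T1 := sqrt1_ge1 m.
have mw : m * w 0 1 <= w 0 2 / 2.
  have : m * w 0 1 <= e * w 0 1 by rewrite ler_wpM2r// ltW.
  lra.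
have x1e : x 0 1 * w 0 0 <= w 0 2.
  have : (x 0 1 * w 0 0) ^+ 2 <= w 0 2 ^+ 2.
    have w00 : 0 < w 0 0 by clear -w0; lra.
    rewrite exprMn -ler_pdivlMr ?exprn_gt0// -expr_div_n; apply: le_trans e3; apply: le_trans te.
    rewrite -x0 (hsqr x); have := sqr_ge0 (x 0 2); clear; lra.
  by rewrite ler_pXn2r ?nnegrE ?(ltW w2)// mulr_ge0 ?(ltW x1)//; clear -w0; lra.
clear e3 e2 te far small ee e0.
apply: (cap_lens_side cB' Bo up Bx nx x1 x2 m0 (le_trans me e1) Bw wC).
  have -> : x 0 1 * w 0 2 - x 0 2 * w 0 1 = (w 0 2 - m * w 0 1) * x 0 1 by rewrite x2; ring.
  rewrite mulrA ler_wpM2r ?(ltW x1)//.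
  have : h * Num.sqrt (1 + m ^+ 2) <= h * 2 by rewrite ler_wpM2l// ltW.
  lra.
have -> : x 0 1 * w 0 2 - x 0 2 * w 0 1 = x 0 1 * (w 0 2 - m * w 0 1) by rewrite x2; ring.
have -> : x 0 0 ^+ 2 - 1 = x 0 1 ^+ 2 * (1 + m ^+ 2) by rewrite (hsqr x) x2; ring.
have -> : w 0 0 * (x 0 1 ^+ 2 * (1 + m ^+ 2)) - x 0 0 * (x 0 1 * w 0 1 + x 0 2 * w 0 2) =
  x 0 1 * (x 0 1 * w 0 0 * (1 + m ^+ 2) - x 0 0 * (w 0 1 + m * w 0 2)) by rewrite x2; ring.
rewrite mulrCA ler_wpM2l ?(ltW x1)//.
have a1 : x 0 1 * w 0 0 * (1 + m ^+ 2) <= w 0 2 * 2.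
  apply: ler_pM => //; first by rewrite mulr_ge0//; lra.
    by rewrite addr_ge0// sqr_ge0.
  have : m ^+ 2 <= 1 by rewrite expr_le1.
  lra.
have a2 : w 0 1 <= x 0 0 * (w 0 1 + m * w 0 2).
  have h1 := mulr_ge0 m0 (ltW w2); apply: (@le_trans _ _ (w 0 1 + m * w 0 2)); first lra.
  by rewrite ler_peMl ?hge1//; lra.
have a3 : 0 <= k * (m * w 0 1) by rewrite !mulr_ge0// ltW.
lra.
Qed.

(** [right_side] with [k = 0] serves both bodies: over a short chord both angles at the far end are
    at least right, and chords of equal length are put together. *)
Lemma arc_lens A B : gset A -> gset B -> sym_pair A B -> exists c1 zA zB,
  [/\ good A c1 zA, good B c1 zB & forall c, 1 < c -> c <= c1 -> forall z, z 0 2 < 0 ->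
  pre (slope_rot (mslope A c)) A z <-> pre (slope_rot (mslope B c)) B (hact (kap (hpt c 0)) z)].
Proof.
move=> GA GB H.
have [wA [hA [CA [hA0 SA]]]] := right_side GA (lexx 0).
have [wB [hB [CB [hB0 SB]]]] := right_side GB (lexx 0).
pose h := Num.min hA hB; pose C := Num.max (Num.max CA CB) 2.
have h0 : 0 < h by rewrite lt_min hA0.
have [hhA hhB] : h <= hA /\ h <= hB by rewrite !ge_min !lexx orbT.
have [CCA CCB C2] : [/\ CA <= C, CB <= C & 2 <= C] by rewrite !le_max !lexx !orbT.
clearbody h C; have C1 : 1 <= C by lra.
have C3 : 0 < 20 * C ^+ 3 by rewrite mulr_gt0// exprn_gt0//; lra.
pose eta := h / (20 * C ^+ 3).
have eta0 : 0 < eta by rewrite divr_gt0.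
have small : 10 * C ^+ 3 * eta < h.
  have : 20 * C ^+ 3 * eta = h by rewrite /eta mulrC divfK// gt_eqF.
  by move=> e; rewrite -[X in _ < X]e -subr_gt0 -mulrBl mulr_gt0//; clear -C3; lra.
clearbody eta; have [dA dA1 {}SA] := SA h C eta hhA h0 CCA eta0; have [dB dB1 {}SB] := SB h C eta hhB h0 CCB eta0.
have [cA [zA [gA _ _]]] := small_slope GA ltr01; have [cB [zB [gB _ _]]] := small_slope GB ltr01.
pose c1 := Num.min (Num.min cA cB) (Num.min (Num.min dA dB) 2).
have c1_1 : 1 < c1 by rewrite !lt_min (good_gt1 gA) (good_gt1 gB) dA1 dB1 ltr1n.
have [[cmA cmB] [cdA cdB] c2] : [/\ c1 <= cA /\ c1 <= cB, c1 <= dA /\ c1 <= dB & c1 <= 2].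
  by rewrite /c1 !ge_min !lexx !orbT.
exists c1, zA, zB; split; [exact: good_le_c gA|exact: good_le_c gB|].
move=> c c_1 cc; have [q0 q1 q2] := hpt0 (ltW c_1).
have HA := SA c c_1 (le_trans cc cdA); have HB := SB c c_1 (le_trans cc cdB).
rewrite oppr0 in HA; have eA := direct_slope_rot (mslope A c); have eB := direct_slope_rot (mslope B c).
apply: (lens h0 C1 _ small q2 _ HA HB).
- by rewrite q0 (le_trans cc)// (le_trans c2).
- exact: hpt_gt0.
- exact: closed_pre (proj1 eA) (g_closed GA).
- exact: closed_pre (proj1 eB) (g_closed GB).
- exact: H.
Qed.

End Relation.

(** * Equally spaced chains and planarity of the arc *)

Section EqualSpacing.
Variable R : realType.
Implicit Types (x y z w : hplane R) (s t u c d : R).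

Lemma lorentz_gt1 x y : x <> y -> 1 < lorentz x y.
Proof.
move=> xy; rewrite lt_neqAle lorentz_ge1 andbT; apply/eqP => /esym/lorentz_eq1.
exact: xy.
Qed.

Lemma orthogonal_det3 (v p q y : 'rV[R]_3) : v != 0 ->
  lorentz v p = 0 -> lorentz v q = 0 -> lorentz v y = 0 -> det3 p q y = 0.
Proof.
move=> v0 vp vq vy; apply/eqP; apply: contraNT v0 => D.
have H (s : 'rV_3) : lorentz v s = 0.
  apply: (mulfI D); rewrite mulr0 -lorentzZr det3_comb !lorentzDr !lorentzZr vp vq vy.
  by rewrite !mulr0 !addr0.
have := H (vec3 1 0 0); have := H (vec3 0 1 0); have := H (vec3 0 0 1).
rewrite /lorentz !vec3E => h2 h1 h0.
by apply/eqP; apply: eq_vec3; rewrite mxE; lra.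
Qed.

(* Equal Gram matrices and equal orientations force [x3 - x0] to be proportional to
   [x2 - x1]: the four points lie in a plane. *)
Lemma four_points x0 x1 x2 x3 c (w : R) : 1 < c ->
  lorentz x0 x1 = c -> lorentz x1 x2 = c -> lorentz x2 x3 = c ->
  lorentz x0 x2 = w -> lorentz x1 x3 = w ->
  0 < det3 x0 x1 x2 -> 0 < det3 x1 x2 x3 ->
  hvec x3 - hvec x0 = ((w - c) / (c - 1)) *: (hvec x2 - hvec x1).
Proof.
move=> c1 e01 e12 e23 e02 e13 d1 d2.
have gram (u v t : 'rV[R]_3) : det3 u v t ^+ 2 =
    lorentz u u * (lorentz v v * lorentz t t - lorentz v t ^+ 2)
    - lorentz u v * (lorentz u v * lorentz t t - lorentz v t * lorentz u t)
    + lorentz u t * (lorentz u v * lorentz v t - lorentz v v * lorentz u t).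
  by rewrite /lorentz /det3; ring.
have dd : det3 x0 x1 x2 = det3 x1 x2 x3.
  apply/eqP; rewrite -(@eqrXn2 _ 2)// ?ltW//; apply/eqP.
  by rewrite !gram !hvec_norm e01 e12 e23 e02 e13; ring.
pose l := (w - c) / (c - 1).
have lc : l * (c - 1) = w - c by rewrite /l divfK// gt_eqF// subr_gt0.
pose D := hvec x3 - hvec x0 - l *: (hvec x2 - hvec x1).
suff : D = 0 by move/subr0_eq.
pose n := cross x1 x2.
have D1 : lorentz D x1 = 0.
  rewrite /D !lorentzE hvec_norm (lorentzC x3) (lorentzC x2 x1) e13 e01 e12.
  by have := lc; lra.
have D2 : lorentz D x2 = 0.
  rewrite /D !lorentzE hvec_norm (lorentzC x3) e23 e02 e12.
  by have := lc; lra.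
have Dn : lorentz D n = 0.
  rewrite lorentzC lorentz_cross; have -> : det3 x1 x2 D = det3 x1 x2 x3 - det3 x0 x1 x2.
    by rewrite /det3 /D !mxE; ring.
  by rewrite dd subrr.
apply/eqP; apply/negPn/negP => D0.
have := orthogonal_det3 D0 D1 D2 Dn.
have -> : det3 x1 x2 n = lorentz x1 x1 * lorentz x2 x2 - lorentz x1 x2 ^+ 2.
  by rewrite /n /det3 /lorentz /cross !vec3E; ring.
by rewrite !hvec_norm e12; nra.
Qed.

(** [a] and [b] stand for the arcs of two bodies, parametrised by the hyperbolic cosine of the
    distance from [ho]. In [move_arc] a reflection carries the arc of [b] up to [c], read backwards
    from [b c], onto points of the arc of [a]. *)
Variables (a b : R -> hplane R) (c1 : R).
Hypothesis c1_gt1 : 1 < c1.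
Hypothesis a1 : a 1 = ho.
Hypothesis b1 : b 1 = ho.
Hypothesis a0 : forall s, 1 <= s -> s <= c1 -> a s 0 0 = s.
Hypothesis b0 : forall s, 1 <= s -> s <= c1 -> b s 0 0 = s.
Hypothesis a_obtuse : forall s t u, 1 <= s -> s < t -> t < u -> u <= c1 ->
  lorentz (a s) (a t) * lorentz (a t) (a u) < lorentz (a s) (a u).
Hypothesis b_obtuse : forall s t u, 1 <= s -> s < t -> t < u -> u <= c1 ->
  lorentz (b s) (b t) * lorentz (b t) (b u) < lorentz (b s) (b u).
Hypothesis a_det : forall s t, 1 < s -> s < t -> t <= c1 -> 0 < det3 ho (a s) (a t).
Hypothesis move_arc : forall c, 1 < c -> c <= c1 -> exists T, [/\ lor T, \det T = -1 &
  forall s, 1 <= s -> s <= c -> hact T (b s) = a (lorentz (b s) (b c))].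

Let F s t := lorentz (b s) (b t).
Let E s t := lorentz (a s) (a t).

Lemma F1 s : 1 <= s -> s <= c1 -> F 1 s = s.
Proof. by move=> *; rewrite /F b1 lorentz_ho b0. Qed.

Lemma spacing_gt1 s t : 1 <= s -> s < t -> t <= c1 -> 1 < F s t /\ 1 < E s t.
Proof.
move=> s1 st tc; have t1 : 1 <= t by apply: le_trans (ltW st).
have sc : s <= c1 by apply: le_trans tc; apply: ltW.
split; apply: lorentz_gt1 => e.
  by have := b0 s1 sc; rewrite e b0// => h; move: st; rewrite h ltxx.
by have := a0 s1 sc; rewrite e a0// => h; move: st; rewrite h ltxx.
Qed.

Lemma F_le s t : 1 <= s -> s <= t -> t <= c1 -> F s t <= t.
Proof.
move=> s1 st tc; have [->|sn] := eqVneq s 1; first by rewrite F1// (le_trans s1).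
have s_1 : 1 < s by rewrite lt_neqAle eq_sym sn.
have [e|tn] := eqVneq s t; first by rewrite /F e hvec_norm (le_trans s1).
have st' : s < t by rewrite lt_neqAle tn.
have := b_obtuse (lexx 1) s_1 st' tc; rewrite -/(F 1 s) -/(F 1 t) -/(F s t) !F1//; last 2 first.
- exact: le_trans s1 st.
- exact: le_trans st tc.
by have [] := spacing_gt1 s1 st' tc; nra.
Qed.

Lemma F_anti s t u : 1 <= s -> s < t -> t <= u -> u <= c1 -> F t u < F s u.
Proof.
move=> s1 st tu uc; have st1 : 1 <= t by apply: le_trans (ltW st).
have [e|tn] := eqVneq t u.
  by rewrite -e /F hvec_norm; have [] := spacing_gt1 s1 st (le_trans tu uc).
have tu' : t < u by rewrite lt_neqAle tn.
have := b_obtuse s1 st tu' uc; rewrite -/(F s t) -/(F t u) -/(F s u).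
have [h _] := spacing_gt1 s1 st (le_trans tu uc).
by have := lorentz_ge1 (b t) (b u); rewrite -/(F t u); nra.
Qed.

Lemma E_anti s t u : 1 <= s -> s < t -> t <= u -> u <= c1 -> E t u < E s u.
Proof.
move=> s1 st tu uc; have st1 : 1 <= t by apply: le_trans (ltW st).
have [e|tn] := eqVneq t u.
  by rewrite -e /E hvec_norm; have [] := spacing_gt1 s1 st (le_trans tu uc).
have tu' : t < u by rewrite lt_neqAle tn.
have := a_obtuse s1 st tu' uc; rewrite -/(E s t) -/(E t u) -/(E s u).
have [_ h] := spacing_gt1 s1 st (le_trans tu uc).
by have := lorentz_ge1 (a t) (a u); rewrite -/(E t u); nra.
Qed.

Lemma E_mono s t u : 1 <= s -> s <= t -> t < u -> u <= c1 -> E s t < E s u.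
Proof.
move=> s1 st tu uc; have [e|sn] := eqVneq s t.
  by rewrite -e /E hvec_norm; have [] := spacing_gt1 s1 (le_lt_trans st tu) uc.
have st' : s < t by rewrite lt_neqAle sn.
have := a_obtuse s1 st' tu uc; rewrite -/(E s t) -/(E t u) -/(E s u).
have [_ h] := spacing_gt1 (le_trans s1 st) tu uc.
by have := lorentz_ge1 (a s) (a t); rewrite -/(E s t); nra.
Qed.

Lemma relation s1 s2 t : 1 <= s1 -> s1 <= t -> 1 <= s2 -> s2 <= t -> 1 < t -> t <= c1 ->
  E (F s1 t) (F s2 t) = F s1 s2.
Proof.
move=> s11 s1t s21 s2t t1 tc; have [T [LT _ H]] := move_arc t1 tc.
by rewrite /E -!H// lorentz_hact.
Qed.

(** The reflection of [move_arc] that brings [b u] to [ho] carries the other two points to the arc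
    of [a], where the orientation is known. *)
Lemma b_det s t u : 1 <= s -> s < t -> t < u -> u <= c1 -> 0 < det3 (b s) (b t) (b u).
Proof.
move=> s1 st tu uc; have t1 : 1 < t by apply: le_lt_trans st.
have u1 : 1 < u by apply: lt_trans tu.
have [T [LT dT H]] := move_arc u1 uc.
have e := det3_mul (b s) (b t) (b u) T; rewrite -!hactE// dT in e.
rewrite !H// in e; [|exact: ltW|exact: ltW|exact: ltW|exact: ltW (lt_trans st tu)].
rewrite -/(F s u) -/(F t u) hvec_norm a1 in e.
have ft : 1 < F t u by have [] := spacing_gt1 (ltW t1) tu uc.
have fst : F t u < F s u by apply: F_anti => //; apply: ltW.
have fu : F s u <= c1 := le_trans (F_le s1 (ltW (lt_trans st tu)) uc) uc.
have := a_det ft fst fu; move: e; rewrite /det3 !hoE; lra.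
Qed.

(** Extends the parametrisation continuously to the whole line, as the intermediate value theorem
    requires. *)
Definition clamp u : R := Num.max 1 (Num.min c1 u).

Lemma clampP u : 1 <= clamp u <= c1.
Proof. by rewrite /clamp le_max lexx /= ge_max ge_min lexx (ltW c1_gt1). Qed.

Lemma clamp_id u : 1 <= u -> u <= c1 -> clamp u = u.
Proof. by move=> u1 uc; rewrite /clamp min_r// max_r. Qed.

(** Obtuseness at [b s], seen from [b 1], gives [s * F s t < t]. *)
Lemma F_lip s t : 1 <= s -> s <= t -> t <= c1 -> F s t <= 1 + (t - s).
Proof.
move=> s1 st tc; have [e|tn] := eqVneq s t; first by rewrite e /F hvec_norm subrr addr0.
have [->|sn] := eqVneq s 1; first by rewrite F1//; [lra|exact: le_trans st].
have s_1 : 1 < s by rewrite lt_neqAle eq_sym sn.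
have st' : s < t by rewrite lt_neqAle tn.
have := b_obtuse (lexx 1) s_1 st' tc; rewrite -/(F 1 s) -/(F 1 t) -/(F s t) !F1//; last 2 first.
- exact: le_trans s1 st.
- exact: le_trans st tc.
by have [] := spacing_gt1 s1 st' tc; nra.
Qed.

Lemma clamp_lip u u' : `|clamp u - clamp u'| <= `|u - u'|.
Proof.
have cl t : (t <= 1 /\ clamp t = 1) \/ (c1 <= t /\ clamp t = c1) \/ ((1 <= t /\ t <= c1) /\ clamp t = t).
  have [t1|t1] := leP t 1.
    by left; rewrite /clamp max_l// ge_min t1 orbT.
  have [tc|tc] := leP c1 t; last by right; right; rewrite clamp_id ?ltW//; split=> //; split; apply: ltW.
  by right; left; rewrite /clamp (min_l tc) max_r// ltW.
have n1 := ler_norm (u - u'); have n2 := ler_norm (u' - u); rewrite distrC in n2. have n0 := normr_ge0 (u - u').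
have hc := c1_gt1; by rewrite ler_norml; apply/andP; case: (cl u) => [[? ->]|[[? ->]|[[? ?] ->]]];
 case: (cl u') => [[? ->]|[[? ->]|[[? ?] ->]]]; split; lra.
Qed.

Lemma b_continuous (v : 'rV[R]_3) : continuous (fun u => lorentz v (b (clamp u)) : R).
Proof.
move=> u; apply: (@cvg_comp _ _ _ (fun u => b (clamp u)) (fun x : hplane R => lorentz v x : R) _ (nbhs (b (clamp u)))); last exact: continuous_lorentz.
move=> S /nbhs_hplane[d d0 h]; apply/nbhs_ballP; exists d => //= u' uu'; apply: h.
have /andP[p1 p2] := clampP u; have /andP[q1 q2] := clampP u'.
have l : `|clamp u - clamp u'| < d by apply: le_lt_trans uu'; exact: clamp_lip.
have [le|le] := leP (clamp u) (clamp u').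
  apply: le_lt_trans (F_lip p1 le q2) _; move: l; rewrite ltr_norml; lra.
rewrite lorentzC; apply: le_lt_trans (F_lip q1 (ltW le) p2) _; move: l; rewrite ltr_norml; lra.
Qed.

Lemma midpoint s t : 1 <= s -> s < t -> t <= c1 ->
  exists u, [/\ s < u, u < t & F s u = F u t].
Proof.
move=> s1 st tc.
pose g u := lorentz (b s) (b (clamp u)) - lorentz (b t) (b (clamp u)).
have cg : continuous g by move=> u; apply: cvgB; apply: b_continuous.
have tc1 : 1 <= t by apply: le_trans (ltW st).
have sc : s <= c1 by apply: le_trans tc; apply: ltW.
have [F1' _] := spacing_gt1 s1 st tc.
have gs : g s < 0.
  by rewrite /g clamp_id// hvec_norm lorentzC subr_lt0.
have gt : 0 < g t.
  by rewrite /g clamp_id// hvec_norm subr_gt0.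
have [||u uI gu] := @IVT R g s t 0 (ltW st).
- exact: continuous_subspaceT.
- by rewrite ge_min le_max (ltW gs) (ltW gt) orbT.
move: uI; rewrite in_itv /= => /andP[su ut].
have eu : clamp u = u by apply: clamp_id; [exact: le_trans su|exact: le_trans ut tc].
exists u; split.
- by rewrite lt_neqAle su andbT; apply/eqP => e; move: gs; rewrite e gu ltxx.
- by rewrite lt_neqAle ut andbT; apply/eqP => e; move: gt; rewrite -e gu ltxx.
- by apply/eqP; rewrite -subr_eq0 /F [X in _ - X]lorentzC -gu /g eu.
Qed.

Definition chain (f : nat -> R) (N : nat) c := [/\ f 0%N = 1, f N = c1 &
  forall i, (i < N)%N -> f i < f i.+1 /\ F (f i) (f i.+1) = c].

Lemma chain_in f N c i : chain f N c -> (i <= N)%N -> 1 <= f i /\ f i <= c1.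
Proof.
move=> [f0 fN st] iN; split.
  elim: i iN => [|i IH] iN; first by rewrite f0.
  by apply: le_trans (IH (ltnW iN)) _; have [/ltW] := st i iN.
have mono k : (i + k <= N)%N -> f i <= f (i + k)%N.
  elim: k => [|k IH] ik; first by rewrite addn0.
  have ik' : (i + k < N)%N by rewrite -addnS.
  by rewrite addnS; apply: le_trans (IH (ltnW ik')) _; have [/ltW] := st _ ik'.
by rewrite -fN -[in leRHS](subnKC iN) mono// subnKC.
Qed.

(** Each step is halved by the point equidistant from its ends. By [relation] the half step [d]
    solves [E d c = d], whose solution is unique because the left side decreases in [d]; so the
    refined chain is again equally spaced. Obtuseness gives [d ^+ 2 < c], whence the bound on
    [d - 1]. *)
Lemma chain_refine f N c : chain f N c -> (0 < N)%N -> exists g d,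
  [/\ chain g N.*2 d, (forall i, (i <= N)%N -> g i.*2 = f i) & d - 1 <= (c - 1) / 2].
Proof.
move=> C N0; have [f0 fN st] := C.
have mid i : exists u, (i < N)%N -> [/\ f i < u, u < f i.+1 & F (f i) u = F u (f i.+1)].
  have [iN|] := ltnP i N; last by exists 0.
  have [fi _] := st i iN; have [f1 _] := chain_in C (ltnW iN); have [_ f2] := chain_in C iN.
  by have [u uP] := midpoint f1 fi f2; exists u.
have [m mP] := choice mid.
pose g j := if odd j then m j./2 else f j./2.
have gd i : g i.*2 = f i by rewrite /g odd_double doubleK.
have gd1 i : g i.*2.+1 = m i by rewrite /g /= odd_double /= uphalf_double.
have Ed i : (i < N)%N -> E (F (f i) (m i)) c = F (f i) (m i).
  move=> iN; have [u1 u2 u3] := mP i iN; have [fi fc] := st i iN.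
  have [f1 _] := chain_in C (ltnW iN); have [f1' f2] := chain_in C iN.
  have := @relation (m i) (f i) (f i.+1).
  rewrite -u3 fc /E lorentzC [F (m i) _]lorentzC; apply=> //; try exact: ltW.
  - by apply: le_trans (ltW u1).
  - by apply: le_lt_trans fi.
have [_ c0] := st 0%N N0.
have cc : c <= c1.
  have [f1' f2] := chain_in C N0; rewrite -c0 f0 F1//.
have d_in i : (i < N)%N -> 1 <= F (f i) (m i) <= c.
  move=> iN; have [u1 u2 u3] := mP i iN; have [fi fc] := st i iN.
  have [f1 _] := chain_in C (ltnW iN); have [f1' f2] := chain_in C iN.
  rewrite lorentz_ge1 /= -fc u3; apply: ltW; apply: F_anti => //; exact: ltW.
have deq i : (i < N)%N -> F (f i) (m i) = F (f 0%N) (m 0%N).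
  move=> iN; have /andP[di1 di2] := d_in i iN; have /andP[d01 d02] := d_in 0%N N0.
  have ei := Ed i iN; have e0 := Ed 0%N N0.
  move: (F (f i) (m i)) (F (f 0%N) (m 0%N)) di1 di2 d01 d02 ei e0 => x y *.
  apply/eqP; rewrite eq_le !leNgt; apply/andP; split; apply/negP => lt.
    by have := @E_anti y x c; lra.
  by have := @E_anti x y c; lra.
exists g, (F (f 0%N) (m 0%N)); split=> //.
- split; [by rewrite (gd 0%N)|by rewrite gd|].
  move=> j jN; have := odd_double_half j; set i := j./2 => <-.
  have iN : (i < N)%N by rewrite ltn_half_double.
  have [u1 u2 u3] := mP i iN.
  case: (odd j) => /=.
    rewrite add1n -doubleS gd gd1 -(deq i iN) u3; split=> //.
  by rewrite add0n gd gd1 -(deq i iN).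
- have [u1 u2 u3] := mP 0%N N0; have [fi fc] := st 0%N N0.
  have [f1 _] := chain_in C (ltnW N0); have [f1' f2] := chain_in C N0.
  have := b_obtuse f1 u1 u2 f2; rewrite -/(F _ _) -/(F (m 0%N) _) -/(F (f 0%N) (f 1%N)) -u3 fc.
  have := lorentz_ge1 (b (f 0%N)) (b (m 0%N)); rewrite -/(F _ _); nra.
Qed.

(** The distance [w] over two steps solves [E c w = c], uniquely because [E c] increases. Hence all
    quadruples of consecutive points have the same Gram matrix, and [four_points] propagates the
    plane of the first three points along the chain. *)
Lemma chain_plane f N c : chain f N c -> (2 <= N)%N -> exists2 v : 'rV[R]_3, v != 0 &
  forall i, (i <= N)%N -> lorentz v (hvec (b (f i)) - hvec ho) = 0.
Proof.
move=> C N2; have [f0 fN st] := C.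
have fin i := @chain_in f N c i C.
have wi i : (i.+1 < N)%N -> E c (F (f i) (f i.+2)) = c.
  move=> iN; have [lt1 e1] := st i (ltnW iN); have [lt2 e2] := st i.+1 iN.
  have [f1 _] := fin i (ltnW (ltnW iN)); have [f2 _] := fin i.+1 (ltnW iN); have [f3 f3'] := fin i.+2 iN.
  have := @relation (f i) (f i.+1) (f i.+2); rewrite e1 e2 /E lorentzC; apply=> //.
  - exact: ltW (lt_trans lt1 lt2).
  - exact: ltW.
  - exact: le_lt_trans lt2.
have wc i : (i.+1 < N)%N -> c < F (f i) (f i.+2) <= c1.
  move=> iN; have [lt1 e1] := st i (ltnW iN); have [lt2 e2] := st i.+1 iN.
  have [f1 _] := fin i (ltnW (ltnW iN)); have [f2 _] := fin i.+1 (ltnW iN); have [f3 f3'] := fin i.+2 iN.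
  rewrite -{1}e2 F_anti ?(ltW lt2)//=.
  exact: le_trans (F_le f1 (ltW (lt_trans lt1 lt2)) f3') f3'.
have c_1 : 1 < c.
  have [lt1 <-] := st 0%N (ltnW N2); have [f1 _] := fin 0%N (leq0n _); have [_ f2] := fin 1%N (ltnW N2).
  by have [] := spacing_gt1 f1 lt1 f2.
have weq i : (i.+1 < N)%N -> F (f i) (f i.+2) = F (f 0%N) (f 2).
  move=> iN; have := wi i iN; have := wi 0%N N2; have /andP[] := wc i iN; have /andP[] := wc 0%N N2.
  move: (F (f i) (f i.+2)) (F (f 0%N) (f 2)) => x y *.
  apply/eqP; rewrite eq_le !leNgt; apply/andP; split; apply/negP => lt.
    by have := @E_mono c y x; lra.
  by have := @E_mono c x y; lra.
have det i : (i.+1 < N)%N -> 0 < det3 (b (f i)) (b (f i.+1)) (b (f i.+2)).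
  move=> iN; have [lt1 e1] := st i (ltnW iN); have [lt2 e2] := st i.+1 iN.
  have [f1 _] := fin i (ltnW (ltnW iN)); have [f3 f3'] := fin i.+2 iN.
  exact: b_det.
pose x i := hvec (b (f i)).
pose v := cross (x 1%N - x 0%N) (x 2 - x 0%N).
have x0 : x 0%N = hvec ho by rewrite /x f0 b1.
have v0 : v != 0.
  have := det 0%N N2; apply: contraTneq => v0.
  have : lorentz v (x 0%N) = 0 by rewrite v0 /lorentz !mxE; ring.
  rewrite lorentz_cross -[b (f 0%N)]/(b (f 0%N)) -/(x 0%N) -/(x 1%N) -/(x 2) => e.
  rewrite -leNgt; suff <- : det3 (x 1%N - x 0%N) (x 2 - x 0%N) (x 0%N) = det3 (x 0%N) (x 1%N) (x 2) by rewrite e.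
  by rewrite /det3 !mxE; ring.
exists v => //.
have rec i : (i.+2 < N)%N -> lorentz v (x i.+3) = lorentz v (x i) +
    ((F (f 0%N) (f 2) - c) / (c - 1)) * (lorentz v (x i.+2) - lorentz v (x i.+1)).
  move=> iN; have iN1 := ltnW iN; have iN2 := ltnW iN1.
  have [_ e1] := st i iN2; have [_ e2] := st i.+1 iN1; have [_ e3] := st i.+2 iN.
  have := four_points c_1 e1 e2 e3 (weq i iN1) (weq i.+1 iN) (det i iN1) (det i.+1 iN).
  move=> /(congr1 (lorentz v)); rewrite lorentzZr !lorentzDr !lorentzNr -/(x i) -/(x i.+1) -/(x i.+2) -/(x i.+3).
  lra.
have base : lorentz v (x 1%N) = lorentz v (x 0%N) /\ lorentz v (x 2) = lorentz v (x 0%N).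
  by rewrite !lorentz_cross /det3 !mxE; split; ring.
suff H i : (i.+2 <= N)%N -> [/\ lorentz v (x i) = lorentz v (x 0%N),
   lorentz v (x i.+1) = lorentz v (x 0%N) & lorentz v (x i.+2) = lorentz v (x 0%N)].
  have x0' := x0; move=> i iN; rewrite lorentzDr lorentzNr -x0.
  have := base; case: i iN => [|[|i]] iN [B1 B2]; [by rewrite subrr|by rewrite -/(x 1%N) B1 subrr|].
  by have [_ _] := H i iN; rewrite -/(x i.+2) => ->; rewrite subrr.
elim: i => [|i IH] iN; first by have [? ?] := base.
have [h0 h1 h2] := IH (ltnW iN); split=> //.
by rewrite rec// h0 h1 h2; ring.
Qed.

(** All the chains share the parameters [1], [s] and [c1], which fixes their plane independently of
    [n]. *)
Lemma chain_dyadic : exists s, forall n, exists f c,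
  [/\ chain f (2 ^ n.+1) c, f (2 ^ n)%N = s & c - 1 <= (c1 - 1) / 2 ^+ n].
Proof.
have [s [s1 s2 s3]] := midpoint (lexx 1) c1_gt1 (lexx c1).
exists s; elim=> [|n [f [c [C fs cn]]]].
  exists (fun i => if i == 0%N then 1 else if i == 1%N then s else c1), (F 1 s); split=> //.
    by split=> // -[|[|]]//.
  rewrite expr0 divr1 F1 ?(ltW s1) ?(ltW s2)//; lra.
have [g [d [D gf dc]]] := chain_refine C (expn_gt0 2 n.+1).
exists g, d; split.
- by rewrite expnS mul2n.
- by rewrite expnS mul2n gf// leq_exp2l.
- apply: le_trans dc _; rewrite exprSr invfM mulrA ler_wpM2r//.
Qed.

(** The chain points lie in the plane through [ho], [b s] and [b c1] and become dense on the arc,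
    whereas a point off the plane has a neighbourhood that misses the plane. *)
Lemma arc_planar : exists2 v : 'rV[R]_3, v != 0 &
  forall u, 1 <= u -> u <= c1 -> lorentz v (b u) = lorentz v ho.
Proof.
have [s H] := chain_dyadic.
pose v := cross (hvec (b s) - hvec ho) (hvec (b c1) - hvec ho).
have on n f c i : chain f (2 ^ n.+1) c -> f (2 ^ n)%N = s -> (i <= 2 ^ n.+1)%N ->
    lorentz v (b (f i)) = lorentz v ho.
  move=> C fs iN; have [f0 fN _] := C.
  have [|w w0 wP] := chain_plane C; first by rewrite expnS leq_pmulr// expn_gt0.
  have ws : lorentz w (hvec (b s) - hvec ho) = 0 by rewrite -fs; apply: wP; rewrite leq_exp2l.
  have wc : lorentz w (hvec (b c1) - hvec ho) = 0 by rewrite -fN; apply: wP.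
  have := orthogonal_det3 w0 ws wc (wP i iN).
  by rewrite -lorentz_cross -/v lorentzDr lorentzNr => /subr0_eq.
have s_in : 1 < s /\ s < c1.
  have [f [c [[f0 f2 st] f1 _]]] := H 0%N; rewrite expn0 in f1; rewrite expn1 in f2.
  have [l1 _] := st 0%N isT; have [l2 _] := st 1%N isT.
  by rewrite -f1 -f2 -{1}f0.
exists v.
  have [s1 sc] := s_in; have := b_det (lexx 1) s1 sc (lexx _); rewrite b1; apply: contraTneq => v0.
  have : lorentz v ho = 0 by rewrite v0 /lorentz !mxE; ring.
  rewrite lorentz_cross => e; rewrite -leNgt -[leRHS]e.
  by rewrite le_eqVlt; apply/orP; left; apply/eqP; rewrite /det3 !mxE; ring.
move=> u u1 uc; apply/eqP/negPn/negP => ne.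
have [d d0 h] : exists2 d, 0 < d & forall y, lorentz (b u) y < 1 + d -> lorentz v y != lorentz v ho.
  apply/(nbhs_hplane (b u) [set y | lorentz v y != lorentz v ho]).
  have [l|l] := ltP (lorentz v (b u)) (lorentz v ho).
    by apply: filterS (near_lorentz_lt l) => y; rewrite /= neq_lt => ->.
  have {}l : lorentz v ho < lorentz v (b u) by rewrite lt_neqAle eq_sym ne.
  by apply: filterS (near_lorentz_gt l) => y; rewrite /= neq_lt => ->; rewrite orbT.
have [n nd] : exists n : nat, (c1 - 1) / 2 ^+ n < d.
  have [n] : exists n : nat, (c1 - 1) / d < n%:R.
    exists (Num.truncn ((c1 - 1) / d)).+1; have := truncnS_gt ((c1 - 1) / d); exact.
  move=> hn; exists n; rewrite ltr_pdivrMr ?exprn_gt0//.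
  move: hn; rewrite ltr_pdivrMr// => hn; apply: lt_trans hn _; rewrite mulrC ltr_pM2l//.
  by rewrite -natrX ltr_nat ltn_expl.
have [f [c [C fs cn]]] := H n; have [f0 fN st] := C.
(* For the first chain parameter [f j] beyond [u], the point [b (f j)] is closer to [b u] than one
   step of the chain. *)
have ex : exists j, u <= f j by exists (2 ^ n.+1)%N; rewrite fN.
have := ex_minnP ex; set P := fun j => u <= f j; case=> j uj jmin.
have jN : (j <= 2 ^ n.+1)%N by apply: jmin; rewrite /P fN.
have [ujE|ujn] := eqVneq u (f j); first by move: ne; rewrite ujE (on n f c j C fs jN) eqxx.
have {}uj : u < f j by rewrite lt_neqAle ujn.
have : ~ (lorentz (b u) (b (f j)) < 1 + d) by move=> /h; rewrite (on n f c j C fs jN) eqxx.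
apply.
case: j uj jmin jN ujn => [|j] uj jmin jN _; first by move: uj; rewrite f0 ltNge u1.
have fu : f j < u by rewrite ltNge; apply/negP => /jmin; rewrite ltnn.
have [lt e] := st j jN; have [f1 _] := chain_in C (ltnW jN); have [_ f2] := chain_in C jN.
have : F u (f j.+1) < c by rewrite -e; apply: F_anti => //; apply: ltW.
rewrite /F; lra.
Qed.

End EqualSpacing.

(** * Strict growth of slopes, transfer between two arcs, local plane sections *)

Section LocalShape.
Variable R : realType.
Implicit Types (x y z w q p : hplane R) (a b c m s t k : R) (A B : set (hplane R)) (v : 'rV[R]_3).

#[local] Opaque hact hpt barc mslope slope_rot slope_rotV kap rho.

Lemma kapK q z : q 0 2 = 0 -> hact (kap q) (hact (kap q) z) = z.
Proof.
move=> q2; have [[e0 e1] e2] := hact_kap z q2.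
have qs := hsqr q; rewrite q2 expr0n /= addr0 in qs.
move: (hact (kap q) z) e0 e1 e2 => y e0 e1 e2.
have [[f0 f1] f2] := hact_kap y q2.
move: (hact (kap q) y) f0 f1 f2 => u f0 f1 f2.
apply: val_inj; apply: eq_vec3; rewrite /=.
- rewrite f0 e0 e1; have -> : (z 0 0 * q 0 0 - z 0 1 * q 0 1) * q 0 0 - (z 0 0 * q 0 1 - z 0 1 * q 0 0) * q 0 1
    = z 0 0 * (q 0 0 ^+ 2 - q 0 1 ^+ 2) by ring.
  by rewrite qs; ring.
- rewrite f1 e0 e1; have -> : (z 0 0 * q 0 0 - z 0 1 * q 0 1) * q 0 1 - (z 0 0 * q 0 1 - z 0 1 * q 0 0) * q 0 0
    = z 0 1 * (q 0 0 ^+ 2 - q 0 1 ^+ 2) by ring.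
  by rewrite qs; ring.
- by rewrite f2 e2.
Qed.

Lemma det_kap q : q 0 2 = 0 -> \det (kap q) = -1.
Proof.
move=> q2; have qs := hsqr q; rewrite q2 expr0n /= addr0 in qs.
rewrite det_mat3 /det3 !vec3E; transitivity (q 0 1 ^+ 2 - q 0 0 ^+ 2); first ring.
by rewrite qs; ring.
Qed.

Lemma near_coord2_lt z a : z 0 2 < a -> \forall w \near z, (w : hplane R) 0 2 < a.
Proof.
have E w : lorentz (vec3 0 0 (-1)) w = w 0 2 by rewrite /lorentz !vec3E; ring.
by rewrite -E => /near_lorentz_lt; apply: filterS => w; rewrite E.
Qed.

Lemma near_coord1_gt z a : a < z 0 1 -> \forall w \near z, a < (w : hplane R) 0 1.
Proof.
have E w : lorentz (vec3 0 (-1) 0) w = w 0 1 by rewrite /lorentz !vec3E; ring.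
by rewrite -E => /near_lorentz_gt; apply: filterS => w; rewrite E.
Qed.

Lemma near_coord0_gt z a : a < z 0 0 -> \forall w \near z, a < (w : hplane R) 0 0.
Proof.
by rewrite -(lorentz_ho z) => /near_lorentz_gt; apply: filterS => w; rewrite lorentz_ho.
Qed.

Lemma near_coord0_lt z a : z 0 0 < a -> \forall w \near z, (w : hplane R) 0 0 < a.
Proof.
by rewrite -(lorentz_ho z) => /near_lorentz_lt; apply: filterS => w; rewrite lorentz_ho.
Qed.

(** The slope tends to 0 at [ho], so it is smaller than [mslope A s] at some earlier [u]. If the
    slopes at [s] and [c] were equal, the chord from [barc A u] to [barc A c] would pass below
    [barc A s]. *)
Lemma mslope_strict A c1 zs s c : gset A -> good A c1 zs -> 1 < s -> s < c -> c <= c1 ->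
  0 < mslope A s -> mslope A s < mslope A c.
Proof.
move=> GA gA s1 sc cc ms; have c_1 : 1 < c by apply: lt_trans sc.
have sc1 : s <= c1 by apply: le_trans (ltW sc) cc.
rewrite ltNge; apply/negP => mm.
have me : mslope A c = mslope A s.
  by apply/eqP; rewrite eq_le mm (mslope_mono GA gA s1 (ltW sc) cc).
have m2 : 0 < mslope A s / 2 by rewrite divr_gt0.
have [c2 [z2 [g2 _ small]]] := small_slope GA m2.
pose u := Num.min c2 ((1 + s) / 2); have c21 := good_gt1 g2.
have u1 : 1 < u by rewrite lt_min c21 /=; lra.
have us : u < s by rewrite gt_min; apply/orP; right; lra.
have uc2 : u <= c2 by rewrite ge_min lexx.
have uc1 : u <= c1 by apply: le_trans (ltW us) sc1.
have mu := small u (ltW u1) uc2.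
have [x0 x2] := @arc_slope _ A _ (ltW u1); have [y0 y2] := @arc_slope _ A _ (ltW c_1).
have x1 := arc_gt0 A u1; have y1 := arc_gt0 A c_1.
have Ax := arc_in GA gA (ltW u1) uc1; have Ay := arc_in GA gA (ltW c_1) cc.
rewrite me in y2; move: (barc A u) (barc A c) x0 x2 y0 y2 x1 y1 Ax Ay => x y x0 x2 y0 y2 x1 y1 Ax Ay.
have [||w [a [b [a0 b0 wE w0]]]] := @segment_radius _ x y s; rewrite ?x0 ?y0//.
have Aw : A w := hconvex_comb (g_convex GA) Ax Ay (ltW a0) (ltW b0) wE.
have e1 : w 0 1 = a * x 0 1 + b * y 0 1 by rewrite wE !mxE.
have e2 : w 0 2 = a * (mslope A u * x 0 1) + b * (mslope A s * y 0 1) by rewrite wE !mxE x2 y2.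
have w1 : 0 < w 0 1 by rewrite e1 addr_gt0// mulr_gt0.
have := mslope_min GA Aw w1; rewrite w0 e1 e2.
have := mulr_gt0 a0 x1; have := mulr_gt0 b0 y1; move: (mslope A s) (mslope A u) mu m2 => ms' mu' *.
nra.
Qed.

Lemma lens_point_interior A' B' q z : q 0 2 = 0 ->
  (forall w, w 0 2 < 0 -> A' w <-> B' (hact (kap q) w)) -> z 0 2 < 0 ->
  interior A' z <-> interior B' (hact (kap q) z).
Proof.
move=> q2 H z2; have nz := near_coord2_lt z2; split=> i.
  apply/(interior_pre B' z (lor_kap q2)); rewrite /interior /=.
  by apply: filterS2 i nz => w Aw w2; apply/H.
have {}i : interior (pre (kap q) B') z by apply/(interior_pre B' z (lor_kap q2)).
by rewrite /interior /=; apply: filterS2 i nz => w Bw w2; apply/H.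
Qed.

Section Transfer.
Variables (A B : set (hplane R)) (c1 : R) (zA zB : hplane R).
Hypotheses (GA : gset A) (GB : gset B) (gA : good A c1 zA) (gB : good B c1 zB).
Hypothesis lensAB : forall c, 1 < c -> c <= c1 -> forall z, z 0 2 < 0 ->
  pre (slope_rot (mslope A c)) A z <-> pre (slope_rot (mslope B c)) B (hact (kap (hpt c 0)) z).

(** [kap] exchanges the ends of the chord, so the image of [barc B s] lies as far from [ho] as
    [barc B s] from [barc B c]. It is a boundary point of [A] below the chord, and [arc_unique]
    identifies it. *)
Lemma arc_mirror s c : 1 < s -> s < c -> c <= c1 -> 0 < mslope B s ->
  exists z, [/\ z 0 2 < 0, hact (slope_rot (mslope B c)) (hact (kap (hpt c 0)) z) = barc B s &
    hact (slope_rot (mslope A c)) z = barc A (lorentz (barc B s) (barc B c)) /\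
    z 0 0 = lorentz (barc B s) (barc B c)].
Proof.
move=> s1 sc cc ms; have c_1 : 1 < c by apply: lt_trans sc.
have sc1 : s <= c1 by apply: le_trans (ltW sc) cc.
have mlt := mslope_strict GB gB s1 sc cc ms.
have L := lensAB c_1 cc; have [q0 q1 q2] := hpt0 (ltW c_1).
have [x0 x2] := @arc_slope _ B _ (ltW s1); have x1 := arc_gt0 B s1.
have Bx := arc_in GB gB (ltW s1) sc1; have nx := arc_not_interior GB gB (ltW s1) sc1.
have [y0 y2] := @arc_slope _ B _ (ltW c_1); have y1 := arc_gt0 B c_1.
have [qy qyE _] := slope_rot_chord y1 y2; rewrite y0 in qy qyE.
have ob := arc_obtuse GB gB (lexx 1) s1 sc cc; rewrite arc1 in ob.
move: (barc B s) (barc B c) x0 x2 x1 Bx nx y0 y2 y1 qy qyE ob => x y x0 x2 x1 Bx nx y0 y2 y1 qy qyE ob.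
have F1 : lorentz x y < c.
  move: ob; rewrite !lorentz_ho x0 y0 => ob; apply: le_lt_trans ob.
  by rewrite ler_peMl ?(ltW s1)//; have := lorentz_ge1 x y; lra.
have F0 : 1 < lorentz x y.
  by apply: lorentz_gt1 => e; move: sc; rewrite -x0 -y0 e ltxx.
pose b' := hact (slope_rotV (mslope B c)) x.
have bx : hact (slope_rot (mslope B c)) b' = x by exact: slope_rotK.
have [b0 _ b2] := slope_rotVE (erefl b').
have TB := sqrt1_ge1 (mslope B c).
have b2n : b' 0 2 < 0.
  have T0 : 0 < Num.sqrt (1 + mslope B c ^+ 2) by lra.
  rewrite -(pmulr_rlt0 _ T0) b2 x2.
  have -> : mslope B s * x 0 1 - mslope B c * x 0 1 = - ((mslope B c - mslope B s) * x 0 1) by ring.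
  by rewrite oppr_lt0 mulr_gt0// subr_gt0.
pose z := hact (kap (hpt c 0)) b'.
have zb : hact (kap (hpt c 0)) z = b' by exact: kapK.
have [[z0 _] z2] := hact_kap b' q2; rewrite -/z in z0 z2.
have z2n : z 0 2 < 0 by rewrite z2.
have zF : z 0 0 = lorentz x y.
  have := lorentz_hact b' (hpt c 0) (proj1 (direct_slope_rot (mslope B c))).
  by rewrite bx qy z0 => ->; rewrite [RHS]/lorentz q2 mulr0 subr0.
exists z; split=> //; first by rewrite zb.
split=> //.
have Az : pre (slope_rot (mslope A c)) A z by apply/L => //; rewrite zb /pre /= bx.
have dA := proj1 (direct_slope_rot (mslope A c)); have dB := proj1 (direct_slope_rot (mslope B c)).
have nz : ~ interior (pre (slope_rot (mslope A c)) A) z.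
  move/(lens_point_interior q2 L z2n); rewrite zb => /(interior_pre _ _ dB); rewrite bx; exact: nx.
have {}nz : ~ interior A (hact (slope_rot (mslope A c)) z).
  by move=> i; apply: nz; apply/(interior_pre _ _ dA).
have [w0 w1 w2] := slope_rotE (erefl (hact (slope_rot (mslope A c)) z)).
rewrite /pre /= in Az; have TA := sqrt1_ge1 (mslope A c); have TA2 := sqr_sqrt1 (mslope A c).
have mA0 := mslope_ge0 GA gA (ltW c_1) cc.
move: (hact (slope_rot (mslope A c)) z) w0 w1 w2 Az nz => w w0 w1 w2 Aw nw.
have wp := germ_up (g_germ GA) Aw.
have T0 : 0 < Num.sqrt (1 + mslope A c ^+ 2) by lra.
have mz : 0 < mslope A c * z 0 1.
  by have := mulr_ge0 (ltW T0) wp; rewrite w2; lra.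
have z1 : 0 < z 0 1.
  rewrite ltNge; apply/negP => z1; have := mulr_ge0_le0 mA0 z1; lra.
have w1p : 0 < w 0 1.
  rewrite -(pmulr_rgt0 _ T0) w1; have : mslope A c * z 0 2 <= 0 by rewrite mulr_ge0_le0// ltW.
  lra.
rewrite -zF -w0; apply: (arc_unique GA gA c_1 cc Aw nw _ _ w1p).
- by rewrite w0 zF.
- by rewrite w0 zF.
- rewrite -(ltr_pM2l T0) w2.
  have -> : Num.sqrt (1 + mslope A c ^+ 2) * (mslope A c * w 0 1) =
    mslope A c * (Num.sqrt (1 + mslope A c ^+ 2) * w 0 1) by ring.
  rewrite w1; have := sqr_ge0 (mslope A c); nra.
Qed.

Lemma arc_move c : 1 < c -> c <= c1 -> (forall s, 1 < s -> s < c -> 0 < mslope B s) ->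
  exists T, [/\ lor T, \det T = -1 &
    forall s, 1 <= s -> s <= c -> hact T (barc B s) = barc A (lorentz (barc B s) (barc B c))].
Proof.
move=> c_1 cc pos; have [q0 q1 q2] := hpt0 (ltW c_1).
have [dV detV] := direct_slope_rotV (mslope B c); have [dA detA] := direct_slope_rot (mslope A c).
have lk := lor_kap q2.
have [y0 y2] := @arc_slope _ B _ (ltW c_1); have y1 := arc_gt0 B c_1.
have [qy _ _] := slope_rot_chord y1 y2; rewrite y0 in qy.
have [x0 x2] := @arc_slope _ A _ (ltW c_1); have x1 := arc_gt0 A c_1.
have [qx _ _] := slope_rot_chord x1 x2; rewrite x0 in qx.
have kq : hact (kap (hpt c 0)) (hpt c 0) = ho.
  have [[e0 e1] e2] := hact_kap (hpt c 0) q2.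
  apply: lorentz_eq1; rewrite lorentz_ho_r e0 q0.
  by have := hsqr (hpt c 0); rewrite q0 q2 expr0n /= addr0 => h; rewrite -!expr2 h; ring.
have TE x : hact (slope_rotV (mslope B c) *m kap (hpt c 0) *m slope_rot (mslope A c)) x =
    hact (slope_rot (mslope A c)) (hact (kap (hpt c 0)) (hact (slope_rotV (mslope B c)) x)).
  by rewrite !hactM//; apply: lorM.
exists (slope_rotV (mslope B c) *m kap (hpt c 0) *m slope_rot (mslope A c)); split.
- by apply: lorM => //; apply: lorM.
- by rewrite !det_mulmx detV detA (det_kap q2); ring.
move=> s s1 sc; rewrite TE.
have [->|sn] := eqVneq s 1.
  by rewrite arc1 slope_rotV_ho lorentz_ho y0 -[X in hact (kap _) X]kq kapK.
have s_1 : 1 < s by rewrite lt_neqAle eq_sym sn.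
have [->|sn'] := eqVneq s c.
  by rewrite -{1}qy slope_rotVK kq hvec_norm arc1 slope_rot_ho.
have sc' : s < c by rewrite lt_neqAle sn'.
have [z [z2 zs [zA' _]]] := arc_mirror s_1 sc' cc (pos s s_1 sc').
by rewrite -{1}zs slope_rotVK kapK.
Qed.

(** If [A] were flat along the chord, it would have no point below the chord to receive the mirror
    image of an arc point of [B]. *)
Lemma nonflat_transfer : (forall s, 1 < s -> s <= c1 -> 0 < mslope B s) ->
  forall c, 1 < c -> c <= c1 -> 0 < mslope A c.
Proof.
move=> pos c c_1 cc; pose s := (1 + c) / 2.
have s1 : 1 < s by rewrite /s; lra.
have sc : s < c by rewrite /s; lra.
have [z [z2 zs [zw z0]]] := arc_mirror s1 sc cc (pos s s1 (le_trans (ltW sc) cc)).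
have F1 : 1 <= lorentz (barc B s) (barc B c) by exact: lorentz_ge1.
have [_ _ w2] := slope_rotE zw.
have Fc : lorentz (barc B s) (barc B c) <= c1.
  have ob := arc_obtuse GB gB (lexx 1) s1 sc cc; rewrite arc1 in ob.
  have [x0 _] := @arc_slope _ B _ (ltW s1); have [y0 _] := @arc_slope _ B _ (ltW c_1).
  move: (barc B s) (barc B c) x0 y0 F1 ob => x y x0 y0 F1 ob; move: ob; rewrite !lorentz_ho x0 y0 => ob.
  by apply: (le_trans _ cc); apply: le_trans (ltW ob); rewrite ler_peMl ?(ltW s1)//; lra.
have up := germ_up (g_germ GA) (arc_in GA gA F1 Fc).
have mA0 := mslope_ge0 GA gA (ltW c_1) cc.
rewrite lt_neqAle mA0 andbT; apply/eqP => m0.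
have T0 := sqrt1_ge1 (mslope A c); have := mulr_ge0 (le_trans ler01 T0) up.
by rewrite w2 -m0 mul0r add0r leNgt z2.
Qed.

End Transfer.

Definition local_shape A v k z := lorentz v z = k /\ \forall w \near z, A w <-> lorentz v w <= k.

(* The reverse triangle inequality gives [a + b + c < 1]. *)
Lemma disk_comb3 v x y z w a b c : 0 < a -> 0 < b -> 0 < c -> x <> y ->
  lorentz v x <= 1 -> lorentz v y <= 1 -> lorentz v w <= 1 ->
  hvec z = a *: hvec x + b *: hvec y + c *: hvec w -> lorentz v z < 1.
Proof.
move=> a0 b0 c0 xy vx vy vw zE.
have n1 : a ^+ 2 + b ^+ 2 + c ^+ 2 + 2 * (a * b * lorentz x y) + 2 * (a * c * lorentz x w)
    + 2 * (b * c * lorentz y w) = 1.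
  rewrite -[RHS](hvec_norm z) zE !lorentzE !hvec_norm (lorentzC y x) (lorentzC w x) (lorentzC w y); ring.
have l1 (t : R) x' y' : 0 < t -> t <= t * lorentz x' y'.
  by move=> t0; have := ler_wpM2l (ltW t0) (lorentz_ge1 x' y'); rewrite mulr1.
have i1 : a * b < a * b * lorentz x y.
  by rewrite -[X in X < _]mulr1 ltr_pM2l ?mulr_gt0//; apply: lorentz_gt1.
have i2 := l1 (a * c) x w (mulr_gt0 a0 c0); have i3 := l1 (b * c) y w (mulr_gt0 b0 c0).
have S1 : a + b + c < 1.
  have : (a + b + c) ^+ 2 < 1 by nra.
  by rewrite -[X in _ < X](expr1n _ 2) ltr_pXn2r// nnegrE//; lra.
have : lorentz v z <= a + b + c.
  rewrite zE !lorentzE.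
  have := ler_wpM2l (ltW a0) vx; have := ler_wpM2l (ltW b0) vy; have := ler_wpM2l (ltW c0) vw; lra.
lra.
Qed.

End LocalShape.

(** * A planar arc that bends is locally the whole boundary *)

Section RoundShape.
Variable R : realType.
Implicit Types (x y z w q p : hplane R) (a b c m s t k : R) (A B : set (hplane R)) (v : 'rV[R]_3).

#[local] Opaque hact hpt barc mslope slope_rot slope_rotV kap rho.

Lemma det3_slope_gt0 x y m : 0 < x 0 1 -> x 0 2 = m * x 0 1 -> m * y 0 1 < y 0 2 -> 0 < det3 ho x y.
Proof.
move=> x1 x2 h; rewrite det3_ho x2.
have -> : x 0 1 * y 0 2 - m * x 0 1 * y 0 1 = x 0 1 * (y 0 2 - m * y 0 1) by ring.
by rewrite mulr_gt0// subr_gt0.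
Qed.

Lemma det3_slope_gt0' x y m : 0 < x 0 1 -> x 0 2 = m * x 0 1 -> y 0 2 < m * y 0 1 -> 0 < det3 ho y x.
Proof.
move=> x1 x2 h; rewrite det3_ho x2.
have -> : y 0 1 * (m * x 0 1) - y 0 2 * x 0 1 = x 0 1 * (m * y 0 1 - y 0 2) by ring.
by rewrite mulr_gt0// subr_gt0.
Qed.

(** A point [w] near the arc is compared with the arc point [y] at the same distance from [ho]. If
    [w] is above [y], it lies in the triangle [ho], [t], [y]. If it is below, [y] lies inside the
    triangle [ho], [t], [w], and [lorentz v w <= 1] would give [lorentz v y < 1] by [disk_comb3]. *)
Lemma round_local_shape B c1 zs v u : gset B -> good B c1 zs ->
  (forall s, 1 < s -> s <= c1 -> 0 < mslope B s) ->
  (forall s, 1 <= s -> s <= c1 -> lorentz v (barc B s) = 1) ->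
  1 < u -> u < c1 -> local_shape B v 1 (barc B u).
Proof.
move=> GB gB pos vb u1 uc; split; first by apply: vb; apply: ltW.
have c1_1 := good_gt1 gB; have Bo := germ_o (g_germ GB).
have Bt := arc_in GB gB (ltW c1_1) (lexx _); have vt := vb c1 (ltW c1_1) (lexx _).
have vo : lorentz v ho = 1 by rewrite -(arc1 B); apply: vb => //; apply: ltW.
have [t0 t2] := @arc_slope _ B _ (ltW c1_1); have t1 := arc_gt0 B c1_1.
have fwt s : 1 < s -> s < c1 -> s * lorentz (barc B s) (barc B c1) < c1.
  by move=> s1 sc; exact: (arc_forward GB gB s1 sc (lexx _)).
have mlt s : 1 < s -> s < c1 -> mslope B s < mslope B c1.
  by move=> s1 sc; exact: (mslope_strict GB gB s1 sc (lexx _) (pos s s1 (ltW sc))).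
have [x0 x2] := @arc_slope _ B _ (ltW u1); have x1 := arc_gt0 B u1.
have fx := fwt u u1 uc; have mx := mlt u u1 uc.
move: (barc B c1) t0 t2 t1 Bt vt fwt fx => t t0 t2 t1 Bt vt fwt fx.
move: (barc B u) x0 x2 x1 fx => x x0 x2 x1 fx.
have N1 : \forall w \near x, 0 < det3 t ho (w : hplane R).
  apply: near_det3_gt; rewrite det3C; apply: (det3_slope_gt0' t1 t2).
  by rewrite x2 ltr_pM2r.
have N2 : \forall w \near x, 1 < (w : hplane R) 0 0 by apply: near_coord0_gt; rewrite x0.
have N2' : \forall w \near x, (w : hplane R) 0 0 < c1 by apply: near_coord0_lt; rewrite x0.
have N3 : \forall w \near x, 0 < (w : hplane R) 0 1 by apply: near_coord1_gt.
have N4 : \forall w \near x, (w : hplane R) 0 0 * lorentz t w < c1.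
  have c : (w : hplane R) 0 0 * lorentz t w @[w --> x] --> x 0 0 * lorentz t x.
    exact: cvgM (@continuous_coord _ _ _) (@continuous_lorentz _ _ _).
  by apply: (cvgr_lt _ c); rewrite x0 lorentzC.
near=> w.
have n1 : 0 < det3 t ho (w : hplane R) by near: w.
have n2 : 1 < w 0 0 by near: w.
have n2' : w 0 0 < c1 by near: w.
have n3 : 0 < w 0 1 by near: w.
have n4 : w 0 0 * lorentz t w < c1 by near: w.
have {}n1 : 0 < det3 ho w t by rewrite -det3C.
have [y0 y2] := @arc_slope _ B _ (ltW n2); have y1 := arc_gt0 B n2.
have By := arc_in GB gB (ltW n2) (ltW n2'); have vy := vb _ (ltW n2) (ltW n2').
have fy := fwt _ n2 n2'; have my := mlt _ n2 n2'.
have min : B w -> mslope B (w 0 0) * w 0 1 <= w 0 2 by move=> Bw; exact: mslope_min.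
have weq : w 0 2 = mslope B (w 0 0) * w 0 1 -> barc B (w 0 0) = w by exact: hpt_eq.
have tne y : y 0 0 < c1 -> ho <> t.
  by move=> h e; move: c1_1; rewrite -t0 -e hoE ltxx.
move: (barc B (w 0 0)) (mslope B (w 0 0)) y0 y2 y1 By vy fy my min weq => y m y0 y2 y1 By vy fy my min weq.
have dyt : 0 < det3 ho y t by apply: (det3_slope_gt0' t1 t2); rewrite y2 ltr_pM2r.
have [lt|gt|eq] := ltgtP (w 0 2) (m * w 0 1); last first.
- by rewrite -(weq eq) vy lexx; split.
- have d1 := det3_slope_gt0 y1 y2 gt.
  have [|||a [b [c [a0 b0 c0 wE]]]] := @triangle_circle _ y w t _ _ _ d1 n1 dyt; rewrite ?y0 ?t0//.
  split=> _; last exact: (hconvex_comb3 (g_convex GB) Bo Bt By (ltW a0) (ltW b0) (ltW c0) wE).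
  by apply: ltW; apply: (disk_comb3 a0 b0 c0 (tne _ n2') _ _ _ wE); rewrite ?vo ?vt ?vy.
- split=> [/min|vw]; first by rewrite leNgt lt.
  have d1 := det3_slope_gt0' y1 y2 lt.
  have [|||a [b [c [a0 b0 c0 yE]]]] := @triangle_circle _ w y t _ _ _ d1 dyt n1; rewrite ?y0 ?t0// 1?lorentzC//.
  have := disk_comb3 a0 b0 c0 (tne _ n2') _ _ vw yE.
  by rewrite vo vt vy !lexx ltxx => /(_ isT isT).
Unshelve. all: by end_near.
Qed.

End RoundShape.

(** * Tangents looking backwards and boundary points to the left *)

Section SecondStage.
Variable R : realType.
Implicit Types (x y z w q p : hplane R) (a b c m s t k : R) (A B : set (hplane R)) (v : 'rV[R]_3).

#[local] Opaque hact hpt barc mslope slope_rot slope_rotV kap rho.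

(** Two plane vectors at an obtuse angle, whose area is small relative to the product of their
    lengths, are nearly opposite. Both lie in the upper half-plane and the first points to the
    right, so the first is nearly horizontal. *)
Lemma back_slope_real (x1 x2 z1 z2 P e : R) : 0 <= x2 -> 0 <= z2 -> x1 * z1 + x2 * z2 < 0 ->
  0 <= x1 * z2 - x2 * z1 -> x1 * z2 - x2 * z1 <= e * P -> 0 < e -> e <= 1 / 8 -> 0 < P ->
  P ^+ 2 <= 4 * ((x1 ^+ 2 + x2 ^+ 2) * (z1 ^+ 2 + z2 ^+ 2)) -> 0 < x1 -> x2 <= 4 * e * x1.
Proof.
move=> x20 z20 dot D0 De e0 e8 P0 PP x10; rewrite leNgt; apply/negP => h.
have xz : 0 <= x2 * z2 by exact: mulr_ge0.
have z10 : z1 < 0 by rewrite -(pmulr_rlt0 _ x10); lra.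
have h1 : 4 * e * x1 * - z1 < x2 * - z1 by rewrite ltr_pM2r// oppr_gt0.
have h2 : x2 * - z1 <= e * P by have := mulr_ge0 (ltW x10) z20; lra.
have h3 : 4 * (x1 * - z1) < P by rewrite -(ltr_pM2l e0); lra.
have h4 : x1 * - z1 > 0 by rewrite mulr_gt0// oppr_gt0.
have h5 : (x1 * z1 + x2 * z2) ^+ 2 <= (x1 * - z1) ^+ 2.
  by rewrite -sqrrN ler_pXn2r ?nnegrE//; lra.
have h6 : 16 * (x1 * - z1) ^+ 2 <= P ^+ 2.
  have -> : 16 * (x1 * - z1) ^+ 2 = (4 * (x1 * - z1)) ^+ 2 by ring.
  by rewrite ler_pXn2r ?nnegrE//; lra.
have h7 : 8 * (x1 * z2 - x2 * z1) <= P.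
  have : e * P <= 1 / 8 * P by rewrite ler_wpM2r// ltW.
  lra.
have h8 : 64 * (x1 * z2 - x2 * z1) ^+ 2 <= P ^+ 2.
  have -> : 64 * (x1 * z2 - x2 * z1) ^+ 2 = (8 * (x1 * z2 - x2 * z1)) ^+ 2 by ring.
  by rewrite ler_pXn2r ?nnegrE//; lra.
have id : (x1 ^+ 2 + x2 ^+ 2) * (z1 ^+ 2 + z2 ^+ 2) =
  (x1 * z2 - x2 * z1) ^+ 2 + (x1 * z1 + x2 * z2) ^+ 2 by ring.
have := exprn_gt0 2 P0; rewrite id in PP; lra.
Qed.

(* [N] is a reflecting germ frame at the point [barc A c], so that [ho] lies ahead of
   it; its direction is close to the tangent since [zs] lies behind. *)
Lemma back_slope A c zs w N e : gset A -> good A c zs -> zs 0 2 <= e * zs 0 1 -> 0 < e -> e <= 1 / 8 ->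
  zs 0 1 ^+ 2 <= 4 * (lorentz (barc A c) zs ^+ 2 - 1) -> A w -> mslope A c * w 0 1 < w 0 2 ->
  lor N -> \det N = -1 -> hact N ho = barc A c -> germ (pre N A) ->
  0 < hact (invmx N) ho 0 1 /\ hact (invmx N) ho 0 2 <= 4 * e * hact (invmx N) ho 0 1.
Proof.
move=> GA gA zse e0 e8 zfar Aw mw lN dN Np gN.
have c1 := good_gt1 gA; have st := arc_star GA gA c1 (lexx c).
have [p0 p2] := @arc_slope _ A _ (ltW c1); have p1 := arc_gt0 A c1.
have m0 := mslope_ge0 GA gA (ltW c1) (lexx c).
have [ms _] := mslope_le1 GA gA (ltW c1) (lexx c).
have z1 := good_1 gA; have Az := good_in gA.
have Ao := germ_o (g_germ GA).
have aK := hactKV lN.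
have D3 x y : det3 ho (hact (invmx N) x) (hact (invmx N) y) = det3 ho (barc A c) (hvec x) * 0 - det3 (barc A c) x y.
  have := det3_mul (hvec (@ho R)) (hact (invmx N) x) (hact (invmx N) y) N.
  by rewrite -!hactE// !aK Np dN => ->; ring.
have L x y : lorentz (hact (invmx N) x) (hact (invmx N) y) = lorentz x y.
  by apply: lorentz_hact; apply: lorV.
have L0 x : hact (invmx N) x 0 0 = lorentz (barc A c) x.
  by rewrite -Np -(lorentz_ho (hact (invmx N) x)) -(lorentz_hact _ _ lN) aK.
have up x : A x -> 0 <= hact (invmx N) x 0 2.
  by move=> Ax; apply: (germ_up gN); rewrite /pre /= aK.
have dz := D3 ho zs; have dw := D3 ho w; have X0 := L0 ho; have Z0 := L0 zs; have XZ := L ho zs.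
have X2 := up _ Ao; have Z2 := up _ Az; have W2 := up _ Aw.
have Xs := hsqr (hact (invmx N) ho); have Zs := hsqr (hact (invmx N) zs).
move: (hact (invmx N) ho) (hact (invmx N) zs) (hact (invmx N) w) dz dw X0 Z0 XZ X2 Z2 W2 Xs Zs.
move: (barc A c) (mslope A c) p0 p2 p1 st zfar m0 ms mw => p m p0 p2 p1 st zfar m0 ms mw X Z W dz dw X0 Z0 XZ X2 Z2 W2 Xs Zs.
clear L L0 D3 aK up gN Np dN lN GA gA Aw Az Ao.
have dz' : X 0 1 * Z 0 2 - X 0 2 * Z 0 1 = p 0 1 * (zs 0 2 - m * zs 0 1).
  by rewrite -det3_ho dz /det3 !hoE p2; ring.
have dw' : X 0 1 * W 0 2 - X 0 2 * W 0 1 = p 0 1 * (w 0 2 - m * w 0 1).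
  by rewrite -det3_ho dw /det3 !hoE p2; ring.
rewrite lorentz_ho_r p0 in X0; rewrite lorentz_ho in XZ.
have dot : X 0 1 * Z 0 1 + X 0 2 * Z 0 2 < 0.
  have : X 0 1 * Z 0 1 + X 0 2 * Z 0 2 = X 0 0 * Z 0 0 - zs 0 0 by rewrite -XZ /lorentz; ring.
  by move=> ->; rewrite X0 Z0 subr_lt0.
have mz : m * zs 0 1 <= zs 0 2 by rewrite -ler_pdivlMr.
have D0 : 0 <= X 0 1 * Z 0 2 - X 0 2 * Z 0 1 by rewrite dz' mulr_ge0 ?(ltW p1)// subr_ge0.
have Dw : 0 < X 0 1 * W 0 2 - X 0 2 * W 0 1 by rewrite dw' mulr_gt0// subr_gt0.
have xz := mulr_ge0 X2 Z2.
have X1 : 0 < X 0 1.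
  rewrite ltNge; apply/negP => X1.
  have Z1 : 0 < Z 0 1.
    by rewrite ltNge; apply/negP => Z1; have := mulr_le0 X1 Z1; lra.
  have h1 := mulr_le0_ge0 X1 Z2; have h2 := mulr_ge0 X2 (ltW Z1).
  have X2e : X 0 2 = 0.
    have : X 0 2 * Z 0 1 == 0 by apply/eqP; lra.
    by rewrite mulf_eq0 (gt_eqF Z1) orbF => /eqP.
  by have h3 := mulr_le0_ge0 X1 W2; rewrite X2e mul0r subr0 in Dw; lra.
split=> //; apply: (back_slope_real X2 Z2 dot D0 (P := p 0 1 * zs 0 1)) => //.
- rewrite dz' mulrCA ler_wpM2l ?(ltW p1)//.
  by have := mulr_ge0 m0 (ltW z1); lra.
- exact: mulr_gt0.
- have -> : Z 0 1 ^+ 2 + Z 0 2 ^+ 2 = lorentz p zs ^+ 2 - 1 by rewrite -Z0 Zs; ring.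
  have -> : X 0 1 ^+ 2 + X 0 2 ^+ 2 = p 0 1 ^+ 2 * (1 + m ^+ 2).
    have -> : X 0 1 ^+ 2 + X 0 2 ^+ 2 = X 0 0 ^+ 2 - 1 by rewrite Xs; ring.
    by rewrite X0 -p0 (hsqr p) p2; ring.
  rewrite exprMn; have L1 := lorentz_ge1 p zs; move: (lorentz p zs) L1 zfar => d L1 zfar.
  apply: (@le_trans _ _ (p 0 1 ^+ 2 * (4 * (d ^+ 2 - 1)))); first by rewrite ler_wpM2l ?sqr_ge0.
  have -> : 4 * (p 0 1 ^+ 2 * (1 + m ^+ 2) * (d ^+ 2 - 1)) = p 0 1 ^+ 2 * (4 * (d ^+ 2 - 1)) * (1 + m ^+ 2) by ring.
  rewrite ler_peMr ?lerDl ?sqr_ge0// mulr_ge0 ?sqr_ge0// mulr_ge0// subr_ge0 exprn_ege1//.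
Qed.

Lemma det_rho : \det (rho R) = -1.
Proof.
Transparent rho. rewrite /rho det_mat3 /det3 !vec3E; ring. Qed.

Lemma germ_interior A w : closed A -> germ A -> interior A w -> 0 < w 0 2.
Proof.
move=> clA gA Aw; have up := germ_up gA (interior_subset Aw).
rewrite lt_neqAle up andbT; apply/eqP => e.
have [k [_ _ k2 _]] := germ_tan gA ltr01.
have [t [a [b [a0 b0 tE At]]]] := toward (hact (rho R) k) clA Aw.
have t2 : t 0 2 = b * - k 0 2 by rewrite tE !mxE hact_rho -e mulr0 add0r.
by have := germ_up gA At; rewrite t2 mulrN oppr_ge0 leNgt mulr_gt0.
Qed.

(** The boundary to the left of [ho] is the arc of the mirrored body, seen in the reflecting frame
    [T]. *)
Lemma left_points A w : gset A -> interior A w -> exists2 c1, 1 < c1 & forall c, 1 < c -> c <= c1 ->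
  exists q, [/\ A q, ~ interior A q, q 0 0 = c, 0 < det3 ho w q &
    forall p, A p -> c <= p 0 0 -> 0 <= det3 ho p q].
Proof.
move=> GA Aw; have no := gset_not_interior GA; have Ao := germ_o (g_germ GA).
have lr := lor_rho R; have cA := g_convex GA; have clA := g_closed GA.
have [|||||N [dN No gN]] := @germ_exists _ (pre (rho R) A) (hact (rho R) w) ho.
- exact: closed_pre.
- exact: hconvex_pre.
- by apply/(interior_pre _ _ lr); rewrite hact_rhoK.
- by rewrite /pre /= hact_rho_ho.
- by move/(interior_pre _ _ lr); rewrite hact_rho_ho.
rewrite (preM _ (proj1 dN) lr) in gN; set T := N *m rho R in gN.
have lT : lor T by exact: lorM (proj1 dN) lr.
have dT : \det T = -1 by rewrite /T det_mulmx (proj2 dN) det_rho mul1r.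
have To : hact T ho = ho by rewrite /T (hactM _ (proj1 dN) lr) No hact_rho_ho.
have TK := hactKV lT.
have D3 x y : det3 ho (hact T x) (hact T y) = det3 ho y x.
  have := det3_mul (hvec (@ho R)) x y T.
  by rewrite -!hactE// To dT => ->; rewrite /det3; ring.
have GG : gset (pre T A) by split; [exact: closed_pre|exact: hconvex_pre|].
have Gw : interior (pre T A) (hact (invmx T) w) by apply/(interior_pre _ _ lT); rewrite TK.
have T0 x : hact T x 0 0 = x 0 0.
  by rewrite -(lorentz_ho (hact T x)) -{1}To lorentz_hact// lorentz_ho.
pose w' := hact (invmx T) w; have w'E : hact T w' = w by exact: TK.
have w'2 : 0 < w' 0 2 := germ_interior (g_closed GG) gN Gw.
have nw := normr_ge0 (w' 0 1).
pose e := w' 0 2 / (`|w' 0 1| + 1) / 2.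
have e0 : 0 < e by rewrite !divr_gt0//; lra.
have eE : 2 * e * (`|w' 0 1| + 1) = w' 0 2 by rewrite /e; field; rewrite gt_eqF//; lra.
have [c1 [zs [gG _ small]]] := small_slope GG e0.
have c1_1 := good_gt1 gG.
exists c1 => // c c_1 cc.
have [q0 q2] := @arc_slope _ (pre T A) _ (ltW c_1); have q1 := arc_gt0 (pre T A) c_1.
have Gq := arc_in GG gG (ltW c_1) cc; have nq := arc_not_interior GG gG (ltW c_1) cc.
have mG := mslope_ge0 GG gG (ltW c_1) cc; have me := small c (ltW c_1) cc.
have mon p : pre T A p -> c <= p 0 0 -> 0 <= det3 ho (barc (pre T A) c) p.
  move=> Gp cp; have p2 := germ_up gN Gp.
  have q2' : 0 <= barc (pre T A) c 0 2 by rewrite q2 mulr_ge0// ltW.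
  have [p1|p1] := ltP 0 (p 0 1); last first.
    by rewrite det3_ho; have := mulr_ge0 (ltW q1) p2; have := mulr_ge0_le0 q2' p1; lra.
  have mp : mslope (pre T A) c * p 0 1 <= p 0 2.
    have := radial (g_convex GG) (germ_o gN) Gp p1 (ltW c_1) cp.
    move=> /(mslope_le (divr_ge0 p2 (ltW p1))); by rewrite ler_pdivlMr.
  rewrite det3_ho q2.
  have -> : barc (pre T A) c 0 1 * p 0 2 - mslope (pre T A) c * barc (pre T A) c 0 1 * p 0 1 =
     barc (pre T A) c 0 1 * (p 0 2 - mslope (pre T A) c * p 0 1) by ring.
  by rewrite mulr_ge0 ?(ltW q1)// subr_ge0.
move: (barc (pre T A) c) (mslope (pre T A) c) q0 q2 q1 Gq nq mG me mon => q m q0 q2 q1 Gq nq mG me mon.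
exists (hact T q); split=> //.
- by move=> i; apply: nq; apply/(interior_pre _ _ lT).
- by rewrite T0 q0.
- rewrite -w'E D3 det3_ho q2.
  have -> : q 0 1 * w' 0 2 - m * q 0 1 * w' 0 1 = q 0 1 * (w' 0 2 - m * w' 0 1) by ring.
  rewrite mulr_gt0// subr_gt0.
  have l1 : m * w' 0 1 <= m * `|w' 0 1| by rewrite ler_wpM2l// ler_norm.
  have l2 : m * `|w' 0 1| <= e * `|w' 0 1| by rewrite ler_wpM2r.
  have l3 := mulr_ge0 (ltW e0) nw; lra.
- move=> p Ap cp; rewrite -(TK p) D3; apply: mon; first by rewrite /pre /= TK.
  by rewrite -T0 TK.
Qed.

End SecondStage.

(** * A reflecting frame just to the right of a boundary point *)

Section Corner.
Variable R : realType.
Implicit Types (x y z w q p : hplane R) (a b c m s t k : R) (A B : set (hplane R)) (v : 'rV[R]_3).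

#[local] Opaque hact hpt barc mslope slope_rot slope_rotV kap rho.

Lemma near_good A zs : A zs -> 0 < zs 0 1 -> 0 <= zs 0 2 -> zs 0 2 <= zs 0 1 ->
  exists2 c1, 1 < c1 & forall c, 1 < c -> c <= c1 -> good A c zs.
Proof.
move=> Az z1 z2 z21; have z0 := hge1 zs.
have p0 : 0 < 16 * zs 0 0 ^+ 2 by rewrite mulr_gt0// exprn_gt0//; lra.
pose d := zs 0 1 ^+ 2 / (16 * zs 0 0 ^+ 2).
have d0 : 0 < d by rewrite divr_gt0// exprn_gt0.
have dE : d * (16 * zs 0 0 ^+ 2) = zs 0 1 ^+ 2 by rewrite /d divfK// gt_eqF.
exists (Num.sqrt (1 + d)); first by rewrite -[X in X < _]sqrtr1 ltr_sqrt; lra.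
move=> c c1 cd; split=> //; rewrite -dE mulrAC mulrC ler_pM2r//.
have : c ^+ 2 <= Num.sqrt (1 + d) ^+ 2 by rewrite ler_pXn2r ?nnegrE ?sqrtr_ge0//; lra.
rewrite sqr_sqrtr; lra.
Qed.

Lemma corner_frame A w k h eta cmax : gset A -> interior A w -> 0 < w 0 1 -> 0 < w 0 2 ->
  k * w 0 2 = w 0 1 + w 0 2 -> 0 < k -> 0 < h -> 16 * h <= w 0 2 -> 0 < eta -> eta <= 1 -> 1 < cmax ->
  exists N, let X := hact (invmx N) ho in let W := hact (invmx N) w in
  [/\ lor N, \det N = -1, gset (pre N A), A (hact N ho) /\ ~ interior A (hact N ho) &
  [/\ 1 < X 0 0 < cmax, W 0 0 <= 2 * w 0 0, 0 < X 0 1 /\ X 0 2 < eta * X 0 1,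
    2 * h * X 0 1 < X 0 1 * W 0 2 - X 0 2 * W 0 1 &
    X 0 0 * w 0 0 - W 0 0 < k * (X 0 1 * W 0 2 - X 0 2 * W 0 1)]].
Proof.
move=> GA Aw w1 w2 kE k0 h0 h16 e0 e1 cm; have w0 := hge1 w.
have Ao := germ_o (g_germ GA); have no := gset_not_interior GA.
(* [back_slope] turns the bound [e] on the slope into [4 * e], which is below [eta]. *)
pose e := eta / 16; have ee : 0 < e by rewrite divr_gt0.
have [zs [Az z1 z2 z21]] := germ_tan (g_germ GA) ee.
have z2' : zs 0 2 <= zs 0 1.
  by apply: le_trans z21 _; rewrite -[leRHS]mul1r ler_wpM2r// /e; lra.
have [cg cg1 gA] := near_good (interior_subset Az) z1 (ltW z2) z2'.
pose e2 := Num.min (w 0 2 / (2 * w 0 1)) (w 0 2 / (2 * (w 0 2 + k * w 0 1))).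
have kw : 0 < w 0 2 + k * w 0 1 by rewrite addr_gt0// mulr_gt0.
have e20 : 0 < e2 by rewrite lt_min !divr_gt0// mulr_gt0.
have e21 : e2 * (2 * w 0 1) <= w 0 2 by rewrite -ler_pdivlMr ?ge_min ?lexx// mulr_gt0.
have e22 : e2 * (2 * (w 0 2 + k * w 0 1)) <= w 0 2 by rewrite -ler_pdivlMr ?ge_min ?lexx ?orbT// mulr_gt0.
have [cs [zs' [gs _ small]]] := small_slope GA e20; have cs1 := good_gt1 gs.
have N1 : \forall y \near (ho : hplane R), zs 0 1 ^+ 2 / 4 + 1 < lorentz zs (y : hplane R) * lorentz zs y.
  have cv : lorentz zs (y : hplane R) * lorentz zs y @[y --> (ho : hplane R)] --> lorentz zs ho * lorentz zs ho.
    exact: cvgM (@continuous_lorentz _ _ _) (@continuous_lorentz _ _ _).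
  apply: (cvgr_gt _ cv); rewrite lorentz_ho_r -expr2 (hsqr zs).
  by have := exprn_gt0 2 z1; have := sqr_ge0 (zs 0 2); clear; lra.
have N2 : \forall y \near (ho : hplane R), lorentz w (y : hplane R) < 2 * w 0 0.
  by apply: near_lorentz_lt; rewrite lorentz_ho_r; lra.
have [d1 d10 D1] := (nbhs_hplane _ _).1 N1; have [d2 d20 D2] := (nbhs_hplane _ _).1 N2.
pose c := Num.min (Num.min cg cs) (Num.min ((1 + cmax) / 2) (1 + Num.min d1 d2 / 2)).
have dm : 0 < Num.min d1 d2 by rewrite lt_min d10.
have [dm1 dm2] : Num.min d1 d2 <= d1 /\ Num.min d1 d2 <= d2 by rewrite !ge_min !lexx orbT.
have c1 : 1 < c by rewrite !lt_min cg1 cs1 /=; apply/andP; split; lra.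
have [ccg ccs ccm ccd] : [/\ c <= cg, c <= cs, c <= (1 + cmax) / 2 & c <= 1 + Num.min d1 d2 / 2].
  by rewrite /c; split; rewrite !ge_min lexx ?orbT.
have {}gA := gA c c1 ccg; have {}small := small c (ltW c1) ccs.
have [p0 p2] := @arc_slope _ A _ (ltW c1); have p1 := arc_gt0 A c1.
have m0 := mslope_ge0 GA gA (ltW c1) (lexx c).
have Ap := arc_in GA gA (ltW c1) (lexx c); have np := arc_not_interior GA gA (ltW c1) (lexx c).
have zfar : zs 0 1 ^+ 2 <= 4 * (lorentz (barc A c) zs ^+ 2 - 1).
  have : zs 0 1 ^+ 2 / 4 + 1 < lorentz zs (barc A c) * lorentz zs (barc A c).
    by apply: D1; rewrite lorentz_ho p0; clear -ccd dm1 d10; lra.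
  rewrite lorentzC; move: (lorentz _ _) => L; rewrite -expr2; clear; lra.
have wfar : lorentz (barc A c) w < 2 * w 0 0.
  by rewrite lorentzC; apply: D2; rewrite lorentz_ho p0; clear -ccd dm2 d20; lra.
have m1 := proj2 (mslope_le1 GA gA (ltW c1) (lexx c)).
clearbody c.
clear N1 N2 D1 D2 ccd dm dm1 dm2 d10 d20 d1 d2 cg1 ccg cs1 ccs gs zs' z2.
have mw : mslope A c * w 0 1 <= w 0 2 / 2.
  have : mslope A c * w 0 1 <= e2 * w 0 1 by rewrite ler_wpM2r// ltW.
  lra.
have mw2 : mslope A c * (w 0 2 + k * w 0 1) <= w 0 2 / 2.
  have : mslope A c * (w 0 2 + k * w 0 1) <= e2 * (w 0 2 + k * w 0 1) by rewrite ler_wpM2r// ltW.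
  lra.
have mw' : mslope A c * w 0 1 < w 0 2 by lra.
have lr := lor_rho R; have cA := g_convex GA; have clA := g_closed GA.
(* The tangent looking back is the right tangent of the mirrored body. *)
have [|||||N0 [dN No gN]] := @germ_exists _ (pre (rho R) A) (hact (rho R) w) (hact (rho R) (barc A c)).
- exact: closed_pre.
- exact: hconvex_pre.
- by apply/(interior_pre _ _ lr); rewrite hact_rhoK.
- by rewrite /pre /= hact_rhoK.
- by move/(interior_pre _ _ lr); rewrite hact_rhoK.
rewrite (preM _ (proj1 dN) lr) in gN; move: (N0 *m rho R) (lorM (proj1 dN) lr)
  (det_mulmx N0 (rho R)) (hactM ho (proj1 dN) lr) gN => N lN detN Np gN.
rewrite (proj2 dN) det_rho mul1r in detN; rewrite No hact_rhoK in Np.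
have e8 : e <= 1 / 8 by rewrite /e; clear -e1; lra.
have [X1 X2] := back_slope GA gA z21 ee e8 zfar (interior_subset Aw) mw' lN detN Np gN.
exists N => /=; split=> //.
- by split; [exact: closed_pre|exact: hconvex_pre|].
- by rewrite Np.
have aK := hactKV lN.
have L0 x : hact (invmx N) x 0 0 = lorentz (barc A c) x.
  by rewrite -Np -(lorentz_ho (hact (invmx N) x)) -(lorentz_hact _ _ lN) aK.
have dw : det3 ho (hact (invmx N) ho) (hact (invmx N) w) = - det3 (barc A c) ho w.
  have := det3_mul (hvec (@ho R)) (hact (invmx N) ho) (hact (invmx N) w) N.
  by rewrite -!hactE// !aK Np detN => ->; ring.
have X0 := L0 ho; have W0 := L0 w; rewrite -W0 in wfar.
have Xs := hsqr (hact (invmx N) ho).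
move: (hact (invmx N) ho) (hact (invmx N) w) X0 W0 dw X1 X2 Xs wfar => X W X0 W0 dw X1 X2 Xs wfar.
rewrite lorentz_ho_r p0 in X0; rewrite X0.
move: (barc A c) (mslope A c) p0 p2 p1 m0 m1 mw mw2 W0 dw => p m p0 p2 p1 m0 m1 mw mw2 W0 dw.
clear -p0 p2 p1 m0 m1 mw mw2 W0 dw X0 X1 X2 Xs wfar c1 ccm cm e0 k0 h0 h16 w1 w2 kE.
rewrite det3_ho in dw.
have {}dw : X 0 1 * W 0 2 - X 0 2 * W 0 1 = p 0 1 * (w 0 2 - m * w 0 1).
  by rewrite dw /det3 !hoE p2; ring.
rewrite dw; split.
- by rewrite c1; clear -ccm cm; lra.
- exact: ltW.
- split=> //; apply: le_lt_trans X2 _; rewrite ltr_pM2r// /e; clear -e0; lra.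
- have X1p : X 0 1 <= 2 * p 0 1.
    have : X 0 1 ^+ 2 <= (2 * p 0 1) ^+ 2.
      have -> : (2 * p 0 1) ^+ 2 = 4 * p 0 1 ^+ 2 by ring.
      have -> : X 0 1 ^+ 2 = p 0 1 ^+ 2 * (1 + m ^+ 2) - X 0 2 ^+ 2.
        by have := hsqr p; have := Xs; rewrite X0 p0 p2; clear; lra.
      have mm : m ^+ 2 <= 1 by rewrite expr_le1.
      have := ler_wpM2l (sqr_ge0 (p 0 1)) mm; have := sqr_ge0 (X 0 2); have := sqr_ge0 (p 0 1).
      clear; lra.
    by rewrite ler_pXn2r ?nnegrE// ?(ltW X1)// mulr_ge0// ltW.
  apply: (@le_lt_trans _ _ (2 * h * (2 * p 0 1))).
    by rewrite ler_wpM2l// mulr_ge0// ltW.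
  have -> : 2 * h * (2 * p 0 1) = p 0 1 * (4 * h) by ring.
  rewrite ltr_pM2l//; clear -h16 h0 mw w2; lra.
- have -> : c * w 0 0 - W 0 0 = p 0 1 * (w 0 1 + m * w 0 2).
    by rewrite W0 /lorentz p0 p2; ring.
  rewrite mulrCA ltr_pM2l// mulrBr kE; clear -mw2 w2; lra.
Qed.

End Corner.

(** * A lens whose chord passes over a given boundary point *)

Section CornerLens.
Variable R : realType.
Implicit Types (x y z w q p : hplane R) (a b c m s t k : R) (A B : set (hplane R)) (v : 'rV[R]_3).

#[local] Opaque hact hpt barc mslope slope_rot slope_rotV kap rho.

(* [ho] is seen from the lens frame [T] as the point [X], slightly below the chord. *)
Lemma corner_lens A B cb : gset A -> gset B -> sym_pair (pre (rho R) A) B -> 1 < cb ->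
  exists (T : 'M[R]_3) t X W, [/\ lor T, 1 < t <= cb,
    [/\ hact T X = ho, pre T A ho & pre T A (hpt t 0)], interior (pre T A) W /\ 0 < W 0 2 &
    [/\ X 0 2 <= 0, 1 < lorentz X (hpt t 0) < t,
       X 0 2 = 0 -> 0 < X 0 1 /\ t * X 0 1 < hpt t 0 0 1 * X 0 0 &
       forall z, z 0 2 < 0 ->
         pre T A z <-> pre (slope_rot (mslope B t)) B (hact (kap (hpt t 0)) z)]].
Proof.
move=> GA GB H cb1; have [w [Aw w1 w2 _]] := germ_tan (g_germ GA) ltr01.
pose k := (w 0 1 + w 0 2) / w 0 2.
have kE : k * w 0 2 = w 0 1 + w 0 2 by rewrite /k divfK// gt_eqF.
have k0 : 0 < k by rewrite divr_gt0// addr_gt0.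
clearbody k.
(* The interior point of [B] is chosen after [k], flat enough to compensate the angle of [A] at the
   far end of the chord. *)
have [wB [h0 [C0 [h00 HB]]]] := right_side GB (ltW k0).
pose h := Num.min h0 (w 0 2 / 16).
have hp : 0 < h by rewrite lt_min h00 divr_gt0.
have [hh h16] : h <= h0 /\ h <= w 0 2 / 16 by rewrite !ge_min !lexx orbT.
clearbody h; have {}h16 : 16 * h <= w 0 2 by clear -h16; lra.
pose C := Num.max C0 (Num.max (2 * w 0 0) cb).
have [CC0 Cw Cb] : [/\ C0 <= C, 2 * w 0 0 <= C & cb <= C].
  by rewrite /C; split; rewrite !le_max lexx ?orbT.
clearbody C; have C1 : 1 <= C by apply: ltW; apply: lt_le_trans Cb.
have C3 : 0 < 20 * C ^+ 3 by rewrite mulr_gt0// exprn_gt0// (lt_le_trans ltr01).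
pose eta := Num.min 1 (h / (20 * C ^+ 3)).
have eta0 : 0 < eta by rewrite lt_min ltr01 divr_gt0.
have eta1 : eta <= 1 by rewrite ge_min lexx.
have small : 10 * C ^+ 3 * eta < h.
  have e : eta * (20 * C ^+ 3) <= h by rewrite -ler_pdivlMr// ge_min lexx orbT.
  apply: lt_le_trans e; rewrite mulrC ltr_pM2l//; clear -C3; lra.
clearbody eta.
have [cB cB1 {}HB] := HB h C eta hh hp CC0 eta0.
pose cm := Num.min cB cb.
have cm1 : 1 < cm by rewrite lt_min cB1.
have [cmB cmb] : cm <= cB /\ cm <= cb by rewrite !ge_min !lexx orbT.
clearbody cm.
have [N [lN dN GN [AN nAN] [/andP[X01 X0c] W0 [X1 X2] Xh Xk]]] := corner_frame GA Aw w1 w2 kE k0 hp h16 eta0 eta1 cm1.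
have Ao := germ_o (g_germ GA).
have aK := hactKV lN.
have L0 x : hact (invmx N) x 0 0 = lorentz (hact N ho) x.
  by rewrite -(lorentz_ho (hact (invmx N) x)) -(lorentz_hact _ _ lN) aK.
have L x y : lorentz (hact (invmx N) x) (hact (invmx N) y) = lorentz x y.
  by apply: lorentz_hact; apply: lorV.
have Dt x y z : det3 (hact (invmx N) x) (hact (invmx N) y) (hact (invmx N) z) = - det3 x y z.
  have := det3_mul (hact (invmx N) x) (hact (invmx N) y) (hact (invmx N) z) N.
  by rewrite -!hactE// !aK dN => ->; ring.
have No : ho = hact (invmx N) (hact N ho) by rewrite hactK.
have NW : interior (pre N A) (hact (invmx N) w) by apply/(interior_pre _ _ lN); rewrite aK.
set p := hact N ho in AN nAN No L0; set X := hact (invmx N) ho in X01 X0c X1 X2 Xh Xk.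
set W := hact (invmx N) w in W0 Xh Xk NW.
have LXW : lorentz X W = w 0 0 by rewrite L lorentz_ho.
have p0 : p 0 0 = X 0 0 by rewrite L0 lorentz_ho_r.
(* Open conditions for the far end of the chord. They hold at [X], hence at every boundary point on
   the left that is close enough to [ho]. *)
pose P q := [/\ 0 < q 0 1, q 0 2 < eta * q 0 1, 2 * h * q 0 1 < q 0 1 * W 0 2 - q 0 2 * W 0 1,
   q 0 0 * lorentz W q - W 0 0 < k * (q 0 1 * W 0 2 - q 0 2 * W 0 1) & (1 + X 0 0) / 2 < q 0 0 < cm].
have NP : \forall q \near X, P q.
  have N1 : \forall q \near X, 0 < (q : hplane R) 0 1 by exact: near_coord1_gt.
  have N2 : \forall q \near X, 0 < lorentz (vec3 0 (- eta) 1) (q : hplane R).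
    by apply: near_lorentz_gt; rewrite /lorentz !vec3E; clear -X2; lra.
  have N3 : \forall q \near X, 0 < lorentz (vec3 0 (2 * h - W 0 2) (W 0 1)) (q : hplane R).
    by apply: near_lorentz_gt; rewrite /lorentz !vec3E; clear -Xh; lra.
  have N4 : \forall q \near X, (q : hplane R) 0 0 * lorentz W q -
       lorentz (vec3 0 (- (k * W 0 2)) (k * W 0 1)) q < W 0 0.
    have cv : (q : hplane R) 0 0 * lorentz W q - lorentz (vec3 0 (- (k * W 0 2)) (k * W 0 1)) q @[q --> X]
      --> X 0 0 * lorentz W X - lorentz (vec3 0 (- (k * W 0 2)) (k * W 0 1)) X.
      apply: cvgB (@continuous_lorentz _ _ _); exact: cvgM (@continuous_coord _ _ _) (@continuous_lorentz _ _ _).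
    apply: (cvgr_lt _ cv); rewrite lorentzC LXW /lorentz !vec3E; clear -Xk; lra.
  have N5 : \forall q \near X, (1 + X 0 0) / 2 < (q : hplane R) 0 0.
    by apply: near_coord0_gt; clear -X01; lra.
  have N6 : \forall q \near X, (q : hplane R) 0 0 < cm by exact: near_coord0_lt.
  near=> q; split; first by near: q.
  - suff : 0 < lorentz (vec3 0 (- eta) 1) q by rewrite /lorentz !vec3E; clear; lra.
    by near: q.
  - suff : 0 < lorentz (vec3 0 (2 * h - W 0 2) (W 0 1)) q by rewrite /lorentz !vec3E; clear; lra.
    by near: q.
  - suff : q 0 0 * lorentz W q - lorentz (vec3 0 (- (k * W 0 2)) (k * W 0 1)) q < W 0 0.
      by move: (lorentz W q) => l; rewrite /lorentz !vec3E; clear; lra.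
    by near: q.
  - by apply/andP; split; near: q.
have [d d0 {}NP] := (nbhs_hplane _ _).1 NP.
have [cq cq1 left] := left_points GA Aw.
pose c := Num.min (Num.min cq (1 + d / 2)) ((1 + X 0 0) / 2).
have c1 : 1 < c by rewrite !lt_min cq1 /=; apply/andP; split; [clear -d0|clear -X01]; lra.
have [ccq cd cX] : [/\ c <= cq, c <= 1 + d / 2 & c <= (1 + X 0 0) / 2].
  by rewrite /c; split; rewrite !ge_min lexx ?orbT.
clearbody c; have [q [Aq nq q0 dwq dpq]] := left c c1 ccq.
have {}dpq : 0 <= det3 ho p q by apply: dpq => //; rewrite p0; clear -cX X01; lra.
pose Q := hact (invmx N) q.
have [Q1 Q2 Qh Qk /andP[Qt Qc]] : P Q by apply: NP; rewrite L lorentz_ho q0; clear -cd d0; lra.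
have GQ : pre N A Q by rewrite /pre /= aK.
have nQ : ~ interior (pre N A) Q by move/(interior_pre _ _ lN); rewrite aK.
have Q20 := germ_up (g_germ GN) GQ.
(* In this frame [X] does not lie above the chord from [ho] to [Q]. *)
have DX : 0 <= X 0 1 * Q 0 2 - X 0 2 * Q 0 1.
  rewrite -det3_ho No Dt; move: dpq; rewrite /det3 !hoE; clear; lra.
have DW : W 0 0 * (Q 0 1 * X 0 2 - Q 0 2 * X 0 1) - W 0 1 * (Q 0 0 * X 0 2 - Q 0 2 * X 0 0)
   + W 0 2 * (Q 0 0 * X 0 1 - Q 0 1 * X 0 0) < 0.
  have : det3 W Q X < 0.
    by rewrite Dt; move: dwq; rewrite [in X in X -> _]det3C oppr_lt0.
  by rewrite /det3; clear; lra.
have LXQ : lorentz X Q = c by rewrite L lorentz_ho q0.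
have XE : hact N X = ho by rewrite aK.
have sym : sym_pair (pre (rho R) A) B := H.
have rN : lor (rho R) := lor_rho R.
have preN : pre N A = pre (N *m rho R) (pre (rho R) A).
  by rewrite -(preM _ lN rN) pre_rhoK.
have dNr : direct (N *m rho R).
  by split; [exact: lorM|rewrite det_mulmx dN det_rho; ring].
clearbody p X W Q.
clear L0 L Dt aK dpq NP left dwq P H LXW p0 nq Aq q0 Ao d0 cd d ccq cq1 cq No q AN nAN Xh Xk.
pose m := Q 0 2 / Q 0 1.
have Q2E : Q 0 2 = m * Q 0 1 by rewrite /m divfK// gt_eqF.
have m0 : 0 <= m by rewrite divr_ge0// ltW.
have me : m <= eta by rewrite ler_pdivrMr// ltW.
clearbody m.
have m1 := le_trans me eta1.
have T2 := sqrt1_le2 m0 m1; have T1 := sqrt1_ge1 m.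
have t1 : 1 < Q 0 0 by clear -Qt X01; lra.
have [oN upN _] := g_germ GN.
have WC : W 0 0 <= C := le_trans W0 Cw.
have sideA : lens_side (pre (slope_rot m) (pre N A)) (hpt (Q 0 0) 0) (hact (slope_rotV m) W) m eta C h k.
  apply: (cap_lens_side (g_convex GN) oN upN GQ nQ Q1 Q2E m0 me NW WC).
    apply: le_trans (ltW Qh); rewrite mulrA ler_wpM2r ?(ltW Q1)//.
    by rewrite mulrC ler_wpM2r// ltW.
  apply: le_trans (ltW Qk); rewrite /lorentz; clear; lra.
have sideB := HB _ t1 (le_trans (ltW Qc) cmB).
have [q0 qq q2] := hpt0 (ltW t1); have q1 : 0 < hpt (Q 0 0) 0 0 1 := hpt_gt0 0 t1.
have qC : hpt (Q 0 0) 0 0 0 <= C by rewrite q0; apply: ltW; apply: lt_le_trans Qc (le_trans cmb Cb).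
have dsr := direct_slope_rot m.
have clA : closed (pre (slope_rot m) (pre N A)) := closed_pre (proj1 dsr) (g_closed GN).
have clB := closed_pre (proj1 (direct_slope_rot (mslope B (Q 0 0)))) (g_closed GB).
have symM : interior (pre (slope_rot m) (pre N A) `&` pre (rho R) (pre (slope_rot (mslope B (Q 0 0))) B)) !=set0 ->
   centrally_symmetric (pre (slope_rot m) (pre N A) `&` pre (rho R) (pre (slope_rot (mslope B (Q 0 0))) B)).
  rewrite preN (preM _ (proj1 dsr) (proj1 dNr)); apply: sym; first exact: directM.
  exact: direct_slope_rot.
have key := lens hp C1 qC small q2 q1 sideA sideB clA clB symM.
have [E0 E1 E2] := slope_rotVE (erefl (hact (slope_rotV m) X)).
have [qQ q1E _] := slope_rot_chord Q1 Q2E.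
have XK := slope_rotK m X; have WK := slope_rotK m W.
have Lc : lorentz (hact (slope_rotV m) X) (hpt (Q 0 0) 0) = c.
  by rewrite -(lorentz_hact _ _ (proj1 dsr)) XK qQ.
have W'i : interior (pre (slope_rot m) (pre N A)) (hact (slope_rotV m) W) := ls_w sideA.
have W'2 : 0 < hact (slope_rotV m) W 0 2 := lt_le_trans hp (ls_h sideA).
have oT := ls_o sideA; have qT := ls_q sideA.
have DW' : hact (slope_rotV m) X 0 2 = 0 -> 0 < hact (slope_rotV m) X 0 1 /\
    Q 0 0 * hact (slope_rotV m) X 0 1 < hpt (Q 0 0) 0 0 1 * hact (slope_rotV m) X 0 0.
  have [F0 F1 F2] := slope_rotVE (erefl (hact (slope_rotV m) W)).
  move: (hact (slope_rotV m) X) (hact (slope_rotV m) W) E0 E1 E2 F0 F1 F2 W'2 => X' W' E0 E1 E2 F0 F1 F2 W'2 X'2.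
  move: (Num.sqrt (1 + m ^+ 2)) T1 q1E (sqr_sqrt1 m) E1 E2 F1 F2 => T T1 q1E TT E1 E2 F1 F2.
  have T0 : 0 < T by apply: lt_le_trans T1.
  have X2E : X 0 2 = m * X 0 1 by move: E2; rewrite X'2 mulr0; clear; lra.
  have X'1E : X' 0 1 = T * X 0 1.
    by apply: (mulfI (lt0r_neq0 T0)); rewrite E1 X2E [RHS]mulrA -[X in _ = X * _]expr2 TT; ring.
  rewrite X'1E q1E E0; split; first exact: mulr_gt0.
  have pos : 0 < W 0 2 - m * W 0 1 by rewrite -F2 mulr_gt0.
  have : 0 < (W 0 2 - m * W 0 1) * (Q 0 1 * X 0 0 - Q 0 0 * X 0 1).
    by move: DW; rewrite X2E Q2E; clear; lra.
  rewrite pmulr_rgt0// => h1; have := mulr_gt0 T0 h1; clear; lra.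
exists (slope_rot m *m N), (Q 0 0), (hact (slope_rotV m) X), (hact (slope_rotV m) W).
rewrite -(preM _ (proj1 dsr) lN); split=> //.
- exact: lorM (proj1 dsr) lN.
- by rewrite t1 (le_trans (ltW Qc) cmb).
- by split=> //; rewrite (hactM _ (proj1 dsr) lN) XK.
- split=> //.
  + rewrite -(pmulr_rle0 _ (lt_le_trans ltr01 T1)) E2 -(pmulr_rle0 _ Q1).
    by move: DX; rewrite Q2E; clear; lra.
  + by rewrite Lc c1 (le_lt_trans cX Qt).
Unshelve. all: by end_near.
Qed.

End CornerLens.

(** * From the shape along an arc to the shape at a possible corner *)

Section Shapes.
Variable R : realType.
Implicit Types (x y z w q p : hplane R) (a b c m s t k : R) (A B : set (hplane R)) (v : 'rV[R]_3).

#[local] Opaque hact hpt barc mslope slope_rot slope_rotV kap rho.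

Lemma flat_local_shape A x (t : hplane R) z : hconvex A -> A ho -> A t -> A z -> (forall y, A y -> 0 <= y 0 2) ->
  t 0 2 = 0 -> 0 < z 0 2 -> x 0 2 = 0 -> 0 < x 0 1 -> t 0 0 * x 0 1 < t 0 1 * x 0 0 ->
  local_shape A (vec3 0 0 1) 0 x.
Proof.
move=> cA Ao At Az up t2 z2 x2 x1 tx.
have E w : lorentz (vec3 0 0 1) w = - w 0 2 by rewrite /lorentz !vec3E; ring.
split; first by rewrite E x2 oppr0.
have t1 : 0 < t 0 1.
  have x0 := hvec0_gt0 x; rewrite -(pmulr_lgt0 _ x0); apply: lt_trans tx.
  by rewrite mulr_gt0// hvec0_gt0.
have D0 : 0 < det3 ho t z by rewrite /det3 !hoE t2 mul0r subr0 mul1r !mul0r subr0 addr0 mulr_gt0.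
have N1 : \forall w \near x, 0 < det3 t z (w : hplane R).
  apply: near_det3_gt; rewrite /det3 x2 t2.
  have : 0 < z 0 2 * (t 0 1 * x 0 0 - t 0 0 * x 0 1) by rewrite mulr_gt0// subr_gt0.
  by clear; lra.
have N2 : \forall w \near x, 0 < det3 z ho (w : hplane R).
  apply: near_det3_gt; rewrite /det3 !hoE x2.
  by have := mulr_gt0 x1 z2; clear; lra.
near=> w; rewrite E oppr_le0; split; first exact: up.
move=> w2.
have ha : 0 < det3 t z (w : hplane R) by near: w.
have hb : 0 < det3 z ho (w : hplane R) by near: w.
have hc : 0 <= det3 ho t w by rewrite det3_ho t2 mul0r subr0 mulr_ge0// ltW.
apply: (@hconvex_comb3 _ A ho t z w ((det3 ho t z)^-1 * det3 w t z)
  ((det3 ho t z)^-1 * det3 ho w z) ((det3 ho t z)^-1 * det3 ho t w)) => //.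
- by rewrite mulr_ge0 ?invr_ge0 ?(ltW D0)// det3C ltW.
- by rewrite mulr_ge0 ?invr_ge0 ?(ltW D0)// -det3C ltW.
- by rewrite mulr_ge0 ?invr_ge0 ?(ltW D0).
by rewrite -!scalerA -!scalerDr -det3_comb scalerA mulVf ?scale1r// gt_eqF.
Unshelve. all: by end_near.
Qed.

Lemma near_pre M z (P : set (hplane R)) : lor M -> (\forall w \near z, P (hact M w)) <-> \forall w \near hact M z, P w.
Proof. exact: interior_pre. Qed.

Lemma local_shape_pre M A v k z : lor M -> local_shape (pre M A) v k z -> local_shape A (v *m M) k (hact M z).
Proof.
move=> lM [vz nz]; have E w : lorentz (v *m M) (hact M w) = lorentz v w by rewrite hactE// (proj1 lM).
split; first by rewrite E.
apply: (near_pre z (fun w => A w <-> lorentz (v *m M) w <= k) lM).1.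
by apply: filterS nz => w; rewrite E.
Qed.

Lemma local_shape_ext A B v k z : (\forall w \near z, A w <-> B w) -> local_shape B v k z -> local_shape A v k z.
Proof.
move=> nz [vz nB]; split=> //; apply: filterS2 nz nB => w AB Bv.
by split=> [/AB/Bv|/Bv/AB].
Qed.

(* Near [z] the set is a half-plane if [k = 0] and [q = -1]; if [k = 1] it is a disk,
   a horodisk or a domain bounded by a hypercycle according to the sign of [q]. *)
Definition bshape A (q : R) k z := exists2 v, lorentz v v = q & local_shape A v k z.

Lemma bshape_pre M A (q : R) k z : lor M -> bshape (pre M A) q k z <-> bshape A q k (hact M z).
Proof.
move=> lM; split=> -[v vv s].
  by exists (v *m M); [rewrite (proj1 lM)|exact: local_shape_pre].
exists (v *m invmx M); first by rewrite (proj1 (lorV lM)).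
rewrite -[z in local_shape _ _ _ z](hactK lM); apply: local_shape_pre (lorV lM) _.
by rewrite (preM _ (lorV lM) lM) mulVmx ?lor_unit// pre1.
Qed.

Lemma bshape_ext A B (q : R) k z : (\forall w \near z, A w <-> B w) -> bshape B q k z -> bshape A q k z.
Proof. by move=> n [v vv s]; exists v => //; apply: local_shape_ext s. Qed.

Definition flat_arc B := exists c1 zs, good B c1 zs /\ mslope B c1 = 0.

Definition round_arc B := exists c1 zs, good B c1 zs /\ forall s, 1 < s -> s <= c1 -> 0 < mslope B s.

(** The dichotomy for one arc: it starts with a straight piece, or its slope is positive from the
    start and the shape is known at its points other than [ho]. *)
Definition arc_shape B (q : R) k :=
  [/\ q = -1, k = 0 & flat_arc B] \/
  [/\ k = 1, round_arc B & exists2 c1, 1 < c1 & forall u, 1 < u -> u < c1 -> bshape B q 1 (barc B u)].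

Lemma flat_arc_slope B c1 zs c : gset B -> good B c1 zs -> mslope B c1 = 0 -> 1 < c -> c <= c1 ->
  mslope B c = 0.
Proof.
move=> GB gB m0 c_1 cc; apply/eqP; rewrite eq_le (mslope_ge0 GB gB (ltW c_1) cc) andbT -m0.
exact: (mslope_mono GB gB c_1 cc (lexx _)).
Qed.

(** In the flat case nothing of [A] lies below the chord, so [X] is on the chord and [A] is a
    half-plane near it. In the round case [X] cannot be on the chord, since points of [A] below it
    would make [X] interior; so [X] lies in the cap and is the mirror image of a point of the known
    arc. *)
Lemma corner_shape A B (q : R) k : gset A -> gset B -> sym_pair (pre (rho R) A) B ->
  arc_shape B q k -> bshape A q k ho.
Proof.
move=> GA GB H [[-> -> [c1 [zs [gB m0]]]]|[-> [c0 [zs [gB0 pos0]]] [cu cu1 sh]]].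
  have [T [t [X [W [lT /andP[t1 tc] [TX oT qT] [Wi W2] [X2 _ Xflat key]]]]]] := corner_lens GA GB H (good_gt1 gB).
  have mt := flat_arc_slope GB gB m0 t1 tc; rewrite mt in key.
  have up z : pre T A z -> 0 <= z 0 2.
    move=> Az; rewrite leNgt; apply/negP => z2; have := (key z z2).1 Az.
    have [_ _ q2] := hpt0 (ltW t1); have [_ y2] := hact_kap z q2.
    move=> /(germ_up (g_germ GB)); have [_ _] := slope_rotE (erefl (hact (slope_rot 0) (hact (kap (hpt t 0)) z))).
    rewrite mul0r add0r y2 expr0n /= addr0 sqrtr1 mul1r => ->; by rewrite leNgt z2.
  have X2' : X 0 2 = 0 by apply/eqP; rewrite eq_le X2 up// /pre /= TX; exact: germ_o (g_germ GA).
  have [X1 Xt] := Xflat X2'; have [q0 _ q2] := hpt0 (ltW t1).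
  rewrite -TX; apply/(bshape_pre _ _ _ _ lT); exists (vec3 0 0 1); first by rewrite /lorentz !vec3E; ring.
  apply: (flat_local_shape (hconvex_pre lT (g_convex GA)) oT qT (interior_subset Wi)) => //.
  by rewrite q0.
pose c1 := Num.min c0 cu; have c01 := good_gt1 gB0.
have c1_1 : 1 < c1 by rewrite lt_min c01.
have [c10 c1u] : c1 <= c0 /\ c1 <= cu by rewrite !ge_min !lexx orbT.
have gB := good_le_c c1_1 c10 gB0.
have {pos0} pos s : 1 < s -> s <= c1 -> 0 < mslope B s by move=> s1 sc; apply: pos0 => //; apply: le_trans c10.
clearbody c1; have {}sh u : 1 < u -> u < c1 -> bshape B q 1 (barc B u).
  by move=> u1 uc; apply: sh => //; apply: lt_le_trans c1u.
have [T [t [X [W [lT /andP[t1 tc] [TX oT qT] [Wi W2] [X2 /andP[Xt1 Xt] Xflat key]]]]]] := corner_lens GA GB H c1_1.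
have [q0 q1 q2] := hpt0 (ltW t1).
have dB := proj1 (direct_slope_rot (mslope B t)).
have nX : ~ interior (pre T A) X.
  by move/(interior_pre _ _ lT); rewrite TX; exact: gset_not_interior.
have lk := lor_kap q2.
have AX : pre T A X by rewrite /pre /= TX; exact: germ_o (g_germ GA).
have [X2e|X2n] := eqVneq (X 0 2) 0.
  case: nX; have [X1 tX] := Xflat X2e.
  pose s := (1 + t) / 2; have s1 : 1 < s by rewrite /s; clear -t1; lra.
  have st : s < t by rewrite /s; clear -t1; lra.
  have sc : s <= c1 by apply: le_trans (ltW st) tc.
  have mlt := mslope_strict GB gB s1 st tc (pos s s1 sc).
  have [x0 x2] := @arc_slope _ B _ (ltW s1); have x1 := arc_gt0 B s1.
  have Bx := arc_in GB gB (ltW s1) sc.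
  move: (barc B s) x0 x2 x1 Bx => x x0 x2 x1 Bx.
  pose b' := hact (slope_rotV (mslope B t)) x.
  have bx : hact (slope_rot (mslope B t)) b' = x by exact: slope_rotK.
  have [_ _ b2] := slope_rotVE (erefl b'); have TB := sqrt1_ge1 (mslope B t).
  have b2n : b' 0 2 < 0.
    rewrite -(pmulr_rlt0 _ (lt_le_trans ltr01 TB)) b2 x2.
    have -> : mslope B s * x 0 1 - mslope B t * x 0 1 = - ((mslope B t - mslope B s) * x 0 1) by ring.
    by rewrite oppr_lt0 mulr_gt0// subr_gt0.
  have [_ y2] := hact_kap b' q2.
  have Ay : pre T A (hact (kap (hpt t 0)) b').
    by apply/key; rewrite ?y2// kapK// /pre /= bx.
  have q1p : 0 < hpt t 0 0 1 := hpt_gt0 0 t1.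
  move: (hact (kap (hpt t 0)) b') y2 Ay => y y2 Ay.
  rewrite -y2 in b2n; move: (hpt t 0) q0 q1 q2 q1p qT tX {key lk Xt1 Xt} => r q0 q1 q2 q1p qT tX.
  apply: (@axis_interior _ (pre T A) ho r y X W (X 0 0 - X 0 1 / r 0 1 * r 0 0) (X 0 1 / r 0 1)) => //.
  - exact: hconvex_pre (g_convex GA).
  - by rewrite hoE.
  - by rewrite !hoE mul1r mul0r gt_eqF.
  - by rewrite subr_gt0 mulrAC ltr_pdivrMr// q0 mulrC [ltRHS]mulrC.
  - exact: divr_gt0.
  - apply: eq_vec3; rewrite !mxE ?hoE /=; first ring.
      by rewrite mulr0 add0r divfK// gt_eqF.
    by rewrite X2e q2; ring.
have {}X2 : X 0 2 < 0 by rewrite lt_neqAle X2n.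
have [[e0 e1] e2] := hact_kap X q2.
have By := (key X X2).1 AX; rewrite /pre /= in By.
have ny : ~ interior B (hact (slope_rot (mslope B t)) (hact (kap (hpt t 0)) X)).
  move=> i; apply: nX; apply/(lens_point_interior q2 key X2).
  by apply/(interior_pre _ _ dB).
have [f0 f1 f2] := slope_rotE (erefl (hact (slope_rot (mslope B t)) (hact (kap (hpt t 0)) X))).
have TB := sqrt1_ge1 (mslope B t); have T0 := lt_le_trans ltr01 TB.
have mB0 := mslope_ge0 GB gB (ltW t1) tc.
have yE : hact (slope_rot (mslope B t)) (hact (kap (hpt t 0)) X) = barc B (lorentz X (hpt t 0)).
  have y0 : hact (slope_rot (mslope B t)) (hact (kap (hpt t 0)) X) 0 0 = lorentz X (hpt t 0).
    by rewrite f0 e0 [RHS]/lorentz q2 mulr0 subr0.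
  move: (hact (slope_rot (mslope B t)) (hact (kap (hpt t 0)) X)) By ny f0 f1 f2 y0 => y By ny f0 f1 f2 y0.
  rewrite -y0; rewrite -y0 in Xt1 Xt.
  have y2 := germ_up (g_germ GB) By.
  have ys : y 0 2 < mslope B t * y 0 1.
    rewrite -(ltr_pM2l T0) f2.
    have -> : Num.sqrt (1 + mslope B t ^+ 2) * (mslope B t * y 0 1) =
      mslope B t * (Num.sqrt (1 + mslope B t ^+ 2) * y 0 1) by ring.
    rewrite f1 e2; move: (hact (kap (hpt t 0)) X 0 1) (mslope B t) X2 => r m X2; clear -X2.
    have := sqr_ge0 m; nra.
  have y1 : 0 < y 0 1.
    rewrite ltNge; apply/negP => y1; have := mulr_ge0_le0 mB0 y1; clear -ys y2; lra.
  exact: (arc_unique GB gB t1 tc By ny Xt1 Xt y1 ys).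
have S : bshape B q 1 (hact (slope_rot (mslope B t)) (hact (kap (hpt t 0)) X)).
  by rewrite yE; apply: sh => //; apply: lt_le_trans tc.
rewrite -TX; apply/(bshape_pre _ _ _ _ lT).
apply: (@bshape_ext _ (pre (kap (hpt t 0)) (pre (slope_rot (mslope B t)) B))).
  by have := near_coord2_lt X2; apply: filterS => w w2; exact: key.
by apply/(bshape_pre _ _ _ _ lk); apply/(bshape_pre _ _ _ _ dB).
Qed.

End Shapes.

(** * The shape of both bodies at all boundary points *)

Section BoundaryShapes.
Variable R : realType.
Implicit Types (x y z w p : hplane R) (a b c m s t k q : R) (A B K L : set (hplane R)) (v : 'rV[R]_3).

#[local] Opaque hact hpt barc mslope slope_rot slope_rotV kap rho.

(** The plane of the arc misses the origin, since otherwise all slopes would be equal, against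
    [mslope_strict]; so its equation can be normalised to the value 1. *)
Lemma round_arc_plane A B c1 zA zB : gset A -> gset B -> good A c1 zA -> good B c1 zB ->
  (forall c, 1 < c -> c <= c1 -> forall z, z 0 2 < 0 ->
    pre (slope_rot (mslope A c)) A z <-> pre (slope_rot (mslope B c)) B (hact (kap (hpt c 0)) z)) ->
  (forall s, 1 < s -> s <= c1 -> 0 < mslope A s) -> (forall s, 1 < s -> s <= c1 -> 0 < mslope B s) ->
  exists v, forall s, 1 <= s -> s <= c1 -> lorentz v (barc B s) = 1.
Proof.
move=> GA GB gA gB H posA posB; have c1_1 := good_gt1 gA.
have [v v0 vb] : exists2 v : 'rV[R]_3, v != 0 &
    forall u, 1 <= u -> u <= c1 -> lorentz v (barc B u) = lorentz v ho.
  apply: (@arc_planar _ (barc A) (barc B) c1 c1_1 (arc1 A) (arc1 B)).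
  - by move=> s s1 _; exact: (@arc_slope _ A _ s1).1.
  - by move=> s s1 _; exact: (@arc_slope _ B _ s1).1.
  - by move=> s t u s1 st tu uc; exact: (arc_obtuse GA gA s1 st tu uc).
  - by move=> s t u s1 st tu uc; exact: (arc_obtuse GB gB s1 st tu uc).
  - move=> s t s1 st tc; have t1 : 1 < t by apply: lt_trans st.
    have [x0 x2] := @arc_slope _ A _ (ltW s1); have x1 := arc_gt0 A s1.
    have [y0 y2] := @arc_slope _ A _ (ltW t1); have y1 := arc_gt0 A t1.
    have mlt := mslope_strict GA gA s1 st tc (posA s s1 (le_trans (ltW st) tc)).
    move: (barc A s) (barc A t) x2 x1 y2 y1 => x y x2 x1 y2 y1.
    by apply: (det3_slope_gt0' y1 y2); rewrite x2 ltr_pM2r.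
  - move=> c c_1 cc; apply: (arc_move GA GB gA gB H c_1 cc) => s s1 sc.
    by apply: posB => //; apply: le_trans (ltW sc) cc.
have k0 : lorentz v ho != 0.
  apply: contra_neq v0 => k0.
  have slope s : 1 < s -> s <= c1 -> v 0 1 + v 0 2 * mslope B s = 0.
    move=> s1 sc; have := vb s (ltW s1) sc; rewrite k0.
    have [_ x2] := @arc_slope _ B _ (ltW s1); have x1 := arc_gt0 B s1.
    move: (barc B s) x2 x1 => x x2 x1; move: k0; rewrite lorentz_ho_r /lorentz x2 => -> h.
    by apply: (mulfI (lt0r_neq0 x1)); rewrite mulr0; move: h; clear; lra.
  pose s := (1 + c1) / 2; have s1 : 1 < s by rewrite /s; clear -c1_1; lra.
  have sc : s < c1 by rewrite /s; clear -c1_1; lra.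
  have mlt := mslope_strict GB gB s1 sc (lexx _) (posB s s1 (ltW sc)).
  have h1 := slope s s1 (ltW sc); have h2 := slope c1 c1_1 (lexx _).
  have v2 : v 0 2 = 0.
    have : v 0 2 * (mslope B c1 - mslope B s) = 0 by move: h1 h2; clear; lra.
    by move/eqP; rewrite mulf_eq0 subr_eq0 (gt_eqF mlt) orbF => /eqP.
  have v1 : v 0 1 = 0 by move: h1; rewrite v2 mul0r addr0.
  by apply: eq_vec3; rewrite mxE//; move: k0; rewrite lorentz_ho_r.
exists ((lorentz v ho)^-1 *: v) => s s1 sc.
by rewrite lorentzZl vb// mulVf.
Qed.

(** [nonflat_transfer], applied in both directions, shows that the two arcs are flat or round
    together. *)
Lemma arc_shapes A B : gset A -> gset B -> sym_pair A B -> exists q k, arc_shape B q k /\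
  ([/\ q = -1, k = 0 & flat_arc A] \/ (k = 1 /\ round_arc A)).
Proof.
move=> GA GB H; have [c1 [zA [zB [gA gB lensAB]]]] := arc_lens GA GB H.
have lensBA c : 1 < c -> c <= c1 -> forall z, z 0 2 < 0 ->
    pre (slope_rot (mslope B c)) B z <-> pre (slope_rot (mslope A c)) A (hact (kap (hpt c 0)) z).
  move=> c_1 cc z z2; have [_ _ q2] := hpt0 (ltW c_1); have [_ y2] := hact_kap z q2.
  have := lensAB c c_1 cc (hact (kap (hpt c 0)) z); rewrite y2 kapK// => /(_ z2) h.
  by split=> /h.
have [[c0 [c0_1 c01 m0]]|nf] := pselect (exists c0, [/\ 1 < c0, c0 <= c1 & mslope B c0 = 0]).
  have fB : flat_arc B by exists c0, zB; split=> //; exact: good_le_c gB.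
  have [[d [d1 dc md]]|nfA] := pselect (exists c0, [/\ 1 < c0, c0 <= c1 & mslope A c0 = 0]).
    exists (-1), 0; split; left; split=> //.
    by exists d, zA; split=> //; exact: good_le_c gA.
  have posA s : 1 < s -> s <= c1 -> 0 < mslope A s.
    move=> s1 sc; rewrite lt_neqAle (mslope_ge0 GA gA (ltW s1) sc) andbT; apply/eqP => e.
    by apply: nfA; exists s.
  by have := nonflat_transfer GB GA gB gA lensBA posA c0_1 c01; rewrite m0 ltxx.
have posB s : 1 < s -> s <= c1 -> 0 < mslope B s.
  move=> s1 sc; rewrite lt_neqAle (mslope_ge0 GB gB (ltW s1) sc) andbT; apply/eqP => e.
  by apply: nf; exists s.
have posA s : 1 < s -> s <= c1 -> 0 < mslope A s.
  exact: (nonflat_transfer GA GB gA gB lensAB posB).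
have [v vb] := round_arc_plane GA GB gA gB lensAB posA posB.
exists (lorentz v v), 1; split; right; split=> //.
- by exists c1, zB.
- exists c1; first exact: good_gt1 gB.
  move=> u u1 uc; exists v => //; exact: (round_local_shape GB gB posB vb u1 uc).
- by exists c1, zA.
Qed.

(** The frame at [x] is taken for the mirrored body. The two reflections and [N] compose to a direct
    motion, under which [sym_pair] is invariant. *)
Lemma corner_boundary K B q k x : closed K -> hconvex K -> interior K !=set0 -> gset B -> sym_pair K B ->
  arc_shape B q k -> K x -> ~ interior K x -> bshape K q k x.
Proof.
move=> clK cK [i Ki] GB H aB Kx nx; have lr := lor_rho R.
have [|||||N [dN No gN]] := @germ_exists _ (pre (rho R) K) (hact (rho R) i) (hact (rho R) x).
- exact: closed_pre.
- exact: hconvex_pre.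
- by apply/(interior_pre _ _ lr); rewrite hact_rhoK.
- by rewrite /pre /= hact_rhoK.
- by move/(interior_pre _ _ lr); rewrite hact_rhoK.
have [lN detN] := dN.
have GA : gset (pre N (pre (rho R) K)).
  by split=> //; [apply: closed_pre => //; exact: closed_pre|apply: hconvex_pre => //; exact: hconvex_pre].
have H' : sym_pair (pre (rho R) (pre N (pre (rho R) K))) B.
  have -> : pre (rho R) (pre N (pre (rho R) K)) = pre (rho R *m N *m rho R) K.
    by rewrite (preM _ lN lr) (preM _ lr (lorM lN lr)) mulmxA.
  apply: sym_pair_pre => //; split; first by do 2 apply: lorM => //.
  by rewrite !det_mulmx det_rho detN; ring.
have := corner_shape GA GB H' aB.
by move=> /(bshape_pre _ _ _ _ lN); rewrite No => /(bshape_pre _ _ _ _ lr); rewrite hact_rhoK.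
Qed.

Lemma sym_pair_pre_r A B N : direct N -> sym_pair A B -> sym_pair A (pre N B).
Proof. by move=> dN H; apply: sym_pairC; apply: sym_pair_pre dN _; exact: sym_pairC. Qed.

Lemma boundary_point K : closed K -> interior K !=set0 -> K <> setT ->
  exists2 x, K x & ~ interior K x.
Proof.
move=> clK [i Ki] KT.
have [y nKy] : exists y, ~ K y.
  by apply: contrapT => h; apply: KT; apply/seteqP; split=> // y _; apply: contrapT => nKy; apply: h; exists y.
have [w [a [b [_ _ _ Kw nw]]]] := segment_boundary clK (interior_subset Ki) nKy.
by exists w.
Qed.

Lemma gset_pre K x : closed K -> hconvex K -> interior K !=set0 -> K x -> ~ interior K x ->
  exists N, [/\ direct N, hact N ho = x & gset (pre N K)].
Proof.
move=> clK cK [i Ki] Kx nx; have [N [dN No gN]] := germ_exists clK cK Ki Kx nx.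
by exists N; split=> //; split=> //; [exact: closed_pre (proj1 dN) clK|exact: hconvex_pre (proj1 dN) cK].
Qed.

(** One arc of [L] determines the shape of [K] everywhere, and an arc of [K] then determines that of
    [L]. *)
Lemma boundary_shapes K L : closed K -> hconvex K -> interior K !=set0 -> K <> setT ->
  closed L -> hconvex L -> interior L !=set0 -> L <> setT -> sym_pair K L ->
  exists q k, [/\ (q = -1 /\ k = 0) \/ k = 1,
    forall x, K x -> ~ interior K x -> bshape K q k x &
    forall x, L x -> ~ interior L x -> bshape L q k x].
Proof.
move=> clK cK iK KT clL cL iL LT H.
have [x Kx nx] := boundary_point clK iK KT; have [y Ly ny] := boundary_point clL iL LT.
have [M [dM Mx GA]] := gset_pre clK cK iK Kx nx; have [N [dN Ny GB]] := gset_pre clL cL iL Ly ny.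
have [q [k [aB fA]]] := arc_shapes GA GB (sym_pair_pre dM (sym_pair_pre_r dN H)).
have sK z : K z -> ~ interior K z -> bshape K q k z.
  exact: corner_boundary clK cK iK GB (sym_pair_pre_r dN H) aB.
exists q, k; split=> //; first by case: fA => [[]|[]]; [left|right].
have aA : arc_shape (pre M K) q k.
  case: fA => [[? ? ?]|[k1 [c1 [zs [gA pos]]]]]; [by left|right; split=> //; first by exists c1, zs].
  exists c1; first exact: good_gt1 gA.
  move=> u u1 uc; rewrite -k1; apply/(bshape_pre _ _ _ _ (proj1 dM)); apply: sK.
    exact: (arc_in GA gA (ltW u1) (ltW uc)).
  by move=> i; apply: (arc_not_interior GA gA (ltW u1) (ltW uc)); apply/(interior_pre _ _ (proj1 dM)).
move=> z; exact: corner_boundary clL cL iL GA (sym_pair_pre_r dM (sym_pairC H)) aA.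
Qed.

End BoundaryShapes.

(** * Uniqueness and sides of a local plane section *)

Section Levels.
Variable R : realType.
Implicit Types (x y z w p : hplane R) (a b c m s t k r q : R) (A B K L E : set (hplane R)) (u v : 'rV[R]_3).

#[local] Opaque hact hpt barc mslope slope_rot slope_rotV kap rho.

(** The form is negative definite on the orthogonal complement of a point, by the Cauchy-Schwarz
    inequality for the last two coordinates. *)
Lemma orth_neg z u : lorentz z u = 0 -> u != 0 -> lorentz u u < 0.
Proof.
move=> zu u0; have z0 := hvec0_gt0 z; have zs := hsqr z.
have h0 : u 0 0 * z 0 0 = u 0 1 * z 0 1 + u 0 2 * z 0 2 by move: zu; rewrite /lorentz; lra.
have cs : (u 0 0 * z 0 0) ^+ 2 <= (u 0 1 ^+ 2 + u 0 2 ^+ 2) * (z 0 0 ^+ 2 - 1).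
  by rewrite h0 zs; have := sqr_ge0 (u 0 1 * z 0 2 - u 0 2 * z 0 1); clear; lra.
have pos : 0 < u 0 1 ^+ 2 + u 0 2 ^+ 2.
  rewrite lt_neqAle addr_ge0 ?sqr_ge0// andbT; apply: contra_neq u0 => /esym/eqP.
  rewrite paddr_eq0 ?sqr_ge0// !sqrf_eq0 => /andP[/eqP u1 /eqP u2].
  apply: eq_vec3; rewrite mxE//; apply: (mulIf (lt0r_neq0 z0)).
  by rewrite h0 u1 u2; ring.
rewrite -(pmulr_rlt0 _ (exprn_gt0 2 z0)); move: cs; rewrite /lorentz exprMn; move: pos; clear; lra.
Qed.

Lemma orth_le0 z u : lorentz z u = 0 -> lorentz u u <= 0.
Proof.
move=> zu; have [->|u0] := eqVneq u 0; last by apply: ltW; exact: orth_neg zu u0.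
by rewrite /lorentz !mxE !mulr0 !subr0.
Qed.

Lemma push_exists z u r : lorentz z u = 0 ->
  exists w, hvec w = Num.sqrt (1 - r ^+ 2 * lorentz u u) *: hvec z + r *: u.
Proof.
move=> zu; have p := orth_le0 zu; have h : 0 < 1 - r ^+ 2 * lorentz u u.
  by have := mulr_ge0_le0 (sqr_ge0 r) p; lra.
set s := Num.sqrt _; have s2 : s ^+ 2 = 1 - r ^+ 2 * lorentz u u by rewrite sqr_sqrtr// ltW.
have s0 : 0 < s by rewrite sqrtr_gt0.
have n1 : lorentz (s *: hvec z + r *: u) (s *: hvec z + r *: u) = 1.
  rewrite !lorentzE hvec_norm (lorentzC u z) zu; move: s2; move: (lorentz u u) => l; clear; lra.
have P : (lorentz (s *: hvec z + r *: u) (s *: hvec z + r *: u) == 1) && (0 < (s *: hvec z + r *: u) 0 0).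
  rewrite n1 eqxx /=; apply: (@hplane_of _ _ z n1).
  by rewrite !lorentzE hvec_norm (lorentzC u z) zu mulr0 addr0 mulr1.
by exists (HPlane P).
Qed.

Lemma sqrt1_le a : 0 <= a -> Num.sqrt (1 + a) <= 1 + a / 2.
Proof.
move=> a0; have h : 0 <= 1 + a by lra.
have s2 := sqr_sqrtr h; have s0 := sqrtr_ge0 (1 + a).
rewrite leNgt; apply/negP => l; have := mulr_gt0 (_ : 0 < Num.sqrt (1 + a) - (1 + a / 2)) (_ : 0 < Num.sqrt (1 + a) + (1 + a / 2)).
rewrite subr_gt0 l => /(_ isT); have p : 0 < Num.sqrt (1 + a) + (1 + a / 2) by lra.
move=> /(_ p); move: s2; move: (Num.sqrt (1 + a)) => s; have := sqr_ge0 a; clear; lra.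
Qed.

(** The factor of [hvec z] exceeds 1 only to second order in [r]; with [r <= 1] the excess is
    bounded linearly in [r], in a form that can be compared with first-order terms. *)
Lemma near_push z u (P : set (hplane R)) : nbhs z P -> lorentz z u = 0 ->
  exists r w, [/\ 0 < r, r <= 1, P w, 1 <= Num.sqrt (1 - r ^+ 2 * lorentz u u) /\
    Num.sqrt (1 - r ^+ 2 * lorentz u u) - 1 <= r * (- lorentz u u / 2) &
    hvec w = Num.sqrt (1 - r ^+ 2 * lorentz u u) *: hvec z + r *: u].
Proof.
move=> /nbhs_hplane[d d0 nP] zu; have p := orth_le0 zu.
pose A := - lorentz u u; have A0 : 0 <= A by rewrite oppr_ge0.
pose r := Num.min 1 (d / (A + 1)).
have r0 : 0 < r by rewrite lt_min ltr01 divr_gt0//; lra.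
have r1 : r <= 1 by rewrite ge_min lexx.
have rd : r * (A + 1) <= d by rewrite -ler_pdivlMr ?ge_min ?lexx ?orbT//; lra.
have rr : r ^+ 2 <= r by rewrite expr2 ler_piMr// ltW.
have [w wE] := push_exists r zu; exists r, w.
have AE : 1 - r ^+ 2 * lorentz u u = 1 + r ^+ 2 * A by rewrite /A; ring.
rewrite AE in wE *.
have rA := mulr_ge0 (sqr_ge0 r) A0; have s := sqrt1_le rA.
have rA' := ler_wpM2r A0 rr.
have s1 : 1 <= Num.sqrt (1 + r ^+ 2 * A) by rewrite -[X in X <= _]sqrtr1 ler_wsqrtr// lerDl.
split=> //; last by split=> //; rewrite -/A; lra.
apply: nP; rewrite wE !lorentzE hvec_norm zu; lra.
Qed.

(** Since [v] and [v'] have the same square, their products with [u = v - v'] are opposite and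
    nonzero. Pushing [z] along [u] stays on the inner side for [v] and leaves the one for [v'];
    [k <= 1] keeps the second-order term below the first-order gain. *)
Lemma local_shape_unique K v v' k z : 0 <= k -> k <= 1 -> lorentz v v = lorentz v' v' ->
  local_shape K v k z -> local_shape K v' k z -> v = v'.
Proof.
move=> k0 k1 vv [vz nv] [v'z nv']; apply/eqP; rewrite -subr_eq0; apply/negPn/negP => u0.
set u := v - v' in u0.
have zu : lorentz z u = 0 by rewrite /u lorentzDr lorentzNr !(lorentzC z) vz v'z subrr.
have n := orth_neg zu u0.
have [r [w [r0 r1 [h1 h2] [s1 s2] wE]]] := near_push (filterI nv nv') zu.
have vu : lorentz v u = lorentz u u / 2 by rewrite /u !lorentzE -vv (lorentzC v' v); field.
have v'u : lorentz v' u = - lorentz u u / 2 by rewrite /u !lorentzE vv (lorentzC v' v); field.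
move: s1 s2 wE; move: (Num.sqrt _) => s s1 s2 wE.
have := h2.1 (h1.2 _); rewrite wE (lorentzDr v) (lorentzDr v') !lorentzZr vz v'z vu v'u.
move: (lorentz u u) n s2 => l n s2.
have rl : 0 < r * - l by rewrite mulr_gt0// oppr_gt0.
have s0 : 0 <= s - 1 by rewrite subr_ge0.
have ks : k * (s - 1) <= 1 * (s - 1) := ler_wpM2r s0 k1.
have ks0 := mulr_ge0 k0 s0.
have h : s * k + r * (l / 2) <= k by lra.
by move=> /(_ h); lra.
Qed.

Lemma local_shape_not_interior K v k z : 0 <= k -> lorentz v v < k ^+ 2 -> local_shape K v k z -> ~ interior K z.
Proof.
move=> k0 vk [vz nv] nK; pose u := k *: hvec z - v.
have zu : lorentz z u = 0 by rewrite /u lorentzDr lorentzNr lorentzZr hvec_norm (lorentzC z) vz; ring.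
have [r [w [r0 r1 [h1 h2] [s1 s2] wE]]] := near_push (filterI nv nK) zu.
have vu : lorentz v u = k ^+ 2 - lorentz v v by rewrite /u !lorentzE vz; ring.
move: s1 s2 wE; move: (Num.sqrt _) => s s1 s2 wE.
have := h1.1 h2; rewrite wE (lorentzDr v) !lorentzZr vz vu.
have p : 0 < r * (k ^+ 2 - lorentz v v) by rewrite mulr_gt0// subr_gt0.
have := ler_wpM2r k0 s1; lra.
Qed.

Lemma local_shape_interior K v k z : 0 <= k -> k <= 1 -> lorentz v v < k ^+ 2 -> local_shape K v k z ->
  exists2 w, interior K w & lorentz v w < k.
Proof.
move=> k0 k1 vk [vz nv]; pose u := v - k *: hvec z.
have zu : lorentz z u = 0 by rewrite /u lorentzDr lorentzNr lorentzZr hvec_norm (lorentzC z) vz; ring.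
have uu : lorentz u u = lorentz v v - k ^+ 2 by rewrite /u !lorentzE hvec_norm (lorentzC z) vz; ring.
have {}nv := nbhs_interior nv.
have [r [w [r0 r1 nw [s1 s2] wE]]] := near_push nv zu.
have vu : lorentz v u = lorentz u u by rewrite uu /u !lorentzE vz; ring.
have vw : lorentz v w < k.
  move: s1 s2 wE; move: (Num.sqrt _) => s s1 s2 wE.
  rewrite wE (lorentzDr v) !lorentzZr vz vu.
  have p : 0 < r * - lorentz u u by rewrite mulr_gt0// uu; lra.
  move: (lorentz u u) s2 p => l s2 p; have s0 : 0 <= s - 1 by rewrite subr_ge0.
  have ks := ler_wpM2r s0 k1; clear -s1 s2 p ks; lra.
exists w => //; rewrite /interior /=.
by apply: filterS2 nw (near_lorentz_lt vw) => y Ky vy; apply/Ky; exact: ltW.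
Qed.

Lemma orth_e1 z : lorentz z (cross z (vec3 0 1 0)) = 0 /\ lorentz (cross z (vec3 0 1 0)) (cross z (vec3 0 1 0)) < 0.
Proof.
have zu : lorentz z (cross z (vec3 0 1 0)) = 0 by rewrite lorentzC lorentz_cross /det3; ring.
split=> //; apply: (orth_neg zu); apply/eqP => e.
have := congr1 (fun u : 'rV_3 => u 0 2) e; rewrite /cross !vec3E mxE => h.
by have := hvec0_gt0 z; lra.
Qed.

Lemma unit_disk z w u r s : hvec w = s *: hvec z + r *: u -> lorentz z u = 0 -> lorentz u u < 0 ->
  0 < r -> ~ lorentz z w <= 1.
Proof.
move=> wE zu uu r0 h; have e : lorentz z w = 1 by apply/eqP; rewrite eq_le h lorentz_ge1.
have s1 : s = 1 by move: e; rewrite wE lorentzDr !lorentzZr hvec_norm zu mulr0 addr0 mulr1.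
have := hvec_norm w; rewrite wE !lorentzE (lorentzC u z) zu hvec_norm s1.
have := mulr_gt0 (exprn_gt0 2 r0) (_ : 0 < - lorentz u u); rewrite oppr_gt0 => /(_ uu).
move: (lorentz u u) => l; clear; lra.
Qed.

(** [v - z] is orthogonal to [z], so [lorentz v v <= 1] with equality only if [v = z]. In that case
    [K] would reduce to [z] near [z], impossible for a convex set with interior points. *)
Lemma local_shape_lt1 K v z : hconvex K -> interior K !=set0 -> local_shape K v 1 z -> lorentz v v < 1.
Proof.
move=> cK [i Ki] [vz nv]; pose n := v - hvec z.
have zn : lorentz z n = 0 by rewrite /n lorentzDr lorentzNr hvec_norm (lorentzC z) vz subrr.
have nn : lorentz n n = lorentz v v - 1 by rewrite /n !lorentzE hvec_norm (lorentzC z) vz; ring.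
have [n0|n0] := eqVneq n 0; last by have := orth_neg zn n0; rewrite nn; lra.
have ve : v = z by move/eqP: n0; rewrite subr_eq0 => /eqP.
have nv0 : K z by apply: (nbhs_singleton nv).2; rewrite vz.
have [e|ne] := eqVneq i z.
  have [zu uu] := orth_e1 z; rewrite e in Ki.
  have [r [w [r0 r1 [h1 h2] [s1 s2] wE]]] := near_push (filterI nv Ki) zu.
  have := h1.1 h2; rewrite ve => h; by case: (unit_disk wE zu uu r0 h).
pose l := lorentz z i; pose u := l^-1 *: hvec i - hvec z.
have l1 : 1 < l by apply: lorentz_gt1 => e; move: ne; rewrite e eqxx.
have l0 : l != 0 by rewrite gt_eqF//; lra.
have zu : lorentz z u = 0 by rewrite /u lorentzDr lorentzNr lorentzZr hvec_norm -/l mulVf// subrr.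
have uu : lorentz u u < 0.
  have -> : lorentz u u = l^-1 ^+ 2 - 2 * (l^-1 * l) + 1.
    by rewrite /u !lorentzE !hvec_norm (lorentzC i z) -/l; ring.
  have := invf_lt1 (_ : 0 < l); rewrite mulVf//; have p : 0 < l by lra.
  have p' : 0 < l^-1 by rewrite invr_gt0.
  move=> /(_ p); rewrite l1 => h; move: (l^-1) p' h => m p' h; clear -p' h; nra.
have [r [w [r0 r1 nw [s1 s2] wE]]] := near_push nv zu.
have Kw : K w.
  apply: (@hconvex_comb _ K z i w (Num.sqrt (1 - r ^+ 2 * lorentz u u) - r) (r * l^-1) cK) => //.
  - exact: interior_subset.
  - by rewrite subr_ge0 (le_trans r1).
  - by rewrite mulr_ge0 ?invr_ge0 ?(ltW r0)//; lra.
  - by rewrite wE /u scalerBr scalerA scalerBl addrA addrAC.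
have := nw.1 Kw; rewrite ve => h; by case: (unit_disk wE zu uu r0 h).
Qed.

End Levels.

(** * Connectedness of the plane sections *)

Section ConnectedLevels.
Variable R : realType.
Implicit Types (x y z w p : hplane R) (a b c m s t k r q kp : R) (A B K L E : set (hplane R)) (u v : 'rV[R]_3).

#[local] Opaque hact hpt barc mslope slope_rot slope_rotV kap rho.

Lemma hplane_curve (f0 f1 f2 : R -> R) : continuous f0 -> continuous f1 -> continuous f2 ->
  (forall t, f0 t ^+ 2 - f1 t ^+ 2 - f2 t ^+ 2 = 1) -> (forall t, 0 < f0 t) ->
  exists g : R -> hplane R, continuous g /\ forall t, hvec (g t) = vec3 (f0 t) (f1 t) (f2 t).
Proof.
move=> c0 c1 c2 n p.
have P t : (lorentz (vec3 (f0 t) (f1 t) (f2 t)) (vec3 (f0 t) (f1 t) (f2 t)) == 1) && (0 < vec3 (f0 t) (f1 t) (f2 t) 0 0).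
  by rewrite /lorentz !vec3E -!expr2 n eqxx p.
exists (fun t => HPlane (P t)); split=> // t; apply: cvg_hplane => i.
have : [|| i == 0, i == 1 | i == 2] by case: i => [[|[|[|]]]].
move=> /or3P[] /eqP -> /=.
- by under eq_fun do rewrite vec3E; rewrite vec3E; exact: c0.
- by under eq_fun do rewrite vec3E; rewrite vec3E; exact: c1.
- by under eq_fun do rewrite vec3E; rewrite vec3E; exact: c2.
Qed.

Lemma connected_range (g : R -> hplane R) : continuous g -> connected (range g).
Proof.
move=> cg; apply: connected_continuous_connected; last exact: continuous_subspaceT.
by apply/connected_intervalP.
Qed.

Lemma angle_exists c s : c ^+ 2 + s ^+ 2 = 1 -> exists t, cos t = c /\ sin t = s.
Proof.
move=> cs; have c1 : -1 <= c <= 1.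
  have h : c ^+ 2 <= 1 by have := sqr_ge0 s; lra.
  by apply/andP; split; rewrite leNgt; apply/negP => l; clear -h l; nra.
have s2 : Num.sqrt (1 - c ^+ 2) = `|s| by rewrite -cs addrAC subrr add0r sqrtr_sqr.
have [s0|s0] := leP 0 s.
  by exists (acos c); rewrite acosK// sin_acos// s2 ger0_norm.
by exists (- acos c); rewrite cosN sinN acosK// sin_acos// s2 ltr0_norm// opprK.
Qed.

(** Each section is the range of a continuous curve: for [k = 1] a horocycle or hypercycle, as a
    graph over coordinate 1, if [kp >= 1], and a circle, parametrised by an angle, if [kp < 1]; for
    [k = 0] a line. *)
Lemma connected_level_frame k kp : (k = 1 \/ k = 0) -> 0 < kp ->
  connected [set z : hplane R | lorentz (vec3 k 0 kp) z = k].
Proof.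
move=> k01 kp0.
have E z : lorentz (vec3 k 0 kp) z = k * z 0 0 - kp * z 0 2.
  by rewrite /lorentz !vec3E; ring.
suff [g cg gE] : exists2 g : R -> hplane R, continuous g & [set z : hplane R | lorentz (vec3 k 0 kp) z = k] = range g.
  by rewrite gE; exact: connected_range.
case: k01 E => -> E.
  have [k1|k1] := leP 1 kp.
    pose S (t : R) := Num.sqrt (kp ^+ 2 + (kp ^+ 2 - 1) * t ^+ 2).
    have kk : 0 <= kp ^+ 2 - 1 by rewrite subr_ge0 exprn_ege1.
    have S2 t : S t ^+ 2 = kp ^+ 2 + (kp ^+ 2 - 1) * t ^+ 2.
      by rewrite sqr_sqrtr// addr_ge0 ?sqr_ge0// mulr_ge0 ?sqr_ge0.
    have S0 t : 0 <= S t by exact: sqrtr_ge0.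
    have kS t : 0 < kp + S t by have := S0 t; lra.
    (* The rationalised root of [(kp ^+ 2 - 1) * f ^+ 2 + 2 * kp * f = t ^+ 2], which remains valid
       for [kp = 1]. *)
    pose f t := t ^+ 2 / (kp + S t).
    have fE t : (kp ^+ 2 - 1) * f t ^+ 2 + 2 * kp * f t = t ^+ 2.
      have e : f t * (kp + S t) = t ^+ 2 by rewrite /f divfK// gt_eqF.
      have h := S2 t; have p := kS t.
      apply: (mulIf (lt0r_neq0 (exprn_gt0 2 p))).
      have -> : ((kp ^+ 2 - 1) * f t ^+ 2 + 2 * kp * f t) * (kp + S t) ^+ 2 =
        (kp ^+ 2 - 1) * (f t * (kp + S t)) ^+ 2 + 2 * kp * (f t * (kp + S t)) * (kp + S t) by ring.
      rewrite e; have -> : (kp + S t) ^+ 2 = kp ^+ 2 + 2 * kp * S t + S t ^+ 2 by ring.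
      by rewrite h; ring.
    have f0 t : 0 <= f t by rewrite /f divr_ge0 ?sqr_ge0// ltW.
    have cS : continuous S.
      move=> t; apply: (@cvg_comp _ _ _ (fun t => kp ^+ 2 + (kp ^+ 2 - 1) * t ^+ 2) Num.sqrt); last exact: sqrt_continuous.
      by apply: (@cvg_quadratic _ _ (kp ^+ 2 - 1) 0 (kp ^+ 2)) => s; ring.
    have cf : continuous f.
      move=> t; apply: cvgM.
        by apply: (@cvg_quadratic _ _ 1 0 0) => s; ring.
      apply: cvgV; first by rewrite gt_eqF.
      by apply: cvgD; [exact: cvg_cst|exact: cS].
    have [||||g [cg gE]] := @hplane_curve (fun t => 1 + kp * f t) id f _ _ cf.
    - by move=> t; apply: cvgD; [exact: cvg_cst|apply: cvgM; [exact: cvg_cst|exact: cf]].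
    - by move=> t; exact: cvg_id.
    - by move=> t; have := fE t; lra.
    - by move=> t; have := mulr_ge0 (ltW kp0) (f0 t); lra.
    exists g => //; apply/seteqP; split=> z /=; last first.
      by move=> [t _ <-]; rewrite E gE !vec3E; ring.
    rewrite E mul1r => z0; exists (z 0 1) => //; have zs := hsqr z; have zp := hvec0_gt0 z.
    have {}z0 : z 0 0 = 1 + kp * z 0 2 by lra.
    have zz : (kp ^+ 2 - 1) * z 0 2 ^+ 2 + 2 * kp * z 0 2 = z 0 1 ^+ 2.
      by move: zs; rewrite z0; lra.
    have z2 : 0 <= z 0 2.
      rewrite leNgt; apply/negP => z2.
      have : 0 <= z 0 2 * ((kp ^+ 2 - 1) * z 0 2 + 2 * kp).
        by have := sqr_ge0 (z 0 1); rewrite -zz; lra.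
      rewrite nmulr_rge0// => h; have := mulr_gt0 kp0 zp; rewrite z0; lra.
    have fz : f (z 0 1) = z 0 2.
      have := fE (z 0 1); rewrite -zz; have := f0 (z 0 1); move: (f (z 0 1)) (z 0 2) z2 => a b b0 a0 e.
      have : (a - b) * ((kp ^+ 2 - 1) * (a + b) + 2 * kp) = 0 by lra.
      move/eqP; rewrite mulf_eq0 => /orP[|]; first by rewrite subr_eq0 => /eqP.
      by have := mulr_ge0 kk (addr_ge0 a0 b0); move=> ? /eqP; lra.
    by apply: val_inj; rewrite /= gE; apply: eq_vec3; rewrite vec3E// fz.
  pose u := 1 - kp ^+ 2; have u0 : 0 < u.
    by rewrite subr_gt0 expr_lt1// ltW.
  pose m := kp / u; have m0 : 0 < m by rewrite divr_gt0.
  have mu : m * u = kp by rewrite /m divfK// gt_eqF.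
  pose S := Num.sqrt u; have S2 : S ^+ 2 = u by rewrite sqr_sqrtr// ltW.
  have S0 : 0 < S by rewrite sqrtr_gt0.
  have [||||| g [cg gE]] := @hplane_curve (fun t => 1 + kp * (m * (1 - cos t))) (fun t => S * m * sin t) (fun t => m * (1 - cos t)).
  - move=> t; apply: cvgD; [exact: cvg_cst|apply: cvgM; [exact: cvg_cst|]].
    by apply: cvgM; [exact: cvg_cst|apply: cvgB; [exact: cvg_cst|exact: continuous_cos]].
  - by move=> t; apply: cvgM; [exact: cvg_cst|exact: continuous_sin].
  - by move=> t; apply: cvgM; [exact: cvg_cst|apply: cvgB; [exact: cvg_cst|exact: continuous_cos]].
  - move=> t; have := cos2Dsin2 t; move: (cos t) (sin t) => c s cs.
    have -> : (S * m * s) ^+ 2 = S ^+ 2 * m ^+ 2 * s ^+ 2 by ring.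
    rewrite S2 (_ : s ^+ 2 = 1 - c ^+ 2); last lra.
    transitivity (1 + 2 * (kp - m * u) * m * (1 - c) + m ^+ 2 * (1 - c) ^+ 2 * (kp ^+ 2 - 1 + u)); first ring.
    by rewrite mu /u; ring.
  - move=> t; have c1 : 0 <= 1 - cos t by rewrite subr_ge0 cos_le1.
    by have := mulr_ge0 (ltW kp0) (mulr_ge0 (ltW m0) c1); lra.
  exists g => //; apply/seteqP; split=> z /=; last first.
    by move=> [t _ <-]; rewrite E gE !vec3E; ring.
  rewrite E mul1r => z0; have zs := hsqr z.
  have {}z0 : z 0 0 = 1 + kp * z 0 2 by lra.
  have [|t [ct st]] := @angle_exists (1 - z 0 2 / m) (z 0 1 / (S * m)).
    have z1 : z 0 1 ^+ 2 = u * (2 * m * z 0 2 - z 0 2 ^+ 2).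
      have -> : u * (2 * m * z 0 2 - z 0 2 ^+ 2) = 2 * (m * u) * z 0 2 - u * z 0 2 ^+ 2 by ring.
      by rewrite mu /u; move: zs; rewrite z0; lra.
    rewrite expr_div_n exprMn S2 z1; field.
    by rewrite !gt_eqF.
  exists t => //; apply: val_inj; rewrite /= gE; apply: eq_vec3; rewrite vec3E// ?ct ?st ?z0.
  - by field; rewrite gt_eqF.
  - by field; rewrite !gt_eqF.
  - by field; rewrite gt_eqF.
have [|||||g [cg gE]] := @hplane_curve (fun t => Num.sqrt (1 + t ^+ 2)) id (fun=> 0).
- move=> t; apply: (@cvg_comp _ _ _ (fun t => 1 + t ^+ 2) Num.sqrt); last exact: sqrt_continuous.
  by apply: (@cvg_quadratic _ _ 1 0 1) => s; ring.
- by move=> t; exact: cvg_id.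
- by move=> t; exact: cvg_cst.
- by move=> t; rewrite sqr_sqrt1; ring.
- by move=> t; have := sqrt1_ge1 t; lra.
exists g => //; apply/seteqP; split=> z /=; last first.
  by move=> [t _ <-]; rewrite E gE !vec3E; ring.
rewrite E mul0r sub0r => /eqP; rewrite oppr_eq0 mulf_eq0 (gt_eqF kp0) /= => /eqP z2.
exists (z 0 1) => //; apply: val_inj; rewrite /= gE; apply: eq_vec3; rewrite vec3E//.
have h := hsqr z; rewrite z2 expr0n /= addr0 in h; rewrite -h sqrtr_sqr ger0_norm//.
exact/ltW/hvec0_gt0.
Qed.

End ConnectedLevels.

(** * From local to global shape *)

Section GlobalShape.
Variable R : realType.
Implicit Types (x y z w p : hplane R) (a b c m s t k r q kp : R) (A B K L E : set (hplane R)) (u v : 'rV[R]_3).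

#[local] Opaque hact hpt barc mslope slope_rot slope_rotV kap rho.

Lemma level_frame x v k : lorentz v x = k -> lorentz v v < k ^+ 2 -> exists M kp,
  [/\ direct M, hact M ho = x, v = vec3 k 0 kp *m M, 0 < kp & kp ^+ 2 = k ^+ 2 - lorentz v v].
Proof.
move=> vx vk; pose kp := Num.sqrt (k ^+ 2 - lorentz v v).
have k2 : kp ^+ 2 = k ^+ 2 - lorentz v v by rewrite sqr_sqrtr// subr_ge0 ltW.
have k0 : 0 < kp by rewrite sqrtr_gt0 subr_gt0.
pose n := kp^-1 *: (v - k *: hvec x).
have nn : lorentz n n = -1.
  rewrite /n lorentz_sub hvec_norm (lorentzC x) vx exprVn k2.
  rewrite (_ : lorentz v v - 2 * k * k + k ^+ 2 * 1 = - (k ^+ 2 - lorentz v v)); last ring.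
  by rewrite mulrN mulVf// -k2 expf_eq0 gt_eqF.
have xn : lorentz x n = 0 by rewrite /n lorentzZr lorentzDr lorentzNr lorentzZr hvec_norm (lorentzC x) vx; ring.
pose e := cross x n.
have ee : lorentz e e = -1.
  have -> : lorentz e e = lorentz x x * lorentz n n - lorentz x n ^+ 2.
    by rewrite /e /lorentz /cross !vec3E; ring.
  by rewrite hvec_norm nn xn; ring.
have xe : lorentz x e = 0 by rewrite lorentzC lorentz_cross /det3; ring.
have en : lorentz e n = 0 by rewrite lorentz_cross /det3; ring.
have L : lor (mat3 x e n) by apply: lor_mat3; rewrite ?hvec_norm ?hvec0_gt0.
exists (mat3 x e n), kp; split=> //.
- split=> //; rewrite det_mat3.
  by rewrite det3N det3C -lorentz_cross -/e ee opprK.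
- by apply: val_inj; rewrite /= hactE// mul_mat3 !hoE scale1r !scale0r !addr0.
- by rewrite mul_mat3 !vec3E scale0r addr0 /n scalerA mulfV ?gt_eqF// scale1r addrC subrK.
Qed.

Lemma continuous_hact M : lor M -> continuous (hact M : hplane R -> hplane R).
Proof. by move=> lM z P; exact: (near_pre z P lM).2. Qed.

Lemma connected_level v k x : (k = 1 \/ k = 0) -> lorentz v x = k -> lorentz v v < k ^+ 2 ->
  connected [set z : hplane R | lorentz v z = k].
Proof.
move=> k01 vx vk; have [M [kp [[lM _] _ -> kp0 _]]] := level_frame vx vk.
have -> : [set z : hplane R | lorentz (vec3 k 0 kp *m M) z = k] =
    hact M @` [set z : hplane R | lorentz (vec3 k 0 kp) z = k].
  apply/seteqP; split=> z /=.
    move=> h; exists (hact (invmx M) z); last by rewrite hactKV.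
    by move: h; rewrite -{1}(hactKV lM z) [X in lorentz _ X]hactE// (proj1 lM).
  by move=> [y yk <-]; rewrite hactE// (proj1 lM).
apply: connected_continuous_connected; first exact: connected_level_frame.
by apply: continuous_subspaceT; exact: continuous_hact.
Qed.

Definition all_shape K q k := forall x, K x -> ~ interior K x -> bshape K q k x.

(** The points of [E] near which [v] describes [K] form an open subset. It is also closed: the
    normal [v'] at a limit point also describes [K] at nearby points of the subset, so it equals [v]
    by [local_shape_unique]. *)
Lemma connected_shape K q k E x v : closed K -> all_shape K q k -> 0 <= k -> k <= 1 -> q < k ^+ 2 ->
  connected E -> (forall z, E z -> (\forall w \near z, K w <-> lorentz v w <= k) -> lorentz v z = k) ->
  lorentz v v = q -> E x -> local_shape K v k x -> forall z, E z -> local_shape K v k z.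
Proof.
move=> clK sK k0 k1 qk cE Ek vv Ex [_ nx].
pose W := [set z : hplane R | \forall w \near z, K w <-> lorentz v w <= k].
suff EW : E `&` W = E.
  by move=> z; rewrite -EW => -[Ez Wz]; split=> //; exact: Ek.
apply: cE; first by exists x.
  by exists W => //; exact: open_interior.
exists (closure (E `&` W)); first exact: closed_closure.
apply/seteqP; split=> z; first by move=> EWz; split; [case: EWz|exact: subset_closure].
move=> [Ez cl]; split=> //.
have sW y : (E `&` W) y -> local_shape K v k y by move=> [Ey Wy]; split=> //; exact: Ek.
have Kz : K z.
  apply: (closed_near clK) => d d0.
  have [|y [EWy zy]] := cl [set y | lorentz z y < 1 + d]; first by apply/nbhs_hplane; exists d.
  exists y => //; have [vy ny] := sW y EWy; apply: (nbhs_singleton ny).2; by rewrite vy.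
have nz : ~ interior K z.
  move=> /nbhs_interior/cl[y [EWy iy]].
  by apply: (local_shape_not_interior k0 _ (sW y EWy)) iy; rewrite vv.
have [v' v'v [v'z nv']] := sK z Kz nz.
have [y [EWy ny]] := cl _ (nbhs_interior nv').
have [vy nvy] := sW y EWy.
have v'y : lorentz v' y = k.
  apply/eqP; rewrite eq_le; apply/andP; split.
    by apply: (nbhs_singleton ny).1; apply: (nbhs_singleton nvy).2; rewrite vy.
  rewrite leNgt; apply/negP => h.
  apply: (local_shape_not_interior k0 _ (sW y EWy)); first by rewrite vv.
  by apply: filterS2 ny (near_lorentz_lt h) => w wK wk; apply/wK; exact: ltW.
suff e : v = v' by rewrite /W /= e.
by apply: (@local_shape_unique R K _ _ k y) => //; rewrite vv v'v.
Qed.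

Lemma level_shape K q k x v : closed K -> all_shape K q k -> (k = 1 \/ k = 0) -> q < k ^+ 2 ->
  lorentz v v = q -> local_shape K v k x -> forall z, lorentz v z = k -> local_shape K v k z.
Proof.
move=> clK sK k01 qk vv sx; have [vx _] := sx.
have [k0 k1] : 0 <= k /\ k <= 1 by case: k01 => ->.
apply: (connected_shape clK sK k0 k1 qk) sx => //.
by apply: (connected_level k01 vx); rewrite vv.
Qed.

(** A point of [K] beyond the section, joined to an interior point of [K] on the inner side, would
    make the crossing point with the section interior to [K]. *)
Lemma level_sub K q k x v : closed K -> hconvex K -> all_shape K q k -> (k = 1 \/ k = 0) -> q < k ^+ 2 ->
  lorentz v v = q -> local_shape K v k x -> forall z, K z -> lorentz v z <= k.
Proof.
move=> clK cK sK k01 qk vv sx y Ky; rewrite leNgt; apply/negP => vy.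
have [k0 k1] : 0 <= k /\ k <= 1 by case: k01 => ->.
have [|i Ki vi] := local_shape_interior k0 k1 _ sx; first by rewrite vv.
have clD : closed [set z : hplane R | lorentz v z <= k].
  apply: (@closed_comp _ _ (fun z : hplane R => lorentz v z : R) [set t : R | t <= k]).
    by move=> z _; apply: continuous_lorentz.
  exact: closed_le.
have [||w [a [b [a0 b0 wE wk nw]]]] := @segment_boundary _ _ i y clD; first exact: ltW.
  by rewrite /= leNgt vy.
have vw : lorentz v w = k.
  apply/eqP; rewrite eq_le wk /= leNgt; apply/negP => h; apply: nw.
  by rewrite /interior /=; apply: filterS (near_lorentz_lt h) => z /ltW.
apply: (local_shape_not_interior k0 _ (level_shape clK sK k01 qk vv sx vw)); first by rewrite vv.
by apply: (interior_comb2 cK Ky Ki b0 a0); rewrite wE addrC.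
Qed.

Lemma level_in K q k x v z : closed K -> all_shape K q k -> (k = 1 \/ k = 0) -> q < k ^+ 2 ->
  lorentz v v = q -> local_shape K v k x -> lorentz v z = k -> K z.
Proof.
move=> clK sK k01 qk vv sx vz; have [_ n] := level_shape clK sK k01 qk vv sx vz.
by apply: (nbhs_singleton n).2; rewrite vz.
Qed.

Lemma orth_unit v z : exists f, [/\ lorentz f f = -1, lorentz v f = 0 & lorentz z f = 0].
Proof.
have [g [gg vg zg]] : exists g, [/\ lorentz g g < 0, lorentz v g = 0 & lorentz z g = 0].
  have [e|n] := eqVneq (cross z v) 0.
    have [zu uu] := orth_e1 z; exists (cross z (vec3 0 1 0)); split=> //.
    have h (w : 'rV_3) : det3 z v w = 0 by rewrite -lorentz_cross e /lorentz !mxE; ring.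
    by rewrite lorentzC lorentz_cross; have := h (vec3 0 1 0); rewrite /det3; lra.
  have zg : lorentz z (cross z v) = 0 by rewrite lorentzC lorentz_cross det3_eq//; right; right.
  exists (cross z v); split=> //; first exact: orth_neg zg n.
  by rewrite lorentzC lorentz_cross det3_eq//; right; left.
exists ((Num.sqrt (- lorentz g g))^-1 *: g).
have g0 : 0 < - lorentz g g by rewrite oppr_gt0.
have s2 := sqr_sqrtr (ltW g0); have s0 : 0 < Num.sqrt (- lorentz g g) by rewrite sqrtr_gt0.
rewrite !lorentzZl !lorentzZr vg zg !mulr0; split=> //.
have e : lorentz g g = - Num.sqrt (- lorentz g g) ^+ 2 by rewrite s2 opprK.
by rewrite [X in _ * (_ * X)]e; field; rewrite gt_eqF.
Qed.

(* [z] lies between two points of the level curve, on the geodesic through [z]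
   orthogonal to [v]. *)
Lemma level_super K q x v z : closed K -> hconvex K -> all_shape K q 1 -> q < 1 ->
  lorentz v v = q -> local_shape K v 1 x -> 0 < lorentz v z -> lorentz v z <= 1 -> K z.
Proof.
move=> clK cK sK q1 vv sx s0 s1; have [f [ff vf zf]] := orth_unit v z.
pose a := (lorentz v z)^-1; have a1 : 1 <= a by rewrite invf_ge1.
have az : a * lorentz v z = 1 by rewrite /a mulVf// gt_eqF.
pose b := Num.sqrt (a ^+ 2 - 1); have b2 : b ^+ 2 = a ^+ 2 - 1 by rewrite sqr_sqrtr// subr_ge0 exprn_ege1.
have ex s : s ^+ 2 = a ^+ 2 - 1 -> exists2 w, hvec w = a *: hvec z + s *: f & K w.
  move=> s2.
  have n1 : lorentz (a *: hvec z + s *: f) (a *: hvec z + s *: f) = 1.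
    by rewrite !lorentzE hvec_norm ff (lorentzC f) zf; move: s2; clear; lra.
  have P : (lorentz (a *: hvec z + s *: f) (a *: hvec z + s *: f) == 1) && (0 < (a *: hvec z + s *: f) 0 0).
    rewrite n1 eqxx /=; apply: (@hplane_of _ _ z n1).
    by rewrite !lorentzE hvec_norm (lorentzC f) zf mulr0 addr0 mulr1; lra.
  exists (HPlane P) => //; apply: (level_in clK sK _ _ vv sx); [by left|by rewrite expr1n|].
  by rewrite /= !lorentzE az vf mulr0 addr0.
have [w1 e1 K1] := ex b b2; have [|w2 e2 K2] := ex (- b); first by rewrite sqrrN.
have a0 : 0 < 2 * a by lra.
apply: (hconvex_comb cK K1 K2 (a := (2 * a)^-1) (b := (2 * a)^-1)); rewrite ?invr_ge0 ?(ltW a0)//.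
rewrite e1 e2 -scalerDr addrACA -scalerDl -scalerDl subrr scale0r addr0 scalerA.
by rewrite (_ : a + a = 2 * a) ?mulVf ?scale1r// ?gt_eqF//; ring.
Qed.

End GlobalShape.

(** * Round boundaries: disks, and exclusion of unbounded bodies *)

Section RoundCase.
Variable R : realType.
Implicit Types (x y z w p : hplane R) (a b c m s t k r q kp : R) (A B K L E : set (hplane R)) (u v : 'rV[R]_3).

#[local] Opaque hact hpt barc mslope slope_rot slope_rotV kap rho.

(* Position in which [v] and its mirror image have a null sum. *)
Lemma null_frame x v : lorentz v x = 1 -> lorentz v v <= 0 -> exists N,
  direct N /\ v = vec3 1 1 (Num.sqrt (- lorentz v v)) *m N.
Proof.
move=> vx v0; have [|M [kp [dM _ vE kp0 kp2]]] := level_frame vx; first by rewrite expr1n; lra.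
have s2 : Num.sqrt (- lorentz v v) ^+ 2 = - lorentz v v by rewrite sqr_sqrtr// oppr_ge0.
move: (Num.sqrt _) s2 => s s2; rewrite expr1n -s2 in kp2.
have cs : (s / kp) ^+ 2 + (kp^-1) ^+ 2 = 1.
  have -> : (s / kp) ^+ 2 + (kp^-1) ^+ 2 = (1 + s ^+ 2) / kp ^+ 2 by field; rewrite gt_eqF.
  by rewrite -kp2 divff// expf_eq0 gt_eqF.
exists (rotm (s / kp) kp^-1 *m M); split; first by apply: directM => //; exact: direct_rotm.
rewrite vE mulmxA; congr (_ *m M); rewrite mul_mat3 !vec3E.
apply: eq_vec3; rewrite !mxE /=; [ring| |].
- by field; rewrite gt_eqF.
- have -> : 1 * 0 + 1 * kp^-1 + s * (s / kp) = (1 + s ^+ 2) / kp by ring.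
  by rewrite -kp2; field; rewrite gt_eqF.
Qed.

(** The sum of the two defining inequalities places the intersection in the horodisk
    [z 0 0 - z 0 1 <= 1], while it contains a ray of the axis ending at the same ideal point. A
    symmetry about [c] carries far points of this ray out of the horodisk. *)
Lemma horo_contradiction K L s u v N M : sym_pair K L -> direct N -> direct M ->
  u = vec3 1 1 s *m N -> v = vec3 1 1 s *m M ->
  (forall z, K z -> lorentz u z <= 1) -> (forall z, 0 < lorentz u z -> lorentz u z <= 1 -> K z) ->
  (forall z, L z -> lorentz v z <= 1) -> (forall z, 0 < lorentz v z -> lorentz v z <= 1 -> L z) -> False.
Proof.
move=> H dN dM uE vE K1 K2 L1 L2.
have eK z : lorentz u (hact N z) = z 0 0 - z 0 1 - s * z 0 2.
  by rewrite uE hactE ?(proj1 (proj1 dN))//; [rewrite /lorentz !vec3E; ring|exact: (proj1 dN)].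
have eL z : lorentz v (hact M (hact (rho R) z)) = z 0 0 - z 0 1 + s * z 0 2.
  rewrite vE hactE ?(proj1 (proj1 dM))//; last exact: (proj1 dM).
  by rewrite /lorentz !vec3E !hact_rho; ring.
pose S := pre N K `&` pre (rho R) (pre M L).
have inS z : z 0 2 = 0 -> 0 < z 0 0 - z 0 1 -> z 0 0 - z 0 1 <= 1 -> S z.
  by move=> z2 h1 h2; split; [apply: K2|apply: L2]; rewrite ?eK ?eL z2 ?mulr0 ?subr0 ?addr0.
have iS : interior S !=set0.
  have [z [z1 z2]] := hpoint_side (1 : R); exists z.
  have zs := hsqr z; rewrite z1 z2 in zs; have z0 := hvec0_gt0 z.
  have [h1 h2] : 0 < z 0 0 - z 0 1 - s * z 0 2 /\ z 0 0 - z 0 1 - s * z 0 2 < 1.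
    by rewrite z1 z2; split; nra.
  have [h3 h4] : 0 < z 0 0 - z 0 1 + s * z 0 2 /\ z 0 0 - z 0 1 + s * z 0 2 < 1.
    by move: h1 h2; rewrite z2 !mulr0 subr0 addr0.
  have E1 w : lorentz (vec3 1 1 s) w = w 0 0 - w 0 1 - s * w 0 2 by rewrite /lorentz !vec3E; ring.
  have E2 w : lorentz (vec3 1 1 (- s)) w = w 0 0 - w 0 1 + s * w 0 2 by rewrite /lorentz !vec3E; ring.
  rewrite -!E1 in h1 h2; rewrite -!E2 in h3 h4.
  have n1 := near_lorentz_gt h1; have n2 := near_lorentz_lt h2.
  have n3 := near_lorentz_gt h3; have n4 := near_lorentz_lt h4.
  rewrite /interior /=; near=> w.
  have k1 : 0 < w 0 0 - w 0 1 - s * w 0 2 by rewrite -E1; near: w.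
  have k2 : w 0 0 - w 0 1 - s * w 0 2 < 1 by rewrite -E1; near: w.
  have l1 : 0 < w 0 0 - w 0 1 + s * w 0 2 by rewrite -E2; near: w.
  have l2 : w 0 0 - w 0 1 + s * w 0 2 < 1 by rewrite -E2; near: w.
  by split; [apply: K2|apply: L2]; rewrite ?eK ?eL// ltW.
have /centrally_symmetricP[c cS] := H N M dN dM iS.
have g0 : 0 < c 0 0 - c 0 1.
  by have := hsqr c; have := hvec0_gt0 c; have := sqr_ge0 (c 0 2); nra.
(* For this point [lorentz c z * (c 0 0 - c 0 1)] is at least 2, whereas the symmetry allows at most
   1. *)
have [z [z1 z2]] := hpoint_side (2 / (c 0 0 - c 0 1) ^+ 2).
have r0 : 0 < z 0 1 by rewrite z1 divr_gt0// exprn_gt0.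
have rE : z 0 1 * (c 0 0 - c 0 1) ^+ 2 = 2 by rewrite z1 divfK// gt_eqF// exprn_gt0.
have zs := hsqr z; rewrite z2 in zs; have z0 := hvec0_gt0 z.
have zg : z 0 1 < z 0 0 by clear -zs r0 z0; nra.
have zl : z 0 0 - z 0 1 <= 1 by clear -zs r0 z0; nra.
have Sz : S z by apply: inS => //; lra.
have [Ks Ls] := cS z Sz.
have := K1 _ Ks; have := L1 _ Ls; rewrite eK eL symmE !mxE => h1 h2.
have l1 : lorentz c z * (c 0 0 - c 0 1) <= 1 by lra.
have l2 : (c 0 0 - c 0 1) * z 0 1 <= lorentz c z.
  have -> : lorentz c z = (c 0 0 - c 0 1) * z 0 1 + c 0 0 * (z 0 0 - z 0 1) by rewrite /lorentz z2; ring.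
  by rewrite lerDl mulr_ge0 ?(ltW (hvec0_gt0 c))// subr_ge0 ltW.
have := ler_wpM2r (ltW g0) l2; lra.
Unshelve. all: by end_near.
Qed.

(** For [q > 0] the normal is a multiple [N] of a point [c], and [lorentz v z <= 1] bounds the
    hyperbolic cosine of the distance from [c] by the inverse of [N]. *)
Lemma disk_of_shape K q x v : closed K -> hconvex K -> all_shape K q 1 -> 0 < q -> q < 1 ->
  lorentz v v = q -> local_shape K v 1 x ->
  exists c : hplane R, K = hdisk c (arcosh (Num.sqrt q)^-1).
Proof.
move=> clK cK sK q0 q1 vv sx; have [vx _] := sx.
have [||c [N N0 vE]] := @hcone _ v x; rewrite ?vv ?vx//.
have NE : N = Num.sqrt q.
  have : N ^+ 2 = q by rewrite -vv vE !lorentzE hvec_norm; ring.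
  by move=> <-; rewrite sqrtr_sqr ger0_norm// ltW.
have N1 : 1 <= N^-1.
  by rewrite invf_ge1// NE -[leRHS]sqrtr1 ler_wsqrtr//; exact: ltW.
have vc z : lorentz v z = N * lorentz c z by rewrite vE lorentzZl.
exists c; rewrite -NE; apply/seteqP; split=> z; rewrite /hdisk /= mdistE.
  move=> /(level_sub clK cK sK (or_introl erefl) _ vv sx); rewrite expr1n => /(_ q1).
  rewrite vc mulrC -ler_pdivlMr// mul1r; exact: le_arcosh (lorentz_ge1 _ _).
move=> h; apply: (level_super clK cK sK q1 vv sx).
  by rewrite vc mulr_gt0// (lt_le_trans ltr01)// lorentz_ge1.
rewrite vc mulrC -ler_pdivlMr// mul1r leNgt; apply/negP => l.
by have := lt_arcosh N1 l; rewrite ltNge h.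
Qed.

Lemma round_disks K L q : closed K -> hconvex K -> interior K !=set0 -> K <> setT ->
  closed L -> hconvex L -> interior L !=set0 -> L <> setT -> sym_pair K L ->
  all_shape K q 1 -> all_shape L q 1 ->
  exists c c' : hplane R, exists2 r, 0 < r & K = hdisk c r /\ L = hdisk c' r.
Proof.
move=> clK cK iK KT clL cL iL LT H sK sL.
have [x Kx nx] := boundary_point clK iK KT; have [y Ly ny] := boundary_point clL iL LT.
have [u uu su] := sK x Kx nx; have [v vv sv] := sL y Ly ny.
have q1 : q < 1 by rewrite -uu; exact: local_shape_lt1 cK iK su.
have q1' : q < 1 ^+ 2 by rewrite expr1n.
have [q0|q0] := ltP 0 q.
  have [c Kc] := disk_of_shape clK cK sK q0 q1 uu su; have [c' Lc] := disk_of_shape clL cL sL q0 q1 vv sv.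
  exists c, c', (arcosh (Num.sqrt q)^-1) => //.
  have s0 : 0 < Num.sqrt q by rewrite sqrtr_gt0.
  have s1 : Num.sqrt q < 1 by rewrite -[X in _ < X]sqrtr1 ltr_sqrt.
  have l1 : 1 < (Num.sqrt q)^-1 by rewrite invf_gt1.
  by have := lt_arcosh (lexx 1) l1; rewrite {1}/arcosh expr1n subrr sqrtr0 addr0 ln1.
have [ux _] := su; have [vy _] := sv.
have [|N [dN uE]] := null_frame ux; first by rewrite uu.
have [|M [dM vE]] := null_frame vy; first by rewrite vv.
rewrite uu in uE; rewrite vv in vE.
exfalso; apply: (horo_contradiction H dN dM uE vE).
- exact: (level_sub clK cK sK (or_introl erefl) q1' uu su).
- by move=> z; exact: (level_super clK cK sK q1 uu su).
- exact: (level_sub clL cL sL (or_introl erefl) q1' vv sv).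
- by move=> z; exact: (level_super clL cL sL q1 vv sv).
Qed.

End RoundCase.

(** * Straight boundaries: plane wedges and the position of boundary lines *)

Section FlatCase.
Variable R : realType.
Implicit Types (x y z w p : hplane R) (a b c m s t k r q kp : R) (A B K L E : set (hplane R)) (u v : 'rV[R]_3).

#[local] Opaque hact hpt barc mslope slope_rot slope_rotV kap rho.

Lemma wedge_match c s a1 a2 b1 b2 : 0 < s -> 0 < c -> c ^+ 2 + s ^+ 2 = 1 ->
  (a1 ^+ 2 + a2 ^+ 2 = 1 \/ a1 = 0 /\ a2 = 0) ->
  (forall u1 u2 : R, 0 <= u2 /\ c * u2 <= s * u1 <-> 0 <= a1 * u1 + a2 * u2 /\ 0 <= b1 * u1 + b2 * u2) ->
  (a1 = 0 /\ a2 = 1) \/ (a1 = s /\ a2 = - c).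
Proof.
move=> s0 c0 cs aU H.
have small (g h : R) : 0 < g -> exists2 e, 0 < e & 0 <= g + e * h.
  move=> g0; have nh := normr_ge0 h; exists (g / (`|h| + 1)); first by rewrite divr_gt0//; lra.
  have -> : g + g / (`|h| + 1) * h = g / (`|h| + 1) * (`|h| + h + 1) by field; rewrite gt_eqF//; lra.
  have p : 0 <= `|h| + h + 1 by have := ler_norm (- h); rewrite normrN; lra.
  by apply: mulr_ge0 => //; apply: divr_ge0; lra.
have [a10 b10] : 0 <= a1 /\ 0 <= b1.
  by have := (H 1 0).1; rewrite !mulr0 !addr0 !mulr1; apply; split=> //; exact: ltW.
have neg g : 0 < g -> ~ (0 <= a1 * 1 + a2 * - g /\ 0 <= b1 * 1 + b2 * - g).
  by move=> g0 /(H 1 (- g)).2[]; rewrite oppr_ge0 leNgt g0.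
(* Otherwise directions slightly below [(1, 0)] would satisfy both inequalities. *)
have aS : 0 < a1 -> 0 < b1 -> False.
  move=> a1p b1p; have [e e0 he] := small a1 (- a2) a1p; have [f f0 hf] := small b1 (- b2) b1p.
  pose g := Num.min e f; have g0 : 0 < g by rewrite lt_min e0.
  have [ge gf] : g <= e /\ g <= f by rewrite !ge_min !lexx orbT.
  apply: (neg g g0); split.
    have [a2n|a2n] := leP 0 a2; last by have := mulr_gt0 g0 (_ : 0 < - a2); rewrite oppr_gt0 => /(_ a2n); lra.
    by have := ler_wpM2r a2n ge; lra.
  have [b2n|b2n] := leP 0 b2; last by have := mulr_gt0 g0 (_ : 0 < - b2); rewrite oppr_gt0 => /(_ b2n); lra.
  by have := ler_wpM2r b2n gf; lra.
have [a1z|a1z] := eqVneq a1 0.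
  left; split=> //; have b1p : 0 < b1.
    rewrite lt_neqAle b10 andbT eq_sym; apply/eqP => b1z.
    have := (H (-1) 0).2; rewrite a1z b1z !mulr0 !mul0r !addr0 mulrN1 oppr_ge0 => h.
    have : s <= 0 by have [] := h (conj (lexx _) (lexx _)).
    by rewrite leNgt s0.
  have [e e0 he] := small b1 (- b2) b1p.
  have a2p : 0 < a2.
    rewrite ltNge; apply/negP => a2n; apply: (neg e e0).
    rewrite a1z; split; last lra.
    by have := mulr_ge0_le0 (ltW e0) a2n; lra.
  case: aU => [|[_ a2z]]; last by move: a2p; rewrite a2z ltxx.
  rewrite a1z expr0n /= add0r => h; apply/eqP; rewrite -(@eqrXn2 _ 2)// ?(ltW a2p)//.
  by rewrite h expr1n.
have a1p : 0 < a1 by rewrite lt_neqAle eq_sym a1z.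
have b1z : b1 = 0.
  by apply/eqP; rewrite eq_le b10 andbT leNgt; apply/negP; exact: aS.
right.
have b2p : 0 < b2.
  rewrite ltNge; apply/negP => b2n; have [e e0 he] := small a1 (- a2) a1p; apply: (neg e e0).
  rewrite b1z; split; first lra.
  by have := mulr_ge0_le0 (ltW e0) b2n; lra.
have d0 : 0 <= a1 * c + a2 * s.
  have := (H c s).1; rewrite (mulrC c s) lexx (ltW s0) => h; exact: (h (conj isT isT)).1.
have dz : a1 * c + a2 * s = 0.
  apply/eqP; rewrite eq_le d0 andbT leNgt; apply/negP => dp.
  have [e e0 he] := small _ (- a1 * s + a2 * c) dp.
  have p1 : 0 <= a1 * (c - e * s) + a2 * (s + e * c) by move: he; lra.
  have p2 : 0 <= b1 * (c - e * s) + b2 * (s + e * c).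
    by rewrite b1z mul0r add0r mulr_ge0 ?(ltW b2p)// addr_ge0 ?(ltW s0)// mulr_ge0 ?ltW.
  have [_ h] := (H _ _).2 (conj p1 p2).
  have : 0 < e * (c ^+ 2 + s ^+ 2) by rewrite cs mulr1.
  by lra.
have a2E : a2 * s = - a1 * c by lra.
case: aU => [h|[h _]]; last by move: a1z; rewrite h eqxx.
have a1s : a1 ^+ 2 = s ^+ 2.
  have e : (a2 * s) ^+ 2 = a1 ^+ 2 * c ^+ 2 by rewrite a2E; ring.
  transitivity (a1 ^+ 2 * (c ^+ 2 + s ^+ 2)); first by rewrite cs mulr1.
  transitivity ((a1 ^+ 2 + a2 ^+ 2) * s ^+ 2); last by rewrite h mul1r.
  by move: e; clear; lra.
have a1E : a1 = s by apply/eqP; rewrite -(@eqrXn2 _ 2)// ?(ltW a1p) ?(ltW s0)//; apply/eqP.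
split=> //; apply: (mulIf (lt0r_neq0 s0)); rewrite a2E a1E; ring.
Qed.

Lemma local_shape_preV M A v k z : lor M -> local_shape A (v *m M) k (hact M z) -> local_shape (pre M A) v k z.
Proof.
move=> lM s; have lV := lorV lM.
have := @local_shape_pre _ (invmx M) (pre M A) (v *m M) k (hact M z) lV.
rewrite (preM _ lV lM) mulVmx ?lor_unit// pre1 mulmxK ?lor_unit// hactK//; exact.
Qed.

Lemma all_shape_pre M K q k : lor M -> all_shape K q k -> all_shape (pre M K) q k.
Proof.
move=> lM sK x Kx nx; apply/(bshape_pre _ _ _ _ lM); apply: sK => // i.
by apply: nx; apply/(interior_pre _ _ lM).
Qed.

Lemma flat_frame K x v : lorentz v v = -1 -> local_shape K v 0 x ->
  exists M, [/\ direct M, hact M ho = x, v = vec3 0 0 1 *m M & local_shape (pre M K) (vec3 0 0 1) 0 ho].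
Proof.
move=> vv sx; have [vx _] := sx; have [|M [kp [dM Mx vE kp0 kp2]]] := level_frame vx.
  by rewrite vv expr0n /=; lra.
have kp1 : kp = 1.
  apply/eqP; rewrite -(@eqrXn2 _ 2)// ?(ltW kp0)//; apply/eqP; rewrite kp2 vv; ring.
rewrite kp1 in vE; exists M; split=> //; apply: local_shape_preV; first exact: (proj1 dM).
by rewrite -vE Mx.
Qed.

(* [1 <= - u 0 2] says that the line of [u] misses the axis and that [K] lies between the two. *)
Lemma flat_lines K u x : closed K -> hconvex K -> all_shape K (-1) 0 -> local_shape K (vec3 0 0 1) 0 ho ->
  lorentz u u = -1 -> local_shape K u 0 x -> u = vec3 0 0 1 \/ 1 <= - u 0 2.
Proof.
move=> clK cK sK s1 uu sx; have q0 : -1 < 0 ^+ 2 :> R by rewrite expr0n /=; lra.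
have v1 : lorentz (vec3 0 0 1) (vec3 0 0 1) = -1 :> R by rewrite /lorentz !vec3E; ring.
have E w : lorentz (vec3 0 0 1) w = - w 0 2 by rewrite /lorentz !vec3E; ring.
have cross p : lorentz u p = 0 -> p 0 2 = 0 -> u = vec3 0 0 1.
  move=> up p2; apply: (@local_shape_unique R K _ _ 0 p) => //; first by rewrite uu v1.
    exact: (level_shape clK sK (or_intror erefl) q0 uu sx up).
  by apply: (level_shape clK sK (or_intror erefl) q0 v1 s1); rewrite E p2 oppr0.
have [a01|a01] := ltP (u 0 0 ^+ 2) (u 0 1 ^+ 2).
  left; pose d := Num.sqrt (u 0 1 ^+ 2 - u 0 0 ^+ 2).
  have d2 : d ^+ 2 = u 0 1 ^+ 2 - u 0 0 ^+ 2 by rewrite sqr_sqrtr// subr_ge0 ltW.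
  have d0 : 0 < d by rewrite sqrtr_gt0 subr_gt0.
  have [e e2 eu] : exists2 e : R, e ^+ 2 = 1 & 0 < e * u 0 1.
    have [h|h|h] := ltgtP (u 0 1) 0; last by move: a01; rewrite h expr0n /= ltNge sqr_ge0.
      by exists (-1); [rewrite sqrrN expr1n|rewrite mulN1r oppr_gt0].
    by exists 1; [rewrite expr1n|rewrite mul1r].
  have P : (lorentz (vec3 (e * u 0 1 / d) (e * u 0 0 / d) 0) (vec3 (e * u 0 1 / d) (e * u 0 0 / d) 0) == 1)
     && (0 < vec3 (e * u 0 1 / d) (e * u 0 0 / d) 0 0 0).
    rewrite /lorentz !vec3E divr_gt0// andbT; apply/eqP.
    transitivity (e ^+ 2 * (u 0 1 ^+ 2 - u 0 0 ^+ 2) / d ^+ 2); first by field; rewrite gt_eqF.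
    by rewrite e2 mul1r -d2 divff// expf_eq0 gt_eqF.
  apply: (cross (HPlane P)); rewrite /= /lorentz !vec3E//; ring.
have [uz nz] := sx; have Kx : K x by apply: (nbhs_singleton nz).2; rewrite uz.
have [h1 h2] := s1; have Ko : K ho by apply: (nbhs_singleton h2).2; rewrite h1.
have x2 : 0 <= x 0 2.
  by have := level_sub clK cK sK (or_intror erefl) q0 v1 s1 Kx; rewrite E oppr_le0.
have u0 : u 0 0 <= 0.
  by have := level_sub clK cK sK (or_intror erefl) q0 uu sx Ko; rewrite lorentz_ho_r.
have u2 : 1 <= u 0 2 ^+ 2.
  by move: uu a01; rewrite /lorentz; clear; lra.
have [u2p|u2n] := leP (u 0 2) 0.
  right; rewrite leNgt; apply/negP => h; clear -u2 u2p h; nra.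
left; apply: (cross x uz); apply/eqP; rewrite eq_le x2 andbT.
rewrite -(pmulr_rle0 _ u2n).
have -> : u 0 2 * x 0 2 = u 0 0 * x 0 0 - u 0 1 * x 0 1 by move: uz; rewrite /lorentz; clear; lra.
have x0 := hvec0_gt0 x; have xs := hsqr x.
have : (u 0 1 * x 0 1) ^+ 2 <= (u 0 0 * x 0 0) ^+ 2.
  rewrite !exprMn; apply: ler_pM; rewrite ?sqr_ge0//.
  by rewrite xs; have := sqr_ge0 (x 0 2); clear; lra.
have u0x : 0 <= - (u 0 0 * x 0 0) by rewrite oppr_ge0 mulr_le0_ge0// ltW.
move: (u 0 0 * x 0 0) (u 0 1 * x 0 1) u0x => g h; clear; move=> g0 hg.
rewrite leNgt; apply/negP => l; nra.
Qed.

End FlatCase.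

(** * Two lines crossing at a small angle *)

Section Wedges.
Variable R : realType.
Implicit Types (x y z w p : hplane R) (a b c m s t k r q kp : R) (A B K L E : set (hplane R)) (u v : 'rV[R]_3).

#[local] Opaque hact hpt barc mslope slope_rot slope_rotV kap rho.

Definition germ_plane K u z := lorentz u z = 0 /\ \forall w \near z, K w <-> lorentz u w <= 0.

(* In the interior the zero vector describes the germ of [K]. *)
Lemma germ_plane_exists K z : all_shape K (-1) 0 -> K z -> exists u,
  germ_plane K u z /\ (lorentz u u = -1 \/ u = 0).
Proof.
move=> sK Kz; have [iz|nz] := pselect (interior K z).
  have l0 w : lorentz (0 : 'rV[R]_3) w = 0 by rewrite /lorentz !mxE !mul0r !subr0.
  exists 0; split; last by right.
  split; first exact: l0.
  by apply: filterS iz => w Kw; rewrite l0 lexx.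
by have [u uu su] := sK z Kz nz; exists u; split=> //; left.
Qed.

Lemma near_symm (c : hplane R) z (P : set (hplane R)) : (\forall w \near symm c z, P w) ->
  \forall w \near z, P (symm c w).
Proof.
move=> /nbhs_hplane[d d0 h]; apply/nbhs_hplane; exists d => // w zw; apply: h.
by rewrite lorentz_symm.
Qed.

Lemma lorentz_refl (c : hplane R) u (w : hplane R) : lorentz (2 * lorentz c u *: hvec c - u) w = lorentz u (symm c w).
Proof. by rewrite symmE !lorentzE (lorentzC u c); ring. Qed.

(** By homogeneity every direction can be tested at a point pushed slightly away from [ho]. *)
Lemma near_directions (P Q : R -> R -> Prop) :
  (forall r (u1 u2 : R), 0 < r -> P (r * u1) (r * u2) <-> P u1 u2) ->
  (forall r (u1 u2 : R), 0 < r -> Q (r * u1) (r * u2) <-> Q u1 u2) ->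
  (\forall w \near (ho : hplane R), P ((w : hplane R) 0 1) (w 0 2) <-> Q (w 0 1) (w 0 2)) ->
  forall u1 u2 : R, P u1 u2 <-> Q u1 u2.
Proof.
move=> hP hQ n u1 u2.
have zu : lorentz ho (vec3 0 u1 u2) = 0 by rewrite lorentz_ho vec3E.
have [r [w [r0 _ h _ wE]]] := near_push n zu.
have e1 : w 0 1 = r * u1 by rewrite wE !mxE /=; ring.
have e2 : w 0 2 = r * u2 by rewrite wE !mxE /=; ring.
by move: h; rewrite /= e1 e2 hP// hQ.
Qed.

(** At the image of [ho], [K] and [L] are half-planes with normals [a] and [b], whose reflections
    [a'] and [b'] cut out the wedge at [ho]. If [a'] is the normal of [K] at [ho], the centre, lying
    in the wedge, has products of equal sign with both normals, which [small] excludes. If [a'] is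
    the normal of [L], then [lorentz a (vec3 0 s (- c)) >= 1], which [flat_lines] and [small]
    exclude. *)
Lemma wedge_contradiction K L c s (o : hplane R) : closed K -> hconvex K -> all_shape K (-1) 0 ->
  local_shape K (vec3 0 0 1) 0 ho -> closed L -> hconvex L -> all_shape L (-1) 0 ->
  local_shape L (vec3 0 s (- c)) 0 ho -> 0 < s -> 0 < c -> c ^+ 2 + s ^+ 2 = 1 ->
  (forall u x, lorentz u u = -1 -> local_shape K u 0 x ->
     s * `|u 0 1| < 1 /\ (1 < - u 0 2 -> s * `|u 0 1| < c * (- u 0 2 - 1))) ->
  (forall z, K z -> L z -> K (symm o z) /\ L (symm o z)) -> False.
Proof.
move=> clK cK sK s1 clL cL sL s2 s0 c0 cs small sym.
have q0 : -1 < 0 ^+ 2 :> R by rewrite expr0n /=; lra.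
have v1 : lorentz (vec3 0 0 1) (vec3 0 0 1) = -1 :> R by rewrite /lorentz !vec3E; ring.
have v2 : lorentz (vec3 0 s (- c)) (vec3 0 s (- c)) = -1.
  by rewrite -cs /lorentz !vec3E; ring.
have E1 w : lorentz (vec3 0 0 1) w = - w 0 2 by rewrite /lorentz !vec3E; ring.
have E2 w : lorentz (vec3 0 s (- c)) w = c * w 0 2 - s * w 0 1 by rewrite /lorentz !vec3E; ring.
have subK := level_sub clK cK sK (or_intror erefl) q0 v1 s1.
have subL := level_sub clL cL sL (or_intror erefl) q0 v2 s2.
have [_ n1] := s1; have [_ n2] := s2.
have Ko : K ho by apply: (nbhs_singleton n1).2; rewrite E1 hoE oppr0.
have Lo : L ho by apply: (nbhs_singleton n2).2; rewrite E2 !hoE !mulr0 subrr.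
have [Kz Lz] := sym ho Ko Lo.
have [a [[az na] aU]] := germ_plane_exists sK Kz; have [b [[bz nb] _]] := germ_plane_exists sL Lz.
pose a' := 2 * lorentz o a *: hvec o - a; pose b' := 2 * lorentz o b *: hvec o - b.
have a'0 : a' 0 0 = 0 by rewrite -lorentz_ho_r /a' lorentz_refl.
have b'0 : b' 0 0 = 0 by rewrite -lorentz_ho_r /b' lorentz_refl.
have a'n : lorentz a' a' = lorentz a a by rewrite /a' !lorentzE hvec_norm (lorentzC a o); ring.
have n3 : \forall w \near (ho : hplane R), (0 <= (w : hplane R) 0 2 /\ c * w 0 2 <= s * w 0 1) <->
    (0 <= a' 0 1 * w 0 1 + a' 0 2 * w 0 2 /\ 0 <= b' 0 1 * w 0 1 + b' 0 2 * w 0 2).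
  have n4 := near_symm na; have n5 := near_symm nb.
  near=> w.
  have h1 : K w <-> lorentz (vec3 0 0 1) w <= 0 by near: w.
  have h2 : L w <-> lorentz (vec3 0 s (- c)) w <= 0 by near: w.
  have h4 : K (symm o w) <-> lorentz a (symm o w) <= 0 by near: w.
  have h5 : L (symm o w) <-> lorentz b (symm o w) <= 0 by near: w.
  have ea : lorentz a (symm o w) = - (a' 0 1 * w 0 1 + a' 0 2 * w 0 2).
    by rewrite -lorentz_refl -/a' /lorentz a'0; ring.
  have eb : lorentz b (symm o w) = - (b' 0 1 * w 0 1 + b' 0 2 * w 0 2).
    by rewrite -lorentz_refl -/b' /lorentz b'0; ring.
  rewrite E1 oppr_le0 in h1; rewrite E2 subr_le0 in h2.
  rewrite ea oppr_le0 in h4; rewrite eb oppr_le0 in h5.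
  split=> [[/h1 Kw /h2 Lw]|[/h4 Kw /h5 Lw]].
    by have [/h4 ? /h5 ?] := sym w Kw Lw.
  by have := sym _ Kw Lw; rewrite !symmK => -[/h1 ? /h2 ?].
have H := @near_directions (fun u1 u2 : R => 0 <= u2 /\ c * u2 <= s * u1)
  (fun u1 u2 : R => 0 <= a' 0 1 * u1 + a' 0 2 * u2 /\ 0 <= b' 0 1 * u1 + b' 0 2 * u2) _ _ n3.
have {}H (u1 u2 : R) : 0 <= u2 /\ c * u2 <= s * u1 <->
    0 <= a' 0 1 * u1 + a' 0 2 * u2 /\ 0 <= b' 0 1 * u1 + b' 0 2 * u2.
  apply: H => r w1 w2 r0 /=.
    rewrite pmulr_rge0// (_ : c * (r * w2) = r * (c * w2)); last ring.
    by rewrite (_ : s * (r * w1) = r * (s * w1)) ?ler_pM2l//; ring.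
  rewrite (_ : a' 0 1 * (r * w1) + a' 0 2 * (r * w2) = r * (a' 0 1 * w1 + a' 0 2 * w2)); last ring.
  rewrite (_ : b' 0 1 * (r * w1) + b' 0 2 * (r * w2) = r * (b' 0 1 * w1 + b' 0 2 * w2)); last ring.
  by rewrite !pmulr_rge0.
have aU' : a' 0 1 ^+ 2 + a' 0 2 ^+ 2 = 1 \/ a' 0 1 = 0 /\ a' 0 2 = 0.
  case: aU => [aa|a0]; last by right; rewrite /a' a0 !mxE /lorentz !mxE; split; ring.
  by left; move: a'n; rewrite aa /lorentz a'0; clear; lra.
have aa : lorentz a a = -1.
  by rewrite -a'n /lorentz a'0; case: (wedge_match s0 c0 cs aU' H) => -[-> ->]; [|rewrite -cs]; ring.
have sa : local_shape K a 0 (symm o ho) by split.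
have [sm1 sm2] := small a _ aa sa.
(* By convexity the centre of symmetry lies in the thin wedge. *)
have oE : hvec o = (2 * lorentz o ho)^-1 *: hvec ho + (2 * lorentz o ho)^-1 *: hvec (symm o ho).
  rewrite -scalerDr symmE addrC subrK scalerA mulVf ?scale1r//.
  by rewrite gt_eqF// mulr_gt0// (lt_le_trans ltr01)// lorentz_ge1.
have o2 : 0 <= (2 * lorentz o ho)^-1.
  by rewrite invr_ge0 mulr_ge0// (le_trans ler01)// lorentz_ge1.
have g1 := subK _ (hconvex_comb cK Ko Kz o2 o2 oE).
have g2 := subL _ (hconvex_comb cL Lo Lz o2 o2 oE).
have aE : a = 2 * lorentz o a' *: hvec o - a'.
  have -> : lorentz o a' = lorentz o a by rewrite /a' !lorentzE hvec_norm; ring.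
  by rewrite /a' opprB addrCA subrr addr0.
have sum v : a' = v -> lorentz v v = -1 -> lorentz a v = 1 + 2 * lorentz v o ^+ 2 /\
    a = 2 * lorentz v o *: hvec o - v.
  move=> av vv; split; last by rewrite {1}aE av (lorentzC v).
  by rewrite aE av !lorentzE vv (lorentzC o v); ring.
have nm := ler_norm (- a 0 1); rewrite normrN in nm.
have nm' : - (s * a 0 1) <= s * `|a 0 1| by rewrite -mulrN ler_wpM2l// ltW.
case: (wedge_match s0 c0 cs aU' H) => -[h1 h2].
  have a'E : a' = vec3 0 0 1 by apply: eq_vec3; rewrite vec3E.
  have [l1 l2] := sum _ a'E v1.
  have a2 : - a 0 2 = 1 + 2 * lorentz (vec3 0 0 1) o ^+ 2 by rewrite -l1 /lorentz !vec3E; ring.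
  have [g0|g0] := eqVneq (lorentz (vec3 0 0 1) o) 0.
    have [|i Ki vi] := local_shape_interior (lexx 0) ler01 _ s1; first by rewrite v1.
    have := level_sub clK cK sK (or_intror erefl) q0 aa sa (interior_subset Ki).
    by rewrite l2 g0 mulr0 scale0r add0r lorentzNl oppr_le0 leNgt vi.
  have gg : 0 < lorentz (vec3 0 0 1) o ^+ 2 by rewrite exprn_even_gt0.
  have a21 : 1 < - a 0 2 by rewrite a2; clear -gg; lra.
  have {}sm2 := sm2 a21.
  have : 0 <= lorentz (a + vec3 0 0 1) (vec3 0 s (- c)).
    rewrite [X in X + _]l2 subrK lorentzZl (lorentzC o); apply: mulr_le0 => //.
    by rewrite mulr_ge0_le0.
  rewrite lorentzDl /lorentz !vec3E; clear -sm2 nm'; lra.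
have a'E : a' = vec3 0 s (- c) by apply: eq_vec3; rewrite vec3E.
have [l1 l2] := sum _ a'E v2.
have l3 : 1 <= lorentz a (vec3 0 s (- c)).
  by rewrite l1; have := sqr_ge0 (lorentz (vec3 0 s (- c)) o); clear; lra.
have c1 : c < 1.
  by have := exprn_gt0 2 s0; clear -cs c0; nra.
case: (flat_lines clK cK sK s1 aa sa) => [e|a2].
  by move: l3; rewrite e /lorentz !vec3E; clear -c1; lra.
have := mulr_ge0 (ltW c0) (le_trans ler01 a2); move: l3; rewrite /lorentz !vec3E; clear -sm1 nm'; lra.
Unshelve. all: by end_near.
Qed.

End Wedges.

(** * Boundary components as lines and the choice of the angle *)

Section Lines.
Variable R : realType.
Implicit Types (x y z w p : hplane R) (a b c m s t k r q kp : R) (A B K L E : set (hplane R)) (u v : 'rV[R]_3).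

Lemma chB s t : ch (s - t) = ch s * ch t - sh s * sh t.
Proof.
rewrite /ch /sh opprB !expRD; move: (expR s) (expR t) (expR (- s)) (expR (- t)) => a b c d.
by field.
Qed.

Lemma sh_surj a : exists s, sh s = a.
Proof.
pose T := Num.sqrt (1 + a ^+ 2); have T2 : T ^+ 2 = 1 + a ^+ 2 := sqr_sqrt1 a; have T1 : 1 <= T := sqrt1_ge1 a.
have p : 0 < a + T.
  rewrite ltNge; apply/negP => h; have : T ^+ 2 <= (- a) ^+ 2 by rewrite ler_pXn2r ?nnegrE//; lra.
  by rewrite T2 sqrrN; lra.
exists (ln (a + T)); rewrite /sh expRN lnK ?posrE//.
have -> : (a + T)^-1 = T - a.
  by apply: (mulfI (lt0r_neq0 p)); rewrite divff ?gt_eqF//; move: T2; clear; lra.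
by field.
Qed.

#[local] Opaque hact hpt barc mslope slope_rot slope_rotV kap rho.

Lemma straight_level v x : lorentz v v = -1 -> lorentz v x = 0 ->
  straight_line [set z : hplane R | lorentz v z = 0].
Proof.
move=> vv vx; have [|M [kp [[lM _] _ -> kp0 _]]] := level_frame vx; first by rewrite vv expr0n /=; lra.
have P s : (lorentz (vec3 (ch s) (sh s) 0) (vec3 (ch s) (sh s) 0) == 1) && (0 < vec3 (ch s) (sh s) 0 0 0).
  by rewrite /lorentz !vec3E -!expr2 ch2 ch_gt0 andbT; apply/eqP; ring.
have E z : lorentz (vec3 0 0 kp *m M) (hact M z) = - (kp * z 0 2).
  by rewrite hactE// (proj1 lM) /lorentz !vec3E; ring.
exists (fun s => hact M (HPlane (P s))).
  move=> s t; rewrite mdistE lorentz_hact// /lorentz /= !vec3E mulr0 subr0 -chB.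
  have [h|h] := leP 0 (s - t); first by rewrite ger0_norm// arcosh_ch.
  by rewrite ltr0_norm// -chN arcosh_ch//; lra.
apply/seteqP; split=> z /=; last by move=> [s _ <-]; rewrite E /= vec3E mulr0 oppr0.
rewrite -{1}(hactKV lM z) E => /eqP; rewrite oppr_eq0 mulf_eq0 (gt_eqF kp0) /= => /eqP y2.
have [s sE] := sh_surj (hact (invmx M) z 0 1); exists s => //.
suff -> : HPlane (P s) = hact (invmx M) z by rewrite hactKV.
have ys := hsqr (hact (invmx M) z); have y0 := hvec0_gt0 (hact (invmx M) z).
apply: val_inj; apply: eq_vec3; rewrite /= vec3E ?y2//.
apply/eqP; rewrite -(@eqrXn2 _ 2)// ?(ltW (ch_gt0 s)) ?(ltW y0)//; apply/eqP.
by rewrite ch2 sE ys y2 expr0n /= addr0.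
Qed.

(** [connected_shape] on the component gives one inclusion; the other holds because the whole
    section is connected and consists of boundary points. *)
Lemma component_level K v x : closed K -> all_shape K (-1) 0 -> lorentz v v = -1 -> local_shape K v 0 x ->
  connected_component (boundary K) x = [set z : hplane R | lorentz v z = 0].
Proof.
move=> clK sK vv sx; have [vx nx] := sx; have q0 : -1 < 0 ^+ 2 :> R by rewrite expr0n /=; lra.
have bd z : local_shape K v 0 z -> boundary K z.
  move=> sz; rewrite boundaryE//; split; first by have [vz nz] := sz; apply: (nbhs_singleton nz).2; rewrite vz.
  by apply: (local_shape_not_interior (lexx 0) _ sz); rewrite vv.
apply/seteqP; split.
  have cc := @component_connected _ (boundary K) x.
  have Ek z : connected_component (boundary K) x z -> (\forall w \near z, K w <-> lorentz v w <= 0) -> lorentz v z = 0.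
    move=> /connected_component_sub; rewrite boundaryE// => -[Kz nKz] nz.
    apply/eqP; rewrite eq_le (nbhs_singleton nz).1//= leNgt; apply/negP => h; apply: nKz.
    by rewrite /interior /=; apply: filterS2 nz (near_lorentz_lt h) => w hw w0; apply/hw; exact: ltW.
  have Ex : connected_component (boundary K) x x by apply: connected_component_refl; exact: bd.
  by move=> z /(connected_shape clK sK (lexx 0) ler01 q0 cc Ek vv Ex sx)[].
apply: connected_component_max => //.
  by move=> z /= vz; apply: bd; exact: (level_shape clK sK (or_intror erefl) q0 vv sx vz).
by apply: (connected_level (or_intror erefl) vx); rewrite vv.
Qed.

Lemma components_lines K : closed K -> all_shape K (-1) 0 -> boundary_components K `<=` straight_line (R:=R).
Proof.
move=> clK sK _ [x + <-]; rewrite {1}boundaryE// => -[Kx nx].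
have [v vv sx] := sK x Kx nx; rewrite (component_level clK sK vv sx).
exact: (straight_level vv (proj1 sx)).
Qed.

Definition normals K : set 'rV[R]_3 := [set v | lorentz v v = -1 /\ exists x, local_shape K v 0 x].

(** Two normals with the same section coincide by [local_shape_unique], so choosing one normal for
    each component exhausts all of them. *)
Lemma finite_normals K : closed K -> all_shape K (-1) 0 -> finite_set (boundary_components K) ->
  finite_set (normals K).
Proof.
move=> clK sK fin; have q0 : -1 < 0 ^+ 2 :> R by rewrite expr0n /=; lra.
have ex C : exists v, (exists2 u, normals K u & [set z : hplane R | lorentz u z = 0] = C) ->
    normals K v /\ [set z : hplane R | lorentz v z = 0] = C.
  by have [[v nv vC]|no] := pselect (exists2 u, normals K u & [set z : hplane R | lorentz u z = 0] = C);
    [exists v|exists 0].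
have [g gP] := choice ex.
have := finite_image g fin; apply: sub_finite_set => v nv; have [vv [x sx]] := nv.
have bx : boundary K x.
  rewrite boundaryE//; split; first by have [vx nx] := sx; apply: (nbhs_singleton nx).2; rewrite vx.
  by apply: (local_shape_not_interior (lexx 0) _ sx); rewrite vv.
exists [set z : hplane R | lorentz v z = 0]; first by exists x => //; exact: component_level.
have [|[uu [y sy]] eqC] := gP [set z : hplane R | lorentz v z = 0]; first by exists v.
have vx : [set z : hplane R | lorentz (g [set z : hplane R | lorentz v z = 0]) z = 0] x by rewrite eqC; have [] := sx.
apply: (@local_shape_unique R K _ _ 0 x) => //; first by rewrite uu vv.
exact: (level_shape clK sK (or_intror erefl) q0 uu sy vx).
Qed.

Lemma seq_small (T : eqType) (l : seq T) (P : T -> R -> Prop) :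
  (forall e : T, exists2 d, 0 < d & forall m, 0 < m -> m <= d -> P e m) ->
  exists2 d, 0 < d & forall e : T, e \in l -> forall m, 0 < m -> m <= d -> P e m.
Proof.
move=> h; elim: l => [|i l [d d0 IH]]; first by exists 1.
have [e e0 he] := h i; exists (Num.min d e); first by rewrite lt_min d0.
move=> j; rewrite in_cons => /predU1P[->|jl] m m0; rewrite le_min => /andP[md me]; first exact: he.
exact: IH.
Qed.

(** One boundary line of each body is moved to [ho]. The angle between them is chosen last, small
    against the finitely many normals of [K] seen in this frame. *)
Lemma flat_contradiction K L : closed K -> hconvex K -> interior K !=set0 -> K <> setT ->
  closed L -> hconvex L -> interior L !=set0 -> L <> setT -> sym_pair K L ->
  all_shape K (-1) 0 -> all_shape L (-1) 0 -> finite_set (boundary_components K) -> False.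
Proof.
move=> clK cK iK KT clL cL iL LT H sK sL fin.
have [x Kx nx] := boundary_point clK iK KT; have [y Ly ny] := boundary_point clL iL LT.
have [u uu su] := sK x Kx nx; have [v vv sv] := sL y Ly ny.
have [M [dM Mx uE s1]] := flat_frame uu su; have [N [dN Ny vE s2]] := flat_frame vv sv.
have [lM _] := dM; have [lN _] := dN.
have /finite_seqP[l lE] := finite_normals clK sK fin.
(* The smallness needed in [wedge_contradiction], stated for the slope [m]; passing to the sine
   multiplies it by the cosine, which is at most 1. *)
pose P (w : 'rV[R]_3) m := m * `|(w *m invmx M) 0 1| < 1 /\
   (1 < - (w *m invmx M) 0 2 -> m * `|(w *m invmx M) 0 1| < - (w *m invmx M) 0 2 - 1).
have [|m m0 mP] := @seq_small _ l P.
  move=> w; rewrite /P; move: (w *m invmx M) => a; have na := normr_ge0 (a 0 1).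
  have dec e : 0 < e -> forall m, 0 < m -> m <= e / (`|a 0 1| + 1) -> m * `|a 0 1| < e.
    move=> e0 m m0; rewrite ler_pdivlMr; last lra.
    by move=> h; apply: lt_le_trans h; rewrite ltr_pM2l//; lra.
  pose e := if 1 < - a 0 2 then Num.min 1 (- a 0 2 - 1) else 1.
  have e0 : 0 < e by rewrite /e; case: ifP => // h; rewrite lt_min ltr01 subr_gt0.
  exists (e / (`|a 0 1| + 1)); first by rewrite divr_gt0//; lra.
  move=> m m0 /(dec e e0 m m0) h; split.
    by apply: lt_le_trans h _; rewrite /e; case: ifP => // _; rewrite ge_min lexx.
  by move=> a2; apply: lt_le_trans h _; rewrite /e a2 ge_min lexx orbT.
have {}mP (w : 'rV[R]_3) : normals K w -> P w m by rewrite lE => wl; apply: mP.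
pose c := (Num.sqrt (1 + m ^+ 2))^-1; pose s := m / Num.sqrt (1 + m ^+ 2).
have T1 := sqrt1_ge1 m; have T0 : 0 < Num.sqrt (1 + m ^+ 2) by lra.
have c0 : 0 < c by rewrite invr_gt0.
have c1 : c <= 1 by rewrite invf_le1.
have s0 : 0 < s by rewrite divr_gt0.
have cs : c ^+ 2 + s ^+ 2 = 1 := slope_rotP m.
have lr := lor_rho R; have dS : direct (slope_rot m) := direct_rotm cs; have [lS _] := dS.
have q0 : -1 < 0 ^+ 2 :> R by rewrite expr0n /=; lra.
pose L1 := pre (rho R) (pre (slope_rot m) (pre N L)).
have s3 : local_shape L1 (vec3 0 s (- c)) 0 ho.
  apply: local_shape_preV => //; apply: local_shape_preV => //.
  rewrite hact_rho_ho slope_rot_ho (_ : _ *m _ *m _ = vec3 0 0 1)//.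
  Transparent rho slope_rot.
  rewrite /rho /slope_rot /rotm -/c -/s !mul_mat3 !vec3E.
  by apply: eq_vec3; rewrite !mxE /=; [ring|ring|rewrite -[RHS]cs; ring].
have /centrally_symmetricP[z0 zsym] : centrally_symmetric (pre M K `&` L1).
  rewrite /L1 (preM _ lS lN); apply: H => //; first exact: directM.
  rewrite -(preM _ lS lN) -/L1.
  have [_ n1] := s1; have [_ n3] := s3.
  (* The direction [(2 * c, s)] points into the open wedge between the two lines. *)
  have zu : lorentz ho (vec3 0 (2 * c) s) = 0 by rewrite lorentz_ho vec3E.
  have [r [w [r0 _ [k1 k3] _ wE]]] := near_push (filterI (nbhs_interior n1) (nbhs_interior n3)) zu.
  have w1 : w 0 1 = r * (2 * c) by rewrite wE !mxE /=; ring.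
  have w2 : w 0 2 = r * s by rewrite wE !mxE /=; ring.
  exists w; rewrite /interior /=.
  have h1 : lorentz (vec3 0 0 1) w < 0.
    by rewrite /lorentz !vec3E w1 w2; have := mulr_gt0 r0 s0; lra.
  have h3 : lorentz (vec3 0 s (- c)) w < 0.
    by rewrite /lorentz !vec3E w1 w2; have := mulr_gt0 r0 (mulr_gt0 c0 s0); lra.
  have g1 := near_lorentz_lt h1; have g3 := near_lorentz_lt h3.
  near=> z; split.
    have [_ e] : pre M K z <-> lorentz (vec3 0 0 1) z <= 0 by near: z.
    by apply: e; apply: ltW; near: z.
  have [_ e] : L1 z <-> lorentz (vec3 0 s (- c)) z <= 0 by near: z.
  by apply: e; apply: ltW; near: z.
have clL1 : closed L1 by do 3 apply: closed_pre => //.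
have cL1 : hconvex L1 by do 3 apply: hconvex_pre => //.
have sL1 : all_shape L1 (-1) 0 by do 3 apply: all_shape_pre => //.
apply: (wedge_contradiction (o := z0) (closed_pre lM clK) (hconvex_pre lM cK) (all_shape_pre lM sK) s1 clL1 cL1 sL1 s3 s0 c0 cs).
  move=> a z aa sa; have [] := mP (a *m M).
    by split; [rewrite (proj1 lM)|exists (hact M z); exact: local_shape_pre].
  rewrite mulmxK ?lor_unit// => p1 p2.
  have sE : s * `|a 0 1| = c * (m * `|a 0 1|) by rewrite /s /c; ring.
  rewrite sE; split.
    by apply: le_lt_trans p1; rewrite ler_piMl// mulr_ge0// ltW.
  by move=> /p2 h; rewrite ltr_pM2l.
by move=> z Kz Lz; have [] := zsym z (conj Kz Lz).
Unshelve. all: by end_near.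
Qed.

End Lines.

(** * Disks, and the passage from congruences to mirrored pairs *)

Section Disks.
Variable R : realType.
Implicit Types (x y z w p : hplane R) (a b c : hplane R) (r : R) (A B K L E : set (hplane R)).

Lemma midpoint_exists a b : exists c, symm c a = b.
Proof.
have l1 := lorentz_ge1 a b.
have [||c [N N0 e]] := @hcone _ (hvec a + hvec b) a; try by rewrite !lorentzE !hvec_norm ?(lorentzC b a); lra.
exists c; apply: val_inj; rewrite /= /symm_vec.
have eN : N ^+ 2 = 2 + 2 * lorentz a b.
  transitivity (lorentz (hvec a + hvec b) (hvec a + hvec b)).
    by rewrite e !lorentzE hvec_norm; ring.
  by rewrite !lorentzE !hvec_norm (lorentzC b a); ring.
have ec : N * lorentz c a = 1 + lorentz a b.
  by rewrite -lorentzZl -e lorentzDl hvec_norm (lorentzC b a).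
have -> : 2 * lorentz c a = N.
  by apply: (mulfI (lt0r_neq0 N0)); rewrite -expr2 eN mulrCA ec; ring.
by rewrite -e addrAC subrr add0r.
Qed.

Lemma congruence_symm c : congruence (symm c).
Proof.
split=> [x y|]; first by rewrite !mdistE lorentz_symm.
by apply/seteqP; split=> // y _; exists (symm c y) => //; rewrite symmK.
Qed.

Lemma congruence_hdisk (f : hplane R -> hplane R) c r : congruence f -> f @` hdisk c r = hdisk (f c) r.
Proof.
move=> [iso onto]; apply/seteqP; split=> y; first by move=> [x cx <-]; rewrite /hdisk /= iso.
have [x _ <-] : range f y by rewrite onto.
by rewrite /hdisk /= iso => cx; exists x.
Qed.

(** The symmetry about the midpoint of the centres exchanges the two disks. *)
Lemma hdisk_lens a b r : centrally_symmetric (hdisk a r `&` hdisk b r).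
Proof.
have [c ab] := midpoint_exists a b; apply/centrally_symmetricP; exists c => z [az bz].
have iso := (congruence_symm c).1; split.
  by rewrite /hdisk /= -[a](symmK c) ab iso.
by rewrite /hdisk /= -ab iso.
Qed.

(** Mirroring [L] is compensated by conjugating [N2] with [rho], which gives a direct motion
    again. *)
Lemma sym_pair_of_congruences K L :
  (forall phi psi : hplane R -> hplane R,
      congruence phi -> orientation_preserving phi ->
      congruence psi -> orientation_preserving psi ->
      interior ((phi @` K) `&` (psi @` L)) !=set0 ->
      centrally_symmetric ((phi @` K) `&` (psi @` L))) ->
  sym_pair K (pre (rho R) L).
Proof.
move=> H N1 N2 d1 d2; have lr := lor_rho R; have [l1 _] := d1; have [l2 e2] := d2.
have d3 : direct (rho R *m N2 *m rho R).
  split; first by apply: lorM => //; exact: lorM.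
  by rewrite !det_mulmx det_rho e2; ring.
have [l3 _] := d3.
rewrite (preM _ l2 lr) (preM _ lr (lorM l2 lr)) mulmxA (preE _ l1) (preE _ l3).
have [v1 e1] := directV d1; have [v3 e3] := directV d3.
apply: H; try exact: congruence_hact.
- by apply: orientation_hact => //; rewrite e1 ltr01.
- by apply: orientation_hact => //; rewrite e3 ltr01.
Qed.

Lemma sym_pair_disks K L : closed K -> hconvex K -> interior K !=set0 -> K <> setT ->
  closed L -> hconvex L -> interior L !=set0 -> L <> setT ->
  (boundary_components K `<=` straight_line (R:=R) -> boundary_components L `<=` straight_line (R:=R) ->
    finite_set (boundary_components K) /\ finite_set (boundary_components L)) ->
  sym_pair K (pre (rho R) L) -> exists c c', exists2 r, 0 < r & K = hdisk c r /\ L = hdisk c' r.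
Proof.
move=> clK cK iK KT clL cL [i iL] LT fin H; have lr := lor_rho R.
have clL' := closed_pre lr clL; have cL' := hconvex_pre lr cL.
have iL' : interior (pre (rho R) L) !=set0.
  by exists (hact (rho R) i); apply/(interior_pre _ _ lr); rewrite hact_rhoK.
have LT' : pre (rho R) L <> setT.
  move=> e; apply: LT; apply/seteqP; split=> // z _.
  have zL : pre (rho R) L (hact (rho R) z) by rewrite e.
  by move: zL; rewrite /pre /= hact_rhoK.
have [q [k [qk sK sL]]] := boundary_shapes clK cK iK KT clL' cL' iL' LT' H.
case: qk => [[qE kE]|kE].
  exfalso; rewrite qE kE in sK sL; have sL2 := all_shape_pre lr sL; rewrite pre_rhoK in sL2.
  have [fK _] := fin (components_lines clK sK) (components_lines clL sL2).
  exact: flat_contradiction clK cK iK KT clL' cL' iL' LT' H sK sL fK.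
rewrite kE in sK sL.
have [c [c' [r r0 [Kc Lc]]]] := round_disks clK cK iK KT clL' cL' iL' LT' H sK sL.
exists c, (hact (rho R) c'), r => //; split=> //.
rewrite -[L](pre_rhoK) Lc; apply/seteqP; split=> z; rewrite /pre /hdisk /= !mdistE.
  by rewrite -(lorentz_hact _ _ lr) hact_rhoK.
by rewrite -(lorentz_hact _ _ lr) hact_rhoK.
Qed.

End Disks.

Theorem theorem4 (R : realType) (K L : set (hplane R))
  (Kclosed : closed K) (Lclosed : closed L)
  (Kconvex : hconvex K) (Lconvex : hconvex L)
  (Kproper : K <> setT) (Lproper : L <> setT)
  (Kint : interior K !=set0) (Lint : interior L !=set0)
  (finite_lines :
    boundary_components K `<=` straight_line (R:=R) ->
    boundary_components L `<=` straight_line (R:=R) ->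
    finite_set (boundary_components K) /\ finite_set (boundary_components L)) :
  (forall phi psi : hplane R -> hplane R,
      congruence phi -> orientation_preserving phi ->
      congruence psi -> orientation_preserving psi ->
      interior ((phi @` K) `&` (psi @` L)) !=set0 ->
      centrally_symmetric ((phi @` K) `&` (psi @` L)))
  <->
  (circle K /\ circle L /\ congruent K L).
Proof.
split=> [H|[[c [r r0 ->]] [_ [f cf <-]]] phi psi cphi _ cpsi _ _]; last first.
  by rewrite !congruence_hdisk//; exact: hdisk_lens.
have [c [c' [r r0 [-> ->]]]] := sym_pair_disks Kclosed Kconvex Kint Kproper Lclosed Lconvex Lint Lproper
  finite_lines (sym_pair_of_congruences H).
split; first by exists c, r.
split; first by exists c', r.
have [m mc] := midpoint_exists c c'; exists (symm m); first exact: congruence_symm.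
by rewrite congruence_hdisk ?mc//; exact: congruence_symm.
Qed.
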